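(* Let $\mathbb B$ be a double category. The following are equivalent: 1. there is a pseudodouble quasi-functor $H:\mathbb B\times\mathbb B\to\mathbb B$ with trivial 2-cells $H(U,u)$ such that $(\mathbb B,H)$ is a purely central premonoidal double category; 2. there is a purely central (resp. left central, or right central) premonoidal structure $(\mathbb B,\ltimes,\rtimes)$ with trivial 2-cells $u\ltimes-|_v$ (resp. $-\rtimes v|_u$); 3. there is a purely central premonoidal structure $(\mathbb B,\ltimes,\rtimes,L_0,R_0)$ with trivial 2-cells $u\ltimes-|_v$; 4. there is a monoidal double category structure $(\mathbb B,\otimes_r)$.
   Context: Double categories are strict: objects, 1h-cells (horizontal), 1v-cells (vertical), squares (2-cells). $[a|b]$: horizontal composition ($a$ left); $a/b$: vertical composition ($a$ on top), also for 1v-cells and transformations. Pseudodouble functors preserve vertical structure strictly and horizontal composition up to coherent natural invertible compositors and unitors. A horizontal pseudonatural transformation $\alpha:F\Rightarrow G$ has 1h-components $\alpha(A)$, squares $\alpha^u$ (top $\alpha(A)$, bottom $\alpha(\tilde A)$, left $F(u)$, right $G(u)$) and invertible horizontally globular 2-cells $\delta_{\alpha,f}:\alpha(B)F(f)\Rightarrow G(f)\alpha(A)$, coherent and natural. A vertical pseudonatural transformation has 1v-components $\alpha(A)$, squares $\alpha_f$ (top $F(f)$, bottom $G(f)$, left $\alpha(A)$, right $\alpha(B)$) and horizontally invertible vertically globular 2-cells $\alpha^u$ between $\alpha(A)/G(u)$ and $F(u)/\alpha(\tilde A)$, coherent and natural; strict if these are identities, and then invertible if all $\alpha_f$ are vertically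 invertible. A modification between two horizontal ($\alpha,\beta$) and two vertical ($\alpha_0,\beta_0$) transformations consists of squares $\Theta_A$ (top $\alpha(A)$, bottom $\beta(A)$, left $\alpha_0(A)$, right $\beta_0(A)$) compatible with all structure cells. $\mathrm{Pseudo}_{ps}(\mathbb B,\mathbb B)$: double category of pseudodouble endofunctors, horizontal and vertical pseudonatural transformations, modifications. Binoidal: pseudodouble functors $A\ltimes-,-\rtimes B:\mathbb B\to\mathbb B$ with $A\ltimes B=A\rtimes B=:A\bowtie B$ $(=AB)$. A 1h-cell (1v-cell) $p:A\to A'$ is left central via a horizontal (vertical) pseudonatural $p\ltimes-:A\ltimes-\Rightarrow A'\ltimes-$ with $p\ltimes B=p\rtimes B$; right central via $-\rtimes p:-\rtimes A\Rightarrow-\rtimes A'$ with $B\rtimes p=B\ltimes p$; a 2-cell $a$ is left (right) central if the cells $a\rtimes B$ (resp. $B\ltimes a$) form a modification $a\ltimes-$ (resp. $-\rtimes a$). Components: $p\ltimes-|_q$, $-\rtimes p|_q$, with $K\ltimes-|_k:(K\ltimes B')(A\ltimes k)\Rightarrow(A'\ltimes k)(K\ltimes B)$ and $-\rtimes k|_K$ in the opposite direction. An invertible 1v-cell is inversely central if it and its inverse are left and right central with mutually inverse components at 1h-cells. Purely central binoidal: every 1-cell and 2-cell is equipped with left and right centrality structures and, for all 1h-cells $K,k$ and 1v-cells $U,u$, $K\ltimes-|_k=(-\rtimes k|_K)^{-1}$, $U\ltimes-|_u=(-\rtimes u|_U)^{-1}$, $K\ltimes-|_u=-\rtimes u|_K$,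 $U\ltimes-|_k=-\rtimes k|_U$. Left central binoidal: every 1h-, 1v- and 2-cell is equipped with a left centrality structure $b\ltimes-$, and $A\mapsto A\ltimes-$, $b\mapsto b\ltimes-$ is a pseudodouble functor $\mathbb B\to\mathrm{Pseudo}_{ps}(\mathbb B,\mathbb B)$ whose compositor and unitor modifications have components at $B$ the compositors and unitors of $-\rtimes B$. Right central: the same with sides exchanged. With $L_0,R_0$: pseudodouble functors $L_0,R_0:\mathbb B\to\mathrm{Pseudo}_{ps}(\mathbb B,\mathbb B)$ with $L_0(A)=A\ltimes-$, $L_0(b)=b\ltimes-$, $R_0(A)=-\rtimes A$, $R_0(b)=-\rtimes b$, $L_0(b)_B=-\rtimes B|_b$, $R_0(b)_B=B\ltimes-|_b$ for all cells $b$ and objects $A,B$; $(\mathbb B,\ltimes,\rtimes,L_0,R_0)$ is purely central if moreover the four identities above hold. Pseudodouble quasi-functor $H:\mathbb B\times\mathbb B\to\mathbb B$: pseudodouble functors $H(A,-),H(-,B)$ agreeing on objects; invertible horizontally globular 2-cells $H(K,k):H(K,B')H(A,k)\Rightarrow H(A',k)H(K,B)$, squares $H(K,u)$ (top $H(K,B)$, bottom $H(K,\tilde B)$, left $H(A,u)$, right $H(A',u)$), $H(U,k)$ (top $H(A,k)$, bottom $H(\tilde A,k)$, left $H(U,B)$, right $H(U,B')$), and horizontally invertible vertically globular $H(U,u)$ (left $H(U,B)/H(\tilde A,u)$, right $H(A,u)/H(U,\tilde B)$), such that each 1-cell in one variable yields a horizontal resp. vertical pseudonatural transformation in the other variable,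 and each 2-cell in one variable yields a modification. $H$ induces a purely central binoidal structure by $A\ltimes-=H(A,-)$, $-\rtimes B=H(-,B)$, $K\ltimes-|_k=H(K,k)$, $K\ltimes-|_u=H(K,u)$, $U\ltimes-|_k=H(U,k)$, $-\rtimes u|_U=H(U,u)$. Premonoidal: a binoidal structure with an object $I$ and invertible vertical strict transformations $\lambda:I\ltimes-\Rightarrow\mathrm{Id}$, $\rho:-\rtimes I\Rightarrow\mathrm{Id}$, $\alpha_{-,B,C}:(-\rtimes B)\rtimes C\Rightarrow-\rtimes(B\bowtie C)$, $\alpha_{A,-,C}:(A\ltimes-)\rtimes C\Rightarrow A\ltimes(-\rtimes C)$, $\alpha_{A,B,-}:(A\bowtie B)\ltimes-\Rightarrow A\ltimes(B\ltimes-)$ with inversely central 1v-components, the $\alpha$'s having common 1v-components, satisfying the pentagon $\alpha_{W,X,Y}Z/\alpha_{W,XY,Z}/W\alpha_{X,Y,Z}=\alpha_{WX,Y,Z}/\alpha_{W,X,YZ}$ in each variable and $\alpha_{W,I,Y}/W\lambda_Y=\rho_WY$, $\alpha_{I,W,Y}/\lambda_{WY}=\lambda_WY$, $\alpha_{W,Y,I}/W\rho_Y=\rho_{WY}$ in each of $W,Y$. A purely/left/right central premonoidal double category is a premonoidal one whose binoidal structure is purely/left/right central; in the presence of such centrality structures the associativity is required to be a transformation of the corresponding three-variable structures (compatible with the exchange cells). Monoidal double category: pseudodouble functors $\otimes:\mathbb B\times\mathbb B\to\mathbb B$, $I:*\to\mathbb B$ with invertible vertical strict associativity and unit transformations satisfying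 the pentagon and unit triangles strictly. The notation $\otimes_r$ refers to the choice, on 1-cells, $K\otimes_rk=(A'\ltimes k)(K\rtimes B)$ and $U\otimes_ru=(U\rtimes B)/(\tilde A\ltimes u)$. *)

(* Defs.v *)
From Stdlib Require Import FunctionalExtensionality ProofIrrelevance ClassicalEpsilon.

Set Implicit Arguments.
Unset Strict Implicit.
Unset Printing Implicit Defensive.

Declare Scope dbl_scope.

(** A strict double category is presented with one type for each kind of cell and
    source and target functions.  The four compositions are total functions
    which are constrained, and used below, only on composable pairs; their
    values elsewhere are irrelevant.  In this presentation the strict laws are
    plain equalities, without transports.  Compositions are written in
    diagrammatic order: [hcmp f g] is the 1h-cell usually written [g f]. *)
Record dblcat := Dblcat {
  ob : Type;
  hor : Type;
  ver : Type;
  sq : Type;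
  hsrc : hor -> ob;
  htgt : hor -> ob;
  vsrc : ver -> ob;
  vtgt : ver -> ob;
  top : sq -> hor;
  bot : sq -> hor;
  lft : sq -> ver;
  rgt : sq -> ver;
  hid : ob -> hor;
  hcmp : hor -> hor -> hor;
  vid : ob -> ver;
  vcmp : ver -> ver -> ver;
  hsid : ver -> sq;
  hscmp : sq -> sq -> sq;
  vsid : hor -> sq;
  vscmp : sq -> sq -> sq;
  hsrc_top : forall a, hsrc (top a) = vsrc (lft a);
  htgt_top : forall a, htgt (top a) = vsrc (rgt a);
  hsrc_bot : forall a, hsrc (bot a) = vtgt (lft a);
  htgt_bot : forall a, htgt (bot a) = vtgt (rgt a);
  hsrc_id : forall A, hsrc (hid A) = A;
  htgt_id : forall A, htgt (hid A) = A;
  hsrc_cmp : forall f g, htgt f = hsrc g -> hsrc (hcmp f g) = hsrc f;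
  htgt_cmp : forall f g, htgt f = hsrc g -> htgt (hcmp f g) = htgt g;
  hcmp1l : forall f, hcmp (hid (hsrc f)) f = f;
  hcmp1r : forall f, hcmp f (hid (htgt f)) = f;
  hcmpA : forall f g h, htgt f = hsrc g -> htgt g = hsrc h ->
    hcmp (hcmp f g) h = hcmp f (hcmp g h);
  vsrc_id : forall A, vsrc (vid A) = A;
  vtgt_id : forall A, vtgt (vid A) = A;
  vsrc_cmp : forall u v, vtgt u = vsrc v -> vsrc (vcmp u v) = vsrc u;
  vtgt_cmp : forall u v, vtgt u = vsrc v -> vtgt (vcmp u v) = vtgt v;
  vcmp1l : forall u, vcmp (vid (vsrc u)) u = u;
  vcmp1r : forall u, vcmp u (vid (vtgt u)) = u;
  vcmpA : forall u v w, vtgt u = vsrc v -> vtgt v = vsrc w ->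
    vcmp (vcmp u v) w = vcmp u (vcmp v w);
  top_hsid : forall u, top (hsid u) = hid (vsrc u);
  bot_hsid : forall u, bot (hsid u) = hid (vtgt u);
  lft_hsid : forall u, lft (hsid u) = u;
  rgt_hsid : forall u, rgt (hsid u) = u;
  top_hscmp : forall a b, rgt a = lft b -> top (hscmp a b) = hcmp (top a) (top b);
  bot_hscmp : forall a b, rgt a = lft b -> bot (hscmp a b) = hcmp (bot a) (bot b);
  lft_hscmp : forall a b, rgt a = lft b -> lft (hscmp a b) = lft a;
  rgt_hscmp : forall a b, rgt a = lft b -> rgt (hscmp a b) = rgt b;
  hscmp1l : forall a, hscmp (hsid (lft a)) a = a;
  hscmp1r : forall a, hscmp a (hsid (rgt a)) = a;
  hscmpA : forall a b c, rgt a = lft b -> rgt b = lft c ->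
    hscmp (hscmp a b) c = hscmp a (hscmp b c);
  top_vsid : forall f, top (vsid f) = f;
  bot_vsid : forall f, bot (vsid f) = f;
  lft_vsid : forall f, lft (vsid f) = vid (hsrc f);
  rgt_vsid : forall f, rgt (vsid f) = vid (htgt f);
  top_vscmp : forall a b, bot a = top b -> top (vscmp a b) = top a;
  bot_vscmp : forall a b, bot a = top b -> bot (vscmp a b) = bot b;
  lft_vscmp : forall a b, bot a = top b -> lft (vscmp a b) = vcmp (lft a) (lft b);
  rgt_vscmp : forall a b, bot a = top b -> rgt (vscmp a b) = vcmp (rgt a) (rgt b);
  vscmp1l : forall a, vscmp (vsid (top a)) a = a;
  vscmp1r : forall a, vscmp a (vsid (bot a)) = a;
  vscmpA : forall a b c, bot a = top b -> bot b = top c ->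
    vscmp (vscmp a b) c = vscmp a (vscmp b c);
  hsid_vid : forall A, hsid (vid A) = vsid (hid A);
  hsid_cmp : forall u v, vtgt u = vsrc v -> hsid (vcmp u v) = vscmp (hsid u) (hsid v);
  vsid_cmp : forall f g, htgt f = hsrc g -> vsid (hcmp f g) = hscmp (vsid f) (vsid g);
  interchange : forall a b c d,
    rgt a = lft b -> rgt c = lft d -> bot a = top c -> bot b = top d ->
    vscmp (hscmp a b) (hscmp c d) = hscmp (vscmp a c) (vscmp b d)
}.

Notation "[ a | b ]" := (hscmp a b)
  (at level 0, a at level 99, b at level 99) : dbl_scope.
Notation "a / b" := (vscmp a b) (at level 40, left associativity) : dbl_scope.
Local Open Scope dbl_scope.

(** [b] is the vertical (resp. horizontal) inverse of the square [a]. *)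
Definition vinv (D : dblcat) (a b : sq D) : Prop :=
  bot a = top b /\ bot b = top a /\ a / b = vsid (top a) /\ b / a = vsid (bot a).

Definition hinv (D : dblcat) (a b : sq D) : Prop :=
  rgt a = lft b /\ rgt b = lft a /\ [a | b] = hsid (lft a) /\ [b | a] = hsid (rgt a).

(** A vertically globular square is trivial when it is an identity. *)
Definition vtrivial (D : dblcat) (a : sq D) : Prop := a = hsid (lft a).

(** Pseudodouble functors: [fc f g] and [fu A] are the compositor and the unitor,
    [fci] and [fui] their inverses.  [fc f g] and [fci f g] are meaningful for
    composable [f], [g] only. *)
Record psfun (C D : dblcat) := Psfun {
  fo :> ob C -> ob D;
  fh : hor C -> hor D;
  fv : ver C -> ver D;
  fs : sq C -> sq D;
  fc : hor C -> hor C -> sq D;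
  fci : hor C -> hor C -> sq D;
  fu : ob C -> sq D;
  fui : ob C -> sq D;
  hsrc_fh : forall f, hsrc (fh f) = fo (hsrc f);
  htgt_fh : forall f, htgt (fh f) = fo (htgt f);
  vsrc_fv : forall u, vsrc (fv u) = fo (vsrc u);
  vtgt_fv : forall u, vtgt (fv u) = fo (vtgt u);
  top_fs : forall a, top (fs a) = fh (top a);
  bot_fs : forall a, bot (fs a) = fh (bot a);
  lft_fs : forall a, lft (fs a) = fv (lft a);
  rgt_fs : forall a, rgt (fs a) = fv (rgt a);
  fv_id : forall A, fv (vid A) = vid (fo A);
  fv_cmp : forall u v, vtgt u = vsrc v -> fv (vcmp u v) = vcmp (fv u) (fv v);
  fs_vsid : forall f, fs (vsid f) = vsid (fh f);
  fs_vscmp : forall a b, bot a = top b -> fs (a / b) = fs a / fs b;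
  top_fc : forall f g, htgt f = hsrc g -> top (fc f g) = hcmp (fh f) (fh g);
  bot_fc : forall f g, htgt f = hsrc g -> bot (fc f g) = fh (hcmp f g);
  lft_fc : forall f g, htgt f = hsrc g -> lft (fc f g) = vid (fo (hsrc f));
  rgt_fc : forall f g, htgt f = hsrc g -> rgt (fc f g) = vid (fo (htgt g));
  fcK : forall f g, htgt f = hsrc g -> vinv (fc f g) (fci f g);
  top_fu : forall A, top (fu A) = hid (fo A);
  bot_fu : forall A, bot (fu A) = fh (hid A);
  lft_fu : forall A, lft (fu A) = vid (fo A);
  rgt_fu : forall A, rgt (fu A) = vid (fo A);
  fuK : forall A, vinv (fu A) (fui A);
  fc_nat : forall a b, rgt a = lft b ->
    [fs a | fs b] / fc (bot a) (bot b) = fc (top a) (top b) / fs [a | b];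
  fu_nat : forall u, hsid (fv u) / fu (vtgt u) = fu (vsrc u) / fs (hsid u);
  fc_assoc : forall f g h, htgt f = hsrc g -> htgt g = hsrc h ->
    [fc f g | vsid (fh h)] / fc (hcmp f g) h = [vsid (fh f) | fc g h] / fc f (hcmp g h);
  fc_unitl : forall f, [fu (hsrc f) | vsid (fh f)] / fc (hid (hsrc f)) f = vsid (fh f);
  fc_unitr : forall f, [vsid (fh f) | fu (htgt f)] / fc f (hid (htgt f)) = vsid (fh f)
}.

(** The cells of a transformation are separated from the laws which make them a
    transformation between two given functors.  [h_di] and [v_di] are the inverses
    of the globular structure cells [h_d] and [v_d]. *)
Record hdat (C D : dblcat) := Hdat {
  h_o : ob C -> hor D;
  h_v : ver C -> sq D;
  h_d : hor C -> sq D;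
  h_di : hor C -> sq D
}.

Record is_htrans (C D : dblcat) (F G : psfun C D) (x : hdat C D) : Prop := Is_htrans {
  hsrc_ho : forall A, hsrc (h_o x A) = F A;
  htgt_ho : forall A, htgt (h_o x A) = G A;
  top_hv : forall u, top (h_v x u) = h_o x (vsrc u);
  bot_hv : forall u, bot (h_v x u) = h_o x (vtgt u);
  lft_hv : forall u, lft (h_v x u) = fv F u;
  rgt_hv : forall u, rgt (h_v x u) = fv G u;
  top_hd : forall f, top (h_d x f) = hcmp (fh F f) (h_o x (htgt f));
  bot_hd : forall f, bot (h_d x f) = hcmp (h_o x (hsrc f)) (fh G f);
  lft_hd : forall f, lft (h_d x f) = vid (F (hsrc f));
  rgt_hd : forall f, rgt (h_d x f) = vid (G (htgt f));
  hdK : forall f, vinv (h_d x f) (h_di x f);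
  hd_cmp : forall f g, htgt f = hsrc g ->
    [fc F f g | vsid (h_o x (htgt g))] / h_d x (hcmp f g) =
    [vsid (fh F f) | h_d x g] / [h_d x f | vsid (fh G g)]
      / [vsid (h_o x (hsrc f)) | fc G f g];
  hd_id : forall A,
    [fu F A | vsid (h_o x A)] / h_d x (hid A) = [vsid (h_o x A) | fu G A];
  hv_cmp : forall u v, vtgt u = vsrc v -> h_v x (vcmp u v) = h_v x u / h_v x v;
  hv_id : forall A, h_v x (vid A) = vsid (h_o x A);
  hd_nat : forall a,
    [fs F a | h_v x (rgt a)] / h_d x (bot a) = h_d x (top a) / [h_v x (lft a) | fs G a]
}.

Record vdat (C D : dblcat) := Vdat {
  v_o : ob C -> ver D;
  v_h : hor C -> sq D;
  v_d : ver C -> sq D;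
  v_di : ver C -> sq D
}.

Record is_vtrans (C D : dblcat) (F G : psfun C D) (x : vdat C D) : Prop := Is_vtrans {
  vsrc_vo : forall A, vsrc (v_o x A) = F A;
  vtgt_vo : forall A, vtgt (v_o x A) = G A;
  top_vh : forall f, top (v_h x f) = fh F f;
  bot_vh : forall f, bot (v_h x f) = fh G f;
  lft_vh : forall f, lft (v_h x f) = v_o x (hsrc f);
  rgt_vh : forall f, rgt (v_h x f) = v_o x (htgt f);
  top_vd : forall u, top (v_d x u) = hid (F (vsrc u));
  bot_vd : forall u, bot (v_d x u) = hid (G (vtgt u));
  lft_vd : forall u, lft (v_d x u) = vcmp (v_o x (vsrc u)) (fv G u);
  rgt_vd : forall u, rgt (v_d x u) = vcmp (fv F u) (v_o x (vtgt u));
  vdK : forall u, hinv (v_d x u) (v_di x u);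
  vd_cmp : forall u v, vtgt u = vsrc v ->
    v_d x (vcmp u v) = [v_d x u / hsid (fv G v) | hsid (fv F u) / v_d x v];
  vd_id : forall A, v_d x (vid A) = hsid (v_o x A);
  vh_cmp : forall f g, htgt f = hsrc g ->
    [v_h x f | v_h x g] / fc G f g = fc F f g / v_h x (hcmp f g);
  vh_id : forall A, hsid (v_o x A) / fu G A = fu F A / v_h x (hid A);
  vd_nat : forall a,
    [v_h x (top a) / fs G a | v_d x (rgt a)] = [v_d x (lft a) | fs F a / v_h x (bot a)]
}.

(** Invertible strict vertical transformations; that the 1v-components are
    invertible follows from the invertibility of the squares. *)
Record is_vstrict_iso (C D : dblcat) (F G : psfun C D) (x : vdat C D) : Prop :=
  Is_vstrict_iso {
  vsi_trans : is_vtrans F G x;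
  vsi_strict : forall u, vtrivial (v_d x u);
  vsi_inv : forall f, exists b, vinv (v_h x f) b
}.

Record is_modif (C D : dblcat) (t b : hdat C D) (l r : vdat C D) (m : ob C -> sq D)
  : Prop := Is_modif {
  top_m : forall A, top (m A) = h_o t A;
  bot_m : forall A, bot (m A) = h_o b A;
  lft_m : forall A, lft (m A) = v_o l A;
  rgt_m : forall A, rgt (m A) = v_o r A;
  m_hor : forall f,
    [v_h l f | m (htgt f)] / h_d b f = h_d t f / [m (hsrc f) | v_h r f];
  m_ver : forall u,
    [v_d l u | h_v t u / m (vtgt u)] = [m (vsrc u) / h_v b u | v_d r u]
}.

Create HintDb bd discriminated.
#[global] Hint Rewrite hsrc_id htgt_id vsrc_id vtgt_id top_hsid bot_hsid lft_hsid
  rgt_hsid top_vsid bot_vsid lft_vsid rgt_vsid hsrc_fh htgt_fh vsrc_fv vtgt_fv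
  top_fs bot_fs lft_fs rgt_fs top_fu bot_fu lft_fu rgt_fu fv_id fs_vsid : bd.

Lemma vcmp1l' (D : dblcat) (A : ob D) u : vsrc u = A -> vcmp (vid A) u = u.
Proof. intros <-; apply vcmp1l. Qed.
Lemma vcmp1r' (D : dblcat) (A : ob D) u : vtgt u = A -> vcmp u (vid A) = u.
Proof. intros <-; apply vcmp1r. Qed.
Lemma hcmp1l' (D : dblcat) (A : ob D) f : hsrc f = A -> hcmp (hid A) f = f.
Proof. intros <-; apply hcmp1l. Qed.
Lemma hcmp1r' (D : dblcat) (A : ob D) f : htgt f = A -> hcmp f (hid A) = f.
Proof. intros <-; apply hcmp1r. Qed.
Lemma hscmp1l' (D : dblcat) (u : ver D) a : lft a = u -> [hsid u | a] = a.
Proof. intros <-; apply hscmp1l. Qed.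
Lemma hscmp1r' (D : dblcat) (u : ver D) a : rgt a = u -> [a | hsid u] = a.
Proof. intros <-; apply hscmp1r. Qed.
Lemma vscmp1l' (D : dblcat) (f : hor D) a : top a = f -> vsid f / a = a.
Proof. intros <-; apply vscmp1l. Qed.
Lemma vscmp1r' (D : dblcat) (f : hor D) a : bot a = f -> a / vsid f = a.
Proof. intros <-; apply vscmp1r. Qed.

Ltac bd1 :=
  match goal with
  | H : is_htrans ?F ?G ?x |- context [hsrc (h_o ?x ?A)] => rewrite (hsrc_ho H A)
  | H : is_htrans ?F ?G ?x |- context [htgt (h_o ?x ?A)] => rewrite (htgt_ho H A)
  | H : is_htrans ?F ?G ?x |- context [top (h_v ?x ?u)] => rewrite (top_hv H u)
  | H : is_htrans ?F ?G ?x |- context [bot (h_v ?x ?u)] => rewrite (bot_hv H u)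
  | H : is_htrans ?F ?G ?x |- context [lft (h_v ?x ?u)] => rewrite (lft_hv H u)
  | H : is_htrans ?F ?G ?x |- context [rgt (h_v ?x ?u)] => rewrite (rgt_hv H u)
  | H : is_htrans ?F ?G ?x |- context [top (h_d ?x ?u)] => rewrite (top_hd H u)
  | H : is_htrans ?F ?G ?x |- context [bot (h_d ?x ?u)] => rewrite (bot_hd H u)
  | H : is_htrans ?F ?G ?x |- context [lft (h_d ?x ?u)] => rewrite (lft_hd H u)
  | H : is_htrans ?F ?G ?x |- context [rgt (h_d ?x ?u)] => rewrite (rgt_hd H u)
  | H : is_vtrans ?F ?G ?x |- context [vsrc (v_o ?x ?A)] => rewrite (vsrc_vo H A)
  | H : is_vtrans ?F ?G ?x |- context [vtgt (v_o ?x ?A)] => rewrite (vtgt_vo H A)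
  | H : is_vtrans ?F ?G ?x |- context [top (v_h ?x ?u)] => rewrite (top_vh H u)
  | H : is_vtrans ?F ?G ?x |- context [bot (v_h ?x ?u)] => rewrite (bot_vh H u)
  | H : is_vtrans ?F ?G ?x |- context [lft (v_h ?x ?u)] => rewrite (lft_vh H u)
  | H : is_vtrans ?F ?G ?x |- context [rgt (v_h ?x ?u)] => rewrite (rgt_vh H u)
  | H : is_vtrans ?F ?G ?x |- context [top (v_d ?x ?u)] => rewrite (top_vd H u)
  | H : is_vtrans ?F ?G ?x |- context [bot (v_d ?x ?u)] => rewrite (bot_vd H u)
  | H : is_vtrans ?F ?G ?x |- context [lft (v_d ?x ?u)] => rewrite (lft_vd H u)
  | H : is_vtrans ?F ?G ?x |- context [rgt (v_d ?x ?u)] => rewrite (rgt_vd H u)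
  | H : is_modif ?t ?b ?l ?r ?x |- context [top (?x ?u)] => rewrite (top_m H u)
  | H : is_modif ?t ?b ?l ?r ?x |- context [bot (?x ?u)] => rewrite (bot_m H u)
  | H : is_modif ?t ?b ?l ?r ?x |- context [lft (?x ?u)] => rewrite (lft_m H u)
  | H : is_modif ?t ?b ?l ?r ?x |- context [rgt (?x ?u)] => rewrite (rgt_m H u)
  end.

(** [bdn] normalizes boundaries, [bd] proves composability side conditions. *)
Ltac bdn := repeat (first
  [ progress (autorewrite with bd)
  | bd1
  | match goal with
    | |- context [top [?a | ?b]] => rewrite (@top_hscmp _ a b) by bd
    | |- context [bot [?a | ?b]] => rewrite (@bot_hscmp _ a b) by bd
    | |- context [lft [?a | ?b]] => rewrite (@lft_hscmp _ a b) by bd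
    | |- context [rgt [?a | ?b]] => rewrite (@rgt_hscmp _ a b) by bd
    | |- context [top (?a / ?b)] => rewrite (@top_vscmp _ a b) by bd
    | |- context [bot (?a / ?b)] => rewrite (@bot_vscmp _ a b) by bd
    | |- context [lft (?a / ?b)] => rewrite (@lft_vscmp _ a b) by bd
    | |- context [rgt (?a / ?b)] => rewrite (@rgt_vscmp _ a b) by bd
    | |- context [top (fc ?F ?f ?g)] => rewrite (@top_fc _ _ F f g) by bd
    | |- context [bot (fc ?F ?f ?g)] => rewrite (@bot_fc _ _ F f g) by bd
    | |- context [lft (fc ?F ?f ?g)] => rewrite (@lft_fc _ _ F f g) by bd
    | |- context [rgt (fc ?F ?f ?g)] => rewrite (@rgt_fc _ _ F f g) by bd
    | |- context [hsrc (hcmp ?f ?g)] => rewrite (@hsrc_cmp _ f g) by bd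
    | |- context [htgt (hcmp ?f ?g)] => rewrite (@htgt_cmp _ f g) by bd
    | |- context [vsrc (vcmp ?f ?g)] => rewrite (@vsrc_cmp _ f g) by bd
    | |- context [vtgt (vcmp ?f ?g)] => rewrite (@vtgt_cmp _ f g) by bd
    | |- context [vcmp (vid ?A) ?u] => rewrite (@vcmp1l' _ A u) by bd
    | |- context [vcmp ?u (vid ?A)] => rewrite (@vcmp1r' _ A u) by bd
    | |- context [hcmp (hid ?A) ?u] => rewrite (@hcmp1l' _ A u) by bd
    | |- context [hcmp ?u (hid ?A)] => rewrite (@hcmp1r' _ A u) by bd
    | |- context [vcmp (vcmp ?u ?v) ?w] => rewrite (@vcmpA _ u v w) by bd
    | |- context [hcmp (hcmp ?u ?v) ?w] => rewrite (@hcmpA _ u v w) by bd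
    | |- context [fv ?F (vcmp ?u ?v)] => rewrite (@fv_cmp _ _ F u v) by bd
    | |- context [hsrc (top ?a)] => rewrite (hsrc_top a)
    | |- context [htgt (top ?a)] => rewrite (htgt_top a)
    | |- context [hsrc (bot ?a)] => rewrite (hsrc_bot a)
    | |- context [htgt (bot ?a)] => rewrite (htgt_bot a)
    end ])
with bd := solve [ assumption | reflexivity | symmetry; assumption
  | bdn; first [reflexivity | assumption | symmetry; assumption | congruence
    | rewrite ?hsrc_top, ?htgt_top, ?hsrc_bot, ?htgt_bot in *; congruence] ].

Section Pasting.
Variable D : dblcat.
Implicit Types (a b c d : sq D) (f g : hor D) (u v : ver D).

Lemma vsid_whl f a b : bot a = top b -> vid (htgt f) = lft a -> vid (htgt f) = lft b ->
  [vsid f | a / b] = [vsid f | a] / [vsid f | b].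
Proof.
intros; rewrite interchange by bd.
now rewrite (@vscmp1l' _ f) by bd.
Qed.

Lemma vsid_whr f a b : bot a = top b -> rgt a = vid (hsrc f) -> rgt b = vid (hsrc f) ->
  [a / b | vsid f] = [a | vsid f] / [b | vsid f].
Proof.
intros; rewrite interchange by bd.
now rewrite (@vscmp1l' _ f (vsid f)) by bd.
Qed.

Lemma hsid_whl u a b : rgt a = lft b -> hid (vtgt u) = top a -> hid (vtgt u) = top b ->
  hsid u / [a | b] = [hsid u / a | hsid u / b].
Proof.
intros; rewrite <- interchange by bd.
now rewrite (@hscmp1l' _ u) by bd.
Qed.

Lemma hsid_whr u a b : rgt a = lft b -> bot a = hid (vsrc u) -> bot b = hid (vsrc u) ->
  [a | b] / hsid u = [a / hsid u | b / hsid u].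
Proof.
intros; rewrite <- interchange by bd.
now rewrite (@hscmp1l' _ u (hsid u)) by bd.
Qed.

Lemma slide_lr a b : rgt a = vid (htgt (top a)) -> lft b = vid (hsrc (top b)) ->
  htgt (top a) = hsrc (top b) ->
  [a | vsid (top b)] / [vsid (bot a) | b] = [a | b].
Proof.
intros Ha Hb E.
assert (htgt (bot a) = htgt (top a)) by (rewrite htgt_bot, Ha; bd).
rewrite interchange; [ now rewrite vscmp1l, vscmp1r | bd | bd | bd | bd ].
Qed.

Lemma slide_rl a b : rgt a = vid (htgt (top a)) -> lft b = vid (hsrc (top b)) ->
  htgt (top a) = hsrc (top b) ->
  [vsid (top a) | b] / [a | vsid (bot b)] = [a | b].
Proof.
intros Ha Hb E.
assert (hsrc (bot b) = hsrc (top b)) by (rewrite hsrc_bot, Hb; bd).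
rewrite interchange; [ now rewrite vscmp1l, vscmp1r | bd | bd | bd | bd ].
Qed.

Lemma vinv_vcmp a b a' b' : bot a = top b -> vinv a a' -> vinv b b' ->
  vinv (a / b) (b' / a').
Proof.
intros E (A1 & A2 & A3 & A4) (B1 & B2 & B3 & B4).
assert (bot b' = top a') by congruence.
repeat split; try bd.
- rewrite vscmpA by bd; rewrite <- (@vscmpA _ b) by bd.
  rewrite B3, <- E, <- (@vscmpA _ a) by bd.
  rewrite vscmp1r, A3; now bdn.
- rewrite vscmpA by bd; rewrite <- (@vscmpA _ a') by bd.
  rewrite A4, E, <- (@vscmpA _ b') by bd.
  rewrite (@vscmp1r' _ (top b) b') by bd. rewrite B4; now bdn.
Qed.

Lemma hinv_hcmp a b a' b' : rgt a = lft b -> hinv a a' -> hinv b b' ->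
  hinv [a | b] [b' | a'].
Proof.
intros E (A1 & A2 & A3 & A4) (B1 & B2 & B3 & B4).
assert (rgt b' = lft a') by congruence.
repeat split; try bd.
- rewrite hscmpA by bd; rewrite <- (@hscmpA _ b) by bd.
  rewrite B3, <- E, <- (@hscmpA _ a) by bd.
  rewrite hscmp1r, A3; now bdn.
- rewrite hscmpA by bd; rewrite <- (@hscmpA _ a') by bd.
  rewrite A4, E, <- (@hscmpA _ b') by bd.
  rewrite (@hscmp1r' _ (lft b) b') by bd. rewrite B4; now bdn.
Qed.

Lemma vinv_lft a b : vinv a b -> vcmp (lft a) (lft b) = vid (hsrc (top a)).
Proof.
intros (E1 & E2 & E3 & _).
rewrite <- lft_vscmp, E3 by bd; bd.
Qed.
Lemma vinv_rgt a b : vinv a b -> vcmp (rgt a) (rgt b) = vid (htgt (top a)).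
Proof.
intros (E1 & E2 & E3 & _).
rewrite <- rgt_vscmp, E3 by bd; bd.
Qed.

Lemma vinv_globl a b A : vinv a b -> lft a = vid A -> lft b = vid A.
Proof.
intros H E. pose proof (vinv_lft H) as K. destruct H as (E1 & E2 & _).
rewrite hsrc_top, E in K; autorewrite with bd in K.
rewrite vcmp1l' in K; [exact K|].
now rewrite <- hsrc_top, <- E1, hsrc_bot, E, vtgt_id.
Qed.
Lemma vinv_globr a b A : vinv a b -> rgt a = vid A -> rgt b = vid A.
Proof.
intros H E. pose proof (vinv_rgt H) as K. destruct H as (E1 & E2 & _).
rewrite htgt_top, E in K; autorewrite with bd in K.
rewrite vcmp1l' in K; [exact K|].
now rewrite <- htgt_top, <- E1, htgt_bot, E, vtgt_id.
Qed.

Lemma vinv_hcmp a b a' b' : rgt a = lft b -> rgt a' = lft b' -> vinv a a' -> vinv b b' ->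
  vinv [a | b] [a' | b'].
Proof.
intros E E' (A1 & A2 & A3 & A4) (B1 & B2 & B3 & B4).
assert (htgt (top a) = hsrc (top b)) by (rewrite htgt_top, hsrc_top; congruence).
assert (htgt (bot a) = hsrc (bot b)) by (rewrite htgt_bot, hsrc_bot; congruence).
repeat split; try bd.
- rewrite interchange by bd. rewrite A3, B3, <- vsid_cmp by bd. now bdn.
- rewrite interchange by bd. rewrite A4, B4, <- vsid_cmp by bd. now bdn.
Qed.

Lemma hinv_vcmp a b a' b' : bot a = top b -> bot a' = top b' -> hinv a a' -> hinv b b' ->
  hinv (a / b) (a' / b').
Proof.
intros E E' (A1 & A2 & A3 & A4) (B1 & B2 & B3 & B4).
assert (vtgt (lft a) = vsrc (lft b)) by (rewrite <- hsrc_bot, <- hsrc_top; congruence).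
assert (vtgt (rgt a) = vsrc (rgt b)) by (rewrite <- htgt_bot, <- htgt_top; congruence).
repeat split; try bd.
- rewrite <- interchange by bd. rewrite A3, B3, <- hsid_cmp by bd. now bdn.
- rewrite <- interchange by bd. rewrite A4, B4, <- hsid_cmp by bd. now bdn.
Qed.

Lemma hinv_top a b : hinv a b -> hcmp (top a) (top b) = hid (vsrc (lft a)).
Proof.
intros (E1 & E2 & E3 & _).
rewrite <- top_hscmp, E3 by bd; bd.
Qed.
Lemma hinv_bot a b : hinv a b -> hcmp (bot a) (bot b) = hid (vtgt (lft a)).
Proof.
intros (E1 & E2 & E3 & _).
rewrite <- bot_hscmp, E3 by bd; bd.
Qed.
Lemma hinv_globt a b A : hinv a b -> top a = hid A -> top b = hid A.
Proof.
intros H E. pose proof (hinv_top H) as K. destruct H as (E1 & E2 & _).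
rewrite <- hsrc_top, E in K; autorewrite with bd in K.
rewrite hcmp1l' in K; [exact K|].
now rewrite hsrc_top, <- E1, <- htgt_top, E, htgt_id.
Qed.
Lemma hinv_globb a b A : hinv a b -> bot a = hid A -> bot b = hid A.
Proof.
intros H E. pose proof (hinv_bot H) as K. destruct H as (E1 & E2 & _).
rewrite <- hsrc_bot, E in K; autorewrite with bd in K.
rewrite hcmp1l' in K; [exact K|].
now rewrite hsrc_bot, <- E1, <- htgt_bot, E, htgt_id.
Qed.

Lemma vinv_id f : vinv (vsid f) (vsid f).
Proof. repeat split; rewrite ?vscmp1l'; bd. Qed.
Lemma hinv_id u : hinv (hsid u) (hsid u).
Proof. repeat split; rewrite ?hscmp1l'; bd. Qed.

Lemma vinv_uniq a b b' : vinv a b -> vinv a b' -> b = b'.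
Proof.
intros (A1 & A2 & A3 & A4) (B1 & B2 & B3 & B4).
rewrite <- (@vscmp1r' _ (top a) b), <- B3, <- vscmpA, A4 by bd.
apply vscmp1l'; bd.
Qed.
Lemma hinv_uniq a b b' : hinv a b -> hinv a b' -> b = b'.
Proof.
intros (A1 & A2 & A3 & A4) (B1 & B2 & B3 & B4).
rewrite <- (@hscmp1r' _ (lft a) b), <- B3, <- hscmpA, A4 by bd.
apply hscmp1l'; bd.
Qed.
End Pasting.

Lemma vinv_fs (C D : dblcat) (F : psfun C D) a b : vinv a b -> vinv (fs F a) (fs F b).
Proof.
intros (A1 & A2 & A3 & A4).
repeat split; try bd.
- rewrite <- fs_vscmp, A3 by bd. now bdn.
- rewrite <- fs_vscmp, A4 by bd. now bdn.
Qed.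

Section Functors.
Variables C D E : dblcat.

Definition fid : psfun D D.
Proof.
refine (@Psfun D D (fun A => A) (fun f => f) (fun u => u) (fun a => a)
  (fun f g => vsid (hcmp f g)) (fun f g => vsid (hcmp f g))
  (fun A => vsid (hid A)) (fun A => vsid (hid A))
  _ _ _ _ _ _ _ _ _ _ _ _ _ _ _ _ _ _ _ _ _ _ _ _ _ _ _);
  intros; try bd; try apply vinv_id.
- rewrite vscmp1l', vscmp1r'; bd.
- rewrite vscmp1l', vscmp1r'; bd.
- rewrite <- !vsid_cmp by bd. rewrite hcmpA by bd. reflexivity.
- rewrite <- vsid_cmp by bd. rewrite hcmp1l. apply vscmp1l'; bd.
- rewrite <- vsid_cmp by bd. rewrite hcmp1r. apply vscmp1l'; bd.
Defined.

Variables (F : psfun C D) (G : psfun D E).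

Definition fcomp : psfun C E.
Proof.
refine (@Psfun C E (fun A => G (F A)) (fun f => fh G (fh F f))
  (fun u => fv G (fv F u)) (fun a => fs G (fs F a))
  (fun f g => fc G (fh F f) (fh F g) / fs G (fc F f g))
  (fun f g => fs G (fci F f g) / fci G (fh F f) (fh F g))
  (fun A => fu G (F A) / fs G (fu F A))
  (fun A => fs G (fui F A) / fui G (F A))
  _ _ _ _ _ _ _ _ _ _ _ _ _ _ _ _ _ _ _ _ _ _ _ _ _ _ _);
  intros; try bd.
- rewrite fs_vscmp, fs_vscmp by bd. reflexivity.
- apply vinv_vcmp; [bd | apply fcK; bd | apply vinv_fs, fcK; bd].
- apply vinv_vcmp; [bd | apply fuK | apply vinv_fs, fuK].
- rewrite <- vscmpA by bd.
  assert (X : [fs G (fs F a) | fs G (fs F b)] / fc G (fh F (bot a)) (fh F (bot b)) =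
    fc G (fh F (top a)) (fh F (top b)) / fs G [fs F a | fs F b]).
  { rewrite <- (bot_fs F a), <- (bot_fs F b), <- (top_fs F a), <- (top_fs F b).
    apply fc_nat; bd. }
  rewrite X, !vscmpA by bd. f_equal.
  rewrite <- !fs_vscmp by bd. f_equal. apply fc_nat; bd.
- rewrite <- vscmpA by bd. rewrite <- (vtgt_fv F), fu_nat.
  rewrite !vscmpA by bd. rewrite vsrc_fv. f_equal.
  rewrite <- !fs_vscmp by bd. f_equal. apply fu_nat.
- assert (X := fc_assoc G (f := fh F f) (g := fh F g) (h := fh F h)).
  rewrite !hsrc_fh, !htgt_fh in X. specialize (X (f_equal _ H) (f_equal _ H0)).
  assert (Y := fc_nat G (a := fc F f g) (b := vsid (fh F h))).
  assert (Z := fc_nat G (a := vsid (fh F f)) (b := fc F g h)).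
  autorewrite with bd in Y, Z. rewrite bot_fc, top_fc in Y, Z by bd.
  rewrite vsid_whr by bd. rewrite vsid_whl by bd.
  rewrite !vscmpA by bd.
  rewrite <- (@vscmpA _ _ (fc G (fh F (hcmp f g)) (fh F h))) by bd.
  rewrite <- (@vscmpA _ _ (fc G (fh F f) (fh F (hcmp g h)))) by bd.
  rewrite Y, Z by bd. rewrite !vscmpA by bd.
  rewrite <- (@vscmpA _ _ (fc G (hcmp (fh F f) (fh F g)) (fh F h))) by bd.
  rewrite <- (@vscmpA _ _ (fc G (fh F f) (hcmp (fh F g) (fh F h)))) by bd.
  rewrite X. f_equal. rewrite <- !fs_vscmp by bd. f_equal. apply fc_assoc; assumption.
- assert (X := fc_unitl G (fh F f)). rewrite hsrc_fh in X.
  assert (Y := fc_nat G (a := fu F (hsrc f)) (b := vsid (fh F f))).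
  autorewrite with bd in Y.
  rewrite vsid_whr, !vscmpA by bd.
  rewrite <- (@vscmpA _ _ (fc G (fh F (hid (hsrc f))) (fh F f))) by bd.
  rewrite Y by bd. rewrite !vscmpA by bd.
  rewrite <- (@vscmpA _ _ (fc G (hid (F (hsrc f))) (fh F f))) by bd. rewrite X.
  rewrite <- fs_vscmp by bd. rewrite fc_unitl. bdn. apply vscmp1l'; bd.
- assert (X := fc_unitr G (fh F f)). rewrite htgt_fh in X.
  assert (Y := fc_nat G (a := vsid (fh F f)) (b := fu F (htgt f))).
  autorewrite with bd in Y.
  rewrite vsid_whl, !vscmpA by bd.
  rewrite <- (@vscmpA _ _ (fc G (fh F f) (fh F (hid (htgt f))))) by bd.
  rewrite Y by bd. rewrite !vscmpA by bd.
  rewrite <- (@vscmpA _ _ (fc G (fh F f) (hid (F (htgt f))))) by bd. rewrite X.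
  rewrite <- fs_vscmp by bd. rewrite fc_unitr. bdn. apply vscmp1l'; bd.
Defined.
End Functors.
Arguments fid D : clear implicits.
Notation "G \o F" := (fcomp F G) (at level 50, left associativity) : dbl_scope.

Definition dbl1 : dblcat.
Proof.
refine (@Dblcat unit unit unit unit (fun _ => tt) (fun _ => tt) (fun _ => tt)
  (fun _ => tt) (fun _ => tt) (fun _ => tt) (fun _ => tt) (fun _ => tt) (fun _ => tt)
  (fun _ _ => tt) (fun _ => tt) (fun _ _ => tt) (fun _ => tt) (fun _ _ => tt)
  (fun _ => tt) (fun _ _ => tt)
  _ _ _ _ _ _ _ _ _ _ _ _ _ _ _ _ _ _ _ _ _ _ _ _ _ _ _ _ _ _ _ _ _ _ _ _ _ _ _ _ _ _ _ _);
  intros; repeat match goal with x : unit |- _ => destruct x end; reflexivity.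
Defined.

Ltac pair_tac :=
  intros; repeat match goal with x : _ * _ |- _ => destruct x end; simpl in *;
  repeat match goal with
  | H : (_, _) = (_, _) |- _ => injection H; clear H; intros
  end; unfold vinv; simpl;
  repeat split; try (f_equal; first [bd | eauto with dblprod]).

Create HintDb dblprod.
#[global] Hint Resolve hsrc_top htgt_top hsrc_bot htgt_bot hcmp1l hcmp1r hcmpA
  vcmp1l vcmp1r vcmpA hscmp1l hscmp1r hscmpA vscmp1l vscmp1r vscmpA
  hsid_vid hsid_cmp vsid_cmp interchange : dblprod.

Definition dblprod (C D : dblcat) : dblcat.
Proof.
refine (@Dblcat (ob C * ob D) (hor C * hor D) (ver C * ver D) (sq C * sq D)
  (fun f => (hsrc (fst f), hsrc (snd f))) (fun f => (htgt (fst f), htgt (snd f)))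
  (fun u => (vsrc (fst u), vsrc (snd u))) (fun u => (vtgt (fst u), vtgt (snd u)))
  (fun a => (top (fst a), top (snd a))) (fun a => (bot (fst a), bot (snd a)))
  (fun a => (lft (fst a), lft (snd a))) (fun a => (rgt (fst a), rgt (snd a)))
  (fun A => (hid (fst A), hid (snd A)))
  (fun f g => (hcmp (fst f) (fst g), hcmp (snd f) (snd g)))
  (fun A => (vid (fst A), vid (snd A)))
  (fun f g => (vcmp (fst f) (fst g), vcmp (snd f) (snd g)))
  (fun u => (hsid (fst u), hsid (snd u)))
  (fun a b => ([fst a | fst b], [snd a | snd b]))
  (fun f => (vsid (fst f), vsid (snd f)))
  (fun a b => (fst a / fst b, snd a / snd b))
  _ _ _ _ _ _ _ _ _ _ _ _ _ _ _ _ _ _ _ _ _ _ _ _ _ _ _ _ _ _ _ _ _ _ _ _ _ _ _ _ _ _ _ _);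
  pair_tac.
Defined.

Definition fproj1 (C D : dblcat) : psfun (dblprod C D) C.
Proof.
refine (@Psfun (dblprod C D) C fst fst fst fst
  (fun f g => vsid (hcmp (fst f) (fst g))) (fun f g => vsid (hcmp (fst f) (fst g)))
  (fun A => vsid (hid (fst A))) (fun A => vsid (hid (fst A)))
  _ _ _ _ _ _ _ _ _ _ _ _ _ _ _ _ _ _ _ _ _ _ _ _ _ _ _);
  intros; repeat match goal with x : _ (dblprod _ _) |- _ => destruct x end; simpl in *;
  repeat match goal with H : (_, _) = (_, _) |- _ => injection H; clear H; intros end;
  try bd; try apply vinv_id.
- rewrite vscmp1l', vscmp1r'; bd.
- rewrite vscmp1l', vscmp1r'; bd.
- rewrite <- !vsid_cmp by bd. rewrite hcmpA by bd. reflexivity.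
- rewrite <- vsid_cmp by bd. rewrite hcmp1l. apply vscmp1l'; bd.
- rewrite <- vsid_cmp by bd. rewrite hcmp1r. apply vscmp1l'; bd.
Defined.

Definition fproj2 (C D : dblcat) : psfun (dblprod C D) D.
Proof.
refine (@Psfun (dblprod C D) D snd snd snd snd
  (fun f g => vsid (hcmp (snd f) (snd g))) (fun f g => vsid (hcmp (snd f) (snd g)))
  (fun A => vsid (hid (snd A))) (fun A => vsid (hid (snd A)))
  _ _ _ _ _ _ _ _ _ _ _ _ _ _ _ _ _ _ _ _ _ _ _ _ _ _ _);
  intros; repeat match goal with x : _ (dblprod _ _) |- _ => destruct x end; simpl in *;
  repeat match goal with H : (_, _) = (_, _) |- _ => injection H; clear H; intros end;
  try bd; try apply vinv_id.
- rewrite vscmp1l', vscmp1r'; bd.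
- rewrite vscmp1l', vscmp1r'; bd.
- rewrite <- !vsid_cmp by bd. rewrite hcmpA by bd. reflexivity.
- rewrite <- vsid_cmp by bd. rewrite hcmp1l. apply vscmp1l'; bd.
- rewrite <- vsid_cmp by bd. rewrite hcmp1r. apply vscmp1l'; bd.
Defined.

Definition fpair (E C D : dblcat) (F : psfun E C) (G : psfun E D) :
  psfun E (dblprod C D).
Proof.
refine (@Psfun E (dblprod C D) (fun A => (F A, G A)) (fun f => (fh F f, fh G f))
  (fun u => (fv F u, fv G u)) (fun a => (fs F a, fs G a))
  (fun f g => (fc F f g, fc G f g)) (fun f g => (fci F f g, fci G f g))
  (fun A => (fu F A, fu G A)) (fun A => (fui F A, fui G A))
  _ _ _ _ _ _ _ _ _ _ _ _ _ _ _ _ _ _ _ _ _ _ _ _ _ _ _);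
  intros; simpl in *; unfold vinv; simpl; try (f_equal; bd).
- now rewrite !fs_vscmp.
- destruct (fcK F H) as (? & ? & ? & ?), (fcK G H) as (? & ? & ? & ?).
  repeat split; f_equal; assumption.
- destruct (fuK F A) as (? & ? & ? & ?), (fuK G A) as (? & ? & ? & ?).
  repeat split; f_equal; assumption.
- now rewrite !fc_nat.
- now rewrite !fu_nat.
- now rewrite !fc_assoc.
- now rewrite !fc_unitl.
- now rewrite !fc_unitr.
Defined.
Notation "<< F , G >>" := (fpair F G) (at level 0) : dbl_scope.

Definition fterm (C : dblcat) : psfun C dbl1.
Proof.
refine (@Psfun C dbl1 (fun _ => tt) (fun _ => tt) (fun _ => tt) (fun _ => tt)
  (fun _ _ => tt) (fun _ _ => tt) (fun _ => tt) (fun _ => tt)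
  _ _ _ _ _ _ _ _ _ _ _ _ _ _ _ _ _ _ _ _ _ _ _ _ _ _ _);
  intros; repeat split; reflexivity.
Defined.

Section Transformations.
Variables C D : dblcat.
Implicit Types F G H K : psfun C D.

Definition hdat_id F : hdat C D :=
  @Hdat C D (fun A => hid (F A)) (fun u => hsid (fv F u))
    (fun f => vsid (fh F f)) (fun f => vsid (fh F f)).

Definition hdat_cmp (x y : hdat C D) : hdat C D :=
  @Hdat C D (fun A => hcmp (h_o x A) (h_o y A)) (fun u => [h_v x u | h_v y u])
    (fun f => [h_d x f | vsid (h_o y (htgt f))] / [vsid (h_o x (hsrc f)) | h_d y f])
    (fun f => [vsid (h_o x (hsrc f)) | h_di y f] / [h_di x f | vsid (h_o y (htgt f))]).

Definition vdat_id F : vdat C D :=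
  @Vdat C D (fun A => vid (F A)) (fun f => vsid (fh F f))
    (fun u => hsid (fv F u)) (fun u => hsid (fv F u)).

Definition vdat_cmp (x y : vdat C D) : vdat C D :=
  @Vdat C D (fun A => vcmp (v_o x A) (v_o y A)) (fun f => v_h x f / v_h y f)
    (fun u => [hsid (v_o x (vsrc u)) / v_d y u | v_d x u / hsid (v_o y (vtgt u))])
    (fun u => [v_di x u / hsid (v_o y (vtgt u)) | hsid (v_o x (vsrc u)) / v_di y u]).

Lemma hdat_id_ok F : is_htrans F F (hdat_id F).
Proof.
constructor; simpl; intros; try bd; try apply vinv_id.
- rewrite <- !hsid_vid, hscmp1r', hscmp1l' by bd.
  rewrite <- !vsid_cmp by bd.
  rewrite vscmp1r', !vscmp1l' by bd. reflexivity.
- rewrite <- !hsid_vid, hscmp1r', hscmp1l' by bd. now rewrite vscmp1r' by bd.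
- rewrite fv_cmp, hsid_cmp by bd. reflexivity.
- rewrite fv_id. apply hsid_vid.
- rewrite hscmp1r', hscmp1l' by bd. now rewrite vscmp1r', vscmp1l' by bd.
Qed.

Lemma vdat_id_ok F : is_vtrans F F (vdat_id F).
Proof.
constructor; simpl; intros; try bd; try apply hinv_id.
- rewrite <- !hsid_cmp by bd. rewrite hscmp1l' by bd. bd.
- rewrite <- vsid_cmp by bd. now rewrite vscmp1r', vscmp1l' by bd.
- rewrite hsid_vid. now rewrite vscmp1r', vscmp1l' by bd.
- rewrite vscmp1r', vscmp1l' by bd. now rewrite hscmp1r', hscmp1l' by bd.
Qed.

Lemma hdat_cmp_ok F G H x y :
  is_htrans F G x -> is_htrans G H y -> is_htrans F H (hdat_cmp x y).
Proof.
intros Hx Hy.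
constructor; simpl; intros; try bd.
- apply vinv_vcmp; [bd | |].
  + apply vinv_hcmp; [bd | | apply (hdK Hx) | apply vinv_id].
    rewrite (vinv_globr (hdK Hx f) (rgt_hd Hx f)). bd.
  + apply vinv_hcmp; [bd | | apply vinv_id | apply (hdK Hy)].
    rewrite (vinv_globl (hdK Hy f) (lft_hd Hy f)). bd.
- rewrite htgt_cmp, hsrc_cmp by bd.
  rewrite vsid_cmp by bd. rewrite <- hscmpA by bd. rewrite <- vscmpA by bd.
  rewrite <- vsid_whr by bd. rewrite (hd_cmp Hx) by bd.
  rewrite !vsid_whr by bd. rewrite (@hscmpA _ (vsid (h_o x _)) (fc G f g)) by bd.
  rewrite (@vscmpA _ _ [_ | [fc G f g | _]]) by bd.
  rewrite <- vsid_whl by bd. rewrite (hd_cmp Hy) by bd.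
  rewrite !vsid_whl by bd.
  rewrite vsid_cmp by bd. rewrite !hscmpA by bd. rewrite <- !vscmpA by bd.
  f_equal. rewrite !vscmpA by bd. f_equal. rewrite <- !vscmpA by bd. f_equal.
  rewrite <- (@hscmpA _ (vsid (h_o x (hsrc f)))) by bd. rewrite <- !vsid_cmp by bd.
  rewrite <- (@hscmpA _ (vsid (fh F f))) by bd. rewrite <- vsid_cmp by bd.
  assert (E1 := @slide_lr _ (h_d x f) (h_d y g)).
  assert (E2 := @slide_rl _ (h_d x f) (h_d y g)).
  rewrite (bot_hd Hx), ?(top_hd Hx), (top_hd Hy) in E1.
  rewrite (bot_hd Hy), ?(top_hd Hy), (top_hd Hx) in E2.
  assert (e : htgt f = hsrc g) by assumption. rewrite ?e. rewrite ?e in E1, E2.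
  rewrite E1, E2 by bd. reflexivity.
- rewrite vsid_cmp by bd. rewrite <- hscmpA by bd. rewrite <- vscmpA by bd.
  rewrite hsrc_id, htgt_id. rewrite <- vsid_whr by bd. rewrite (hd_id Hx).
  rewrite !hscmpA by bd. rewrite <- vsid_whl by bd. now rewrite (hd_id Hy).
- rewrite interchange by bd. now rewrite (hv_cmp Hx), (hv_cmp Hy) by bd.
- rewrite (hv_id Hx), (hv_id Hy), <- vsid_cmp; bd.
- rewrite <- hscmpA, <- vscmpA by bd. rewrite htgt_bot, hsrc_bot.
  rewrite (interchange (a := [fs F a | h_v x (rgt a)])) by bd.
  rewrite (hd_nat Hx), (@vscmp1r' _ _ (h_v y (rgt a))) by bd.
  rewrite <- (@vscmp1l' _ (h_o y (htgt (top a))) (h_v y (rgt a))) by bd.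
  rewrite <- interchange by bd. rewrite (@hscmpA _ (h_v x _)) by bd.
  rewrite (@vscmpA _ [h_d x _ | _]) by bd.
  rewrite (@interchange _ (h_v x _)) by bd.
  rewrite (hd_nat Hy), (@vscmp1r' _ _ (h_v x (lft a))) by bd.
  rewrite <- (@vscmp1l' _ (h_o x (hsrc (top a))) (h_v x (lft a))) by bd.
  rewrite <- interchange by bd. rewrite <- vscmpA, hscmpA by bd.
  rewrite (@vscmp1l' _ _ (h_v x (lft a))) by bd. reflexivity.
Qed.

Lemma vdat_cmp_ok F G H x y :
  is_vtrans F G x -> is_vtrans G H y -> is_vtrans F H (vdat_cmp x y).
Proof.
intros Hx Hy.
constructor; simpl; intros; try bd.
- apply hinv_hcmp; [bd | |].
  + apply hinv_vcmp; [bd | | apply hinv_id | apply (vdK Hy)].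
    rewrite (hinv_globt (vdK Hy u) (top_vd Hy u)). bd.
  + apply hinv_vcmp; [bd | | apply (vdK Hx) | apply hinv_id].
    rewrite (hinv_globb (vdK Hx u) (bot_vd Hx u)). bd.
- rewrite vsrc_cmp, vtgt_cmp by bd.
  rewrite (vd_cmp Hx), (vd_cmp Hy) by bd.
  rewrite !hsid_whl, !hsid_whr by bd. rewrite !hscmpA by bd.
  rewrite <- !vscmpA by bd. f_equal.
  rewrite <- !hscmpA by bd. f_equal.
  rewrite !vscmpA by bd. rewrite <- !hsid_cmp by bd.
  rewrite <- !vscmpA by bd. rewrite <- !hsid_cmp by bd.
  rewrite <- !interchange by bd.
  rewrite !hscmp1l', !hscmp1r' by bd. reflexivity.
- rewrite (vd_id Hx), (vd_id Hy), <- !hsid_cmp by bd. bdn. rewrite hscmp1l' by bd.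
  reflexivity.
- rewrite <- interchange by bd. rewrite vscmpA by bd. rewrite (vh_cmp Hy) by bd.
  rewrite <- vscmpA by bd. rewrite (vh_cmp Hx) by bd. rewrite vscmpA; bd.
- rewrite hsid_cmp by bd. rewrite vscmpA by bd. rewrite (vh_id Hy).
  rewrite <- vscmpA by bd. rewrite (vh_id Hx). rewrite vscmpA; bd.
- rewrite <- hscmpA, vscmpA by bd. rewrite <- hsrc_top, <- !htgt_top.
  rewrite <- (@interchange _ (v_h x (top a)) (hsid (v_o x (htgt (top a))))) by bd.
  rewrite (vd_nat Hy), (@hscmp1r' _ _ (v_h x (top a))) by bd.
  rewrite <- (@hscmp1l' _ (v_o x (hsrc (top a))) (v_h x (top a))) by bd.
  rewrite interchange by bd. rewrite hscmpA by bd.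
  rewrite <- (@vscmpA _ (v_h x _)) by bd.
  rewrite <- (@interchange _ (v_h x (top a) / fs G a)) by bd.
  rewrite (vd_nat Hx).
  rewrite <- htgt_bot, (@hscmp1r' _ _ (v_h y (bot a))) by bd.
  rewrite <- (@hscmp1l' _ (v_o y (hsrc (bot a))) (v_h y (bot a))) by bd.
  rewrite interchange by bd. rewrite <- hscmpA, vscmpA by bd. 
  rewrite hsrc_bot, (@hscmp1l' _ _ (v_h y (bot a))) by bd. reflexivity.
Qed.
End Transformations.

Section Pseudo.
Variables C D : dblcat.

Record harr := Harr {
  ha_dom : psfun C D;
  ha_cod : psfun C D;
  ha_dat :> hdat C D;
  ha_ok : is_htrans ha_dom ha_cod ha_dat
}.

Record varr := Varr {
  va_dom : psfun C D;
  va_cod : psfun C D;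
  va_dat :> vdat C D;
  va_ok : is_vtrans va_dom va_cod va_dat
}.

Record marr := Marr {
  ma_top : harr;
  ma_bot : harr;
  ma_lft : varr;
  ma_rgt : varr;
  ma_sq :> ob C -> sq D;
  ma_tl : ha_dom ma_top = va_dom ma_lft;
  ma_tr : ha_cod ma_top = va_dom ma_rgt;
  ma_bl : ha_dom ma_bot = va_cod ma_lft;
  ma_br : ha_cod ma_bot = va_cod ma_rgt;
  ma_ok : is_modif ma_top ma_bot ma_lft ma_rgt ma_sq
}.

Definition harr_id (F : psfun C D) : harr := Harr (hdat_id_ok F).
Definition varr_id (F : psfun C D) : varr := Varr (vdat_id_ok F).

Lemma harr_cmp_ok (x y : harr) : ha_cod x = ha_dom y ->
  is_htrans (ha_dom x) (ha_cod y) (hdat_cmp x y).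
Proof.
intros e. apply hdat_cmp_ok with (G := ha_cod x); [apply ha_ok | rewrite e; apply ha_ok].
Qed.
Lemma varr_cmp_ok (x y : varr) : va_cod x = va_dom y ->
  is_vtrans (va_dom x) (va_cod y) (vdat_cmp x y).
Proof.
intros e. apply vdat_cmp_ok with (G := va_cod x); [apply va_ok | rewrite e; apply va_ok].
Qed.

Definition harr_cmp (x y : harr) : harr :=
  match excluded_middle_informative (ha_cod x = ha_dom y) with
  | left e => Harr (harr_cmp_ok e)
  | right _ => x
  end.
Definition varr_cmp (x y : varr) : varr :=
  match excluded_middle_informative (va_cod x = va_dom y) with
  | left e => Varr (varr_cmp_ok e)
  | right _ => x
  end.

Lemma harr_cmpE x y (e : ha_cod x = ha_dom y) : harr_cmp x y = Harr (harr_cmp_ok e).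
Proof.
unfold harr_cmp; destruct excluded_middle_informative as [e'|]; [|contradiction].
f_equal; apply proof_irrelevance.
Qed.
Lemma varr_cmpE x y (e : va_cod x = va_dom y) : varr_cmp x y = Varr (varr_cmp_ok e).
Proof.
unfold varr_cmp; destruct excluded_middle_informative as [e'|]; [|contradiction].
f_equal; apply proof_irrelevance.
Qed.

Lemma harr_ext (x y : harr) : ha_dom x = ha_dom y -> ha_cod x = ha_cod y ->
  (forall A, h_o x A = h_o y A) -> (forall u, h_v x u = h_v y u) ->
  (forall f, h_d x f = h_d y f) -> x = y.
Proof.
destruct x as [F G [xo xv xd xi] Hx], y as [F' G' [yo yv yd yi] Hy]; simpl.
intros <- <- E1 E2 E3.
apply functional_extensionality in E1, E2, E3. subst yo yv yd.
assert (xi = yi).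
{ apply functional_extensionality; intros f.
  eapply vinv_uniq; [apply (hdK Hx) | apply (hdK Hy)]. }
subst yi. f_equal; apply proof_irrelevance.
Qed.

Lemma varr_ext (x y : varr) : va_dom x = va_dom y -> va_cod x = va_cod y ->
  (forall A, v_o x A = v_o y A) -> (forall u, v_h x u = v_h y u) ->
  (forall f, v_d x f = v_d y f) -> x = y.
Proof.
destruct x as [F G [xo xv xd xi] Hx], y as [F' G' [yo yv yd yi] Hy]; simpl.
intros <- <- E1 E2 E3.
apply functional_extensionality in E1, E2, E3. subst yo yv yd.
assert (xi = yi).
{ apply functional_extensionality; intros f.
  eapply hinv_uniq; [apply (vdK Hx) | apply (vdK Hy)]. }
subst yi. f_equal; apply proof_irrelevance.
Qed.

Lemma marr_ext (x y : marr) : ma_top x = ma_top y -> ma_bot x = ma_bot y ->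
  ma_lft x = ma_lft y -> ma_rgt x = ma_rgt y -> (forall A, x A = y A) -> x = y.
Proof.
destruct x, y; simpl. intros <- <- <- <- E.
apply functional_extensionality in E. subst ma_sq1.
f_equal; apply proof_irrelevance.
Qed.

Lemma modif_hid (x : varr) :
  is_modif (hdat_id (va_dom x)) (hdat_id (va_cod x)) x x (fun A => hsid (v_o x A)).
Proof.
destruct x as [F G x Hx]; simpl.
constructor; simpl; intros; try bd.
- rewrite hscmp1l', hscmp1r' by bd. rewrite vscmp1l', vscmp1r'; bd.
- rewrite <- !hsid_cmp by bd. rewrite hscmp1l', hscmp1r'; bd.
Qed.
Lemma modif_vid (x : harr) :
  is_modif x x (vdat_id (ha_dom x)) (vdat_id (ha_cod x)) (fun A => vsid (h_o x A)).
Proof.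
destruct x as [F G x Hx]; simpl.
constructor; simpl; intros; try bd.
- rewrite <- !vsid_cmp by bd. rewrite vscmp1l', vscmp1r'; bd.
- rewrite vscmp1l', vscmp1r' by bd. rewrite hscmp1l', hscmp1r'; bd.
Qed.

Lemma modif_hcmp F G H F' G' H' (t t' b b' : hdat C D) (l m r : vdat C D) a c :
  is_htrans F G t -> is_htrans G H t' -> is_htrans F' G' b -> is_htrans G' H' b' ->
  is_vtrans F F' l -> is_vtrans G G' m -> is_vtrans H H' r ->
  is_modif t b l m a -> is_modif t' b' m r c ->
  is_modif (hdat_cmp t t') (hdat_cmp b b') l r (fun A => [a A | c A]).
Proof.
intros Ht Ht' Hb Hb' Hl Hm Hr Ha Hc.
constructor; simpl; intros; try bd.
- rewrite <- hscmpA, <- vscmpA by bd.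
  rewrite (@interchange _ [v_h l f | a (htgt f)]) by bd.
  rewrite (m_hor Ha), (@vscmp1r' _ _ (c (htgt f))) by bd.
  rewrite <- (@vscmp1l' _ (h_o t' (htgt f)) (c (htgt f))) by bd.
  rewrite <- interchange by bd. rewrite (@vscmpA _ [_ | vsid _]), hscmpA by bd.
  rewrite (@interchange _ (a (hsrc f))) by bd.
  rewrite (m_hor Hc), (@vscmp1r' _ _ (a (hsrc f))) by bd.
  rewrite <- (@vscmp1l' _ (h_o t (hsrc f)) (a (hsrc f))) by bd.
  rewrite <- interchange by bd. rewrite vscmpA, hscmpA by bd.
  rewrite (@vscmp1l' _ _ (a (hsrc f))) by bd. reflexivity.
- rewrite interchange by bd. rewrite <- hscmpA, (m_ver Ha) by bd.
  rewrite hscmpA, (m_ver Hc) by bd. rewrite <- hscmpA by bd.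
  rewrite <- interchange by bd. reflexivity.
Qed.

Lemma modif_vcmp F G H F' G' H' (t m b : hdat C D) (l l' r r' : vdat C D) a c :
  is_htrans F F' t -> is_htrans G G' m -> is_htrans H H' b ->
  is_vtrans F G l -> is_vtrans G H l' -> is_vtrans F' G' r -> is_vtrans G' H' r' ->
  is_modif t m l r a -> is_modif m b l' r' c ->
  is_modif t b (vdat_cmp l l') (vdat_cmp r r') (fun A => a A / c A).
Proof.
intros Ht Hm Hb Hl Hl' Hr Hr' Ha Hc.
constructor; simpl; intros; try bd.
- rewrite <- interchange by bd. rewrite vscmpA, (m_hor Hc) by bd.
  rewrite <- vscmpA, (m_hor Ha) by bd. rewrite vscmpA by bd.
  rewrite <- interchange by bd. reflexivity.
- rewrite hscmpA, <- vscmpA by bd.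
  rewrite <- (@interchange _ (v_d l u)) by bd.
  rewrite (m_ver Ha), (@hscmp1l' _ _ (c (vtgt u))) by bd.
  rewrite <- (@hscmp1r' _ (v_o r' (vtgt u)) (c (vtgt u))) by bd.
  rewrite interchange by bd. rewrite <- hscmpA, vscmpA by bd.
  rewrite <- (@interchange _ (hsid (v_o l (vsrc u)))) by bd.
  rewrite (m_ver Hc), (@hscmp1l' _ _ (a (vsrc u))) by bd.
  rewrite <- (@hscmp1r' _ (v_o r (vsrc u)) (a (vsrc u))) by bd.
  rewrite interchange by bd. rewrite hscmpA, <- vscmpA by bd.
  rewrite (@hscmp1r' _ _ (a (vsrc u))) by bd. reflexivity.
Qed.

Definition marr_hid (x : varr) : marr :=
  @Marr (harr_id (va_dom x)) (harr_id (va_cod x)) x x (fun A => hsid (v_o x A))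
    eq_refl eq_refl eq_refl eq_refl (modif_hid x).
Definition marr_vid (x : harr) : marr :=
  @Marr x x (varr_id (ha_dom x)) (varr_id (ha_cod x)) (fun A => vsid (h_o x A))
    eq_refl eq_refl eq_refl eq_refl (modif_vid x).

Definition marr_hcmp_aux (a b : marr) (e : ma_rgt a = ma_lft b) : marr.
Proof.
refine (@Marr (harr_cmp (ma_top a) (ma_top b)) (harr_cmp (ma_bot a) (ma_bot b))
  (ma_lft a) (ma_rgt b) (fun A => [a A | b A]) _ _ _ _ _);
abstract (destruct a as [t s l r a tl tr bl br Ha], b as [t' s' l' r' b tl' tr' bl' br' Hb];
  simpl in *; subst l';
  rewrite ?(harr_cmpE (eq_trans tr (eq_sym tl'))), ?(harr_cmpE (eq_trans br (eq_sym bl')));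
  simpl; try assumption;
  destruct t, s, t', s', l, r, r'; simpl in *; subst; (eapply modif_hcmp; [ | | | | | | | exact Ha | exact Hb]; eassumption)).
Defined.

Definition marr_vcmp_aux (a b : marr) (e : ma_bot a = ma_top b) : marr.
Proof.
refine (@Marr (ma_top a) (ma_bot b) (varr_cmp (ma_lft a) (ma_lft b))
  (varr_cmp (ma_rgt a) (ma_rgt b)) (fun A => a A / b A) _ _ _ _ _);
abstract (destruct a as [t s l r a tl tr bl br Ha], b as [t' s' l' r' b tl' tr' bl' br' Hb];
  simpl in *; subst t';
  rewrite ?(varr_cmpE (eq_trans (eq_sym bl) tl')), ?(varr_cmpE (eq_trans (eq_sym br) tr'));
  simpl; try assumption;
  destruct t, s, s', l, r, l', r'; simpl in *; subst; (eapply modif_vcmp; [ | | | | | | | exact Ha | exact Hb]; eassumption)).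
Defined.

Definition marr_hcmp (a b : marr) : marr :=
  match excluded_middle_informative (ma_rgt a = ma_lft b) with
  | left e => marr_hcmp_aux e
  | right _ => a
  end.
Definition marr_vcmp (a b : marr) : marr :=
  match excluded_middle_informative (ma_bot a = ma_top b) with
  | left e => marr_vcmp_aux e
  | right _ => a
  end.

Lemma marr_hcmpE a b (e : ma_rgt a = ma_lft b) : marr_hcmp a b = marr_hcmp_aux e.
Proof.
unfold marr_hcmp; destruct excluded_middle_informative as [e'|]; [|contradiction].
f_equal; apply proof_irrelevance.
Qed.
Lemma marr_vcmpE a b (e : ma_bot a = ma_top b) : marr_vcmp a b = marr_vcmp_aux e.
Proof.
unfold marr_vcmp; destruct excluded_middle_informative as [e'|]; [|contradiction].
f_equal; apply proof_irrelevance.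
Qed.

Lemma harr_cmp_spec x y : ha_cod x = ha_dom y ->
  ha_dom (harr_cmp x y) = ha_dom x /\ ha_cod (harr_cmp x y) = ha_cod y /\
  ha_dat (harr_cmp x y) = hdat_cmp x y.
Proof. intros e; now rewrite (harr_cmpE e). Qed.
Lemma varr_cmp_spec x y : va_cod x = va_dom y ->
  va_dom (varr_cmp x y) = va_dom x /\ va_cod (varr_cmp x y) = va_cod y /\
  va_dat (varr_cmp x y) = vdat_cmp x y.
Proof. intros e; now rewrite (varr_cmpE e). Qed.
Lemma marr_hcmp_spec a b : ma_rgt a = ma_lft b ->
  ma_top (marr_hcmp a b) = harr_cmp (ma_top a) (ma_top b) /\
  ma_bot (marr_hcmp a b) = harr_cmp (ma_bot a) (ma_bot b) /\
  ma_lft (marr_hcmp a b) = ma_lft a /\ ma_rgt (marr_hcmp a b) = ma_rgt b /\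
  ma_sq (marr_hcmp a b) = fun A => [a A | b A].
Proof. intros e; now rewrite (marr_hcmpE e). Qed.
Lemma marr_vcmp_spec a b : ma_bot a = ma_top b ->
  ma_top (marr_vcmp a b) = ma_top a /\ ma_bot (marr_vcmp a b) = ma_bot b /\
  ma_lft (marr_vcmp a b) = varr_cmp (ma_lft a) (ma_lft b) /\
  ma_rgt (marr_vcmp a b) = varr_cmp (ma_rgt a) (ma_rgt b) /\
  ma_sq (marr_vcmp a b) = fun A => a A / b A.
Proof. intros e; now rewrite (marr_vcmpE e). Qed.

Lemma harr_cmp1l x : harr_cmp (harr_id (ha_dom x)) x = x.
Proof.
rewrite (@harr_cmpE (harr_id (ha_dom x)) x eq_refl).
destruct x as [F G x Hx]; apply harr_ext; simpl; intros; try bd.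
- now rewrite hscmp1l' by bd.
- rewrite <- vsid_cmp by bd. rewrite vscmp1l' by bd.
  rewrite <- hsid_vid, hscmp1l'; bd.
Qed.
Lemma harr_cmp1r x : harr_cmp x (harr_id (ha_cod x)) = x.
Proof.
rewrite (@harr_cmpE x (harr_id (ha_cod x)) eq_refl).
destruct x as [F G x Hx]; apply harr_ext; simpl; intros; try bd.
- now rewrite hscmp1r' by bd.
- rewrite <- vsid_cmp, <- hsid_vid, hscmp1r', vscmp1r' by bd. reflexivity.
Qed.
Lemma varr_cmp1l x : varr_cmp (varr_id (va_dom x)) x = x.
Proof.
rewrite (@varr_cmpE (varr_id (va_dom x)) x eq_refl).
destruct x as [F G x Hx]; apply varr_ext; simpl; intros; try bd.
- now rewrite vscmp1l' by bd.
- rewrite <- hsid_cmp by bd. rewrite hsid_vid, vscmp1l', hscmp1r'; bd.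
Qed.
Lemma varr_cmp1r x : varr_cmp x (varr_id (va_cod x)) = x.
Proof.
rewrite (@varr_cmpE x (varr_id (va_cod x)) eq_refl).
destruct x as [F G x Hx]; apply varr_ext; simpl; intros; try bd.
- now rewrite vscmp1r' by bd.
- rewrite <- hsid_cmp by bd. rewrite hsid_vid, vscmp1r', hscmp1l'; bd.
Qed.

Lemma harr_cmpA x y z : ha_cod x = ha_dom y -> ha_cod y = ha_dom z ->
  harr_cmp (harr_cmp x y) z = harr_cmp x (harr_cmp y z).
Proof.
intros e e'.
destruct (harr_cmp_spec e) as (E1 & E2 & E3), (harr_cmp_spec e') as (E1' & E2' & E3').
destruct (@harr_cmp_spec (harr_cmp x y) z) as (A1 & A2 & A3); [congruence|].
destruct (@harr_cmp_spec x (harr_cmp y z)) as (B1 & B2 & B3); [congruence|].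
destruct x as [F G x Hx], y as [G1 H y Hy], z as [H1 K z Hz]; simpl in *; subst G1 H1.
apply harr_ext; [congruence | congruence | | |]; rewrite A3, B3, E3, E3'; simpl; intros.
- bd.
- apply hscmpA; bd.
- rewrite !vsid_cmp by bd. rewrite vsid_whr, vsid_whl by bd.
  rewrite !vscmpA by bd. rewrite !hscmpA by bd. reflexivity.
Qed.

Lemma varr_cmpA x y z : va_cod x = va_dom y -> va_cod y = va_dom z ->
  varr_cmp (varr_cmp x y) z = varr_cmp x (varr_cmp y z).
Proof.
intros e e'.
destruct (varr_cmp_spec e) as (E1 & E2 & E3), (varr_cmp_spec e') as (E1' & E2' & E3').
destruct (@varr_cmp_spec (varr_cmp x y) z) as (A1 & A2 & A3); [congruence|].
destruct (@varr_cmp_spec x (varr_cmp y z)) as (B1 & B2 & B3); [congruence|].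
destruct x as [F G x Hx], y as [G1 H y Hy], z as [H1 K z Hz]; simpl in *; subst G1 H1.
apply varr_ext; [congruence | congruence | | |]; rewrite A3, B3, E3, E3'; simpl; intros.
- bd.
- apply vscmpA; bd.
- rewrite !hsid_cmp by bd. rewrite hsid_whr, hsid_whl by bd.
  rewrite !hscmpA by bd. rewrite !vscmpA by bd. reflexivity.
Qed.
End Pseudo.

(** Pseudo_ps(C, D): as for any double category here, composites are only
    meaningful for composable cells; elsewhere the first argument is returned. *)
Definition pseudo (C D : dblcat) : dblcat.
Proof.
refine (@Dblcat (psfun C D) (harr C D) (varr C D) (marr C D)
  (@ha_dom C D) (@ha_cod C D) (@va_dom C D) (@va_cod C D)
  (@ma_top C D) (@ma_bot C D) (@ma_lft C D) (@ma_rgt C D)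
  (@harr_id C D) (@harr_cmp C D) (@varr_id C D) (@varr_cmp C D)
  (@marr_hid C D) (@marr_hcmp C D) (@marr_vid C D) (@marr_vcmp C D)
  (@ma_tl C D) (@ma_tr C D) (@ma_bl C D) (@ma_br C D)
  _ _ _ _ (@harr_cmp1l C D) (@harr_cmp1r C D) (@harr_cmpA C D)
  _ _ _ _ (@varr_cmp1l C D) (@varr_cmp1r C D) (@varr_cmpA C D)
  _ _ _ _ _ _ _ _ _ _ _ _ _ _ _ _ _ _ _ _ _ _ _ _ _ _); intros; try reflexivity;
  try (destruct (harr_cmp_spec H) as (? & ? & ?); assumption);
  try (destruct (varr_cmp_spec H) as (? & ? & ?); assumption);
  try (destruct (marr_hcmp_spec H) as (? & ? & ? & ? & ?); assumption);
  try (destruct (marr_vcmp_spec H) as (? & ? & ? & ? & ?); assumption).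
- destruct (@marr_hcmp_spec _ _ (marr_hid (ma_lft a)) a eq_refl) as (E1 & E2 & E3 & E4 & E5).
  destruct a as [t s l r a tl tr bl br Ha]; apply marr_ext; simpl in *.
  + rewrite E1, <- tl. apply harr_cmp1l.
  + rewrite E2, <- bl. apply harr_cmp1l.
  + exact E3.
  + exact E4.
  + intros A; rewrite E5; apply hscmp1l'; bd.
- destruct (@marr_hcmp_spec _ _ a (marr_hid (ma_rgt a)) eq_refl) as (E1 & E2 & E3 & E4 & E5).
  destruct a as [t s l r a tl tr bl br Ha]; apply marr_ext; simpl in *.
  + rewrite E1, <- tr. apply harr_cmp1r.
  + rewrite E2, <- br. apply harr_cmp1r.
  + exact E3.
  + exact E4.
  + intros A; rewrite E5; apply hscmp1r'; bd.
- destruct (marr_hcmp_spec H) as (E1 & E2 & E3 & E4 & E5).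
  destruct (marr_hcmp_spec H0) as (E1' & E2' & E3' & E4' & E5').
  destruct (@marr_hcmp_spec _ _ (marr_hcmp a b) c) as (A1 & A2 & A3 & A4 & A5); [congruence|].
  destruct (@marr_hcmp_spec _ _ a (marr_hcmp b c)) as (B1 & B2 & B3 & B4 & B5); [congruence|].
  destruct a as [t s l r a tl tr bl br Ha], b as [t' s' l' r' b tl' tr' bl' br' Hb],
    c as [t'' s'' l'' r'' c tl'' tr'' bl'' br'' Hc]; simpl in *.
  apply marr_ext; simpl.
  + rewrite A1, B1, E1, E1'. apply harr_cmpA; congruence.
  + rewrite A2, B2, E2, E2'. apply harr_cmpA; congruence.
  + congruence.
  + congruence.
  + intros A; rewrite A5, B5, E5, E5'. subst l' l''. apply hscmpA; bd.
- destruct (@marr_vcmp_spec _ _ (marr_vid (ma_top a)) a eq_refl) as (E1 & E2 & E3 & E4 & E5).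
  destruct a as [t s l r a tl tr bl br Ha]; apply marr_ext; simpl in *.
  + exact E1.
  + exact E2.
  + rewrite E3, tl. apply varr_cmp1l.
  + rewrite E4, tr. apply varr_cmp1l.
  + intros A; rewrite E5; apply vscmp1l'; bd.
- destruct (@marr_vcmp_spec _ _ a (marr_vid (ma_bot a)) eq_refl) as (E1 & E2 & E3 & E4 & E5).
  destruct a as [t s l r a tl tr bl br Ha]; apply marr_ext; simpl in *.
  + exact E1.
  + exact E2.
  + rewrite E3, bl. apply varr_cmp1r.
  + rewrite E4, br. apply varr_cmp1r.
  + intros A; rewrite E5; apply vscmp1r'; bd.
- destruct (marr_vcmp_spec H) as (E1 & E2 & E3 & E4 & E5).
  destruct (marr_vcmp_spec H0) as (E1' & E2' & E3' & E4' & E5').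
  destruct (@marr_vcmp_spec _ _ (marr_vcmp a b) c) as (A1 & A2 & A3 & A4 & A5); [congruence|].
  destruct (@marr_vcmp_spec _ _ a (marr_vcmp b c)) as (B1 & B2 & B3 & B4 & B5); [congruence|].
  destruct a as [t s l r a tl tr bl br Ha], b as [t' s' l' r' b tl' tr' bl' br' Hb],
    c as [t'' s'' l'' r'' c tl'' tr'' bl'' br'' Hc]; simpl in *.
  apply marr_ext; simpl.
  + congruence.
  + congruence.
  + rewrite A3, B3, E3, E3'. apply varr_cmpA; congruence.
  + rewrite A4, B4, E4, E4'. apply varr_cmpA; congruence.
  + intros A; rewrite A5, B5, E5, E5'. subst t' t''. apply vscmpA; bd.
- apply marr_ext; simpl; intros.
  + reflexivity.
  + reflexivity.
  + apply varr_ext; simpl; intros; try reflexivity; apply hsid_vid.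
  + apply varr_ext; simpl; intros; try reflexivity; apply hsid_vid.
  + apply hsid_vid.
- destruct (varr_cmp_spec H) as (E1 & E2 & E3).
  destruct (@marr_vcmp_spec _ _ (marr_hid u) (marr_hid v)) as (A1 & A2 & A3 & A4 & A5);
    [now simpl; rewrite H|].
  apply marr_ext; simpl in *.
  + now rewrite A1, E1.
  + now rewrite A2, E2.
  + now rewrite A3.
  + now rewrite A4.
  + intros A; rewrite A5, E3; simpl.
    pose proof (va_ok u) as Hu; pose proof (va_ok v) as Hv; rewrite <- H in Hv.
    apply hsid_cmp; bd.
- destruct (harr_cmp_spec H) as (E1 & E2 & E3).
  destruct (@marr_hcmp_spec _ _ (marr_vid f) (marr_vid g)) as (A1 & A2 & A3 & A4 & A5);
    [now simpl; rewrite H|].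
  apply marr_ext; simpl in *.
  + now rewrite A1.
  + now rewrite A2.
  + now rewrite A3, E1.
  + now rewrite A4, E2.
  + intros A; rewrite A5, E3; simpl.
    pose proof (ha_ok f) as Hf; pose proof (ha_ok g) as Hg; rewrite <- H in Hg.
    apply vsid_cmp; bd.
- destruct (marr_hcmp_spec H) as (A1 & A2 & A3 & A4 & A5).
  destruct (marr_hcmp_spec H0) as (B1 & B2 & B3 & B4 & B5).
  destruct (marr_vcmp_spec H1) as (E1 & E2 & E3 & E4 & E5).
  destruct (marr_vcmp_spec H2) as (F1 & F2 & F3 & F4 & F5).
  destruct (@marr_vcmp_spec _ _ (marr_hcmp a b) (marr_hcmp c d)) as (X1 & X2 & X3 & X4 & X5);
    [congruence|].
  destruct (@marr_hcmp_spec _ _ (marr_vcmp a c) (marr_vcmp b d)) as (Y1 & Y2 & Y3 & Y4 & Y5);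
    [congruence|].
  apply marr_ext.
  + congruence.
  + congruence.
  + congruence.
  + congruence.
  + intros A; rewrite X5, Y5, A5, B5, E5, F5.
    pose proof (ma_ok a) as Ha; pose proof (ma_ok b) as Hb;
    pose proof (ma_ok c) as Hc; pose proof (ma_ok d) as Hd.
    rewrite <- H in Hb; rewrite <- H0 in Hd; rewrite <- H1 in Hc; rewrite <- H2 in Hd.
    apply interchange; bd.
Defined.

Record binoidal (B : dblcat) := Binoidal {
  bL : ob B -> psfun B B; (* [bL X A] is A |x - *)
  bR : ob B -> psfun B B; (* [bR X A] is - x| A *)
  bLR : forall A C, bL A C = bR C A
}.

Section Centrality.
Variables (B : dblcat) (X : binoidal B).
Local Notation L := (bL X).
Local Notation R := (bR X).

Definition is_left_central_hor (K : hor B) (t : hdat B B) : Prop :=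
  is_htrans (L (hsrc K)) (L (htgt K)) t /\ forall A, h_o t A = fh (R A) K.
Definition is_right_central_hor (K : hor B) (t : hdat B B) : Prop :=
  is_htrans (R (hsrc K)) (R (htgt K)) t /\ forall A, h_o t A = fh (L A) K.
Definition is_left_central_ver (U : ver B) (t : vdat B B) : Prop :=
  is_vtrans (L (vsrc U)) (L (vtgt U)) t /\ forall A, v_o t A = fv (R A) U.
Definition is_right_central_ver (U : ver B) (t : vdat B B) : Prop :=
  is_vtrans (R (vsrc U)) (R (vtgt U)) t /\ forall A, v_o t A = fv (L A) U.

Definition is_left_central_sq (a : sq B) (t b : hdat B B) (l r : vdat B B) : Prop :=
  is_modif t b l r (fun A => fs (R A) a).
Definition is_right_central_sq (a : sq B) (t b : hdat B B) (l r : vdat B B) : Prop :=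
  is_modif t b l r (fun A => fs (L A) a).

Record inv_central (U : ver B) := Inv_central {
  ic_inv : ver B;
  ic_vsrc : vsrc ic_inv = vtgt U;
  ic_vtgt : vtgt ic_inv = vsrc U;
  ic_K : vcmp U ic_inv = vid (vsrc U);
  ic_Ki : vcmp ic_inv U = vid (vtgt U);
  ic_l : vdat B B;
  ic_r : vdat B B;
  ic_li : vdat B B;
  ic_ri : vdat B B;
  ic_lP : is_left_central_ver U ic_l;
  ic_rP : is_right_central_ver U ic_r;
  ic_liP : is_left_central_ver ic_inv ic_li;
  ic_riP : is_right_central_ver ic_inv ic_ri;
  ic_lK : forall k, vinv (v_h ic_l k) (v_h ic_li k);
  ic_rK : forall K, vinv (v_h ic_r K) (v_h ic_ri K)
}.

(** Purely central structures: [pc_lh K] is the transformation K |x -,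
    [pc_rh k] is - x| k, etc. *)
Record purely_central := Purely_central {
  pc_lh : hor B -> hdat B B;
  pc_lv : ver B -> vdat B B;
  pc_rh : hor B -> hdat B B;
  pc_rv : ver B -> vdat B B;
  pc_lhP : forall K, is_left_central_hor K (pc_lh K);
  pc_lvP : forall U, is_left_central_ver U (pc_lv U);
  pc_rhP : forall k, is_right_central_hor k (pc_rh k);
  pc_rvP : forall u, is_right_central_ver u (pc_rv u);
  pc_lsP : forall a, is_left_central_sq a (pc_lh (top a)) (pc_lh (bot a))
    (pc_lv (lft a)) (pc_lv (rgt a));
  pc_rsP : forall a, is_right_central_sq a (pc_rh (top a)) (pc_rh (bot a))
    (pc_rv (lft a)) (pc_rv (rgt a));
  pc_hh : forall K k, h_d (pc_lh K) k = h_di (pc_rh k) K;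
  pc_vv : forall U u, v_d (pc_lv U) u = v_di (pc_rv u) U;
  pc_hv : forall K u, h_v (pc_lh K) u = v_h (pc_rv u) K;
  pc_vh : forall U k, v_h (pc_lv U) k = h_v (pc_rh k) U
}.

(** The cells of [lc] are the b |x -; the conditions say that the underlying
    cell-components are the b x| A. *)
Record left_central := Left_central {
  lc :> psfun B (pseudo B B);
  lc_o : forall A, fo lc A = L A;
  lc_h : forall K A, h_o (ha_dat (fh lc K)) A = fh (R A) K;
  lc_v : forall U A, v_o (va_dat (fv lc U)) A = fv (R A) U;
  lc_s : forall a A, ma_sq (fs lc a) A = fs (R A) a;
  lc_c : forall f g A, htgt f = hsrc g -> ma_sq (fc lc f g) A = fc (R A) f g;
  lc_u : forall C A, ma_sq (fu lc C) A = fu (R A) C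
}.

Record right_central := Right_central {
  rc :> psfun B (pseudo B B);
  rc_o : forall A, fo rc A = R A;
  rc_h : forall K A, h_o (ha_dat (fh rc K)) A = fh (L A) K;
  rc_v : forall U A, v_o (va_dat (fv rc U)) A = fv (L A) U;
  rc_s : forall a A, ma_sq (fs rc a) A = fs (L A) a;
  rc_c : forall f g A, htgt f = hsrc g -> ma_sq (fc rc f g) A = fc (L A) f g;
  rc_u : forall C A, ma_sq (fu rc C) A = fu (L A) C
}.

Record lr_structure := Lr_structure {
  L0 : psfun B (pseudo B B);
  R0 : psfun B (pseudo B B);
  L0_o : forall A, fo L0 A = L A;
  R0_o : forall A, fo R0 A = R A;
  L0_h : forall K A, h_o (ha_dat (fh L0 K)) A = fh (R A) K;
  L0_v : forall U A, v_o (va_dat (fv L0 U)) A = fv (R A) U;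
  L0_s : forall a A, ma_sq (fs L0 a) A = fs (R A) a;
  R0_h : forall K A, h_o (ha_dat (fh R0 K)) A = fh (L A) K;
  R0_v : forall U A, v_o (va_dat (fv R0 U)) A = fv (L A) U;
  R0_s : forall a A, ma_sq (fs R0 a) A = fs (L A) a
}.

Record lr_purely_central := Lr_purely_central {
  lr :> lr_structure;
  lr_hh : forall K k, h_d (ha_dat (fh (L0 lr) K)) k = h_di (ha_dat (fh (R0 lr) k)) K;
  lr_vv : forall U u, v_d (va_dat (fv (L0 lr) U)) u = v_di (va_dat (fv (R0 lr) u)) U;
  lr_hv : forall K u, h_v (ha_dat (fh (L0 lr) K)) u = v_h (va_dat (fv (R0 lr) u)) K;
  lr_vh : forall U k, v_h (va_dat (fv (L0 lr) U)) k = h_v (ha_dat (fh (R0 lr) k)) U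
}.

(** The exchange cells provided by a centrality structure, in the directions of
    the components of K |x - and U |x -:
    [ex_hh K k] : (K |x B')(A |x k) => (A' |x k)(K |x B),
    [ex_hv K u] = K |x -|_u,  [ex_vh U k] = U |x -|_k,  [ex_vv U u] = U |x -|_u. *)
Record exchange := Exchange {
  ex_hh : hor B -> hor B -> sq B;
  ex_hv : hor B -> ver B -> sq B;
  ex_vh : ver B -> hor B -> sq B;
  ex_vv : ver B -> ver B -> sq B;
  ex_vvi : ver B -> ver B -> sq B
}.

Definition purely_exchange (S : purely_central) : exchange := Exchange
  (fun K k => h_d (pc_lh S K) k) (fun K u => h_v (pc_lh S K) u)
  (fun U k => v_h (pc_lv S U) k) (fun U u => v_d (pc_lv S U) u)
  (fun U u => v_di (pc_lv S U) u).

Definition left_exchange (S : left_central) : exchange := Exchange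
  (fun K k => h_d (ha_dat (fh S K)) k) (fun K u => h_v (ha_dat (fh S K)) u)
  (fun U k => v_h (va_dat (fv S U)) k) (fun U u => v_d (va_dat (fv S U)) u)
  (fun U u => v_di (va_dat (fv S U)) u).

Definition right_exchange (S : right_central) : exchange := Exchange
  (fun K k => h_di (ha_dat (fh S k)) K) (fun K u => v_h (va_dat (fv S u)) K)
  (fun U k => h_v (ha_dat (fh S k)) U) (fun U u => v_di (va_dat (fv S u)) U)
  (fun U u => v_d (va_dat (fv S u)) U).

Definition lr_exchange (S : lr_purely_central) : exchange := Exchange
  (fun K k => h_d (ha_dat (fh (L0 S) K)) k) (fun K u => h_v (ha_dat (fh (L0 S) K)) u)
  (fun U k => v_h (va_dat (fv (L0 S) U)) k) (fun U u => v_d (va_dat (fv (L0 S) U)) u)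
  (fun U u => v_di (va_dat (fv (L0 S) U)) u).
End Centrality.

(** [al1 Y Z], [al2 W Z], [al3 W Y] are the associativity as a transformation in
    its first, second and third variable; [alo] is their common 1v-component.  In
    the pentagon and in the unit triangles the whiskerings W |x a and a x| Z by an
    object are images under a functor, and those by the varying 1h-cell are
    components of the centrality structures of the 1v-cell a. *)
Record premonoidal (B : dblcat) (X : binoidal B) := Premonoidal {
  pI : ob B;
  lam : vdat B B;
  rho : vdat B B;
  alo : ob B -> ob B -> ob B -> ver B;
  al1 : ob B -> ob B -> vdat B B;
  al2 : ob B -> ob B -> vdat B B;
  al3 : ob B -> ob B -> vdat B B;
  lamP : is_vstrict_iso (bL X pI) (fid B) lam;
  rhoP : is_vstrict_iso (bR X pI) (fid B) rho;
  al1P : forall Y Z, is_vstrict_iso (bR X Z \o bR X Y) (bR X (bL X Y Z)) (al1 Y Z);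
  al2P : forall W Z, is_vstrict_iso (bR X Z \o bL X W) (bL X W \o bR X Z) (al2 W Z);
  al3P : forall W Y, is_vstrict_iso (bL X (bL X W Y)) (bL X W \o bL X Y) (al3 W Y);
  al1_o : forall W Y Z, v_o (al1 Y Z) W = alo W Y Z;
  al2_o : forall W Y Z, v_o (al2 W Z) Y = alo W Y Z;
  al3_o : forall W Y Z, v_o (al3 W Y) Z = alo W Y Z;
  lamC : forall Y, inv_central X (v_o lam Y);
  rhoC : forall W, inv_central X (v_o rho W);
  alC : forall W Y Z, inv_central X (alo W Y Z);
  pent_o : forall V W Y Z,
    vcmp (vcmp (fv (bR X Z) (alo V W Y)) (alo V (bL X W Y) Z)) (fv (bL X V) (alo W Y Z))
    = vcmp (alo (bL X V W) Y Z) (alo V W (bL X Y Z));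
  pent_1 : forall f W Y Z,
    fs (bR X Z) (v_h (al1 W Y) f) / v_h (al1 (bL X W Y) Z) f / v_h (ic_r (alC W Y Z)) f
    = v_h (al1 Y Z) (fh (bR X W) f) / v_h (al1 W (bL X Y Z)) f;
  pent_2 : forall V f Y Z,
    fs (bR X Z) (v_h (al2 V Y) f) / v_h (al2 V Z) (fh (bR X Y) f)
      / fs (bL X V) (v_h (al1 Y Z) f)
    = v_h (al1 Y Z) (fh (bL X V) f) / v_h (al2 V (bL X Y Z)) f;
  pent_3 : forall V W f Z,
    fs (bR X Z) (v_h (al3 V W) f) / v_h (al2 V Z) (fh (bL X W) f)
      / fs (bL X V) (v_h (al2 W Z) f)
    = v_h (al2 (bL X V W) Z) f / v_h (al3 V W) (fh (bR X Z) f);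
  pent_4 : forall V W Y f,
    v_h (ic_l (alC V W Y)) f / v_h (al3 V (bL X W Y)) f / fs (bL X V) (v_h (al3 W Y) f)
    = v_h (al3 (bL X V W) Y) f / v_h (al3 V W) (fh (bL X Y) f);
  triM_o : forall W Y,
    vcmp (alo W pI Y) (fv (bL X W) (v_o lam Y)) = fv (bR X Y) (v_o rho W);
  triM_1 : forall f Y,
    v_h (al1 pI Y) f / v_h (ic_r (lamC Y)) f = fs (bR X Y) (v_h rho f);
  triM_2 : forall W f,
    v_h (al3 W pI) f / fs (bL X W) (v_h lam f) = v_h (ic_l (rhoC W)) f;
  triL_o : forall W Y,
    vcmp (alo pI W Y) (v_o lam (bL X W Y)) = fv (bR X Y) (v_o lam W);
  triL_1 : forall f Y,
    v_h (al2 pI Y) f / v_h lam (fh (bR X Y) f) = fs (bR X Y) (v_h lam f);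
  triL_2 : forall W f,
    v_h (al3 pI W) f / v_h lam (fh (bL X W) f) = v_h (ic_l (lamC W)) f;
  triR_o : forall W Y,
    vcmp (alo W Y pI) (fv (bL X W) (v_o rho Y)) = v_o rho (bL X W Y);
  triR_1 : forall f Y,
    v_h (al1 Y pI) f / v_h (ic_r (rhoC Y)) f = v_h rho (fh (bR X Y) f);
  triR_2 : forall W f,
    v_h (al2 W pI) f / fs (bL X W) (v_h rho f) = v_h rho (fh (bL X W) f)
}.

Section Compatibility.
Variables (B : dblcat) (X : binoidal B).

(** The image of a square under a pseudodouble functor, with composite (resp.
    identity) top and bottom 1h-cells replaced using compositors (resp. unitors). *)
Definition fs_cmp (F : psfun B B) (f g f' g' : hor B) (a : sq B) : sq B :=
  fc F f g / fs F a / fci F f' g'.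
Definition fs_id (F : psfun B B) (A A' : ob B) (a : sq B) : sq B :=
  fu F A / fs F a / fui F A'.

(** The associativity is a strict vertical transformation between the
    three-variable structures (WY)Z and W(YZ): [as_ij_pq] is the compatibility with
    the exchange of a [p]-cell in the [i]-th variable and a [q]-cell in the [j]-th. *)
Record assoc_compat (E : exchange B) (P : premonoidal X) : Prop := Assoc_compat {
  as_12_hh : forall K k Z,
    fs_cmp (bR X Z) (fh (bL X (hsrc K)) k) (fh (bR X (htgt k)) K)
      (fh (bR X (hsrc k)) K) (fh (bL X (htgt K)) k) (ex_hh E K k)
      / [v_h (al1 P (hsrc k) Z) K | v_h (al2 P (htgt K) Z) k]
    = [v_h (al2 P (hsrc K) Z) k | v_h (al1 P (htgt k) Z) K]
      / ex_hh E K (fh (bR X Z) k);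
  as_13_hh : forall K Y k,
    ex_hh E (fh (bR X Y) K) k / [v_h (al1 P Y (hsrc k)) K | v_h (al3 P (htgt K) Y) k]
    = [v_h (al3 P (hsrc K) Y) k | v_h (al1 P Y (htgt k)) K] / ex_hh E K (fh (bL X Y) k);
  as_23_hh : forall W K k,
    ex_hh E (fh (bL X W) K) k / [v_h (al2 P W (hsrc k)) K | v_h (al3 P W (htgt K)) k]
    = [v_h (al3 P W (hsrc K)) k | v_h (al2 P W (htgt k)) K]
      / fs_cmp (bL X W) (fh (bL X (hsrc K)) k) (fh (bR X (htgt k)) K)
          (fh (bR X (hsrc k)) K) (fh (bL X (htgt K)) k) (ex_hh E K k);
  as_12_hv : forall K u Z,
    fs (bR X Z) (ex_hv E K u) / v_h (al1 P (vtgt u) Z) K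
    = v_h (al1 P (vsrc u) Z) K / ex_hv E K (fv (bR X Z) u);
  as_13_hv : forall K Y u,
    ex_hv E (fh (bR X Y) K) u / v_h (al1 P Y (vtgt u)) K
    = v_h (al1 P Y (vsrc u)) K / ex_hv E K (fv (bL X Y) u);
  as_23_hv : forall W K u,
    ex_hv E (fh (bL X W) K) u / v_h (al2 P W (vtgt u)) K
    = v_h (al2 P W (vsrc u)) K / fs (bL X W) (ex_hv E K u);
  as_12_vh : forall U k Z,
    fs (bR X Z) (ex_vh E U k) / v_h (al2 P (vtgt U) Z) k
    = v_h (al2 P (vsrc U) Z) k / ex_vh E U (fh (bR X Z) k);
  as_13_vh : forall U Y k,
    ex_vh E (fv (bR X Y) U) k / v_h (al3 P (vtgt U) Y) k
    = v_h (al3 P (vsrc U) Y) k / ex_vh E U (fh (bL X Y) k);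
  as_23_vh : forall W U k,
    ex_vh E (fv (bL X W) U) k / v_h (al3 P W (vtgt U)) k
    = v_h (al3 P W (vsrc U)) k / fs (bL X W) (ex_vh E U k);
  as_12_vv : forall U u Z,
    fs_id (bR X Z) (bL X (vsrc U) (vsrc u)) (bL X (vtgt U) (vtgt u)) (ex_vv E U u)
      / hsid (alo P (vtgt U) (vtgt u) Z)
    = hsid (alo P (vsrc U) (vsrc u) Z) / ex_vv E U (fv (bR X Z) u);
  as_13_vv : forall U Y u,
    ex_vv E (fv (bR X Y) U) u / hsid (alo P (vtgt U) Y (vtgt u))
    = hsid (alo P (vsrc U) Y (vsrc u)) / ex_vv E U (fv (bL X Y) u);
  as_23_vv : forall W U u,
    ex_vv E (fv (bL X W) U) u / hsid (alo P W (vtgt U) (vtgt u))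
    = hsid (alo P W (vsrc U) (vsrc u))
      / fs_id (bL X W) (bL X (vsrc U) (vsrc u)) (bL X (vtgt U) (vtgt u)) (ex_vv E U u)
}.

(** The centrality structures of an inversely central 1v-cell are the given ones. *)
Record central_agrees (E : exchange B) (U : ver B) (c : inv_central X U) : Prop :=
  Central_agrees {
  ca_l : forall k, v_h (ic_l c) k = ex_vh E U k;
  ca_li : forall k, v_h (ic_li c) k = ex_vh E (ic_inv c) k;
  ca_r : forall K, v_h (ic_r c) K = ex_hv E K U;
  ca_ri : forall K, v_h (ic_ri c) K = ex_hv E K (ic_inv c);
  ca_lv : forall u, v_d (ic_l c) u = ex_vv E U u;
  ca_liv : forall u, v_d (ic_li c) u = ex_vv E (ic_inv c) u;
  ca_rv : forall V, v_d (ic_r c) V = ex_vvi E V U;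
  ca_riv : forall V, v_d (ic_ri c) V = ex_vvi E V (ic_inv c)
}.

Record central_premonoidal (E : exchange B) := Central_premonoidal {
  cp :> premonoidal X;
  cp_lam : forall Y, central_agrees E (lamC cp Y);
  cp_rho : forall W, central_agrees E (rhoC cp W);
  cp_al : forall W Y Z, central_agrees E (alC cp W Y Z);
  cp_assoc : assoc_compat E cp
}.
End Compatibility.

Record quasi_functor (B : dblcat) := Quasi_functor {
  qL : ob B -> psfun B B; (* H(A,-) *)
  qR : ob B -> psfun B B; (* H(-,A) *)
  qLR : forall A C, qL A C = qR C A;
  qhh : hor B -> hor B -> sq B;
  qhhi : hor B -> hor B -> sq B;
  qhv : hor B -> ver B -> sq B;
  qvh : ver B -> hor B -> sq B;
  qvv : ver B -> ver B -> sq B;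
  qvvi : ver B -> ver B -> sq B;
  ql_hor (K : hor B) : hdat B B := Hdat (fun A => fh (qR A) K) (qhv K) (qhh K) (qhhi K);
  ql_ver (U : ver B) : vdat B B := Vdat (fun A => fv (qR A) U) (qvh U) (qvv U) (qvvi U);
  qr_hor (k : hor B) : hdat B B := Hdat (fun A => fh (qL A) k)
    (fun U => qvh U k) (fun K => qhhi K k) (fun K => qhh K k);
  qr_ver (u : ver B) : vdat B B := Vdat (fun A => fv (qL A) u)
    (fun K => qhv K u) (fun U => qvvi U u) (fun U => qvv U u);
  ql_horP : forall K, is_htrans (qL (hsrc K)) (qL (htgt K)) (ql_hor K);
  ql_verP : forall U, is_vtrans (qL (vsrc U)) (qL (vtgt U)) (ql_ver U);
  qr_horP : forall k, is_htrans (qR (hsrc k)) (qR (htgt k)) (qr_hor k);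
  qr_verP : forall u, is_vtrans (qR (vsrc u)) (qR (vtgt u)) (qr_ver u);
  ql_sqP : forall a, is_modif (ql_hor (top a)) (ql_hor (bot a))
    (ql_ver (lft a)) (ql_ver (rgt a)) (fun A => fs (qR A) a);
  qr_sqP : forall a, is_modif (qr_hor (top a)) (qr_hor (bot a))
    (qr_ver (lft a)) (qr_ver (rgt a)) (fun A => fs (qL A) a)
}.

Definition quasi_binoidal (B : dblcat) (H : quasi_functor B) : binoidal B :=
  Binoidal (qLR H).

Definition quasi_purely (B : dblcat) (H : quasi_functor B) :
  purely_central (quasi_binoidal H) :=
  @Purely_central B (quasi_binoidal H) (ql_hor H) (ql_ver H) (qr_hor H) (qr_ver H)
    (fun K => conj (ql_horP H K) (fun _ => eq_refl))
    (fun U => conj (ql_verP H U) (fun _ => eq_refl))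
    (fun k => conj (qr_horP H k) (fun _ => eq_refl))
    (fun u => conj (qr_verP H u) (fun _ => eq_refl))
    (ql_sqP H) (qr_sqP H)
    (fun _ _ => eq_refl) (fun _ _ => eq_refl) (fun _ _ => eq_refl) (fun _ _ => eq_refl).

Section Monoidal.
Variable B : dblcat.
Local Notation BB := (dblprod B B).
Local Notation BBB := (dblprod (dblprod B B) B).

Section Functors.
Variables (T : psfun BB B) (I : psfun dbl1 B).

Definition tensl : psfun BBB B := T \o << T \o fproj1 BB B, fproj2 BB B >>.
Definition tensr : psfun BBB B :=
  T \o << fproj1 B B \o fproj1 BB B, T \o << fproj2 B B \o fproj1 BB B, fproj2 BB B >> >>.
Definition tensIl : psfun B B := T \o << I \o fterm B, fid B >>.
Definition tensIr : psfun B B := T \o << fid B, I \o fterm B >>.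
End Functors.

Record monoidal := Monoidal {
  tens : psfun BB B;
  munit : psfun dbl1 B;
  mal : vdat BBB B;
  mlam : vdat B B;
  mrho : vdat B B;
  malP : is_vstrict_iso (tensl tens) (tensr tens) mal;
  mlamP : is_vstrict_iso (tensIl tens munit) (fid B) mlam;
  mrhoP : is_vstrict_iso (tensIr tens munit) (fid B) mrho;
  mpent_o : forall V W Y Z,
    vcmp (vcmp (fv tens (v_o mal (V, W, Y), vid Z)) (v_o mal (V, tens (W, Y), Z)))
      (fv tens (vid V, v_o mal (W, Y, Z)))
    = vcmp (v_o mal (tens (V, W), Y, Z)) (v_o mal (V, W, tens (Y, Z)));
  mpent_h : forall f g h k,
    fs tens (v_h mal (f, g, h), vsid k) / v_h mal (f, fh tens (g, h), k)
      / fs tens (vsid f, v_h mal (g, h, k))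
    = v_h mal (fh tens (f, g), h, k) / v_h mal (f, g, fh tens (h, k));
  mtriM_o : forall W Y,
    vcmp (v_o mal (W, munit tt, Y)) (fv tens (vid W, v_o mlam Y))
    = fv tens (v_o mrho W, vid Y);
  mtriM_h : forall f g,
    v_h mal (f, fh munit tt, g) / fs tens (vsid f, v_h mlam g)
    = fs tens (v_h mrho f, vsid g);
  mtriL_o : forall W Y,
    vcmp (v_o mal (munit tt, W, Y)) (v_o mlam (tens (W, Y)))
    = fv tens (v_o mlam W, vid Y);
  mtriL_h : forall f g,
    v_h mal (fh munit tt, f, g) / v_h mlam (fh tens (f, g))
    = fs tens (v_h mlam f, vsid g);
  mtriR_o : forall W Y,
    vcmp (v_o mal (W, Y, munit tt)) (fv tens (vid W, v_o mrho Y))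
    = v_o mrho (tens (W, Y));
  mtriR_h : forall f g,
    v_h mal (f, g, fh munit tt) / fs tens (vsid f, v_h mrho g)
    = v_h mrho (fh tens (f, g))
}.

(** The tensor product is (x)_r for the binoidal structure [X]: on 1h-cells
    K * k = (A' |x k)(K x| B), on 1v-cells U * u = (U x| B) / (A~ |x u). *)
Record tens_r (X : binoidal B) (M : monoidal) : Prop := Tens_r {
  tr_o : forall A C, tens M (A, C) = bL X A C;
  tr_h : forall K k, fh (tens M) (K, k) = hcmp (fh (bR X (hsrc k)) K) (fh (bL X (htgt K)) k);
  tr_v : forall U u, fv (tens M) (U, u) = vcmp (fv (bR X (vsrc u)) U) (fv (bL X (vtgt U)) u)
}.
End Monoidal.

Section Statements.
Variable B : dblcat.

Definition has_quasi_premonoidal : Prop :=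
  exists H : quasi_functor B, (forall U u, vtrivial (qvv H U u)) /\
    inhabited (central_premonoidal (quasi_binoidal H) (purely_exchange (quasi_purely H))).

Definition has_purely_central_premonoidal : Prop :=
  exists (X : binoidal B) (S : purely_central X),
    (forall u v, vtrivial (v_d (pc_lv S u) v)) /\
    inhabited (central_premonoidal X (purely_exchange S)).

Definition has_left_central_premonoidal : Prop :=
  exists (X : binoidal B) (S : left_central X),
    (forall u v, vtrivial (v_d (va_dat (fv S u)) v)) /\
    inhabited (central_premonoidal X (left_exchange S)).

Definition has_right_central_premonoidal : Prop :=
  exists (X : binoidal B) (S : right_central X),
    (forall v u, vtrivial (v_d (va_dat (fv S v)) u)) /\
    inhabited (central_premonoidal X (right_exchange S)).

Definition has_lr_purely_central_premonoidal : Prop :=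
  exists (X : binoidal B) (S : lr_purely_central X),
    (forall u v, vtrivial (v_d (va_dat (fv (L0 S) u)) v)) /\
    inhabited (central_premonoidal X (lr_exchange S)).

Definition has_monoidal_r : Prop :=
  exists (X : binoidal B) (M : monoidal B), tens_r X M.
End Statements.

(* Main.v *)
Require Import Defs.
From Stdlib Require Import FunctionalExtensionality ProofIrrelevance ClassicalEpsilon.

Set Implicit Arguments.
Unset Strict Implicit.
Unset Printing Implicit Defensive.
Local Open Scope dbl_scope.

(** Let H be a quasi-functor with trivial cells H(U,u).  Then (K,k) |-> (A' |x k)(K x| B) is a pseudodouble
    functor: its compositor inserts the exchange cell H(K',k) between the two middle factors, and it is strict
    on 1v-cells because H(U,u) is trivial.  The associativity cell at (f,g,h) is the pasting of the three
    one-variable associativities at f, g and h; it is compatible with compositors precisely because these are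
    compatible with the exchange cells.  Conversely, a monoidal product T gives H(K,k) as the comparison of the
    two factorizations T(K,1)T(1,k) and T(1,k)T(K,1) of T(K,k), and the one-variable associativities are the
    cells at (f,1,1), (1,g,1), (1,1,h), corrected by unitors of T since T(1,1) is only isomorphic to 1.
    A left (right) central structure is a quasi-functor curried in its first (second) variable. *)

(** * Boundaries of cells *)

(** Everything is routed through the quasi-functor, because its exchange cells are the data that
    each of the other structures packages differently. Compositions are total functions, so each use
    of associativity, units or interchange has composability conditions, and one boundary can have
    many names. The predicates [hc], [vc] and [cell] therefore act as typing judgements: tactics
    infer boundaries in normal form and compare the normal forms. The normal form of 1v-composites
    includes the rules of the situation at hand, notably that U and u commute when H(U,u) is
    trivial; hence commuting 1v-cells rarely appear in the pastings. The main obstacle is that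
    compositors, unitors and exchange cells meet in the same diagrams. In each large pasting the
    compositors are pushed to the top and the bottom until only vertical strands remain, one for
    each tensor factor; every strand is then an instance of a one-variable axiom. In the converse
    direction the quasi-functor laws are obtained by whiskering T with pairs of constant and
    identity transformations, so no coherence law of the exchange cells has to be checked by
    hand. *)

Definition hc (D : dblcat) (f : hor D) (A B : ob D) : Prop := hsrc f = A /\ htgt f = B.
Definition vc (D : dblcat) (u : ver D) (A B : ob D) : Prop := vsrc u = A /\ vtgt u = B.
Definition cell (D : dblcat) (a : sq D) (t b : hor D) (l r : ver D) : Prop :=
  top a = t /\ bot a = b /\ lft a = l /\ rgt a = r.

Section Boundaries.
Variable D : dblcat.
Implicit Types (A B C : ob D) (f g h : hor D) (u v w : ver D) (a b : sq D).

Lemma hc_refl f : hc f (hsrc f) (htgt f). Proof. now split. Qed.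
Lemma hc_top a : hc (top a) (vsrc (lft a)) (vsrc (rgt a)).
Proof. split; [apply hsrc_top | apply htgt_top]. Qed.
Lemma hc_bot a : hc (bot a) (vtgt (lft a)) (vtgt (rgt a)).
Proof. split; [apply hsrc_bot | apply htgt_bot]. Qed.
Lemma hc_hid A : hc (hid A) A A. Proof. split; [apply hsrc_id | apply htgt_id]. Qed.
Lemma hc_hcmp f g A B B' C : hc f A B -> hc g B' C -> B = B' -> hc (hcmp f g) A C.
Proof.
intros [<- <-] [<- <-] E; split; [apply hsrc_cmp | apply htgt_cmp]; exact E.
Qed.
Lemma vc_refl u : vc u (vsrc u) (vtgt u). Proof. now split. Qed.
Lemma vc_vid A : vc (vid A) A A. Proof. split; [apply vsrc_id | apply vtgt_id]. Qed.
Lemma vc_vcmp u v A B B' C : vc u A B -> vc v B' C -> B = B' -> vc (vcmp u v) A C.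
Proof.
intros [<- <-] [<- <-] E; split; [apply vsrc_cmp | apply vtgt_cmp]; exact E.
Qed.
Lemma cell_refl a : cell a (top a) (bot a) (lft a) (rgt a).
Proof. now repeat split. Qed.
Lemma cell_vsid f A B : hc f A B -> cell (vsid f) f f (vid A) (vid B).
Proof.
intros [<- <-]; repeat split; [apply top_vsid | apply bot_vsid | apply lft_vsid | apply rgt_vsid].
Qed.
Lemma cell_hsid u A B : vc u A B -> cell (hsid u) (hid A) (hid B) u u.
Proof.
intros [<- <-]; repeat split; [apply top_hsid | apply bot_hsid | apply lft_hsid | apply rgt_hsid].
Qed.
(** The composite boundaries are variables [t3] and [b3] bound by equations, so that a tactic can
    fill them with normal forms instead of raw composites. *)
Lemma cell_h a b (t1 t2 b1 b2 t3 b3 : hor D) (l m m' r : ver D) :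
  cell a t1 b1 l m -> cell b t2 b2 m' r -> m = m' ->
  hcmp t1 t2 = t3 -> hcmp b1 b2 = b3 -> cell [a | b] t3 b3 l r.
Proof.
intros (<- & <- & <- & <-) (<- & <- & <- & <-) E <- <-.
repeat split; [apply top_hscmp | apply bot_hscmp | apply lft_hscmp | apply rgt_hscmp]; exact E.
Qed.
Lemma cell_v a b (t m m' b' : hor D) (l1 r1 l2 r2 l r : ver D) :
  cell a t m l1 r1 -> cell b m' b' l2 r2 -> m = m' ->
  vcmp l1 l2 = l -> vcmp r1 r2 = r -> cell (a / b) t b' l r.
Proof.
intros (<- & <- & <- & <-) (<- & <- & <- & <-) E <- <-.
repeat split; [apply top_vscmp | apply bot_vscmp | apply lft_vscmp | apply rgt_vscmp]; exact E.
Qed.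
Lemma cell_eq a (t b t' b' : hor D) (l r l' r' : ver D) :
  cell a t b l r -> t = t' -> b = b' -> l = l' -> r = r' -> cell a t' b' l' r'.
Proof. now intros H <- <- <- <-. Qed.
Lemma hc_eq f A B A' B' : hc f A B -> A = A' -> B = B' -> hc f A' B'.
Proof. now intros H <- <-. Qed.
Lemma vc_eq u A B A' B' : vc u A B -> A = A' -> B = B' -> vc u A' B'.
Proof. now intros H <- <-. Qed.
Lemma hc_src f A B : hc f A B -> hsrc f = A. Proof. now intros []. Qed.
Lemma hc_tgt f A B : hc f A B -> htgt f = B. Proof. now intros []. Qed.
Lemma vc_src u A B : vc u A B -> vsrc u = A. Proof. now intros []. Qed.
Lemma vc_tgt u A B : vc u A B -> vtgt u = B. Proof. now intros []. Qed.
Lemma hc_top_cell a (t b : hor D) (l r : ver D) A B : cell a t b l r -> hc t A B -> hc (top a) A B.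
Proof. now intros (<- & _ & _ & _). Qed.
Lemma hc_bot_cell a (t b : hor D) (l r : ver D) A B : cell a t b l r -> hc b A B -> hc (bot a) A B.
Proof. now intros (_ & <- & _ & _). Qed.
Lemma vc_lft_cell a (t b : hor D) (l r : ver D) A B : cell a t b l r -> vc l A B -> vc (lft a) A B.
Proof. now intros (_ & _ & <- & _). Qed.
Lemma vc_rgt_cell a (t b : hor D) (l r : ver D) A B : cell a t b l r -> vc r A B -> vc (rgt a) A B.
Proof. now intros (_ & _ & _ & <-). Qed.
Lemma c_top a (t b : hor D) (l r : ver D) : cell a t b l r -> top a = t. Proof. now intros (? & ? & ? & ?). Qed.
Lemma c_bot a (t b : hor D) (l r : ver D) : cell a t b l r -> bot a = b. Proof. now intros (? & ? & ? & ?). Qed.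
Lemma c_lft a (t b : hor D) (l r : ver D) : cell a t b l r -> lft a = l. Proof. now intros (? & ? & ? & ?). Qed.
Lemma c_rgt a (t b : hor D) (l r : ver D) : cell a t b l r -> rgt a = r. Proof. now intros (? & ? & ? & ?). Qed.
(** One step of right-association in the shape of an inference rule: [x] and [y] are evars that
    receive the normal forms of the inner and of the whole composite. *)
Lemma hcmpA_eq f g h x y A B B' C C' E : hc f A B -> hc g B' C -> hc h C' E -> B = B' -> C = C' ->
  hcmp g h = x -> hcmp f x = y -> hcmp (hcmp f g) h = y.
Proof. intros [_ <-] [E1 <-] [E2 _] E3 E4 <- <-; apply hcmpA; congruence. Qed.
Lemma vcmpA_eq u v w x y A B B' C C' E : vc u A B -> vc v B' C -> vc w C' E -> B = B' -> C = C' ->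
  vcmp v w = x -> vcmp u x = y -> vcmp (vcmp u v) w = y.
Proof. intros [_ <-] [E1 <-] [E2 _] E3 E4 <- <-; apply vcmpA; congruence. Qed.
Lemma hcmp_eq f g f' g' x : f = f' -> g = g' -> hcmp f' g' = x -> hcmp f g = x.
Proof. now intros <- <-. Qed.
Lemma vid_eq A B : A = B -> vid A = vid B. Proof. now intros <-. Qed.
Lemma hid_eq A B : A = B -> hid A = hid B. Proof. now intros <-. Qed.
Lemma vcmp_eq u v u' v' x : u = u' -> v = v' -> vcmp u' v' = x -> vcmp u v = x.
Proof. now intros <- <-. Qed.
End Boundaries.

Section FunctorBoundaries.
Variables (C D : dblcat) (F : psfun C D).
Lemma hc_fh f A B X Y : hc f A B -> F A = X -> F B = Y -> hc (fh F f) X Y.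
Proof. intros [<- <-] <- <-; split; [apply hsrc_fh | apply htgt_fh]. Qed.
Lemma vc_fv f A B X Y : vc f A B -> F A = X -> F B = Y -> vc (fv F f) X Y.
Proof. intros [<- <-] <- <-; split; [apply vsrc_fv | apply vtgt_fv]. Qed.
Lemma cell_fs (a : sq C) (t b : hor C) (l r : ver C) (t' b' : hor D) (l' r' : ver D) : cell a t b l r ->
  fh F t = t' -> fh F b = b' -> fv F l = l' -> fv F r = r' -> cell (fs F a) t' b' l' r'.
Proof.
intros (<- & <- & <- & <-) <- <- <- <-.
repeat split; [apply top_fs | apply bot_fs | apply lft_fs | apply rgt_fs].
Qed.
Lemma cell_fc f g h A B B' C' X Y : hc f A B -> hc g B' C' -> B = B' -> F A = X -> F C' = Y ->
  hcmp f g = h -> cell (fc F f g) (hcmp (fh F f) (fh F g)) (fh F h) (vid X) (vid Y).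
Proof.
intros [<- <-] [<- <-] E <- <- <-.
repeat split; [apply top_fc | apply bot_fc | apply lft_fc | apply rgt_fc]; exact E.
Qed.
Lemma cell_fci f g h A B B' C' X Y : hc f A B -> hc g B' C' -> B = B' -> F A = X -> F C' = Y ->
  hcmp f g = h -> cell (fci F f g) (fh F h) (hcmp (fh F f) (fh F g)) (vid X) (vid Y).
Proof.
intros [<- <-] [<- <-] E <- <- <-. pose proof (fcK F E) as K.
pose proof (vinv_globl K (lft_fc F E)). pose proof (vinv_globr K (rgt_fc F E)).
destruct K as (K1 & K2 & _). rewrite bot_fc in K1 by exact E. rewrite top_fc in K2 by exact E.
now repeat split.
Qed.
Lemma fh_eq f g : f = g -> fh F f = fh F g. Proof. now intros <-. Qed.
Lemma cell_fu A X : F A = X -> cell (fu F A) (hid X) (fh F (hid A)) (vid X) (vid X).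
Proof.
intros <-; repeat split; [apply top_fu | apply bot_fu | apply lft_fu | apply rgt_fu].
Qed.
Lemma cell_fui A X : F A = X -> cell (fui F A) (fh F (hid A)) (hid X) (vid X) (vid X).
Proof.
intros <-. pose proof (fuK F A) as K.
pose proof (vinv_globl K (lft_fu F A)). pose proof (vinv_globr K (rgt_fu F A)).
destruct K as (K1 & K2 & _). rewrite bot_fu in K1. rewrite top_fu in K2. now repeat split.
Qed.
Lemma fv_vid_eq A X : F A = X -> fv F (vid A) = vid X.
Proof. intros <-; apply fv_id. Qed.
Lemma fv_vcmp_eq u v A B B' C' x y : vc u A B -> vc v B' C' -> B = B' -> fv F u = x ->
  fv F v = y -> fv F (vcmp u v) = vcmp x y.
Proof. intros [<- <-] [<- <-] E <- <-; now apply fv_cmp. Qed.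
End FunctorBoundaries.

(* The tactics below compute boundaries: on a goal whose right-hand side is an evar they instantiate it
   with a normal form.  The hooks are redefined whenever cells with known boundaries are introduced. *)
Ltac on_hook := fail.
Ltac on := first [ on_hook | reflexivity ].
Ltac oeq := first [ reflexivity | assumption | symmetry; assumption
  | etransitivity; [ on | symmetry; etransitivity; [ on | reflexivity ]] | congruence ].
Ltac hc_hook := fail.
Ltac ty_fwd := fail.
Ltac vc_hook := fail.
Ltac cell_hook := fail.
Ltac hc_tac :=
  first [ eassumption | hc_hook |
  lazymatch goal with
  | |- hc (hid _) _ _ => apply hc_hid
  | |- hc (hcmp _ _) _ _ => eapply hc_hcmp; [hc_tac | hc_tac | oeq]
  | |- hc (fh _ _) _ _ => eapply hc_fh; [hc_tac | on | on ]
  | |- hc (top _) _ _ => first [eapply hc_top_cell; [ty_fwd | lazymatch goal with |- hc (top _) _ _ => fail | _ => hc_tac end] | apply hc_top]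
  | |- hc (bot _) _ _ => first [eapply hc_bot_cell; [ty_fwd | lazymatch goal with |- hc (bot _) _ _ => fail | _ => hc_tac end] | apply hc_bot]
  | |- hc _ _ _ => apply hc_refl
  end ].
Ltac vc_tac :=
  first [ eassumption | vc_hook |
  lazymatch goal with
  | |- vc (vid _) _ _ => apply vc_vid
  | |- vc (vcmp _ _) _ _ => eapply vc_vcmp; [vc_tac | vc_tac | oeq]
  | |- vc (fv _ _) _ _ => eapply vc_fv; [vc_tac | on | on ]
  | |- vc (lft _) _ _ => first [eapply vc_lft_cell; [ty_fwd | lazymatch goal with |- vc (lft _) _ _ => fail | _ => vc_tac end] | apply vc_refl]
  | |- vc (rgt _) _ _ => first [eapply vc_rgt_cell; [ty_fwd | lazymatch goal with |- vc (rgt _) _ _ => fail | _ => vc_tac end] | apply vc_refl]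
  | |- vc _ _ _ => apply vc_refl
  end ].
Ltac obt :=
  lazymatch goal with
  | |- hsrc _ = _ => eapply eq_trans; [eapply hc_src; hc_tac | oeq]
  | |- htgt _ = _ => eapply eq_trans; [eapply hc_tgt; hc_tac | oeq]
  | |- vsrc _ = _ => eapply eq_trans; [eapply vc_src; vc_tac | oeq]
  | |- vtgt _ = _ => eapply eq_trans; [eapply vc_tgt; vc_tac | oeq]
  | |- hc _ _ _ => eapply hc_eq; [hc_tac | oeq | oeq]
  | |- vc _ _ _ => eapply vc_eq; [vc_tac | oeq | oeq]
  end.
Ltac obs :=
  lazymatch goal with
  | |- hsrc _ = hsrc _ => first [reflexivity | assumption | etransitivity; [eapply hc_src; hc_tac | symmetry; obt]]
  | |- hsrc _ = htgt _ => first [reflexivity | assumption | etransitivity; [eapply hc_src; hc_tac | symmetry; obt]]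
  | |- htgt _ = hsrc _ => first [reflexivity | assumption | etransitivity; [eapply hc_tgt; hc_tac | symmetry; obt]]
  | |- htgt _ = htgt _ => first [reflexivity | assumption | etransitivity; [eapply hc_tgt; hc_tac | symmetry; obt]]
  | |- vsrc _ = vsrc _ => first [reflexivity | assumption | etransitivity; [eapply vc_src; vc_tac | symmetry; obt]]
  | |- vsrc _ = vtgt _ => first [reflexivity | assumption | etransitivity; [eapply vc_src; vc_tac | symmetry; obt]]
  | |- vtgt _ = vsrc _ => first [reflexivity | assumption | etransitivity; [eapply vc_tgt; vc_tac | symmetry; obt]]
  | |- vtgt _ = vtgt _ => first [reflexivity | assumption | etransitivity; [eapply vc_tgt; vc_tac | symmetry; obt]]
  | |- hsrc _ = _ => obt
  | |- htgt _ = _ => obt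
  | |- vsrc _ = _ => obt
  | |- vtgt _ = _ => obt
  | |- _ = hsrc _ => symmetry; obt
  | |- _ = htgt _ => symmetry; obt
  | |- _ = vsrc _ => symmetry; obt
  | |- _ = vtgt _ => symmetry; obt
  | |- hc _ _ _ => obt
  | |- vc _ _ _ => obt
  | |- _ => oeq
  end.
(** Normal forms are right-associated composites without identities. The two factors are expected to
    be normal already. *)
Ltac hcn :=
  lazymatch goal with
  | |- hcmp (hid _) _ = _ => apply hcmp1l'; obs
  | |- hcmp _ (hid _) = _ => apply hcmp1r'; obs
  | |- hcmp (hcmp _ _) _ = _ => eapply hcmpA_eq; [ hc_tac | hc_tac | hc_tac | oeq | oeq | hcn | hcn ]
  | |- _ => reflexivity
  end.
Ltac vcn_hook := fail.
Ltac vcn := first [ vcn_hook |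
  lazymatch goal with
  | |- vcmp (vid _) _ = _ => apply vcmp1l'; obs
  | |- vcmp _ (vid _) = _ => apply vcmp1r'; obs
  | |- vcmp (vcmp _ _) _ = _ => eapply vcmpA_eq; [ vc_tac | vc_tac | vc_tac | oeq | oeq | vcn | vcn ]
  | |- _ => reflexivity
  end ].
Ltac hn_hook := fail.
Ltac obn := lazymatch goal with
  | |- hsrc _ = _ => obt | |- htgt _ = _ => obt | |- vsrc _ = _ => obt | |- vtgt _ = _ => obt
  | |- _ => on end.
Ltac hn :=
  lazymatch goal with
  | |- hid _ = _ => eapply hid_eq; obn
  | |- fh _ _ = _ => eapply fh_eq; hn
  | |- hcmp _ _ = _ => eapply hcmp_eq; [hn | hn | hcn]
  | |- _ => first [ hn_hook | reflexivity ]
  end.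
Ltac vn_hook := fail.
Ltac fvn :=
  lazymatch goal with
  | |- fv _ (vid _) = _ => apply fv_vid_eq; on
  | |- fv _ (vcmp _ _) = _ => eapply fv_vcmp_eq; [vc_tac | vc_tac | oeq | fvn | fvn]
  | |- _ => reflexivity
  end.
Ltac vn :=
  lazymatch goal with
  | |- vid _ = _ => eapply vid_eq; obn
  | |- vcmp _ _ = _ => eapply vcmp_eq; [vn | vn | vcn]
  | |- fv _ _ = _ => fvn
  | |- _ => first [ vn_hook | reflexivity ]
  end.
Ltac heq := first [ reflexivity | assumption | symmetry; assumption
  | eapply eq_trans; [hn | symmetry; eapply eq_trans; [hn | reflexivity]] | congruence ].
Ltac veq_hook := fail.
Ltac veq := first [ reflexivity | assumption | symmetry; assumption | veq_hook
  | eapply eq_trans; [vn | symmetry; eapply eq_trans; [vn | first [reflexivity | veq_hook]]] | congruence ].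
Ltac ty :=
  first [ eassumption | cell_hook |
  lazymatch goal with
  | |- cell (hscmp _ _) _ _ _ _ => eapply cell_h; [ty | ty | veq | hcn | hcn]
  | |- cell (vscmp _ _) _ _ _ _ => eapply cell_v; [ty | ty | heq | vcn | vcn]
  | |- cell (vsid _) _ _ _ _ => eapply cell_vsid; hc_tac
  | |- cell (hsid _) _ _ _ _ => eapply cell_hsid; vc_tac
  | |- cell (fs _ _) _ _ _ _ => eapply cell_fs; [ty | reflexivity | reflexivity | fvn | fvn]
  | |- cell (fc _ _ _) _ _ _ _ => eapply cell_fc; [hc_tac | hc_tac | oeq | on | on | hn]
  | |- cell (fci _ _ _) _ _ _ _ => eapply cell_fci; [hc_tac | hc_tac | oeq | on | on | hn]
  | |- cell (fu _ _) _ _ _ _ => eapply cell_fu; on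
  | |- cell (fui _ _) _ _ _ _ => eapply cell_fui; on
  | |- cell _ _ _ _ _ => apply cell_refl
  end ].
(** Ties a recursion: the boundary of [top a] is read off the inferred type of [a], while typing [a]
    needs the boundaries of its 1-cells. *)
Ltac ty_fwd ::= ty.
Ltac scs := first [ reflexivity | assumption | symmetry; assumption |
  lazymatch goal with
  | |- @eq (hor _) ?a ?b =>
     eapply eq_trans; [ first [eapply c_top; ty | eapply c_bot; ty | hn] |
       symmetry; eapply eq_trans; [ first [eapply c_top; ty | eapply c_bot; ty | hn] | heq ]]
  | |- @eq (ver _) ?a ?b =>
     eapply eq_trans; [ first [eapply c_lft; ty | eapply c_rgt; ty | vn] |
       symmetry; eapply eq_trans; [ first [eapply c_lft; ty | eapply c_rgt; ty | vn] | veq ]]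
  | |- cell _ _ _ _ _ => eapply cell_eq; [ty | heq | heq | veq | veq]
  | |- _ => obs
  end ].
Ltac sc := solve [ scs ].

(* The [match] moves on to the next occurrence when a side condition fails. *)
Ltac ich := match goal with
  |- context [vscmp (hscmp ?a ?b) (hscmp ?c ?d)] => rewrite (@interchange _ a b c d) by sc end.
Ltac vA := repeat match goal with
  |- context [vscmp (vscmp ?a ?b) ?c] => rewrite (@vscmpA _ a b c) by sc end.
Ltac vAr := repeat match goal with
  |- context [vscmp ?a (vscmp ?b ?c)] => rewrite <- (@vscmpA _ a b c) by sc end.
Ltac hA := repeat match goal with
  |- context [hscmp (hscmp ?a ?b) ?c] => rewrite (@hscmpA _ a b c) by sc end.
Ltac v1 := repeat match goal with
  | |- context [vscmp (vsid ?f) ?a] => rewrite (@vscmp1l' _ f a) by sc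
  | |- context [vscmp ?a (vsid ?f)] => rewrite (@vscmp1r' _ f a) by sc end.
Ltac h1 := repeat match goal with
  | |- context [hscmp (hsid ?f) ?a] => rewrite (@hscmp1l' _ f a) by sc
  | |- context [hscmp ?a (hsid ?f)] => rewrite (@hscmp1r' _ f a) by sc end.

Section CellBoundaries.
Variable D : dblcat.
Lemma cell_hct (a : sq D) f f' u u' A A' C C' : cell a f f' u u' -> vc u A C -> vc u' A' C' ->
  hc f A A'.
Proof. intros (<- & <- & <- & <-) [<- <-] [<- <-]; apply hc_top. Qed.
Lemma cell_hcb (a : sq D) f f' u u' A A' C C' : cell a f f' u u' -> vc u A C -> vc u' A' C' ->
  hc f' C C'.
Proof. intros (<- & <- & <- & <-) [<- <-] [<- <-]; apply hc_bot. Qed.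
End CellBoundaries.

(** A square whose sides have known endpoints determines the endpoints of its top and bottom. They
    are recorded as hypotheses, where [sc] finds them. *)
Ltac sat := repeat match goal with
  | Ha : cell ?a ?f ?f' ?u ?u', Hu : vc ?u ?A ?C, Hu' : vc ?u' ?A' ?C' |- _ =>
    lazymatch goal with
    | _ : hc f A A', _ : hc f' C C' |- _ => fail
    | _ => let K1 := fresh "Hc" in let K2 := fresh "Hc" in
       pose proof (cell_hct Ha Hu Hu') as K1; pose proof (cell_hcb Ha Hu Hu') as K2
    end
  end.

Tactic Notation "lhs" tactic3(tac) := eapply eq_trans; [ tac; reflexivity | ].
Tactic Notation "rhs" tactic3(tac) := symmetry; eapply eq_trans; [ tac; reflexivity | ]; symmetry.

(** For equations whose left side is a two-fold composite: the composite is also found when it is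
    hidden inside a right-associated one. *)
Ltac vrw E := first [ rewrite E |
  let T := type of E in
  match T with vscmp ?x ?y = _ =>
    rewrite <- (@vscmpA _ x y) by sc; rewrite E; rewrite vscmpA by sc end ].

Lemma vinv_sym (D : dblcat) (a b : sq D) : vinv a b -> vinv b a.
Proof. intros (? & ? & ? & ?); repeat split; congruence. Qed.
Lemma hinv_sym (D : dblcat) (a b : sq D) : hinv a b -> hinv b a.
Proof. intros (? & ? & ? & ?); repeat split; congruence. Qed.

(** * Pasting in the image of a pseudodouble functor *)

Section FunctorPasting.
Variables (S D : dblcat) (F : psfun S D).
Lemma fcKv f g A A' A'' : hc f A A' -> hc g A' A'' -> vinv (fc F f g) (fci F f g).
Proof. intros [<- <-] [E <-]. exact (fcK F (eq_sym E)). Qed.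
Lemma fcE_l f g A A' A'' : hc f A A' -> hc g A' A'' ->
  fc F f g / fci F f g = vsid (hcmp (fh F f) (fh F g)).
Proof. intros [<- <-] [E <-]. destruct (fcK F (eq_sym E)) as (_ & _ & -> & _). now rewrite top_fc. Qed.
Lemma fcE_r f g A A' A'' : hc f A A' -> hc g A' A'' ->
  fci F f g / fc F f g = vsid (fh F (hcmp f g)).
Proof. intros [<- <-] [E <-]. destruct (fcK F (eq_sym E)) as (_ & _ & _ & ->). now rewrite bot_fc. Qed.
(** Multiplying by the inverses on both sides turns a commuting square around. Every law about
    inverse compositors, inverse unitors and inverse exchange cells is derived from the law of the
    original cells in this way. *)
Lemma vinv_conj (p p' q q' x y : sq D) : vinv p p' -> vinv q q' -> bot x = top q -> bot p = top y ->
  x / q = p / y -> y / q' = p' / x.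
Proof.
intros (P1 & P2 & P3 & P4) (Q1 & Q2 & Q3 & Q4) E1 E2 E.
assert (E3 : bot y = bot q) by (rewrite <- (bot_vscmp E2), <- E; now apply bot_vscmp).
assert (E4 : bot p' = top x) by (rewrite P2, <- (top_vscmp E2), <- E; now apply top_vscmp).
rewrite <- (@vscmp1l' _ (bot p) y), <- P4 by congruence.
rewrite (@vscmpA _ p' p y), <- E by congruence.
rewrite vscmpA, (@vscmpA _ x q q'), Q3 by (rewrite ?bot_vscmp, ?top_vscmp by congruence; congruence).
now rewrite (@vscmp1r' _ (top q) x).
Qed.
Lemma fci_nat a b f f' u u' g g' w A A' A'' C C' C'' : cell a f f' u u' -> cell b g g' u' w ->
  vc u A C -> vc u' A' C' -> vc w A'' C'' ->
  fs F [a | b] / fci F f' g' = fci F f g / [fs F a | fs F b].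
Proof.
intros Ha Hb Hu Hu' Hw. sat.
pose proof (@fc_nat _ _ F a b) as E. rewrite (c_rgt Ha), (c_lft Hb) in E. specialize (E eq_refl).
rewrite (c_top Ha), (c_top Hb), (c_bot Ha), (c_bot Hb) in E.
rewrite <- (@vscmp1l' _ (fh F (hcmp f g)) (fs F [a | b])) by sc.
erewrite <- fcE_r by eassumption. vA. rewrite <- (@vscmpA _ (fc F f g)), <- E by sc.
vA. erewrite fcE_l by eassumption. now rewrite vscmp1r' by sc.
Qed.
Lemma fc_natE a b f f' u u' g g' w A A' A'' C C' C'' : cell a f f' u u' -> cell b g g' u' w ->
  vc u A C -> vc u' A' C' -> vc w A'' C'' ->
  [fs F a | fs F b] / fc F f' g' = fc F f g / fs F [a | b].
Proof.
intros Ha Hb Hu Hu' Hw.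
pose proof (@fc_nat _ _ F a b) as E. rewrite (c_rgt Ha), (c_lft Hb) in E. specialize (E eq_refl).
now rewrite (c_top Ha), (c_top Hb), (c_bot Ha), (c_bot Hb) in E.
Qed.
(** [[p | q]] starts at [hid A], which is also [hid A] composed with itself. By the unit law, two
    unitors side by side followed by a compositor are again a unitor. *)
Lemma fu_cmp A p q s t : cell p (hid A) s (vid A) (vid A) -> cell q (hid A) t (vid A) (vid A) ->
  fu F A / fs F [p | q] = [fu F A / fs F p | fu F A / fs F q] / fc F s t.
Proof.
intros Hp Hq.
pose proof (vc_vid A) as Hv; pose proof Hv as Hv'. sat.
rewrite <- interchange, vscmpA by sc.
erewrite fc_natE by eassumption.
rewrite <- vscmpA by sc. f_equal.
pose proof (fc_unitl F (hid A)) as E. rewrite hsrc_id in E.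
rewrite <- (@slide_rl _ (fu F A) (fu F A)) by sc.
rewrite top_fu, bot_fu. rewrite vscmpA, E by sc.
rewrite <- hsid_vid, hscmp1l' by sc. v1. reflexivity.
Qed.

Lemma fc_assocE f g h A0 A1 A2 A3 : hc f A0 A1 -> hc g A1 A2 -> hc h A2 A3 ->
  [fc F f g | vsid (fh F h)] / fc F (hcmp f g) h = [vsid (fh F f) | fc F g h] / fc F f (hcmp g h).
Proof. intros [<- <-] [E1 <-] [E2 <-]. now apply fc_assoc. Qed.

Lemma fci_assocE f g h A0 A1 A2 A3 : hc f A0 A1 -> hc g A1 A2 -> hc h A2 A3 ->
  fci F (hcmp f g) h / [fci F f g | vsid (fh F h)] = fci F f (hcmp g h) / [vsid (fh F f) | fci F g h].
Proof.
intros Hf Hg Hh. pose proof (fc_assocE Hf Hg Hh) as E.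
eapply vinv_uniq with (a := [fc F f g | vsid (fh F h)] / fc F (hcmp f g) h).
- apply vinv_vcmp; [sc | apply vinv_hcmp; [sc | sc | | apply vinv_id] |];
    eapply fcKv; sc.
- rewrite E. apply vinv_vcmp; [sc | apply vinv_hcmp; [sc | sc | apply vinv_id |] |];
    eapply fcKv; sc.
Qed.

Lemma fc_nat3 x y z p q r p' q' r' u v w t A0 A1 A2 A3 C0 C1 C2 C3 :
  cell x p p' u v -> cell y q q' v w -> cell z r r' w t ->
  vc u A0 C0 -> vc v A1 C1 -> vc w A2 C2 -> vc t A3 C3 ->
  [vsid (fh F p) | fc F q r] / (fc F p (hcmp q r) / fs F [x | [y | z]]) =
  [fs F x | [fs F y | fs F z]] / ([vsid (fh F p') | fc F q' r'] / fc F p' (hcmp q' r')).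
Proof.
intros Hx Hy Hz Hu Hv Hw Ht. sat.
erewrite <- (fc_natE (a := x) (b := [y | z])) by sc.
rewrite <- !(@vscmpA _ _ [_ | _]), !interchange by sc. v1.
erewrite fc_natE by eassumption. reflexivity.
Qed.
Lemma fci_nat3 x y z p q r p' q' r' u v w t A0 A1 A2 A3 C0 C1 C2 C3 :
  cell x p p' u v -> cell y q q' v w -> cell z r r' w t ->
  vc u A0 C0 -> vc v A1 C1 -> vc w A2 C2 -> vc t A3 C3 ->
  fs F [x | [y | z]] / (fci F p' (hcmp q' r') / [vsid (fh F p') | fci F q' r']) =
  fci F p (hcmp q r) / ([vsid (fh F p) | fci F q r] / [fs F x | [fs F y | fs F z]]).
Proof.
intros Hx Hy Hz Hu Hv Hw Ht. sat.
rewrite <- vscmpA by sc. erewrite (fci_nat (a := x) (b := [y | z])) by sc.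
rewrite vscmpA, !interchange by sc. v1.
erewrite fci_nat by eassumption. reflexivity.
Qed.

(** Both sides are the compositor of four factors. The right-hand form merges the middle pair first,
    which is where an exchange cell acts. *)
Lemma fc4 a b c d A0 A1 A2 A3 A4 : hc a A0 A1 -> hc b A1 A2 -> hc c A2 A3 -> hc d A3 A4 ->
  [fc F a b | fc F c d] / fc F (hcmp a b) (hcmp c d) =
  [vsid (fh F a) | [fc F b c | vsid (fh F d)]] /
  ([vsid (fh F a) | fc F (hcmp b c) d] / fc F a (hcmp (hcmp b c) d)).
Proof.
intros Ha Hb Hc Hd.
rewrite <- (@vscmpA _ _ [_ | fc F (hcmp b c) d]), <- vsid_whl by sc.
erewrite (fc_assocE (f := b)) by eassumption.
rewrite (hcmpA (f := b)) by sc.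
rewrite vsid_whl, vscmpA by sc.
erewrite <- (fc_assocE (f := a)) by sc.
rewrite <- (@vscmpA _ _ [fc F a b | _]) by sc.
rewrite <- hscmpA, <- vsid_cmp, interchange by sc. v1. reflexivity.
Qed.

(** The square under [F] has the shape of a compositor of the tensor product: a cell [x] in the
    middle, then [y] and [z] side by side. The image of [x] comes out conjugated by compositors, the
    form [fs_cmp] in which the associativity axioms mention exchange cells. *)
Lemma fs_cmp_paste a b c d b' c' s t x y z A0 A1 A2 A3 A4 A5 :
  hc a A0 A1 -> hc b A1 A2 -> hc c A2 A3 -> hc d A3 A4 -> hc c' A1 A5 -> hc b' A5 A3 ->
  cell x (hcmp b c) (hcmp c' b') (vid A1) (vid A3) ->
  cell y (hcmp a c') s (vid A0) (vid A5) -> cell z (hcmp b' d) t (vid A5) (vid A4) ->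
  [fc F a b | fc F c d] / (fc F (hcmp a b) (hcmp c d) / fs F ([vsid a | [x | vsid d]] / [y | z])) =
  [vsid (fh F a) | [fc F b c / fs F x / fci F c' b' | vsid (fh F d)]] /
  ([fc F a c' / fs F y | fc F b' d / fs F z] / fc F s t).
Proof.
intros Ha Hb Hc Hd Hc' Hb' Hx Hy Hz.
assert (hs : hc s A0 A5). { eapply cell_hcb; [exact Hy | apply vc_vid | apply vc_vid]. }
assert (ht : hc t A5 A4). { eapply cell_hcb; [exact Hz | apply vc_vid | apply vc_vid]. }
rewrite fs_vscmp by sc.
rewrite <- (@interchange _ (fc F a c')), (@vscmpA _ [fc F a c' | _]) by sc.
erewrite (fc_natE (a := y)) by (first [eassumption | apply vc_vid]).
rewrite <- !(@vscmpA _ [fc F _ _ | fc F _ _]), (fc4 Ha Hb Hc Hd) by sc.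
rewrite <- !vscmpA by sc. f_equal.
rewrite (@vscmpA _ _ [fc F a c' | _]), (fc4 Ha Hc' Hb' Hd) by sc.
vA. rhs (rewrite <- vscmpA, <- vsid_whl, <- vsid_whr by sc).
vA. erewrite fcE_r by sc. v1.
erewrite <- (fc_natE (a := vsid a)) by sc. rewrite fs_vsid.
rewrite <- (@vscmpA _ [_ | fc F (hcmp b c) d]), <- vsid_whl by sc.
erewrite <- (fc_natE (a := x)) by sc. rewrite fs_vsid.
rewrite vsid_whl, vsid_whr, vsid_whl by sc. vA. rewrite (hcmpA (f := c')) by sc. reflexivity.
Qed.
End FunctorPasting.

(** * Images of globular cells under a pseudodouble functor *)

Section Images.
Variables (D E : dblcat) (T : psfun D E).

Lemma fuE_l A : fu T A / fui T A = vsid (hid (T A)).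
Proof. destruct (fuK T A) as (_ & _ & -> & _). now rewrite top_fu. Qed.
Lemma fuE_r A : fui T A / fu T A = vsid (fh T (hid A)).
Proof. destruct (fuK T A) as (_ & _ & _ & ->). now rewrite bot_fu. Qed.
Lemma fc_unitrE f A A' : hc f A A' -> [vsid (fh T f) | fu T A'] / fc T f (hid A') = vsid (fh T f).
Proof. intros [<- <-]; apply fc_unitr. Qed.
Lemma fc_unitlE f A A' : hc f A A' -> [fu T A | vsid (fh T f)] / fc T (hid A) f = vsid (fh T f).
Proof. intros [<- <-]; apply fc_unitl. Qed.
Lemma fci_unitrE f A A' : hc f A A' -> fci T f (hid A') / [vsid (fh T f) | fui T A'] = vsid (fh T f).
Proof.
intros Hf. apply (vinv_uniq (a := vsid (fh T f))); [|apply vinv_id].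
rewrite <- (fc_unitrE Hf) at 1. apply vinv_vcmp; [sc | apply vinv_hcmp; [sc | sc | apply vinv_id | apply fuK] |].
eapply fcKv; [exact Hf | apply hc_hid].
Qed.
Lemma fci_unitlE f A A' : hc f A A' -> fci T (hid A) f / [fui T A | vsid (fh T f)] = vsid (fh T f).
Proof.
intros Hf. apply (vinv_uniq (a := vsid (fh T f))); [|apply vinv_id].
rewrite <- (fc_unitlE Hf) at 1. apply vinv_vcmp; [sc | apply vinv_hcmp; [sc | sc | apply fuK | apply vinv_id] |].
eapply fcKv; [apply hc_hid | exact Hf].
Qed.

(** The unit law solved for the compositor: with an identity factor it is only a whiskered unitor,
    so compositors of this kind can be eliminated. *)
Lemma fciU_r f A A' : hc f A A' -> fci T f (hid A') = [vsid (fh T f) | fu T A'].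
Proof.
intros Hf. rewrite <- (@vscmp1l' _ (fh T f) (fci T f (hid A'))) by sc. rewrite <- (fc_unitrE Hf) at 1.
rewrite vscmpA, (fcE_l T Hf (hc_hid A')) by sc. now rewrite vscmp1r' by sc.
Qed.
Lemma fciU_l f A A' : hc f A A' -> fci T (hid A) f = [fu T A | vsid (fh T f)].
Proof.
intros Hf. rewrite <- (@vscmp1l' _ (fh T f) (fci T (hid A) f)) by sc. rewrite <- (fc_unitlE Hf) at 1.
rewrite vscmpA, (fcE_l T (hc_hid A) Hf) by sc. now rewrite vscmp1r' by sc.
Qed.
Lemma fcU_r f A A' : hc f A A' -> fc T f (hid A') = [vsid (fh T f) | fui T A'].
Proof.
intros Hf. rewrite <- (@vscmp1r' _ (fh T f) (fc T f (hid A'))) by sc. rewrite <- (fci_unitrE Hf) at 1.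
rewrite <- vscmpA, (fcE_l T Hf (hc_hid A')) by sc. now rewrite vscmp1l' by sc.
Qed.
Lemma fcU_l f A A' : hc f A A' -> fc T (hid A) f = [fui T A | vsid (fh T f)].
Proof.
intros Hf. rewrite <- (@vscmp1r' _ (fh T f) (fc T (hid A) f)) by sc. rewrite <- (fci_unitlE Hf) at 1.
rewrite <- vscmpA, (fcE_l T (hc_hid A) Hf) by sc. now rewrite vscmp1l' by sc.
Qed.

(** The image of a vertically globular square lies between images of identities; unitors make it
    globular again. The unit laws absorb the compositor of [[y | d]], so pasting with such a
    corrected image is strict. *)
Lemma fs_vr y d s t l m r A A' C C' : cell y s t l m -> cell d (hid A) (hid C) m r ->
  vc l A' C' -> vc m A C -> vc r A C ->
  [fs T y | fu T A / fs T d / fui T C] = fs T [y | d].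
Proof.
intros Hy Hd Hl Hm Hr.
assert (Hs : hc s A' A) by (eapply cell_hct; eassumption).
assert (Ht : hc t C' C) by (eapply cell_hcb; eassumption).
transitivity ([vsid (fh T s) | fu T A] / ([fs T y | fs T d] / [vsid (fh T t) | fui T C])).
{ rewrite !interchange by sc. v1. rewrite vscmpA by sc. reflexivity. }
rewrite <- (vscmp1r [fs T y | fs T d]).
replace (bot [fs T y | fs T d]) with (hcmp (fh T t) (fh T (hid C))) by (symmetry; sc).
erewrite <- fcE_l by sc. vA. rewrite <- (@vscmpA _ [fs T y | fs T d]) by sc.
erewrite fc_natE by eassumption. vA. rewrite (fci_unitrE Ht).
rewrite <- (@vscmpA _ [_ | fu T A]), (fc_unitrE Hs) by sc. v1. reflexivity.
Qed.
Lemma fs_vl y d s t l m r A A' C C' : cell y s t m r -> cell d (hid A) (hid C) l m ->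
  vc r A' C' -> vc m A C -> vc l A C ->
  [fu T A / fs T d / fui T C | fs T y] = fs T [d | y].
Proof.
intros Hy Hd Hr Hm Hl.
assert (Hs : hc s A A') by (eapply cell_hct; eassumption).
assert (Ht : hc t C C') by (eapply cell_hcb; eassumption).
transitivity ([fu T A | vsid (fh T s)] / ([fs T d | fs T y] / [fui T C | vsid (fh T t)])).
{ rewrite !interchange by sc. v1. rewrite vscmpA by sc. reflexivity. }
rewrite <- (vscmp1r [fs T d | fs T y]).
replace (bot [fs T d | fs T y]) with (hcmp (fh T (hid C)) (fh T t)) by (symmetry; sc).
erewrite <- fcE_l by sc. vA. rewrite <- (@vscmpA _ [fs T d | fs T y]) by sc.
erewrite fc_natE by eassumption. vA. rewrite (fci_unitlE Ht).
rewrite <- (@vscmpA _ [fu T A | _]), (fc_unitlE Hs) by sc. v1. reflexivity.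
Qed.
Lemma vglob_hcmp a b l m r A C : cell a (hid A) (hid C) l m -> cell b (hid A) (hid C) m r ->
  vc l A C -> vc m A C -> vc r A C ->
  fu T A / fs T [a | b] / fui T C = [fu T A / fs T a / fui T C | fu T A / fs T b / fui T C].
Proof.
intros Ha Hb Hl Hm Hr.
symmetry.
transitivity ([fu T A | vsid (hid (T A))] / [fs T a | fu T A / fs T b / fui T C] / [fui T C | vsid (hid (T C))]).
{ rewrite !interchange by sc. v1. reflexivity. }
erewrite fs_vr by eassumption. rewrite <- !hsid_vid. h1. reflexivity.
Qed.
Lemma vglob_hsid u A C : vc u A C -> fu T A / fs T (hsid u) / fui T C = hsid (fv T u).
Proof.
intros [<- <-]. rewrite <- fu_nat. vA. rewrite fuE_l. now rewrite vscmp1r' by sc.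
Qed.
Lemma vglob_vcmp a b l m l' r' A A' C : cell a (hid A) (hid C) l m -> cell b (hid C) (hid A') l' r' ->
  vc l A C -> vc m A C -> vc l' C A' -> vc r' C A' ->
  fu T A / fs T (a / b) / fui T A' = (fu T A / fs T a / fui T C) / (fu T C / fs T b / fui T A').
Proof.
intros Ha Hb Hl Hm Hl' Hm'. rewrite fs_vscmp by sc. vA.
rewrite <- (@vscmpA _ (fui T C)), fuE_r by sc. v1. reflexivity.
Qed.
Lemma hglob_l p q r q' r' a A0 A1 A2 A3 A2' : hc p A0 A1 -> hc q A1 A2 -> hc r A2 A3 ->
  hc q' A1 A2' -> hc r' A2' A3 -> cell a (hcmp q r) (hcmp q' r') (vid A1) (vid A3) ->
  ([vsid (fh T p) | fc T q r] / fc T p (hcmp q r)) / fs T [vsid p | a] =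
  [vsid (fh T p) | fc T q r / fs T a / fci T q' r'] / ([vsid (fh T p) | fc T q' r'] / fc T p (hcmp q' r')).
Proof.
intros Hp Hq Hr Hq' Hr' Ha. vA. erewrite <- (fc_natE T (a := vsid p)) by sc.
rewrite fs_vsid. rewrite <- !vscmpA by sc. rewrite !vsid_whl by sc. vA. do 2 f_equal.
rewrite <- (@vscmpA _ [_ | fci T _ _]), <- vsid_whl by sc. erewrite fcE_r by sc.
rewrite <- vsid_cmp by sc. v1. reflexivity.
Qed.
Lemma hglob_r p q r p' q' a A0 A1 A2 A3 A1' : hc p A0 A1 -> hc q A1 A2 -> hc r A2 A3 ->
  hc p' A0 A1' -> hc q' A1' A2 -> cell a (hcmp p q) (hcmp p' q') (vid A0) (vid A2) ->
  ([fc T p q | vsid (fh T r)] / fc T (hcmp p q) r) / fs T [a | vsid r] =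
  [fc T p q / fs T a / fci T p' q' | vsid (fh T r)] / ([fc T p' q' | vsid (fh T r)] / fc T (hcmp p' q') r).
Proof.
intros Hp Hq Hr Hp' Hq' Ha. vA. erewrite <- (fc_natE T (b := vsid r)) by sc.
rewrite fs_vsid. rewrite <- !vscmpA by sc. rewrite !vsid_whr by sc. vA. do 2 f_equal.
rewrite <- (@vscmpA _ [fci T _ _ | _]), <- vsid_whr by sc. erewrite fcE_r by sc.
rewrite <- vsid_cmp by sc. v1. reflexivity.
Qed.

(** Here [K] is the compositor law of a horizontal transformation and the conclusion is the same law
    after whiskering by [T]. [hglob_l] and [hglob_r] release the images of [dg] and [df], and the
    associativity of compositors matches the three-fold compositors left between them. *)
Lemma hglob_cmp P Q PQ R S RS x0 x1 x2 A0 A1 A2 C0 C1 C2 a df dg d g :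
  hc P A0 A1 -> hc Q A1 A2 -> hc PQ A0 A2 -> hc R C0 C1 -> hc S C1 C2 -> hc RS C0 C2 ->
  hc x0 A0 C0 -> hc x1 A1 C1 -> hc x2 A2 C2 ->
  cell a (hcmp P Q) PQ (vid A0) (vid A2) -> cell g (hcmp R S) RS (vid C0) (vid C2) ->
  cell df (hcmp P x1) (hcmp x0 R) (vid A0) (vid C1) -> cell dg (hcmp Q x2) (hcmp x1 S) (vid A1) (vid C2) ->
  cell d (hcmp PQ x2) (hcmp x0 RS) (vid A0) (vid C2) ->
  [a | vsid x2] / d = [vsid P | dg] / [df | vsid S] / [vsid x0 | g] ->
  [fc T P Q / fs T a | vsid (fh T x2)] / (fc T PQ x2 / fs T d / fci T x0 RS) =
  [vsid (fh T P) | fc T Q x2 / fs T dg / fci T x1 S] / [fc T P x1 / fs T df / fci T x0 R | vsid (fh T S)]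
    / [vsid (fh T x0) | fc T R S / fs T g].
Proof.
intros HP HQ HPQ HR HS HRS H0 H1 H2 Ha Hg Hdf Hdg Hd K.
pose proof (hglob_l HP HQ H2 H1 HS Hdg) as E1.
pose proof (hglob_r HP H1 HS H0 HR Hdf) as E2.
rewrite <- (fc_assocE T HP H1 HS) in E1.
rewrite (fc_assocE T H0 HR HS) in E2.
lhs (rewrite vsid_whr by sc; vA; rewrite <- (@vscmpA _ [fs T a | _]) by sc;
  rewrite <- fs_vsid; erewrite (fc_natE T) by sc).
lhs (vA; rewrite <- (@vscmpA _ (fs T _) (fs T d)), <- fs_vscmp, K by sc).
lhs (rewrite fs_vscmp, fs_vscmp by sc; vA; rewrite fs_vsid).
lhs (rewrite <- (@vscmpA _ [fc T P Q | _]), (fc_assocE T HP HQ H2) by sc).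
lhs (rewrite <- (@vscmpA _ _ (fs T [vsid P | dg])), E1 by sc).
lhs (rewrite vscmpA by sc; rewrite <- (@vscmpA _ _ (fs T [df | vsid S])), E2 by sc).
vA. do 2 f_equal.
erewrite (fci_nat T (a := vsid x0)) by sc. rewrite <- (@vscmpA _ (fc T x0 _)) by sc. erewrite fcE_l by sc.
rewrite fs_vsid. rewrite (vsid_whl (a := fc T R S)) by sc. v1. reflexivity.
Qed.
End Images.

(** * Whiskering, and the quasi-functor of a tensor product *)

Section Whiskering.
Variables (C D E : dblcat) (T : psfun D E) (F G : psfun C D).

(** [fs T] of a structure cell runs between images of composites. The compositors on both sides make
    it a cell between composites of images, as a transformation from [T \o F] to [T \o G]
    requires. *)
Definition whisk_h (x : hdat C D) : hdat C E := Hdat (fun A => fh T (h_o x A)) (fun u => fs T (h_v x u))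
  (fun f => fc T (fh F f) (h_o x (htgt f)) / fs T (h_d x f) / fci T (h_o x (hsrc f)) (fh G f))
  (fun f => fc T (h_o x (hsrc f)) (fh G f) / fs T (h_di x f) / fci T (fh F f) (h_o x (htgt f))).

Definition whisk_v (x : vdat C D) : vdat C E := Vdat (fun A => fv T (v_o x A)) (fun f => fs T (v_h x f))
  (fun u => fu T (F (vsrc u)) / fs T (v_d x u) / fui T (G (vtgt u)))
  (fun u => fu T (F (vsrc u)) / fs T (v_di x u) / fui T (G (vtgt u))).

Lemma whisk_htrans x : is_htrans F G x -> is_htrans (T \o F) (T \o G) (whisk_h x).
Proof.
intros Hx.
assert (Ho : forall A, hc (h_o x A) (F A) (G A)) by (intros; split; apply Hx).
assert (Hv : forall u, cell (h_v x u) (h_o x (vsrc u)) (h_o x (vtgt u)) (fv F u) (fv G u)) by (intros; repeat split; apply Hx).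
assert (Hd : forall f, cell (h_d x f) (hcmp (fh F f) (h_o x (htgt f))) (hcmp (h_o x (hsrc f)) (fh G f)) (vid (F (hsrc f))) (vid (G (htgt f)))) by (intros; repeat split; apply Hx).
assert (HF : forall f, hc (fh F f) (F (hsrc f)) (F (htgt f))) by (intros; sc).
assert (HG : forall f, hc (fh G f) (G (hsrc f)) (G (htgt f))) by (intros; sc).
constructor; simpl; intros.
- apply (hc_src (hc_fh (Ho A) eq_refl eq_refl)).
- apply (hc_tgt (hc_fh (Ho A) eq_refl eq_refl)).
- apply (c_top (cell_fs (Hv u) eq_refl eq_refl eq_refl eq_refl)).
- apply (c_bot (cell_fs (Hv u) eq_refl eq_refl eq_refl eq_refl)).
- apply (c_lft (cell_fs (Hv u) eq_refl eq_refl eq_refl eq_refl)).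
- apply (c_rgt (cell_fs (Hv u) eq_refl eq_refl eq_refl eq_refl)).
- pose proof (Hd f). pose proof (Ho (hsrc f)). pose proof (Ho (htgt f)). sc.
- pose proof (Hd f). pose proof (Ho (hsrc f)). pose proof (Ho (htgt f)). sc.
- pose proof (Hd f). pose proof (Ho (hsrc f)). pose proof (Ho (htgt f)). sc.
- pose proof (Hd f). pose proof (Ho (hsrc f)). pose proof (Ho (htgt f)). sc.
- pose proof (Hd f) as Hf. pose proof (Ho (hsrc f)). pose proof (Ho (htgt f)).
  pose proof (hdK Hx f) as K.
  assert (Hi : cell (h_di x f) (hcmp (h_o x (hsrc f)) (fh G f)) (hcmp (fh F f) (h_o x (htgt f))) (vid (F (hsrc f))) (vid (G (htgt f)))).
  { repeat split; [destruct K as (<- & _); apply Hf | destruct K as (_ & -> & _); apply Hf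
     | apply (vinv_globl K), Hf | apply (vinv_globr K), Hf]. }
  rewrite (@vscmpA _ (fc T (h_o x (hsrc f)) (fh G f))) by sc.
  apply vinv_vcmp; [sc | apply vinv_vcmp; [sc | eapply fcKv; sc | apply vinv_fs, K] |].
  destruct (fcKv T (Ho (hsrc f)) (HG f)) as (K1 & K2 & K3 & K4).
  repeat split; [exact K2 | exact K1 | rewrite K4; f_equal; exact K1 | rewrite K3; f_equal; symmetry; exact K2].
- pose proof (hd_cmp Hx H) as K.
  pose proof (Hd f) as Hdf. pose proof (Hd g) as Hdg. pose proof (Hd (hcmp f g)) as Hdfg.
  pose proof (HF g) as HFg. pose proof (HG g) as HGg. pose proof (HF (hcmp f g)) as HFfg. pose proof (HG (hcmp f g)) as HGfg.
  rewrite ?(hsrc_cmp H), ?(htgt_cmp H), <- ?H in *.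
  eapply hglob_cmp; [ | | | | | | | | | | | | | | exact K]; try eassumption; try apply Ho; try apply HF; try apply HG.
  + assert (hc f (hsrc f) (htgt f)) by sc. assert (hc g (htgt f) (htgt g)) by (split; congruence). sc.
  + assert (hc f (hsrc f) (htgt f)) by sc. assert (hc g (htgt f) (htgt g)) by (split; congruence). sc.
- pose proof (hd_id Hx A) as K. pose proof (Hd (hid A)) as HdA. pose proof (Ho A) as HA.
  rewrite hsrc_id, htgt_id in *.
  lhs (rewrite vsid_whr by sc; vA; rewrite <- (@vscmpA _ [fs T _ | _]) by sc;
   rewrite <- fs_vsid; erewrite (fc_natE T) by sc).
  lhs (vA; rewrite <- (@vscmpA _ (fs T _) (fs T _)), <- fs_vscmp, K by sc).
  lhs (rewrite fs_vsid, <- (@vscmpA _ [fu T _ | _]), (fc_unitlE T HA) by sc).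
  erewrite (fci_nat T) by sc. rewrite (fciU_r T HA), fs_vsid. v1. rewrite vsid_whl by sc. reflexivity.
- rewrite hv_cmp with (1 := Hx) by assumption. pose proof (Hv u). pose proof (Hv v). rewrite H in *. now rewrite fs_vscmp by sc.
- rewrite hv_id with (1 := Hx). now rewrite fs_vsid.
- pose proof (hd_nat Hx a) as K. pose proof (Hd (top a)) as Ht. pose proof (Hd (bot a)) as Hb.
  pose proof (Hv (lft a)). pose proof (Hv (rgt a)).
  pose proof (hc_top a) as Ea. pose proof (hc_bot a) as Eb. rewrite (proj1 Ea), (proj2 Ea), (proj1 Eb), (proj2 Eb) in *.
  pose proof (Ho (vsrc (lft a))). pose proof (Ho (vsrc (rgt a))). pose proof (Ho (vtgt (lft a))). pose proof (Ho (vtgt (rgt a))).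
  lhs (rewrite <- !vscmpA by sc; erewrite (fc_natE T) by sc; vA; rewrite <- (@vscmpA _ (fs T _) (fs T _)), <- fs_vscmp, K by sc).
  rewrite fs_vscmp by sc. vA. erewrite (fci_nat T) by sc. reflexivity.
Qed.

Lemma whisk_vtrans x : is_vtrans F G x -> is_vtrans (T \o F) (T \o G) (whisk_v x).
Proof.
intros Hx.
assert (Ho : forall A, vc (v_o x A) (F A) (G A)) by (intros; split; apply Hx).
assert (Hh : forall f, cell (v_h x f) (fh F f) (fh G f) (v_o x (hsrc f)) (v_o x (htgt f))) by (intros; repeat split; apply Hx).
assert (Hd : forall u, cell (v_d x u) (hid (F (vsrc u))) (hid (G (vtgt u))) (vcmp (v_o x (vsrc u)) (fv G u)) (vcmp (fv F u) (v_o x (vtgt u)))) by (intros; repeat split; apply Hx).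
assert (HF : forall u, vc (fv F u) (F (vsrc u)) (F (vtgt u))) by (intros; sc).
assert (HG : forall u, vc (fv G u) (G (vsrc u)) (G (vtgt u))) by (intros; sc).
assert (HdT : forall u, cell (fu T (F (vsrc u)) / fs T (v_d x u) / fui T (G (vtgt u))) (hid (T (F (vsrc u)))) (hid (T (G (vtgt u))))
  (vcmp (fv T (v_o x (vsrc u))) (fv T (fv G u))) (vcmp (fv T (fv F u)) (fv T (v_o x (vtgt u))))).
{ intros u. pose proof (Ho (vsrc u)). pose proof (Ho (vtgt u)). pose proof (Hd u). sc. }
constructor; simpl; intros.
- apply (vc_src (vc_fv (Ho A) eq_refl eq_refl)).
- apply (vc_tgt (vc_fv (Ho A) eq_refl eq_refl)).
- apply (c_top (cell_fs (Hh f) eq_refl eq_refl eq_refl eq_refl)).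
- apply (c_bot (cell_fs (Hh f) eq_refl eq_refl eq_refl eq_refl)).
- apply (c_lft (cell_fs (Hh f) eq_refl eq_refl eq_refl eq_refl)).
- apply (c_rgt (cell_fs (Hh f) eq_refl eq_refl eq_refl eq_refl)).
- apply (c_top (HdT u)).
- apply (c_bot (HdT u)).
- apply (c_lft (HdT u)).
- apply (c_rgt (HdT u)).
- pose proof (vdK Hx u) as K. pose proof (Ho (vsrc u)). pose proof (Ho (vtgt u)).
  assert (Hi : cell (v_di x u) (hid (F (vsrc u))) (hid (G (vtgt u))) (vcmp (fv F u) (v_o x (vtgt u))) (vcmp (v_o x (vsrc u)) (fv G u))).
  { repeat split; [apply (hinv_globt K), Hx | apply (hinv_globb K), Hx | destruct K as (<- & _); apply Hx | destruct K as (_ & -> & _); apply Hx]. }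
  pose proof (Hd u). destruct K as (K1 & K2 & K3 & K4).
  repeat split; [sc | sc | |]; erewrite <- vglob_hcmp by sc.
  + rewrite K3, (c_lft (HdT u)), (c_lft (Hd u)). erewrite vglob_hsid by sc. f_equal. sc.
  + rewrite K4, (c_rgt (HdT u)), (c_rgt (Hd u)). erewrite vglob_hsid by sc. f_equal. sc.
- pose proof (Hd u) as Hu. pose proof (Hd v) as Hv. pose proof (HF u). pose proof (HF v). pose proof (HG u). pose proof (HG v).
  pose proof (Ho (vsrc u)). pose proof (Ho (vtgt u)). pose proof (Ho (vtgt v)).
  rewrite vd_cmp with (1 := Hx), (vsrc_cmp H), (vtgt_cmp H) by assumption. rewrite <- ?H in *.
  erewrite vglob_hcmp by sc.
  f_equal; erewrite vglob_vcmp by sc; f_equal; eapply vglob_hsid; sc.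
- pose proof (Ho A). rewrite vd_id with (1 := Hx), vsrc_id, vtgt_id. apply vglob_hsid, H.
- pose proof (Hh f) as Hf. pose proof (Hh g) as Hg. pose proof (Hh (hcmp f g)).
  pose proof (Ho (hsrc f)). pose proof (Ho (htgt f)). pose proof (Ho (htgt g)).
  pose proof (vh_cmp Hx H) as K. rewrite ?(hsrc_cmp H), ?(htgt_cmp H), <- ?H in *.
  assert (hc f (hsrc f) (htgt f)) by sc. assert (hc g (htgt f) (htgt g)) by (split; congruence).
  rewrite <- vscmpA by sc. erewrite (fc_natE T) by sc. vA.
  rewrite <- !fs_vscmp by sc. now rewrite K.
- pose proof (Hh (hid A)). pose proof (Ho A). rewrite hsrc_id, htgt_id in *.
  pose proof (vh_id Hx A) as K.
  rewrite <- vscmpA by sc. pose proof (fu_nat T (v_o x A)) as E1. rewrite (proj1 H0), (proj2 H0) in E1. rewrite E1. vA.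
  rewrite <- !fs_vscmp by sc. now rewrite K.
- pose proof (vd_nat Hx a) as K. pose proof (Hh (top a)) as Ht. pose proof (Hh (bot a)) as Hb.
  pose proof (Hd (lft a)). pose proof (Hd (rgt a)).
  pose proof (hc_top a) as Ea. pose proof (hc_bot a) as Eb. rewrite (proj1 Ea), (proj2 Ea), (proj1 Eb), (proj2 Eb) in *.
  pose proof (Ho (vsrc (lft a))). pose proof (Ho (vsrc (rgt a))). pose proof (Ho (vtgt (lft a))). pose proof (Ho (vtgt (rgt a))).
  rewrite <- !fs_vscmp by sc. erewrite fs_vr, fs_vl by sc. now rewrite K.
Qed.

End Whiskering.

Section WhiskerModif.
Variables (C D E : dblcat) (T : psfun D E) (F G F' G' : psfun C D) (t b : hdat C D) (l r : vdat C D) (m : ob C -> sq D).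
Lemma whisk_modif : is_htrans F G t -> is_htrans F' G' b -> is_vtrans F F' l -> is_vtrans G G' r ->
  is_modif t b l r m ->
  is_modif (whisk_h T F G t) (whisk_h T F' G' b) (whisk_v T F F' l) (whisk_v T G G' r) (fun A => fs T (m A)).
Proof.
intros Ht Hb Hl Hr Hm.
assert (Hto : forall A, hc (h_o t A) (F A) (G A)) by (intros; split; apply Ht).
assert (Hbo : forall A, hc (h_o b A) (F' A) (G' A)) by (intros; split; apply Hb).
assert (Hlo : forall A, vc (v_o l A) (F A) (F' A)) by (intros; split; apply Hl).
assert (Hro : forall A, vc (v_o r A) (G A) (G' A)) by (intros; split; apply Hr).
assert (Hmc : forall A, cell (m A) (h_o t A) (h_o b A) (v_o l A) (v_o r A)) by (intros; repeat split; apply Hm).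
constructor; simpl; intros.
- apply (c_top (cell_fs (Hmc A) eq_refl eq_refl eq_refl eq_refl)).
- apply (c_bot (cell_fs (Hmc A) eq_refl eq_refl eq_refl eq_refl)).
- apply (c_lft (cell_fs (Hmc A) eq_refl eq_refl eq_refl eq_refl)).
- apply (c_rgt (cell_fs (Hmc A) eq_refl eq_refl eq_refl eq_refl)).
- pose proof (Hmc (hsrc f)). pose proof (Hmc (htgt f)). pose proof (Hto (hsrc f)). pose proof (Hto (htgt f)).
  pose proof (Hbo (hsrc f)). pose proof (Hbo (htgt f)). pose proof (Hlo (hsrc f)). pose proof (Hlo (htgt f)).
  pose proof (Hro (hsrc f)). pose proof (Hro (htgt f)).
  assert (cell (v_h l f) (fh F f) (fh F' f) (v_o l (hsrc f)) (v_o l (htgt f))) by (repeat split; apply Hl).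
  assert (cell (v_h r f) (fh G f) (fh G' f) (v_o r (hsrc f)) (v_o r (htgt f))) by (repeat split; apply Hr).
  assert (cell (h_d t f) (hcmp (fh F f) (h_o t (htgt f))) (hcmp (h_o t (hsrc f)) (fh G f)) (vid (F (hsrc f))) (vid (G (htgt f)))) by (intros; repeat split; apply Ht).
  assert (cell (h_d b f) (hcmp (fh F' f) (h_o b (htgt f))) (hcmp (h_o b (hsrc f)) (fh G' f)) (vid (F' (hsrc f))) (vid (G' (htgt f)))) by (intros; repeat split; apply Hb).
  lhs (rewrite <- !vscmpA by sc; erewrite (fc_natE T) by sc; vA; rewrite <- (@vscmpA _ (fs T _) (fs T _)), <- fs_vscmp, (m_hor Hm) by sc).
  rewrite fs_vscmp by sc. vA. erewrite (fci_nat T) by sc. reflexivity.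
- pose proof (Hmc (vsrc u)). pose proof (Hmc (vtgt u)). pose proof (Hto (vsrc u)). pose proof (Hto (vtgt u)).
  pose proof (Hbo (vsrc u)). pose proof (Hbo (vtgt u)). pose proof (Hlo (vsrc u)). pose proof (Hlo (vtgt u)).
  pose proof (Hro (vsrc u)). pose proof (Hro (vtgt u)).
  assert (cell (h_v t u) (h_o t (vsrc u)) (h_o t (vtgt u)) (fv F u) (fv G u)) by (repeat split; apply Ht).
  assert (cell (h_v b u) (h_o b (vsrc u)) (h_o b (vtgt u)) (fv F' u) (fv G' u)) by (repeat split; apply Hb).
  assert (cell (v_d l u) (hid (F (vsrc u))) (hid (F' (vtgt u))) (vcmp (v_o l (vsrc u)) (fv F' u)) (vcmp (fv F u) (v_o l (vtgt u)))) by (repeat split; apply Hl).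
  assert (cell (v_d r u) (hid (G (vsrc u))) (hid (G' (vtgt u))) (vcmp (v_o r (vsrc u)) (fv G' u)) (vcmp (fv G u) (v_o r (vtgt u)))) by (repeat split; apply Hr).
  assert (vc (fv F u) (F (vsrc u)) (F (vtgt u))) by sc. assert (vc (fv G u) (G (vsrc u)) (G (vtgt u))) by sc.
  assert (vc (fv F' u) (F' (vsrc u)) (F' (vtgt u))) by sc. assert (vc (fv G' u) (G' (vsrc u)) (G' (vtgt u))) by sc.
  rewrite <- !fs_vscmp by sc. erewrite fs_vr, fs_vl by sc. now rewrite (m_ver Hm).
Qed.
End WhiskerModif.

(** * Pairs of transformations and constant transformations *)

Section Pairing.
Variables (E C D : dblcat).
Definition pair_h (x : hdat E C) (y : hdat E D) : hdat E (dblprod C D) := Hdat (D := dblprod C D)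
  (fun A => (h_o x A, h_o y A)) (fun u => (h_v x u, h_v y u)) (fun f => (h_d x f, h_d y f)) (fun f => (h_di x f, h_di y f)).
Definition pair_v (x : vdat E C) (y : vdat E D) : vdat E (dblprod C D) := Vdat (D := dblprod C D)
  (fun A => (v_o x A, v_o y A)) (fun u => (v_h x u, v_h y u)) (fun f => (v_d x f, v_d y f)) (fun f => (v_di x f, v_di y f)).

Lemma pair_htrans F F' G G' x y : is_htrans F G x -> is_htrans F' G' y ->
  is_htrans << F, F' >> << G, G' >> (pair_h x y).
Proof.
intros Hx Hy. constructor; simpl; intros; try (f_equal; first [apply Hx | apply Hy]; assumption).
destruct (hdK Hx f) as (? & ? & ? & ?), (hdK Hy f) as (? & ? & ? & ?).
repeat split; simpl; f_equal; assumption.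
Qed.
Lemma pair_vtrans F F' G G' x y : is_vtrans F G x -> is_vtrans F' G' y ->
  is_vtrans << F, F' >> << G, G' >> (pair_v x y).
Proof.
intros Hx Hy. constructor; simpl; intros; try (f_equal; first [apply Hx | apply Hy]; assumption).
destruct (vdK Hx u) as (? & ? & ? & ?), (vdK Hy u) as (? & ? & ? & ?).
repeat split; simpl; f_equal; assumption.
Qed.
Lemma pair_modif t b l r m t' b' l' r' m' : is_modif t b l r m -> is_modif t' b' l' r' m' ->
  is_modif (pair_h t t') (pair_h b b') (pair_v l l') (pair_v r r') (fun A => (m A, m' A) : sq (dblprod C D)).
Proof.
intros Hx Hy. constructor; simpl; intros; f_equal; first [apply Hx | apply Hy].
Qed.
End Pairing.

Section Constant.
Variables (C D : dblcat).
Definition constf (I : ob D) : psfun C D.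
Proof.
refine (@Psfun C D (fun _ => I) (fun _ => hid I) (fun _ => vid I) (fun _ => vsid (hid I))
  (fun _ _ => vsid (hid I)) (fun _ _ => vsid (hid I)) (fun _ => vsid (hid I)) (fun _ => vsid (hid I))
  _ _ _ _ _ _ _ _ _ _ _ _ _ _ _ _ _ _ _ _ _ _ _ _ _ _ _); intros; try apply vinv_id; try sc.
all: rewrite <- ?hsid_vid, ?hscmp1l' by sc; rewrite ?hsid_vid; v1; reflexivity.
Defined.
Definition const_h (K : hor D) : hdat C D := Hdat (fun _ => K) (fun _ => vsid K) (fun _ => vsid K) (fun _ => vsid K).
Definition const_v (U : ver D) : vdat C D := Vdat (fun _ => U) (fun _ => hsid U) (fun _ => hsid U) (fun _ => hsid U).
Lemma const_htrans K A A' : hc K A A' -> is_htrans (constf A) (constf A') (const_h K).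
Proof.
intros HK. constructor; simpl; intros; try apply vinv_id; try sc.
all: rewrite <- ?hsid_vid; h1; v1; reflexivity.
Qed.
Lemma const_vtrans U A A' : vc U A A' -> is_vtrans (constf A) (constf A') (const_v U).
Proof.
intros HU. constructor; simpl; intros; try apply hinv_id; try sc.
all: rewrite ?hsid_vid; v1; h1; reflexivity.
Qed.
Lemma const_modif a : is_modif (const_h (top a)) (const_h (bot a)) (const_v (lft a)) (const_v (rgt a)) (fun _ => a).
Proof.
constructor; simpl; intros; try reflexivity; v1; h1; reflexivity.
Qed.
End Constant.

(** Reduces a strict transformation to its essential laws: once the 1v-components [o] are strictly
    natural, identity squares serve as globular cells, and the pasting with them disappears from the
    remaining axioms. *)
Lemma hsid_vtrans (C D : dblcat) (F G : psfun C D) (o : ob C -> ver D) (m : hor C -> sq D) :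
  (forall A, vc (o A) (F A) (G A)) ->
  (forall f, cell (m f) (fh F f) (fh G f) (o (hsrc f)) (o (htgt f))) ->
  (forall u, vcmp (o (vsrc u)) (fv G u) = vcmp (fv F u) (o (vtgt u))) ->
  (forall f g, htgt f = hsrc g -> [m f | m g] / fc G f g = fc F f g / m (hcmp f g)) ->
  (forall A, hsid (o A) / fu G A = fu F A / m (hid A)) ->
  (forall a, m (top a) / fs G a = fs F a / m (bot a)) ->
  (forall f, exists b, vinv (m f) b) ->
  is_vstrict_iso F G (Vdat o m (fun u => hsid (vcmp (o (vsrc u)) (fv G u)))
    (fun u => hsid (vcmp (o (vsrc u)) (fv G u)))).
Proof.
intros Ho Hm Hn Hc Hu Ha Hi.
assert (K : forall u, vc (fv F u) (F (vsrc u)) (F (vtgt u))) by (intros; sc).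
assert (K' : forall u, vc (fv G u) (G (vsrc u)) (G (vtgt u))) by (intros; sc).
assert (KK : forall u, vc (vcmp (o (vsrc u)) (fv G u)) (F (vsrc u)) (G (vtgt u))).
{ intros u. eapply vc_vcmp; [apply Ho | apply K' | reflexivity]. }
constructor; [constructor | | exact Hi]; simpl; intros.
- apply Ho.
- apply Ho.
- apply (c_top (Hm f)).
- apply (c_bot (Hm f)).
- apply (c_lft (Hm f)).
- apply (c_rgt (Hm f)).
- rewrite top_hsid; f_equal; apply KK.
- rewrite bot_hsid; f_equal; apply KK.
- apply lft_hsid.
- rewrite rgt_hsid; apply Hn.
- apply hinv_id.
- assert (E : vcmp (vcmp (o (vsrc u)) (fv G u)) (fv G v) = vcmp (fv F u) (vcmp (o (vsrc v)) (fv G v))).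
  { pose proof (Ho (vsrc u)) as H1. pose proof (Ho (vsrc v)) as H2.
    pose proof (K u) as H3; pose proof (K' u) as H4; pose proof (K' v) as H5; rewrite H in H3, H4.
    rewrite Hn, H, vcmpA by sc. reflexivity. }
  rewrite vsrc_cmp, fv_cmp by assumption.
  rewrite <- !hsid_cmp by (rewrite ?(proj1 (K' _)), ?(proj2 (KK _)), ?(proj2 (K _)), ?(proj1 (KK _)), H; reflexivity).
  rewrite <- E, hscmp1l' by apply lft_hsid.
  f_equal. symmetry; apply vcmpA; [now rewrite (proj2 (Ho _)), (proj1 (K' _)) | now rewrite (proj2 (K' _)), (proj1 (K' _)), H].
- rewrite vsrc_id, fv_id. f_equal. apply vcmp1r', Ho.
- apply Hc; assumption.
- apply Hu.
- assert (E1 : lft (fs F a / m (bot a)) = vcmp (o (vsrc (lft a))) (fv G (lft a))).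
  { rewrite Hn, lft_vscmp by (rewrite bot_fs; symmetry; apply (c_top (Hm _))).
    now rewrite lft_fs, (c_lft (Hm _)), hsrc_bot. }
  assert (E2 : rgt (m (top a) / fs G a) = vcmp (o (vsrc (rgt a))) (fv G (rgt a))).
  { rewrite rgt_vscmp by (rewrite top_fs; apply (c_bot (Hm _))).
    now rewrite rgt_fs, (c_rgt (Hm _)), htgt_top. }
  rewrite (hscmp1r' E2), (hscmp1l' E1). apply Ha.
- unfold vtrivial; simpl. now rewrite lft_hsid.
Qed.

Section StrictIso.
Variables (C D : dblcat) (F G : psfun C D) (x : vdat C D) (Hx : is_vstrict_iso F G x).
Lemma vstrict_vc A : vc (v_o x A) (F A) (G A).
Proof. split; apply (vsi_trans Hx). Qed.
(** An identity square has equal left and right sides; for the structure square of [u] these are the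
    two sides of the naturality equation. *)
Lemma vstrict_natv u A A' : vc u A A' -> vcmp (v_o x A) (fv G u) = vcmp (fv F u) (v_o x A').
Proof.
intros [<- <-]. pose proof (vsi_trans Hx) as K.
rewrite <- (lft_vd K), <- (rgt_vd K), (vsi_strict Hx u). now rewrite lft_hsid, rgt_hsid.
Qed.
Lemma vstrict_cell f A A' : hc f A A' -> cell (v_h x f) (fh F f) (fh G f) (v_o x A) (v_o x A').
Proof. intros [<- <-]. repeat split; apply (vsi_trans Hx). Qed.
Lemma vstrict_nat a f f' u u' : cell a f f' u u' -> v_h x f / fs G a = fs F a / v_h x f'.
Proof.
intros (<- & <- & <- & <-). pose proof (vsi_trans Hx) as K.
pose proof (vd_nat K a) as E. rewrite (vsi_strict Hx (lft a)), (vsi_strict Hx (rgt a)) in E.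
rewrite (lft_vd K), (lft_vd K) in E.
assert (E1 : lft (fs F a / v_h x (bot a)) = vcmp (v_o x (vsrc (lft a))) (fv G (lft a))).
{ rewrite lft_vscmp by (rewrite bot_fs, (top_vh K); reflexivity).
  rewrite lft_fs, (lft_vh K), hsrc_bot. symmetry. apply vstrict_natv, vc_refl. }
assert (E2 : rgt (v_h x (top a) / fs G a) = vcmp (v_o x (vsrc (rgt a))) (fv G (rgt a))).
{ rewrite rgt_vscmp by (rewrite top_fs, (bot_vh K); reflexivity).
  rewrite rgt_fs, (rgt_vh K), htgt_top. reflexivity. }
rewrite (hscmp1r' E2), (hscmp1l' E1) in E. exact E.
Qed.
Lemma vstrict_fc f g A A' A'' : hc f A A' -> hc g A' A'' -> [v_h x f | v_h x g] / fc G f g = fc F f g / v_h x (hcmp f g).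
Proof. intros [<- <-] [E <-]. apply (vh_cmp (vsi_trans Hx)); now symmetry. Qed.
End StrictIso.

(** * The quasi-functor of a pseudodouble functor on a product *)

Section TensorQuasi.
Variables (B : dblcat) (T : psfun (dblprod B B) B).

(** The transformation [K |x -] is the whiskering by [T] of the pair formed by the constant
    transformation at [K] and an identity transformation; the other three kinds and the
    modifications arise likewise. The cells written out in the record are what these whiskerings
    compute to, hence all six families of laws hold by [exact]. *)
Definition tens_quasi : quasi_functor B.
Proof.
refine (@Quasi_functor B (fun A => T \o << constf B A, fid B >>) (fun A => T \o << fid B, constf B A >>) (fun _ _ => eq_refl)
  (fun K k => fc T (hid (hsrc K), k) (K, hid (htgt k)) / fs T (vsid K, vsid k) / fci T (K, hid (hsrc k)) (hid (htgt K), k))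
  (fun K k => fc T (K, hid (hsrc k)) (hid (htgt K), k) / fs T (vsid K, vsid k) / fci T (hid (hsrc K), k) (K, hid (htgt k)))
  (fun K u => fs T (vsid K, hsid u)) (fun U k => fs T (hsid U, vsid k))
  (fun U u => fu T (vsrc U, vsrc u) / fs T (hsid U, hsid u) / fui T (vtgt U, vtgt u))
  (fun U u => fu T (vsrc U, vsrc u) / fs T (hsid U, hsid u) / fui T (vtgt U, vtgt u)) _ _ _ _ _ _).
- intros K. exact (whisk_htrans T (pair_htrans (const_htrans B (hc_refl K)) (hdat_id_ok (fid B)))).
- intros U. exact (whisk_vtrans T (pair_vtrans (const_vtrans B (vc_refl U)) (vdat_id_ok (fid B)))).
- intros k. exact (whisk_htrans T (pair_htrans (hdat_id_ok (fid B)) (const_htrans B (hc_refl k)))).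
- intros u. exact (whisk_vtrans T (pair_vtrans (vdat_id_ok (fid B)) (const_vtrans B (vc_refl u)))).
- intros a; rewrite (hsrc_top a), (htgt_top a), (hsrc_bot a), (htgt_bot a). exact (whisk_modif T (pair_htrans (const_htrans B (hc_top a)) (hdat_id_ok (fid B)))
    (pair_htrans (const_htrans B (hc_bot a)) (hdat_id_ok (fid B))) (pair_vtrans (const_vtrans B (vc_refl (lft a))) (vdat_id_ok (fid B)))
    (pair_vtrans (const_vtrans B (vc_refl (rgt a))) (vdat_id_ok (fid B))) (pair_modif (const_modif B a) (modif_vid (harr_id (fid B))))).
- intros a; rewrite (hsrc_top a), (htgt_top a), (hsrc_bot a), (htgt_bot a). exact (whisk_modif T (pair_htrans (hdat_id_ok (fid B)) (const_htrans B (hc_top a)))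
    (pair_htrans (hdat_id_ok (fid B)) (const_htrans B (hc_bot a))) (pair_vtrans (vdat_id_ok (fid B)) (const_vtrans B (vc_refl (lft a))))
    (pair_vtrans (vdat_id_ok (fid B)) (const_vtrans B (vc_refl (rgt a)))) (pair_modif (modif_vid (harr_id (fid B))) (const_modif B a))).
Defined.
End TensorQuasi.

(** * Central structures and quasi-functors *)

Lemma hdat_eq (C D : dblcat) (x y : hdat C D) : (forall A, h_o x A = h_o y A) ->
  (forall u, h_v x u = h_v y u) -> (forall f, h_d x f = h_d y f) ->
  (forall f, h_di x f = h_di y f) -> x = y.
Proof.
destruct x, y; simpl; intros E1 E2 E3 E4.
f_equal; apply functional_extensionality; assumption.
Qed.
Lemma vdat_eq (C D : dblcat) (x y : vdat C D) : (forall A, v_o x A = v_o y A) ->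
  (forall u, v_h x u = v_h y u) -> (forall f, v_d x f = v_d y f) ->
  (forall f, v_di x f = v_di y f) -> x = y.
Proof.
destruct x, y; simpl; intros E1 E2 E3 E4.
f_equal; apply functional_extensionality; assumption.
Qed.
Lemma is_modif_ext (C D : dblcat) (t b : hdat C D) l r m m' :
  (forall A, m A = m' A) -> is_modif t b l r m -> is_modif t b l r m'.
Proof. intros E; now replace m' with m by (apply functional_extensionality; exact E). Qed.

Section Purely.
Variables (B : dblcat) (X : binoidal B) (S : purely_central X).

(** The axiom [pc_hh] equates the exchange cell of [K |x -] with an inverse cell of [- x| k].
    Uniqueness of inverses gives the equation the other way round. *)
Lemma pc_hhi K k : h_d (pc_rh S k) K = h_di (pc_lh S K) k.
Proof.
destruct (pc_lhP S K) as [H1 _], (pc_rhP S k) as [H2 _].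
eapply vinv_uniq; [|apply (hdK H1)]. rewrite (pc_hh S). apply vinv_sym, (hdK H2).
Qed.
Lemma pc_vvi U u : v_d (pc_rv S u) U = v_di (pc_lv S U) u.
Proof.
destruct (pc_lvP S U) as [H1 _], (pc_rvP S u) as [H2 _].
eapply hinv_uniq; [|apply (vdK H1)]. rewrite (pc_vv S). apply hinv_sym, (vdK H2).
Qed.

Definition purely_quasi : quasi_functor B.
Proof.
(* Each transformation of [S] equals the record that the quasi-functor assembles from the left-hand
   cells. For the right-hand transformations, in [E3] and [E4], this is the content of the four
   identities of a purely central structure. *)
assert (E1 : forall K, pc_lh S K = Hdat (fun A => fh (bR X A) K) (h_v (pc_lh S K)) (h_d (pc_lh S K)) (h_di (pc_lh S K))).
{ intros K; apply hdat_eq; try reflexivity. apply (pc_lhP S K). }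
assert (E2 : forall U, pc_lv S U = Vdat (fun A => fv (bR X A) U) (v_h (pc_lv S U)) (v_d (pc_lv S U)) (v_di (pc_lv S U))).
{ intros K; apply vdat_eq; try reflexivity. apply (pc_lvP S K). }
assert (E3 : forall k, pc_rh S k = Hdat (fun A => fh (bL X A) k) (fun U => v_h (pc_lv S U) k)
   (fun K => h_di (pc_lh S K) k) (fun K => h_d (pc_lh S K) k)).
{ intros k; apply hdat_eq; simpl; intros.
  - apply (pc_rhP S k).
  - symmetry; apply pc_vh.
  - apply pc_hhi.
  - symmetry; apply pc_hh. }
assert (E4 : forall u, pc_rv S u = Vdat (fun A => fv (bL X A) u) (fun K => h_v (pc_lh S K) u)
   (fun U => v_di (pc_lv S U) u) (fun U => v_d (pc_lv S U) u)).
{ intros u; apply vdat_eq; simpl; intros.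
  - apply (pc_rvP S u).
  - symmetry; apply pc_hv.
  - apply pc_vvi.
  - symmetry; apply pc_vv. }
refine (@Quasi_functor B (bL X) (bR X) (bLR X) (fun K k => h_d (pc_lh S K) k) (fun K k => h_di (pc_lh S K) k)
  (fun K u => h_v (pc_lh S K) u) (fun U k => v_h (pc_lv S U) k)
  (fun U u => v_d (pc_lv S U) u) (fun U u => v_di (pc_lv S U) u) _ _ _ _ _ _).
- intros K. rewrite <- E1. apply (pc_lhP S K).
- intros K. rewrite <- E2. apply (pc_lvP S K).
- intros K. rewrite <- E3. apply (pc_rhP S K).
- intros K. rewrite <- E4. apply (pc_rvP S K).
- intros a. rewrite <- !E1, <- !E2. apply (pc_lsP S a).
- intros a. rewrite <- !E3, <- !E4. apply (pc_rsP S a).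
Defined.
End Purely.

Lemma quasi_iff_purely (B : dblcat) : has_quasi_premonoidal B <-> has_purely_central_premonoidal B.
Proof.
split.
- intros (H & Hvv & P). exists (quasi_binoidal H), (quasi_purely H). split; assumption.
(* With the binoidal structure destructured, the one induced by [purely_quasi S], and also its
   exchange cells, are the given ones up to conversion; so [P] itself is the required premonoidal
   structure. *)
- intros ([L R E] & S & Hvv & P). exists (purely_quasi S). split; assumption.
Qed.

(** Exchanging the variables reverses the direction of the globular exchange cells, hence the
    inverses in the cells for two 1h-cells and for two 1v-cells. *)
Definition swap_quasi (B : dblcat) (H : quasi_functor B) : quasi_functor B :=
  @Quasi_functor B (qR H) (qL H) (fun A C => eq_sym (qLR H C A))
  (fun k K => qhhi H K k) (fun k K => qhh H K k) (fun k U => qvh H U k) (fun u K => qhv H K u)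
  (fun u U => qvvi H U u) (fun u U => qvv H U u)
  (qr_horP H) (qr_verP H) (ql_horP H) (ql_verP H) (qr_sqP H) (ql_sqP H).

(** * Transformations obtained from functors into the double category Pseudo *)

Section Lr.
Variables (B : dblcat) (X : binoidal B) (S : lr_purely_central X).
(** The endpoints of [fh F K] are known only through the equations [hsrc_fh] and [htgt_fh];
    rewriting with these gives a transformation between the prescribed functors. *)
Lemma psfun_htrans (F : psfun B (pseudo B B)) K (G : ob B -> psfun B B) : (forall A, fo F A = G A) ->
  is_htrans (G (hsrc K)) (G (htgt K)) (ha_dat (fh F K)).
Proof.
intros E. rewrite <- !E. pose proof (ha_ok (fh F K)) as H.
pose proof (hsrc_fh F K) as E1; pose proof (htgt_fh F K) as E2; simpl in E1, E2.
rewrite E1, E2 in H. exact H.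
Qed.
Lemma psfun_vtrans (F : psfun B (pseudo B B)) K (G : ob B -> psfun B B) : (forall A, fo F A = G A) ->
  is_vtrans (G (vsrc K)) (G (vtgt K)) (va_dat (fv F K)).
Proof.
intros E. rewrite <- !E. pose proof (va_ok (fv F K)) as H.
pose proof (vsrc_fv F K) as E1; pose proof (vtgt_fv F K) as E2; simpl in E1, E2.
rewrite E1, E2 in H. exact H.
Qed.
Lemma psfun_modif (F : psfun B (pseudo B B)) a (m : ob B -> sq B) : (forall A, ma_sq (fs F a) A = m A) ->
  is_modif (ha_dat (fh F (top a))) (ha_dat (fh F (bot a))) (va_dat (fv F (lft a))) (va_dat (fv F (rgt a))) m.
Proof.
intros E. pose proof (ma_ok (fs F a)) as H.
pose proof (top_fs F a) as E1; pose proof (bot_fs F a) as E2; pose proof (lft_fs F a) as E3;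
  pose proof (rgt_fs F a) as E4; simpl in E1, E2, E3, E4.
rewrite E1, E2, E3, E4 in H. eapply is_modif_ext; [exact E | exact H].
Qed.

Definition lr_purely : purely_central X.
Proof.
refine (@Purely_central B X (fun K => ha_dat (fh (L0 S) K)) (fun U => va_dat (fv (L0 S) U))
  (fun K => ha_dat (fh (R0 S) K)) (fun U => va_dat (fv (R0 S) U)) _ _ _ _ _ _ _ _ _ _).
- intros K; split; [apply psfun_htrans, L0_o | apply L0_h].
- intros K; split; [apply psfun_vtrans, L0_o | apply L0_v].
- intros K; split; [apply psfun_htrans, R0_o | apply R0_h].
- intros K; split; [apply psfun_vtrans, R0_o | apply R0_v].
- intros a; apply psfun_modif, L0_s.
- intros a; apply psfun_modif, R0_s.
- apply lr_hh.
- apply lr_vv.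
- apply lr_hv.
- apply lr_vh.
Defined.
End Lr.

Lemma lr_has_purely (B : dblcat) : has_lr_purely_central_premonoidal B -> has_purely_central_premonoidal B.
Proof. intros (X & S & Hvv & P). exists X, (lr_purely S). split; assumption. Qed.

(** The horizontal dual of [vinv_conj], for vertically globular cells. *)
Lemma hinv_conj (D : dblcat) (p p' q q' x y : sq D) : hinv p p' -> hinv q q' ->
  rgt x = lft q -> rgt p = lft y -> [x | q] = [p | y] -> [y | q'] = [p' | x].
Proof.
intros (P1 & P2 & P3 & P4) (Q1 & Q2 & Q3 & Q4) E1 E2 E.
assert (E3 : rgt y = rgt q) by (rewrite <- (rgt_hscmp E2), <- E; now apply rgt_hscmp).
assert (E4 : rgt p' = lft x) by (rewrite P2, <- (lft_hscmp E2), <- E; now apply lft_hscmp).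
rewrite <- (@hscmp1l' _ (rgt p) y), <- P4 by congruence.
rewrite (@hscmpA _ p' p y), <- E by congruence.
rewrite hscmpA, (@hscmpA _ x q q'), Q3 by (rewrite ?rgt_hscmp, ?lft_hscmp by congruence; congruence).
now rewrite (@hscmp1r' _ (lft q) x).
Qed.

(** * Left central structures and the quasi-functors they induce *)

Section Left.
Variables (B : dblcat) (X : binoidal B) (S : left_central X).
Notation L := (bL X).
Notation R := (bR X).
Notation lh K := (ha_dat (fh S K)).
Notation lv U := (va_dat (fv S U)).

Lemma lhP K : is_htrans (L (hsrc K)) (L (htgt K)) (lh K).
Proof. apply psfun_htrans, lc_o. Qed.
Lemma lvP U : is_vtrans (L (vsrc U)) (L (vtgt U)) (lv U).
Proof. apply psfun_vtrans, lc_o. Qed.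
Lemma lsP a : is_modif (lh (top a)) (lh (bot a)) (lv (lft a)) (lv (rgt a)) (fun A => fs (R A) a).
Proof. apply psfun_modif, lc_s. Qed.
Lemma lv_vcmp u v : vtgt u = vsrc v -> lv (vcmp u v) = vdat_cmp (lv u) (lv v).
Proof.
intros E. rewrite (fv_cmp S E). apply varr_cmp_spec.
pose proof (vsrc_fv S v) as E1; pose proof (vtgt_fv S u) as E2; simpl in *. congruence.
Qed.
Lemma lv_vid A : lv (vid A) = vdat_id (L A).
Proof. rewrite (fv_id S). simpl. now rewrite lc_o. Qed.
(** Component by component, the modification axioms of the compositor of [S] say how [fc (R A) f g]
    passes the exchange cells. They become the compositor laws of the right-hand transformations. *)
Lemma lfcP f g : htgt f = hsrc g -> is_modif (hdat_cmp (lh f) (lh g)) (lh (hcmp f g))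
  (vdat_id (L (hsrc f))) (vdat_id (L (htgt g))) (fun A => fc (R A) f g).
Proof.
intros E. pose proof (ma_ok (fc S f g)) as H.
pose proof (top_fc S E) as E1; pose proof (bot_fc S E) as E2; pose proof (lft_fc S E) as E3;
  pose proof (rgt_fc S E) as E4; simpl in E1, E2, E3, E4.
rewrite E1, E2, E3, E4 in H. simpl in H. rewrite !lc_o in H.
assert (E5 : ha_cod (fh S f) = ha_dom (fh S g)).
{ pose proof (hsrc_fh S g) as F1; pose proof (htgt_fh S f) as F2; simpl in *. congruence. }
destruct (harr_cmp_spec E5) as (_ & _ & E6). rewrite E6 in H.
eapply is_modif_ext; [|exact H]. intros A; simpl. now apply lc_c.
Qed.
Lemma lfuP C : is_modif (hdat_id (L C)) (lh (hid C)) (vdat_id (L C)) (vdat_id (L C)) (fun A => fu (R A) C).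
Proof.
pose proof (ma_ok (fu S C)) as H.
pose proof (top_fu S C) as E1; pose proof (bot_fu S C) as E2; pose proof (lft_fu S C) as E3;
  pose proof (rgt_fu S C) as E4; simpl in E1, E2, E3, E4.
rewrite E1, E2, E3, E4 in H. simpl in H. rewrite !lc_o in H.
eapply is_modif_ext; [|exact H]. intros A; simpl. apply lc_u.
Qed.
Lemma RL A C : R C A = L A C. Proof. symmetry; apply bLR. Qed.
Lemma lho K A : h_o (lh K) A = fh (R A) K. Proof. apply lc_h. Qed.
Lemma lvo K A : v_o (lv K) A = fv (R A) K. Proof. apply lc_v. Qed.

Lemma left_ql_hor K : is_htrans (L (hsrc K)) (L (htgt K)) (Hdat (fun A => fh (R A) K) (h_v (lh K)) (h_d (lh K)) (h_di (lh K))).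
Proof.
pose proof (lhP K) as H.
replace (Hdat _ _ _ _) with (lh K); [exact H|]. apply hdat_eq; try reflexivity. apply lho.
Qed.
Lemma left_ql_ver K : is_vtrans (L (vsrc K)) (L (vtgt K)) (Vdat (fun A => fv (R A) K) (v_h (lv K)) (v_d (lv K)) (v_di (lv K))).
Proof.
pose proof (lvP K) as H.
replace (Vdat _ _ _ _) with (lv K); [exact H|]. apply vdat_eq; try reflexivity. apply lvo.
Qed.

Lemma hc_bR C f A A' : hc f A A' -> hc (fh (R C) f) (L A C) (L A' C).
Proof. intros [<- <-]; split; rewrite ?hsrc_fh, ?htgt_fh; apply RL. Qed.
Lemma cell_lhd f g A A' C C' : hc f A A' -> hc g C C' ->
  cell (h_d (lh f) g) (hcmp (fh (L A) g) (fh (R C') f)) (hcmp (fh (R C) f) (fh (L A') g))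
    (vid (L A C)) (vid (L A' C')).
Proof.
intros [<- <-] [<- <-]; pose proof (lhP f) as K. rewrite <- !lho.
repeat split; [apply (top_hd K) | apply (bot_hd K) | apply (lft_hd K) | apply (rgt_hd K)].
Qed.
Lemma cell_lhdi f g A A' C C' : hc f A A' -> hc g C C' ->
  cell (h_di (lh f) g) (hcmp (fh (R C) f) (fh (L A') g)) (hcmp (fh (L A) g) (fh (R C') f))
    (vid (L A C)) (vid (L A' C')).
Proof.
intros Hf Hg. destruct (cell_lhd Hf Hg) as (T & U & V & W).
pose proof (hdK (lhP f) g) as K.
pose proof (vinv_globl K V) as K1. pose proof (vinv_globr K W) as K2.
destruct K as (K3 & K4 & _). repeat split; congruence.
Qed.
Lemma cell_lhv f u A A' C C' : hc f A A' -> vc u C C' ->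
  cell (h_v (lh f) u) (fh (R C) f) (fh (R C') f) (fv (L A) u) (fv (L A') u).
Proof.
intros [<- <-] [<- <-]; pose proof (lhP f) as K. rewrite <- !lho.
repeat split; [apply (top_hv K) | apply (bot_hv K) | apply (lft_hv K) | apply (rgt_hv K)].
Qed.
Lemma cell_lvh u g A A' C C' : vc u A A' -> hc g C C' ->
  cell (v_h (lv u) g) (fh (L A) g) (fh (L A') g) (fv (R C) u) (fv (R C') u).
Proof.
intros [<- <-] [<- <-]; pose proof (lvP u) as K. rewrite <- !lvo.
repeat split; [apply (top_vh K) | apply (bot_vh K) | apply (lft_vh K) | apply (rgt_vh K)].
Qed.
Lemma cell_lvd u v A A' C C' : vc u A A' -> vc v C C' ->
  cell (v_d (lv u) v) (hid (L A C)) (hid (L A' C')) (vcmp (fv (R C) u) (fv (L A') v)) (vcmp (fv (L A) v) (fv (R C') u)).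
Proof.
intros [<- <-] [<- <-]; pose proof (lvP u) as K. rewrite <- !lvo.
repeat split; [apply (top_vd K) | apply (bot_vd K) | apply (lft_vd K) | apply (rgt_vd K)].
Qed.
Lemma cell_lvdi u v A A' C C' : vc u A A' -> vc v C C' ->
  cell (v_di (lv u) v) (hid (L A C)) (hid (L A' C')) (vcmp (fv (L A) v) (fv (R C') u)) (vcmp (fv (R C) u) (fv (L A') v)).
Proof.
intros Hf Hg. destruct (cell_lvd Hf Hg) as (T & U & V & W).
pose proof (vdK (lvP u) v) as K.
pose proof (hinv_globt K T) as K1. pose proof (hinv_globb K U) as K2.
destruct K as (K3 & K4 & _). repeat split; congruence.
Qed.
Lemma lhd_l f g : vinv (h_d (lh f) g) (h_di (lh f) g).
Proof. exact (hdK (lhP f) g). Qed.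
End Left.

Ltac on_hook ::= lazymatch goal with |- fo (bR ?X ?C) ?A = _ => exact (RL X A C) end.
Ltac hc_hook ::= lazymatch goal with |- hc (fh (bR _ _) _) _ _ => eapply hc_bR; hc_tac end.
Ltac vc_hook ::= fail.
Ltac vcn_hook ::= fail.
Ltac cell_hook ::= lazymatch goal with
  | |- cell (h_d _ _) _ _ _ _ => eapply cell_lhd; hc_tac
  | |- cell (h_di _ _) _ _ _ _ => eapply cell_lhdi; hc_tac
  | |- cell (h_v _ _) _ _ _ _ => eapply cell_lhv; [hc_tac | vc_tac]
  | |- cell (v_h _ _) _ _ _ _ => eapply cell_lvh; [vc_tac | hc_tac]
  | |- cell (v_d _ _) _ _ _ _ => eapply cell_lvd; vc_tac
  | |- cell (v_di _ _) _ _ _ _ => eapply cell_lvdi; vc_tac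
  end.

Section LeftQuasi.
Variables (B : dblcat) (X : binoidal B) (S : left_central X).
Notation L := (bL X).
Notation R := (bR X).
Notation lh K := (ha_dat (fh S K)).
Notation lv U := (va_dat (fv S U)).

(** The laws of [- x| k] are laws of [S] read in the other variable: compositor and unitor laws come
    from the compositor and unitor modifications, vertical functoriality from that of [S] on
    1v-cells, and naturality from the modifications attached to squares. [vinv_conj] accounts for
    the reversed exchange cells. *)
Lemma left_qr_hor k : is_htrans (R (hsrc k)) (R (htgt k))
  (Hdat (fun A => fh (L A) k) (fun U => v_h (lv U) k) (fun K => h_di (lh K) k) (fun K => h_d (lh K) k)).
Proof.
assert (Hk : hc k (hsrc k) (htgt k)) by apply hc_refl.
constructor; simpl; intros; try (sc).
- apply vinv_sym, lhd_l.
- assert (Hf : hc f (hsrc f) (htgt f)) by apply hc_refl.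
  assert (Hg : hc g (htgt f) (htgt g)) by (split; [now symmetry | reflexivity]).
  pose proof (m_hor (lfcP S H) k) as E; simpl in E. rewrite !lho in E.
  assert (E1 : [fc (R (hsrc k)) f g | vsid (fh (L (htgt g)) k)] / h_di (lh (hcmp f g)) k =
    ([vsid (fh (R (hsrc k)) f) | h_di (lh g) k] / [h_di (lh f) k | vsid (fh (R (htgt k)) g)]) /
   [vsid (fh (L (hsrc f)) k) | fc (R (htgt k)) f g]).
  { eapply vinv_conj; [ | apply lhd_l | | | exact E]; [ | sc | sc].
    apply vinv_vcmp; [sc | | ]; apply vinv_hcmp; try sc; first [apply vinv_id | apply lhd_l]. }
  exact E1.
- pose proof (m_hor (lfuP S A) k) as E; simpl in E.
  assert (E1 : [fu (R (hsrc k)) A | vsid (fh (L A) k)] / h_di (lh (hid A)) k =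
    vsid (fh (L A) k) / [vsid (fh (L A) k) | fu (R (htgt k)) A]).
  { eapply vinv_conj; [apply vinv_id | apply lhd_l | sc | sc | exact E]. }
  rewrite E1. v1. reflexivity.
- now rewrite lv_vcmp.
- now rewrite lv_vid.
- assert (Ha : cell a (top a) (bot a) (lft a) (rgt a)) by apply cell_refl.
  eapply vinv_conj; [apply lhd_l | apply lhd_l | sc | sc | exact (m_hor (lsP S a) k)].
Qed.

Lemma left_qr_ver u : is_vtrans (R (vsrc u)) (R (vtgt u))
  (Vdat (fun A => fv (L A) u) (fun K => h_v (lh K) u) (fun U => v_di (lv U) u) (fun U => v_d (lv U) u)).
Proof.
constructor; simpl; intros; try (sc).
- apply hinv_sym, (vdK (lvP S u0)).
- rewrite lv_vcmp by assumption. simpl. now rewrite !lvo.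
- now rewrite lv_vid.
- assert (Hf : hc f (hsrc f) (htgt f)) by apply hc_refl.
  assert (Hg : hc g (htgt f) (htgt g)) by (split; [now symmetry | reflexivity]).
  pose proof (m_ver (lfcP S H) u) as E; simpl in E.
  rewrite hscmp1l', hscmp1r' in E by sc. exact E.
- pose proof (m_ver (lfuP S A) u) as E; simpl in E.
  rewrite hscmp1l', hscmp1r' in E by sc. exact E.
- pose proof (m_ver (lsP S a) u) as E. simpl in E.
  eapply hinv_conj; [apply (vdK (lvP S _)) | apply (vdK (lvP S _)) | | | symmetry; exact E].
  all: assert (Ha : cell a (top a) (bot a) (lft a) (rgt a)) by apply cell_refl; sc.
Qed.

(** A modification in one variable is naturality in the other: the two axioms are [hd_nat] and
    [vd_nat] of the left-hand transformations, turned around by inverses. *)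
Lemma left_qr_sq a : is_modif
  (Hdat (fun A => fh (L A) (top a)) (fun U => v_h (lv U) (top a)) (fun K => h_di (lh K) (top a)) (fun K => h_d (lh K) (top a)))
  (Hdat (fun A => fh (L A) (bot a)) (fun U => v_h (lv U) (bot a)) (fun K => h_di (lh K) (bot a)) (fun K => h_d (lh K) (bot a)))
  (Vdat (fun A => fv (L A) (lft a)) (fun K => h_v (lh K) (lft a)) (fun U => v_di (lv U) (lft a)) (fun U => v_d (lv U) (lft a)))
  (Vdat (fun A => fv (L A) (rgt a)) (fun K => h_v (lh K) (rgt a)) (fun U => v_di (lv U) (rgt a)) (fun U => v_d (lv U) (rgt a)))
  (fun A => fs (L A) a).
Proof.
assert (Ha : cell a (top a) (bot a) (lft a) (rgt a)) by apply cell_refl.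
constructor; simpl; intros; try apply top_fs; try apply bot_fs; try apply lft_fs; try apply rgt_fs.
- eapply vinv_conj; [apply lhd_l | apply lhd_l | sc | sc | exact (hd_nat (lhP S f) a)].
- symmetry. eapply hinv_conj; [apply (vdK (lvP S _)) | apply (vdK (lvP S _)) | sc | sc | exact (vd_nat (lvP S u) a)].
Qed.

Lemma left_ql_sq a : is_modif
  (Hdat (fun A => fh (R A) (top a)) (h_v (lh (top a))) (h_d (lh (top a))) (h_di (lh (top a))))
  (Hdat (fun A => fh (R A) (bot a)) (h_v (lh (bot a))) (h_d (lh (bot a))) (h_di (lh (bot a))))
  (Vdat (fun A => fv (R A) (lft a)) (v_h (lv (lft a))) (v_d (lv (lft a))) (v_di (lv (lft a))))
  (Vdat (fun A => fv (R A) (rgt a)) (v_h (lv (rgt a))) (v_d (lv (rgt a))) (v_di (lv (rgt a))))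
  (fun A => fs (R A) a).
Proof.
destruct (lsP S a); constructor; simpl; intros; try apply top_fs; try apply bot_fs; try apply lft_fs;
  try apply rgt_fs; [apply m_hor | apply m_ver].
Qed.

Definition left_quasi : quasi_functor B := @Quasi_functor B L R (bLR X)
  (fun K k => h_d (lh K) k) (fun K k => h_di (lh K) k) (fun K u => h_v (lh K) u)
  (fun U k => v_h (lv U) k) (fun U u => v_d (lv U) u) (fun U u => v_di (lv U) u)
  (left_ql_hor S) (left_ql_ver S) left_qr_hor left_qr_ver left_ql_sq left_qr_sq.
End LeftQuasi.

Lemma left_has_quasi B : has_left_central_premonoidal B -> has_quasi_premonoidal B.
Proof. intros ([L R E] & S & Hvv & P). exists (left_quasi S). split; assumption. Qed.

Lemma binoidal_eq (B : dblcat) (X Y : binoidal B) : bL X = bL Y -> bR X = bR Y -> X = Y.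
Proof. destruct X, Y; simpl; intros <- <-; f_equal; apply ProofIrrelevance.proof_irrelevance. Qed.

Lemma vtrivial_inv (D : dblcat) (a b : sq D) : hinv a b -> vtrivial a -> vtrivial b.
Proof.
unfold vtrivial. intros H E. pose proof H as H'. destruct H as (H1 & H2 & _).
rewrite E in H'. pose proof (hinv_uniq H' (hinv_id (lft a))) as K.
rewrite K, lft_hsid. reflexivity.
Qed.

Lemma right_has_quasi B : has_right_central_premonoidal B -> has_quasi_premonoidal B.
Proof.
intros (X & S & Hvv & P).
(* With the two sides exchanged, a right central structure is a left central one. The quasi-functor
   which that yields is then swapped back. *)
pose (X' := Binoidal (bL := bR X) (bR := bL X) (fun A C => eq_sym (bLR X C A))).
pose (S' := @Left_central B X' (rc S) (rc_o S) (rc_h S) (rc_v S) (rc_s S) (rc_c S) (rc_u S)).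
exists (swap_quasi (left_quasi S')). split.
- intros U u. simpl. eapply vtrivial_inv; [|exact (Hvv u U)].
  exact (vdK (lvP S' u) U).
(* Swapping twice restores both families of functors; only the proof that they agree on objects has
   changed, which proof irrelevance identifies. *)
- assert (E : quasi_binoidal (swap_quasi (left_quasi S')) = X) by (apply binoidal_eq; reflexivity).
  change (purely_exchange _) with (right_exchange S). rewrite E. exact P.
Qed.

(** * Cells of a quasi-functor and their boundaries *)

Section Quasi.
Variables (B : dblcat) (H : quasi_functor B).
Notation L := (qL H).
Notation R := (qR H).
Implicit Types (f g h k : hor B) (u v w : ver B) (a b : sq B).

Lemma qRL A C : R C A = L A C. Proof. symmetry; apply qLR. Qed.
Lemma hc_fhR C f A A' : hc f A A' -> hc (fh (R C) f) (L A C) (L A' C).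
Proof. intros [<- <-]; split; rewrite ?hsrc_fh, ?htgt_fh; apply qRL. Qed.

Lemma cell_qhh f g A A' C C' : hc f A A' -> hc g C C' ->
  cell (qhh H f g) (hcmp (fh (L A) g) (fh (R C') f)) (hcmp (fh (R C) f) (fh (L A') g))
    (vid (L A C)) (vid (L A' C')).
Proof.
intros [<- <-] [<- <-]; pose proof (ql_horP H f) as K.
repeat split; [apply (top_hd K) | apply (bot_hd K) | apply (lft_hd K) | apply (rgt_hd K)].
Qed.
Lemma qhhK f g : vinv (qhh H f g) (qhhi H f g).
Proof. exact (hdK (ql_horP H f) g). Qed.
Lemma qhh_l f g A A' C C' : hc f A A' -> hc g C C' ->
  qhh H f g / qhhi H f g = vsid (hcmp (fh (L A) g) (fh (R C') f)).
Proof.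
intros Hf Hg. destruct (qhhK f g) as (_ & _ & -> & _). f_equal. exact (c_top (cell_qhh Hf Hg)).
Qed.
Lemma qhh_r f g A A' C C' : hc f A A' -> hc g C C' ->
  qhhi H f g / qhh H f g = vsid (hcmp (fh (R C) f) (fh (L A') g)).
Proof.
intros Hf Hg. destruct (qhhK f g) as (_ & _ & _ & ->). f_equal. exact (c_bot (cell_qhh Hf Hg)).
Qed.
Lemma cell_qhhi f g A A' C C' : hc f A A' -> hc g C C' ->
  cell (qhhi H f g) (hcmp (fh (R C) f) (fh (L A') g)) (hcmp (fh (L A) g) (fh (R C') f))
    (vid (L A C)) (vid (L A' C')).
Proof.
intros [<- <-] [<- <-]; pose proof (qr_horP H g) as K. rewrite <- !qRL.
repeat split; [apply (top_hd K) | apply (bot_hd K) | apply (lft_hd K) | apply (rgt_hd K)].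
Qed.
Lemma cell_qhv f u A A' C C' : hc f A A' -> vc u C C' ->
  cell (qhv H f u) (fh (R C) f) (fh (R C') f) (fv (L A) u) (fv (L A') u).
Proof.
intros [<- <-] [<- <-]; pose proof (ql_horP H f) as K.
repeat split; [apply (top_hv K) | apply (bot_hv K) | apply (lft_hv K) | apply (rgt_hv K)].
Qed.
Lemma cell_qvh u g A A' C C' : vc u A A' -> hc g C C' ->
  cell (qvh H u g) (fh (L A) g) (fh (L A') g) (fv (R C) u) (fv (R C') u).
Proof.
intros [<- <-] [<- <-]; pose proof (qr_horP H g) as K.
repeat split; [apply (top_hv K) | apply (bot_hv K) | apply (lft_hv K) | apply (rgt_hv K)].
Qed.

Lemma cell_qvv u v A A' C C' : vc u A A' -> vc v C C' -> cell (qvv H u v) (hid (L A C)) (hid (L A' C'))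
  (vcmp (fv (R C) u) (fv (L A') v)) (vcmp (fv (L A) v) (fv (R C') u)).
Proof.
intros [<- <-] [<- <-]; pose proof (ql_verP H u) as K.
repeat split; [apply (top_vd K) | apply (bot_vd K) | apply (lft_vd K) | apply (rgt_vd K)].
Qed.
Lemma cell_qvvi u v A A' C C' : vc u A A' -> vc v C C' -> cell (qvvi H u v) (hid (L A C)) (hid (L A' C'))
  (vcmp (fv (L A) v) (fv (R C') u)) (vcmp (fv (R C) u) (fv (L A') v)).
Proof.
intros [<- <-] [<- <-]; pose proof (qr_verP H v) as K. rewrite <- !qRL.
repeat split; [apply (top_vd K) | apply (bot_vd K) | apply (lft_vd K) | apply (rgt_vd K)].
Qed.

Hypothesis Hvv : forall u v, vtrivial (qvv H u v).
(** A trivial H(u,v) is an identity square, so its two sides, which are the two orders of applying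
    [u] and [v], coincide. In this form triviality enters the boundary computations. *)
Lemma qvv_comm u v A A' C C' : vc u A A' -> vc v C C' ->
  vcmp (fv (R C) u) (fv (L A') v) = vcmp (fv (L A) v) (fv (R C') u).
Proof.
intros [<- <-] [<- <-]; pose proof (ql_verP H u) as K.
change (fv (R (vsrc v)) u) with (v_o (ql_ver H u) (vsrc v)).
change (fv (R (vtgt v)) u) with (v_o (ql_ver H u) (vtgt v)).
rewrite <- (lft_vd K), <- (rgt_vd K). simpl. rewrite (Hvv u v). now rewrite lft_hsid, rgt_hsid.
Qed.
Lemma qvv_comm_x u v A A' C C' X Y w x y : vc u A A' -> vc v C C' -> vc w X Y -> L A' C' = X ->
  vcmp (fv (L A') v) w = x -> vcmp (fv (R C) u) x = y ->
  vcmp (fv (L A) v) (vcmp (fv (R C') u) w) = y.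
Proof.
intros Hu Hv [Ew _] <- <- <-. rewrite <- !vcmpA by (destruct Hu, Hv; rewrite ?vsrc_fv, ?vtgt_fv; subst; rewrite ?qRL, ?Ew; reflexivity).
now rewrite (qvv_comm Hu Hv).
Qed.
End Quasi.

Ltac on_hook ::= lazymatch goal with |- fo (qR ?H ?C) ?A = _ => exact (qRL H A C) end.
Ltac hc_hook ::= lazymatch goal with |- hc (fh (qR _ _) _) _ _ => eapply hc_fhR; hc_tac end.
Ltac cell_hook ::= lazymatch goal with
  | |- cell (qhh _ _ _) _ _ _ _ => eapply cell_qhh; hc_tac
  | |- cell (qhhi _ _ _) _ _ _ _ => eapply cell_qhhi; hc_tac
  | |- cell (qhv _ _ _) _ _ _ _ => eapply cell_qhv; [hc_tac | vc_tac]
  | |- cell (qvh _ _ _) _ _ _ _ => eapply cell_qvh; [vc_tac | hc_tac]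
  | |- cell (qvv _ _ _) _ _ _ _ => eapply cell_qvv; vc_tac
  | |- cell (qvvi _ _ _) _ _ _ _ => eapply cell_qvvi; vc_tac
  end.
(** From here on the normal form of a 1v-composite puts the image under [qR] before the image under
    [qL], whenever triviality of H(U,u) is among the hypotheses. *)
Ltac vcn_hook ::= lazymatch goal with
  | Hvv : forall u v, vtrivial (qvv ?H u v) |- vcmp (fv (qL ?H _) _) (fv (qR ?H _) _) = _ =>
     symmetry; eapply (qvv_comm Hvv); vc_tac
  | Hvv : forall u v, vtrivial (qvv ?H u v) |- vcmp (fv (qL ?H _) _) (vcmp (fv (qR ?H _) _) _) = _ =>
     eapply (qvv_comm_x Hvv); [vc_tac | vc_tac | vc_tac | oeq | vcn | reflexivity]
  end.

(** * Laws of the exchange cells *)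

Section QuasiLaws.
Variables (B : dblcat) (H : quasi_functor B).
Notation L := (qL H).
Notation R := (qR H).
Implicit Types (f g h k : hor B) (u v w : ver B) (a b : sq B).

Lemma qhh_cmpr f g g' A A' C C' C'' : hc f A A' -> hc g C C' -> hc g' C' C'' ->
  [fc (L A) g g' | vsid (fh (R C'') f)] / qhh H f (hcmp g g') =
  [vsid (fh (L A) g) | qhh H f g'] / [qhh H f g | vsid (fh (L A') g')]
   / [vsid (fh (R C) f) | fc (L A') g g'].
Proof.
intros [<- <-] [<- <-] [E <-]. exact (hd_cmp (ql_horP H f) (eq_sym E)).
Qed.
Lemma qhh_idr f C A A' : hc f A A' ->
  [fu (L A) C | vsid (fh (R C) f)] / qhh H f (hid C) = [vsid (fh (R C) f) | fu (L A') C].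
Proof. intros [<- <-]. exact (hd_id (ql_horP H f) C). Qed.
Lemma qhhi_cmpl f f' g A A' A'' C C' : hc f A A' -> hc f' A' A'' -> hc g C C' ->
  [fc (R C) f f' | vsid (fh (L A'') g)] / qhhi H (hcmp f f') g =
  [vsid (fh (R C) f) | qhhi H f' g] / [qhhi H f g | vsid (fh (R C') f')]
   / [vsid (fh (L A) g) | fc (R C') f f'].
Proof.
intros [<- <-] [E <-] [<- <-]. exact (hd_cmp (qr_horP H g) (eq_sym E)).
Qed.
Lemma qhhi_idl g A C C' : hc g C C' ->
  [fu (R C) A | vsid (fh (L A) g)] / qhhi H (hid A) g = [vsid (fh (L A) g) | fu (R C') A].
Proof. intros [<- <-]. exact (hd_id (qr_horP H g) A). Qed.
Lemma qhv_cmp f u v A A' C : vc u A C -> vc v C A' ->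
  qhv H f (vcmp u v) = qhv H f u / qhv H f v.
Proof. intros [<- <-] [E <-]; exact (hv_cmp (ql_horP H f) (eq_sym E)). Qed.
Lemma qhv_id f C : qhv H f (vid C) = vsid (fh (R C) f).
Proof. exact (hv_id (ql_horP H f) C). Qed.
Lemma qvh_cmp g u v A A' C : vc u A C -> vc v C A' ->
  qvh H (vcmp u v) g = qvh H u g / qvh H v g.
Proof. intros [<- <-] [E <-]; exact (hv_cmp (qr_horP H g) (eq_sym E)). Qed.
Lemma qvh_id g C : qvh H (vid C) g = vsid (fh (L C) g).
Proof. exact (hv_id (qr_horP H g) C). Qed.
Lemma qhh_natr f b g g' u v A A' : cell b g g' u v -> hc f A A' ->
  [fs (L A) b | qhv H f v] / qhh H f g' = qhh H f g / [qhv H f u | fs (L A') b].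
Proof. intros (<- & <- & <- & <-) [<- <-]. exact (hd_nat (ql_horP H f) b). Qed.
Lemma qhh_natl a g f f' u v C C' : cell a f f' u v -> hc g C C' ->
  [qvh H u g | fs (R C') a] / qhh H f' g = qhh H f g / [fs (R C) a | qvh H v g].
Proof. intros (<- & <- & <- & <-) [<- <-]. exact (m_hor (ql_sqP H a) g). Qed.
Lemma qhv_fc f f' u A A' A'' C C' : hc f A A' -> hc f' A' A'' -> vc u C C' ->
  [qhv H f u | qhv H f' u] / fc (R C') f f' = fc (R C) f f' / qhv H (hcmp f f') u.
Proof. intros [<- <-] [E <-] [<- <-]. exact (vh_cmp (qr_verP H u) (eq_sym E)). Qed.
Lemma qhv_fu u A C C' : vc u C C' ->
  hsid (fv (L A) u) / fu (R C') A = fu (R C) A / qhv H (hid A) u.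
Proof. intros [<- <-]. exact (vh_id (qr_verP H u) A). Qed.
Lemma qvh_fc g g' u A A' C C' C'' : vc u A A' -> hc g C C' -> hc g' C' C'' ->
  [qvh H u g | qvh H u g'] / fc (L A') g g' = fc (L A) g g' / qvh H u (hcmp g g').
Proof. intros [<- <-] [<- <-] [E <-]. exact (vh_cmp (ql_verP H u) (eq_sym E)). Qed.
Lemma qvh_fu u A A' C : vc u A A' ->
  hsid (fv (R C) u) / fu (L A') C = fu (L A) C / qvh H u (hid C).
Proof. intros [<- <-]. exact (vh_id (ql_verP H u) C). Qed.

(** In the first variable the quasi-functor axiom is stated for the inverse exchange cells.
    Composing with the exchange cells and cancelling the inverses one after the other gives the law
    for [qhh]. *)
Lemma qhh_cmpl f f' g A A' A'' C C' : hc f A A' -> hc f' A' A'' -> hc g C C' ->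
  [vsid (fh (L A) g) | fc (R C') f f'] / qhh H (hcmp f f') g =
  [qhh H f g | vsid (fh (R C') f')] / [vsid (fh (R C) f) | qhh H f' g]
   / [fc (R C) f f' | vsid (fh (L A'') g)].
Proof.
intros Hf Hf' Hg.
pose proof (qhhi_cmpl Hf Hf' Hg) as E.
rewrite <- (@vscmp1r' _ (hcmp (fh (R C) (hcmp f f')) (fh (L A'') g)) [fc (R C) f f' | _]) by sc.
rewrite <- (qhh_r H (hc_hcmp Hf Hf' eq_refl) Hg), <- (@vscmpA _ [fc (R C) f f' | _]), E by sc.
vA. rewrite <- (@vscmpA _ [vsid _ | qhh H f' g]) by sc.
rewrite <- vsid_whl, (qhh_l H Hf' Hg), <- vsid_cmp by sc. v1.
rewrite <- (@vscmpA _ [qhh H f g | _]) by sc.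
rewrite <- vsid_whr, (qhh_l H Hf Hg), <- vsid_cmp by sc. v1. reflexivity.
Qed.
Lemma qhh_idl g A C C' : hc g C C' ->
  [vsid (fh (L A) g) | fu (R C') A] / qhh H (hid A) g = [fu (R C) A | vsid (fh (L A) g)].
Proof.
intros Hg. rewrite <- (qhhi_idl A Hg), vscmpA, (qhh_r H (hc_hid A) Hg) by sc. v1. reflexivity.
Qed.

Hypothesis Hvv : forall u v, vtrivial (qvv H u v).
(** In general this naturality holds only up to pasting with the cells H(U,u). These are identities
    here, and so are their inverses, so the pasting drops out. *)
Lemma qhv_nat a f f' l r u C C' : cell a f f' l r -> vc u C C' ->
  qhv H f u / fs (R C') a = fs (R C) a / qhv H f' u.
Proof.
intros Ha Hu.
assert (E : forall x y, qvvi H x y = hsid (vcmp (fv (R (vsrc y)) x) (fv (L (vtgt x)) y))).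
{ intros x y. eapply hinv_uniq; [exact (vdK (ql_verP H x) y)|]. simpl.
  rewrite (Hvv x y). simpl. pose proof (lft_vd (ql_verP H x) y) as E; simpl in E.
  rewrite E. apply hinv_id. }
pose proof (vd_nat (qr_verP H u) a) as K; simpl in K. rewrite !E in K.
destruct Ha as (<- & <- & <- & <-), Hu as [<- <-].
rewrite hscmp1l', hscmp1r' in K; [exact K| |].
all: sc.
Qed.
Lemma qvh_nat b g g' l r u A A' : cell b g g' l r -> vc u A A' ->
  qvh H u g / fs (L A') b = fs (L A) b / qvh H u g'.
Proof.
intros Ha Hu.
pose proof (vd_nat (ql_verP H u) b) as K; simpl in K.
rewrite (Hvv u (lft b)), (Hvv u (rgt b)) in K.
pose proof (fun y => lft_vd (ql_verP H u) y) as E; simpl in E.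
rewrite !E in K.
destruct Ha as (<- & <- & <- & <-), Hu as [<- <-].
rewrite hscmp1l', hscmp1r' in K; [exact K| |].
all: sc.
Qed.
End QuasiLaws.

(** * Currying a quasi-functor into Pseudo *)

Section Curry.
Variables (B : dblcat) (H : quasi_functor B).
Notation L := (qL H).
Notation R := (qR H).

Definition curry_h K : harr B B := Harr (ql_horP H K).
Definition curry_v U : varr B B := Varr (ql_verP H U).
Definition curry_s a : marr B B := @Marr B B (curry_h (top a)) (curry_h (bot a)) (curry_v (lft a)) (curry_v (rgt a))
  (fun A => fs (R A) a) (f_equal L (hsrc_top a)) (f_equal L (htgt_top a)) (f_equal L (hsrc_bot a)) (f_equal L (htgt_bot a))
  (ql_sqP H a).

Lemma curry_cmp f g : htgt f = hsrc g -> ha_cod (curry_h f) = ha_dom (curry_h g).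
Proof. intros E; simpl; now rewrite E. Qed.

Section Composable.
Variables (f g : hor B) (E : htgt f = hsrc g).
(** The compositor laws of the right-hand transformations, read in the other variable, are the
    axioms which make the compositors of the functors [R A] a modification. *)
Lemma curry_fc_modif : is_modif (ha_dat (harr_cmp (curry_h f) (curry_h g))) (ql_hor H (hcmp f g))
  (vdat_id (L (hsrc f))) (vdat_id (L (htgt g))) (fun A => fc (R A) f g).
Proof.
destruct (harr_cmp_spec (curry_cmp E)) as (_ & _ & ->).
assert (Hf : hc f (hsrc f) (htgt f)) by apply hc_refl.
assert (Hg : hc g (htgt f) (htgt g)) by (split; [now symmetry | reflexivity]).
constructor; simpl; intros; try sc.
- eapply qhh_cmpl; [exact Hf | exact Hg | apply hc_refl].
- rewrite hscmp1l', hscmp1r' by sc. eapply qhv_fc; [exact Hf | exact Hg | apply vc_refl].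
Qed.
Lemma curry_fci_modif : is_modif (ql_hor H (hcmp f g)) (ha_dat (harr_cmp (curry_h f) (curry_h g)))
  (vdat_id (L (hsrc f))) (vdat_id (L (htgt g))) (fun A => fci (R A) f g).
Proof.
pose proof curry_fc_modif as K.
destruct (harr_cmp_spec (curry_cmp E)) as (_ & _ & EE). rewrite EE in *.
assert (Hf : hc f (hsrc f) (htgt f)) by apply hc_refl.
assert (Hg : hc g (htgt f) (htgt g)) by (split; [now symmetry | reflexivity]).
constructor; simpl; intros; try sc.
- pose proof (m_hor K f0) as E1; simpl in E1.
  symmetry; eapply vinv_conj; [ | | | | symmetry; exact E1].
  + apply vinv_hcmp; try sc; [apply vinv_id | eapply fcKv; sc].
  + apply vinv_hcmp; try sc; [eapply fcKv; sc | apply vinv_id].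
  + sc.
  + sc.
- pose proof (m_ver K u) as E1; simpl in E1. rewrite hscmp1l', hscmp1r' in E1 |- * by sc.
  eapply vinv_conj; [eapply fcKv; sc | eapply fcKv; sc | sc | sc | exact E1].
Qed.

Definition curry_fc0 : marr B B.
Proof.
refine (@Marr B B (harr_cmp (curry_h f) (curry_h g)) (curry_h (hcmp f g)) (varr_id (L (hsrc f)))
  (varr_id (L (htgt g))) (fun A => fc (R A) f g) _ _ _ _ curry_fc_modif); simpl.
- apply (harr_cmp_spec (curry_cmp E)).
- apply (harr_cmp_spec (curry_cmp E)).
- f_equal; sc.
- f_equal; sc.
Defined.
Definition curry_fci0 : marr B B.
Proof.
refine (@Marr B B (curry_h (hcmp f g)) (harr_cmp (curry_h f) (curry_h g)) (varr_id (L (hsrc f)))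
  (varr_id (L (htgt g))) (fun A => fci (R A) f g) _ _ _ _ curry_fci_modif); simpl.
- f_equal; sc.
- f_equal; sc.
- apply (harr_cmp_spec (curry_cmp E)).
- apply (harr_cmp_spec (curry_cmp E)).
Defined.
End Composable.

Lemma curry_fu_modif (C : ob B) : is_modif (hdat_id (L C)) (ql_hor H (hid C)) (vdat_id (L C)) (vdat_id (L C))
  (fun A => fu (R A) C).
Proof.
constructor; simpl; intros; try sc.
- v1. eapply qhh_idl; apply hc_refl.
- rewrite hscmp1l', hscmp1r' by sc. eapply qhv_fu; apply vc_refl.
Qed.
Lemma curry_fui_modif (C : ob B) : is_modif (ql_hor H (hid C)) (hdat_id (L C)) (vdat_id (L C)) (vdat_id (L C))
  (fun A => fui (R A) C).
Proof.
pose proof (curry_fu_modif C) as K.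
constructor; simpl; intros; try sc.
- pose proof (m_hor K f) as E1; simpl in E1.
  symmetry; eapply vinv_conj; [ | | | | symmetry; exact E1].
  + apply vinv_hcmp; try sc; [apply vinv_id | apply fuK].
  + apply vinv_hcmp; try sc; [apply fuK | apply vinv_id].
  + sc.
  + sc.
- pose proof (m_ver K u) as E1; simpl in E1. rewrite hscmp1l', hscmp1r' in E1 |- * by sc.
  eapply vinv_conj; [apply fuK | apply fuK | sc | sc | exact E1].
Qed.
Definition curry_fu (C : ob B) : marr B B.
Proof.
refine (@Marr B B (harr_id (L C)) (curry_h (hid C)) (varr_id (L C)) (varr_id (L C)) (fun A => fu (R A) C)
  _ _ _ _ (curry_fu_modif C)); simpl; f_equal; sc.
Defined.
Definition curry_fui (C : ob B) : marr B B.
Proof.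
refine (@Marr B B (curry_h (hid C)) (harr_id (L C)) (varr_id (L C)) (varr_id (L C)) (fun A => fui (R A) C)
  _ _ _ _ (curry_fui_modif C)); simpl; f_equal; sc.
Defined.
(* The value for non-composable [f], [g] is irrelevant. *)
Definition curry_fc f g : marr B B :=
  match excluded_middle_informative (htgt f = hsrc g) with
  | left E => curry_fc0 E | right _ => curry_s (vsid f) end.
Definition curry_fci f g : marr B B :=
  match excluded_middle_informative (htgt f = hsrc g) with
  | left E => curry_fci0 E | right _ => curry_s (vsid f) end.
Lemma curry_fcE f g (E : htgt f = hsrc g) : exists E', curry_fc f g = curry_fc0 (f := f) (g := g) E'.
Proof. unfold curry_fc; destruct excluded_middle_informative as [E'|]; [now exists E' | contradiction]. Qed.
Lemma curry_fciE f g (E : htgt f = hsrc g) : exists E', curry_fci f g = curry_fci0 (f := f) (g := g) E'.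
Proof. unfold curry_fci; destruct excluded_middle_informative as [E'|]; [now exists E' | contradiction]. Qed.

Lemma curry_v_vid A : curry_v (vid A) = varr_id (L A).
Proof.
apply varr_ext; simpl; [f_equal; sc | f_equal; sc | intros D; sc | intros f | intros f].
- apply (hv_id (qr_horP H f)).
- pose proof (vd_id (qr_verP H f) A) as E; simpl in E.
  assert (K : hinv (qvv H (vid A) f) (qvvi H (vid A) f)) by exact (vdK (ql_verP H (vid A)) f).
  rewrite E in K. apply hinv_sym in K. eapply hinv_uniq; [exact K | apply hinv_id].
Qed.
Lemma curry_v_vcmp u v : vtgt u = vsrc v -> curry_v (vcmp u v) = varr_cmp (curry_v u) (curry_v v).
Proof.
intros E.
assert (E0 : va_cod (curry_v u) = va_dom (curry_v v)) by (simpl; now rewrite E).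
destruct (varr_cmp_spec E0) as (E1 & E2 & E3).
apply varr_ext; rewrite ?E1, ?E2, ?E3; simpl; [f_equal; sc | f_equal; sc | intros D | intros f | intros f].
- now apply fv_cmp.
- now apply (hv_cmp (qr_horP H f)).
(* The available law speaks of [qvvi]. Both sides of the goal are horizontal inverses of the same
   square, hence equal. *)
- pose proof (vd_cmp (qr_verP H f) E) as E4; simpl in E4.
  assert (K : forall w, hinv (qvv H w f) (qvvi H w f)) by (intros w; exact (vdK (ql_verP H w) f)).
  pose proof (hinv_sym (K (vcmp u v))) as K1. rewrite E4 in K1.
  eapply hinv_uniq; [exact K1|].
  apply hinv_hcmp; [ | apply hinv_vcmp; [ | | apply hinv_sym, K | apply hinv_id] | apply hinv_vcmp; [ | | apply hinv_id | apply hinv_sym, K]].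
  all: sc.
Qed.

Lemma curry_s_vsid f : curry_s (vsid f) = marr_vid (curry_h f).
Proof.
apply marr_ext; simpl.
- now rewrite top_vsid.
- now rewrite bot_vsid.
- rewrite lft_vsid. apply curry_v_vid.
- rewrite rgt_vsid. apply curry_v_vid.
- intros A. apply fs_vsid.
Qed.
End Curry.

Section PseudoComponents.
Variables C D : dblcat.
Lemma ma_hscmp (a b : sq (pseudo C D)) A : rgt a = lft b -> ma_sq [a | b] A = [ma_sq a A | ma_sq b A].
Proof. intros E. destruct (marr_hcmp_spec E) as (_ & _ & _ & _ & K). exact (f_equal (fun m => m A) K). Qed.
Lemma ma_vscmp (a b : sq (pseudo C D)) A : bot a = top b -> ma_sq (a / b) A = ma_sq a A / ma_sq b A.
Proof. intros E. destruct (marr_vcmp_spec E) as (_ & _ & _ & _ & K). exact (f_equal (fun m => m A) K). Qed.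
Lemma ma_vsid (f : hor (pseudo C D)) A : ma_sq (vsid f) A = vsid (h_o (ha_dat f) A).
Proof. reflexivity. Qed.
(** Once the boundaries are typed, an equation of modifications is checked on components. There each
    law of [curry] becomes the corresponding law of a functor [R A]. *)
Lemma pseudo_ext (a b : sq (pseudo C D)) t s l r : cell a t s l r -> cell b t s l r ->
  (forall A, ma_sq a A = ma_sq b A) -> a = b.
Proof.
intros (E1 & E2 & E3 & E4) (F1 & F2 & F3 & F4) E.
apply marr_ext; [now transitivity t | now transitivity s | now transitivity l | now transitivity r | exact E].
Qed.
End PseudoComponents.

Section CurryCells.
Variables (B : dblcat) (H : quasi_functor B).
Notation L := (qL H).
Notation R := (qR H).
Notation PS := (pseudo B B).
Lemma hc_curry f A A' : hc f A A' -> hc (D := PS) (curry_h H f) (L A) (L A').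
Proof. now intros [<- <-]. Qed.
Lemma vc_curry f A A' : vc f A A' -> vc (D := PS) (curry_v H f) (L A) (L A').
Proof. now intros [<- <-]. Qed.
Lemma cell_curry_s a t b l r : cell a t b l r ->
  cell (D := PS) (curry_s H a) (curry_h H t) (curry_h H b) (curry_v H l) (curry_v H r).
Proof. now intros (<- & <- & <- & <-). Qed.
Lemma cell_curry_fc f g A A' A'' : hc f A A' -> hc g A' A'' ->
  cell (D := PS) (curry_fc H f g) (@hcmp PS (curry_h H f) (curry_h H g)) (curry_h H (hcmp f g))
    (@vid PS (L A)) (@vid PS (L A'')).
Proof.
intros [<- <-] [E <-]. destruct (curry_fcE H (eq_sym E)) as [E' ->]. now repeat split.
Qed.
Lemma cell_curry_fci f g A A' A'' : hc f A A' -> hc g A' A'' ->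
  cell (D := PS) (curry_fci H f g) (curry_h H (hcmp f g)) (@hcmp PS (curry_h H f) (curry_h H g))
    (@vid PS (L A)) (@vid PS (L A'')).
Proof.
intros [<- <-] [E <-]. destruct (curry_fciE H (eq_sym E)) as [E' ->]. now repeat split.
Qed.
Lemma cell_curry_fu C : cell (D := PS) (curry_fu H C) (@hid PS (L C)) (curry_h H (hid C))
    (@vid PS (L C)) (@vid PS (L C)).
Proof. now repeat split. Qed.
Lemma cell_curry_fui C : cell (D := PS) (curry_fui H C) (curry_h H (hid C)) (@hid PS (L C))
    (@vid PS (L C)) (@vid PS (L C)).
Proof. now repeat split. Qed.
Lemma ma_curry_fc f g A A' A'' C : hc f A A' -> hc g A' A'' -> ma_sq (curry_fc H f g) C = fc (R C) f g.
Proof. intros [<- <-] [E <-]. now destruct (curry_fcE H (eq_sym E)) as [E' ->]. Qed.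
Lemma ma_curry_fci f g A A' A'' C : hc f A A' -> hc g A' A'' -> ma_sq (curry_fci H f g) C = fci (R C) f g.
Proof. intros [<- <-] [E <-]. now destruct (curry_fciE H (eq_sym E)) as [E' ->]. Qed.
End CurryCells.

Section CurryFunctor.
Variables (B : dblcat) (H : quasi_functor B).
Notation L := (qL H).
Notation R := (qR H).
Notation PS := (pseudo B B).

Lemma curry_fcK f g A A' A'' : hc f A A' -> hc g A' A'' -> vinv (D := PS) (curry_fc H f g) (curry_fci H f g).
Proof.
intros Hf Hg.
pose proof (cell_curry_fc H Hf Hg) as K1. pose proof (cell_curry_fci H Hf Hg) as K2.
pose proof (hc_curry H Hf). pose proof (hc_curry H Hg). pose proof (hc_curry H (hc_hcmp Hf Hg eq_refl)).
split; [sc | split; [sc | split]].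
- rewrite (c_top K1). eapply pseudo_ext; [sc | sc |].
  intros C. rewrite ma_vscmp by sc. rewrite (ma_curry_fc H C Hf Hg), (ma_curry_fci H C Hf Hg), ma_vsid.
  erewrite fcE_l by eassumption. f_equal.
  destruct (@harr_cmp_spec B B (curry_h H f) (curry_h H g)) as (_ & _ & E).
  { apply curry_cmp. sc. }
  simpl. now rewrite E.
- rewrite (c_bot K1). eapply pseudo_ext; [sc | sc |].
  intros C. rewrite ma_vscmp by sc. rewrite (ma_curry_fc H C Hf Hg), (ma_curry_fci H C Hf Hg), ma_vsid.
  eapply fcE_r; eassumption.
Qed.
Lemma curry_fuK A : vinv (D := PS) (curry_fu H A) (curry_fui H A).
Proof.
pose proof (cell_curry_fu H A) as K1. pose proof (cell_curry_fui H A) as K2.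
pose proof (hc_curry H (hc_hid A)).
split; [sc | split; [sc | split]].
- rewrite (c_top K1). eapply pseudo_ext; [sc | sc |].
  intros C. rewrite ma_vscmp by sc. simpl. destruct (fuK (R C) A) as (_ & _ & -> & _).
  now rewrite top_fu, qRL.
- rewrite (c_bot K1). eapply pseudo_ext; [sc | sc |].
  intros C. rewrite ma_vscmp by sc. simpl. destruct (fuK (R C) A) as (_ & _ & _ & ->). now rewrite bot_fu.
Qed.

Lemma curry_s_vscmp a b : bot a = top b -> curry_s H (a / b) = @vscmp PS (curry_s H a) (curry_s H b).
Proof.
intros E.
assert (Ha : cell a (top a) (bot a) (lft a) (rgt a)) by apply cell_refl.
assert (Hb : cell b (bot a) (bot b) (lft b) (rgt b)) by (rewrite E; apply cell_refl).
pose proof (cell_curry_s H Ha) as K1. pose proof (cell_curry_s H Hb) as K2.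
assert (E1 : vtgt (lft a) = vsrc (lft b)) by (rewrite <- hsrc_bot, <- hsrc_top; congruence).
assert (E2 : vtgt (rgt a) = vsrc (rgt b)) by (rewrite <- htgt_bot, <- htgt_top; congruence).
eapply pseudo_ext.
- apply cell_curry_s. eapply (cell_v Ha Hb); reflexivity.
- eapply cell_v; [exact K1 | exact K2 | reflexivity | |]; symmetry; now apply curry_v_vcmp.
- intros A. rewrite ma_vscmp by sc. simpl. now apply fs_vscmp.
Qed.

Lemma curry_fc_nat a b : rgt a = lft b ->
  @vscmp PS (@hscmp PS (curry_s H a) (curry_s H b)) (curry_fc H (bot a) (bot b)) =
  @vscmp PS (curry_fc H (top a) (top b)) (curry_s H [a | b]).
Proof.
intros E.
assert (Ha : cell a (top a) (bot a) (lft a) (rgt a)) by apply cell_refl.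
assert (Hb : cell b (top b) (bot b) (rgt a) (rgt b)) by (rewrite E; apply cell_refl).
pose proof (vc_refl (lft a)) as U. pose proof (vc_refl (rgt a)) as V. pose proof (vc_refl (rgt b)) as W. sat.
assert (Hab : cell [a | b] (hcmp (top a) (top b)) (hcmp (bot a) (bot b)) (lft a) (rgt b)) by sc.
pose proof (cell_curry_s H Ha) as K1. pose proof (cell_curry_s H Hb) as K2. pose proof (cell_curry_s H Hab) as K3.
assert (Ht : hc (top b) (vsrc (rgt a)) (vsrc (rgt b))) by (eapply cell_hct; eassumption).
assert (Hb' : hc (bot b) (vtgt (rgt a)) (vtgt (rgt b))) by (eapply cell_hcb; eassumption).
pose proof (cell_curry_fc H (hc_top a) Ht) as K4. pose proof (cell_curry_fc H (hc_bot a) Hb') as K5.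
pose proof (vc_curry H U). pose proof (vc_curry H V). pose proof (vc_curry H W).
eapply pseudo_ext; [sc | sc |].
intros A. rewrite !ma_vscmp, ma_hscmp by sc.
rewrite (ma_curry_fc H A (hc_top a) Ht), (ma_curry_fc H A (hc_bot a) Hb'). simpl. now apply fc_nat.
Qed.

Lemma curry_fu_nat u : @vscmp PS (@hsid PS (curry_v H u)) (curry_fu H (vtgt u)) =
  @vscmp PS (curry_fu H (vsrc u)) (curry_s H (hsid u)).
Proof.
pose proof (vc_curry H (vc_refl u)). pose proof (cell_curry_fu H (vsrc u)). pose proof (cell_curry_fu H (vtgt u)).
pose proof (cell_curry_s H (cell_hsid (vc_refl u))).
eapply pseudo_ext; [sc | sc |].
intros A. rewrite !ma_vscmp by sc. simpl. apply fu_nat.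
Qed.

Lemma curry_fc_assoc f g h A0 A1 A2 A3 : hc f A0 A1 -> hc g A1 A2 -> hc h A2 A3 ->
  @vscmp PS (@hscmp PS (curry_fc H f g) (@vsid PS (curry_h H h))) (curry_fc H (hcmp f g) h) =
  @vscmp PS (@hscmp PS (@vsid PS (curry_h H f)) (curry_fc H g h)) (curry_fc H f (hcmp g h)).
Proof.
intros Hf Hg Hh.
assert (Hfg : hc (hcmp f g) A0 A2) by sc. assert (Hgh : hc (hcmp g h) A1 A3) by sc.
pose proof (cell_curry_fc H Hf Hg). pose proof (cell_curry_fc H Hg Hh).
pose proof (cell_curry_fc H Hfg Hh) as K. pose proof (cell_curry_fc H Hf Hgh).
rewrite hcmpA in K by sc.
pose proof (hc_curry H Hf). pose proof (hc_curry H Hg). pose proof (hc_curry H Hh).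
pose proof (hc_curry H Hfg). pose proof (hc_curry H Hgh).
eapply pseudo_ext; [sc | sc |].
intros C. rewrite !ma_vscmp, !ma_hscmp by sc.
erewrite !ma_curry_fc by eassumption. rewrite !ma_vsid. simpl. eapply fc_assocE; eassumption.
Qed.
Lemma curry_unitl f A A' : hc f A A' ->
  @vscmp PS (@hscmp PS (curry_fu H A) (@vsid PS (curry_h H f))) (curry_fc H (hid A) f) = @vsid PS (curry_h H f).
Proof.
intros Hf. pose proof (hc_curry H Hf). pose proof (hc_curry H (hc_hid A)).
pose proof (cell_curry_fu H A). pose proof (cell_curry_fc H (hc_hid A) Hf) as K. rewrite (hcmp1l' (proj1 Hf)) in K.
eapply pseudo_ext; [sc | sc |].
intros C. rewrite !ma_vscmp, !ma_hscmp by sc.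
rewrite (ma_curry_fc H C (hc_hid A) Hf), ma_vsid. simpl. rewrite <- (proj1 Hf). apply fc_unitl.
Qed.
Lemma curry_unitr f A A' : hc f A A' ->
  @vscmp PS (@hscmp PS (@vsid PS (curry_h H f)) (curry_fu H A')) (curry_fc H f (hid A')) = @vsid PS (curry_h H f).
Proof.
intros Hf. pose proof (hc_curry H Hf). pose proof (hc_curry H (hc_hid A')).
pose proof (cell_curry_fu H A'). pose proof (cell_curry_fc H Hf (hc_hid A')) as K. rewrite (hcmp1r' (proj2 Hf)) in K.
eapply pseudo_ext; [sc | sc |].
intros C. rewrite !ma_vscmp, !ma_hscmp by sc.
rewrite (ma_curry_fc H C Hf (hc_hid A')), ma_vsid. simpl. rewrite <- (proj2 Hf). apply fc_unitr.
Qed.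

Definition curry : psfun B PS.
Proof.
refine (@Psfun B PS L (curry_h H) (curry_v H) (curry_s H) (curry_fc H) (curry_fci H) (curry_fu H) (curry_fui H)
  _ _ _ _ _ _ _ _ _ _ _ _ _ _ _ _ _ _ _ _ _ _ _ _ _ _ _); intros; try reflexivity.
- apply curry_v_vid.
- now apply curry_v_vcmp.
- apply curry_s_vsid.
- now apply curry_s_vscmp.
- eapply c_top, cell_curry_fc; split; eauto.
- eapply c_bot, cell_curry_fc; split; eauto.
- eapply c_lft, cell_curry_fc; split; eauto.
- eapply c_rgt, cell_curry_fc; split; eauto.
- eapply curry_fcK; split; eauto.
- apply curry_fuK.
- now apply curry_fc_nat.
- apply curry_fu_nat.
- eapply curry_fc_assoc; split; eauto.
- eapply curry_unitl; split; eauto.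
- eapply curry_unitr; split; eauto.
Defined.
End CurryFunctor.

Section QuasiCentral.
Variables (B : dblcat) (H : quasi_functor B).

Definition quasi_left : left_central (quasi_binoidal H) :=
  @Left_central B (quasi_binoidal H) (curry H) (fun _ => eq_refl) (fun _ _ => eq_refl)
    (fun _ _ => eq_refl) (fun _ _ => eq_refl)
    (fun f g A E => @ma_curry_fc B H f g _ _ _ A (conj eq_refl E) (conj eq_refl eq_refl)) (fun _ _ => eq_refl).

Definition quasi_right : right_central (quasi_binoidal H) :=
  @Right_central B (quasi_binoidal H) (curry (swap_quasi H)) (fun _ => eq_refl) (fun _ _ => eq_refl)
    (fun _ _ => eq_refl) (fun _ _ => eq_refl)
    (fun f g A E => @ma_curry_fc B (swap_quasi H) f g _ _ _ A (conj eq_refl E) (conj eq_refl eq_refl)) (fun _ _ => eq_refl).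
Definition quasi_lr : lr_purely_central (quasi_binoidal H) :=
  @Lr_purely_central B (quasi_binoidal H)
    (@Lr_structure B (quasi_binoidal H) (curry H) (curry (swap_quasi H)) (fun _ => eq_refl) (fun _ => eq_refl)
    (fun _ _ => eq_refl) (fun _ _ => eq_refl) (fun _ _ => eq_refl) (fun _ _ => eq_refl) (fun _ _ => eq_refl) (fun _ _ => eq_refl))
    (fun _ _ => eq_refl) (fun _ _ => eq_refl) (fun _ _ => eq_refl) (fun _ _ => eq_refl).
End QuasiCentral.

Lemma quasi_has_left B : has_quasi_premonoidal B -> has_left_central_premonoidal B.
Proof. intros (H & Hvv & P). exists (quasi_binoidal H), (quasi_left H). now split. Qed.
Lemma quasi_has_right B : has_quasi_premonoidal B -> has_right_central_premonoidal B.
Proof.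
intros (H & Hvv & P). exists (quasi_binoidal H), (quasi_right H). split; [|exact P].
intros v u. eapply vtrivial_inv; [apply (vdK (ql_verP H u) v) | apply Hvv].
Qed.
Lemma quasi_has_lr B : has_quasi_premonoidal B -> has_lr_purely_central_premonoidal B.
Proof. intros (H & Hvv & P). exists (quasi_binoidal H), (quasi_lr H). now split. Qed.

(** * The tensor product of a quasi-functor *)

Section Tens.
Variables (B : dblcat) (H : quasi_functor B).
Notation L := (qL H).
Notation R := (qR H).
Hypothesis Hvv : forall u v, vtrivial (qvv H u v).

(* The product (x)_r on 1h-cells, 1v-cells and squares, and its compositor and unitor. *)
Definition th (f g : hor B) := hcmp (fh (R (hsrc g)) f) (fh (L (htgt f)) g).
Definition tv (u v : ver B) := vcmp (fv (R (vsrc v)) u) (fv (L (vtgt u)) v).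
Definition ts (a b : sq B) :=
  [fs (R (hsrc (top b))) a / qhv H (bot a) (lft b) | qvh H (rgt a) (top b) / fs (L (htgt (bot a))) b].
Definition tc (f g f' g' : hor B) :=
  [vsid (fh (R (hsrc g)) f) | [qhh H f' g | vsid (fh (L (htgt f')) g')]] /
  [fc (R (hsrc g)) f f' | fc (L (htgt f')) g g'].
Definition tci (f g f' g' : hor B) :=
  [fci (R (hsrc g)) f f' | fci (L (htgt f')) g g'] /
  [vsid (fh (R (hsrc g)) f) | [qhhi H f' g | vsid (fh (L (htgt f')) g')]].
Definition tu A C := [fu (R C) A | fu (L A) C].
Definition tui A C := [fui (R C) A | fui (L A) C].

Lemma thE f g A A' C C' : hc f A A' -> hc g C C' -> th f g = hcmp (fh (R C) f) (fh (L A') g).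
Proof. now intros [<- <-] [<- <-]. Qed.
Lemma tvE f g A A' C C' : vc f A A' -> vc g C C' -> tv f g = vcmp (fv (R C) f) (fv (L A') g).
Proof. now intros [<- <-] [<- <-]. Qed.
Lemma tsE a b f f' u u' g g' v v' A A' C C' D D' E E' :
  cell a f f' u u' -> cell b g g' v v' -> vc u A D -> vc u' A' D' -> vc v C E -> vc v' C' E' ->
  ts a b = [fs (R C) a / qhv H f' v | qvh H u' g / fs (L D') b].
Proof.
intros Ha Hb Hu Hu' Hv Hv'. destruct (cell_hct Hb Hv Hv') as [E1 _], (cell_hcb Ha Hu Hu') as [_ E2].
destruct Ha as (<- & <- & <- & <-), Hb as (<- & <- & <- & <-). unfold ts. now rewrite E1, E2.
Qed.
Lemma tcE f g f' g' A A' A'' C C' C'' : hc f A A' -> hc f' A' A'' -> hc g C C' -> hc g' C' C'' ->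
  tc f g f' g' = [vsid (fh (R C) f) | [qhh H f' g | vsid (fh (L A'') g')]] /
  [fc (R C) f f' | fc (L A'') g g'].
Proof. now intros [<- <-] [E1 <-] [<- <-] [E2 <-]. Qed.
Lemma tciE f g f' g' A A' A'' C C' C'' : hc f A A' -> hc f' A' A'' -> hc g C C' -> hc g' C' C'' ->
  tci f g f' g' = [fci (R C) f f' | fci (L A'') g g'] /
  [vsid (fh (R C) f) | [qhhi H f' g | vsid (fh (L A'') g')]].
Proof. now intros [<- <-] [E1 <-] [<- <-] [E2 <-]. Qed.

Lemma cell_ts a b f f' u u' g g' v v' A A' C C' D D' E E' :
  cell a f f' u u' -> cell b g g' v v' -> vc u A D -> vc u' A' D' -> vc v C E -> vc v' C' E' ->
  cell (ts a b) (th f g) (th f' g') (tv u v) (tv u' v').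
Proof.
intros Ha Hb Hu Hu' Hv Hv'. sat.
rewrite (tsE Ha Hb Hu Hu' Hv Hv').
erewrite !thE, !tvE by eassumption. sc.
Qed.

Lemma cell_tsE a b f f' u u' g g' v v' A A' C C' D D' E E' :
  cell a f f' u u' -> cell b g g' v v' -> vc u A D -> vc u' A' D' -> vc v C E -> vc v' C' E' ->
  cell (ts a b) (hcmp (fh (R C) f) (fh (L A') g)) (hcmp (fh (R E) f') (fh (L D') g'))
    (vcmp (fv (R C) u) (fv (L D) v)) (vcmp (fv (R C') u') (fv (L D') v')).
Proof.
intros Ha Hb Hu Hu' Hv Hv'. sat. rewrite (tsE Ha Hb Hu Hu' Hv Hv'). sc.
Qed.

Lemma ts_vsidr a k f f' u u' A A' C C' D D' : cell a f f' u u' -> vc u A D -> vc u' A' D' ->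
  hc k C C' -> ts a (vsid k) = [fs (R C) a | qvh H u' k].
Proof.
intros Ha Hu Hu' Hk. sat.
rewrite (tsE Ha (cell_vsid Hk) Hu Hu' (vc_vid C) (vc_vid C')), qhv_id, fs_vsid. v1. reflexivity.
Qed.
Lemma ts_vsidl b k g g' v v' A A' C C' D D' : cell b g g' v v' -> vc v C D -> vc v' C' D' ->
  hc k A A' -> ts (vsid k) b = [qhv H k v | fs (L A') b].
Proof.
intros Hb Hv Hv' Hk. sat.
rewrite (tsE (cell_vsid Hk) Hb (vc_vid A) (vc_vid A') Hv Hv'), qvh_id, fs_vsid. v1. reflexivity.
Qed.

(** The squares of [a2] and [b] lie on the wrong sides of the cells H(f',v) and H(w',g). They are
    moved across by [qhv_nat] and [qvh_nat], so functoriality on squares rests on the triviality of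
    H(U,u). *)
Lemma ts_vcmp a b f f' f'' u u' w w' g g' g'' v v' x x' a2 b2 A A' C C' D D' E E' F F' G G' :
  cell a f f' u u' -> cell a2 f' f'' w w' -> cell b g g' v v' -> cell b2 g' g'' x x' ->
  vc u A D -> vc u' A' D' -> vc w D F -> vc w' D' F' ->
  vc v C E -> vc v' C' E' -> vc x E G -> vc x' E' G' ->
  ts (a / a2) (b / b2) = ts a b / ts a2 b2.
Proof.
intros Ha Ha2 Hb Hb2 Hu Hu' Hw Hw' Hv Hv' Hx Hx'. sat.
rewrite (tsE Ha Hb Hu Hu' Hv Hv'), (tsE Ha2 Hb2 Hw Hw' Hx Hx').
assert (Haa : cell (a / a2) f f'' (vcmp u w) (vcmp u' w')) by sc.
assert (Hbb : cell (b / b2) g g'' (vcmp v x) (vcmp v' x')) by sc.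
assert (K1 : vc (vcmp u w) A F) by sc. assert (K2 : vc (vcmp u' w') A' F') by sc.
assert (K3 : vc (vcmp v x) C G) by sc. assert (K4 : vc (vcmp v' x') C' G') by sc.
rewrite (tsE Haa Hbb K1 K2 K3 K4).
rewrite (qhv_cmp H f'' Hv Hx), (qvh_cmp H g Hu' Hw'), !fs_vscmp by sc.
rewrite interchange by sc. vA. f_equal.
- f_equal. rewrite <- (@vscmpA _ (fs (R C) a2)), <- (@vscmpA _ (qhv H f' v)) by sc. f_equal.
  symmetry; eapply qhv_nat; eassumption.
- f_equal. rewrite <- (@vscmpA _ (qvh H w' g)), <- (@vscmpA _ (fs (L D') b)) by sc. f_equal.
  eapply qvh_nat; eassumption.
Qed.

Lemma ts_vsid f g A A' C C' : hc f A A' -> hc g C C' -> ts (vsid f) (vsid g) = vsid (th f g).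
Proof.
intros Hf Hg. rewrite (thE Hf Hg).
erewrite tsE by (first [eapply cell_vsid; eassumption | apply vc_vid]).
rewrite qhv_id, qvh_id, !fs_vsid, !vscmp1l' by sc. symmetry; apply vsid_cmp; sc.
Qed.

Lemma tc_nat a b c d f f' u u' g g' w h h' v v' k k' x A A' A'' C C' C'' D D' D'' E E' E'' :
  cell a f f' u u' -> cell c g g' u' w -> cell b h h' v v' -> cell d k k' v' x ->
  vc u A D -> vc u' A' D' -> vc w A'' D'' -> vc v C E -> vc v' C' E' -> vc x C'' E'' ->
  [ts a b | ts c d] / tc f' h' g' k' = tc f h g k / ts [a | c] [b | d].
Proof.
intros Ha Hc Hb Hd Hu Hu' Hw Hv Hv' Hx. sat.
rewrite (tsE Ha Hb Hu Hu' Hv Hv'), (tsE Hc Hd Hu' Hw Hv' Hx).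
assert (Hac : cell [a | c] (hcmp f g) (hcmp f' g') u w) by sc.
assert (Hbd : cell [b | d] (hcmp h k) (hcmp h' k') v x) by sc.
rewrite (tsE Hac Hbd Hu Hw Hv Hx).
erewrite !tcE by eassumption.
(* The middle block: the exchange cell is natural in a square of either variable, so it passes first
   the square [b] and then the square [c]. *)
assert (M : [qvh H u' h / fs (L D') b | fs (R C') c / qhv H g' v'] / qhh H g' h' =
  qhh H g h / [fs (R C) c / qhv H g' v | qvh H w h / fs (L D'') b]).
{ rewrite <- interchange by sc. rewrite vscmpA by sc.
  rewrite (qhh_natr H (f := g') Hb) by eassumption.
  rewrite <- vscmpA by sc. rewrite (qhh_natl H (g := h) Hc) by eassumption.
  rewrite vscmpA, interchange by sc. reflexivity. }
hA. rewrite <- (@hscmpA _ (qvh H u' h / _)) by sc.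
rewrite <- vscmpA by sc.
rewrite interchange by sc. rewrite (@interchange _ _ _ _ (vsid _)) by sc.
rewrite M. v1.
rewrite <- (@vscmp1l' _ (fh (R C) f) (fs (R C) a / _)) by sc.
rewrite <- (@vscmp1l' _ (fh (L A'') k) (qvh H w k / _)) by sc.
rewrite <- (@interchange _ (qhh H g h)) by sc.
rewrite <- (@interchange _ (vsid (fh (R C) f))) by sc. vA. f_equal.
hA. rewrite <- (@hscmpA _ (fs (R C) a / _)) by sc.
rewrite (@interchange _ [_ | _] [_ | _]) by sc. rewrite interchange by sc.
f_equal.
- rewrite <- interchange by sc. rewrite vscmpA by sc.
  erewrite qhv_fc by eassumption. rewrite <- !vscmpA by sc.
  erewrite <- (c_bot Ha), <- (c_bot Hc), <- (c_top Ha), <- (c_top Hc), (@fc_nat _ _ (R C) a c) by sc. reflexivity.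
- rewrite <- interchange by sc. rewrite vscmpA by sc.
  erewrite <- (c_bot Hb), <- (c_bot Hd), (@fc_nat _ _ (L D'') b d) by sc.
  rewrite (c_top Hb), (c_top Hd). rewrite <- !vscmpA by sc.
  erewrite qvh_fc by eassumption. reflexivity.
Qed.

(** Both sides contain the same three exchange cells, at (f',g), (f'',g') and (f'',g): the pairs in
    which a first factor has to pass an earlier second factor. [X1] and [X2] split the exchange at a
    composite to make all three visible; below them, the compositors are associative in each
    variable separately. *)
Lemma tc_assoc f f' f'' g g' g'' A0 A1 A2 A3 C0 C1 C2 C3 :
  hc f A0 A1 -> hc f' A1 A2 -> hc f'' A2 A3 -> hc g C0 C1 -> hc g' C1 C2 -> hc g'' C2 C3 ->
  [tc f g f' g' | vsid (th f'' g'')] / tc (hcmp f f') (hcmp g g') f'' g'' =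
  [vsid (th f g) | tc f' g' f'' g''] / tc f g (hcmp f' f'') (hcmp g' g'').
Proof.
intros F1 F2 F3 G1 G2 G3.
assert (F12 : hc (hcmp f f') A0 A2) by sc. assert (F23 : hc (hcmp f' f'') A1 A3) by sc.
assert (G12 : hc (hcmp g g') C0 C2) by sc. assert (G23 : hc (hcmp g' g'') C1 C3) by sc.
erewrite !tcE, !thE by eassumption.
rewrite vsid_whr, vsid_whl, !vsid_cmp by sc.
assert (X1 : [[fc (R C0) f f' | fc (L A2) g g'] | [vsid (fh (R C2) f'') | vsid (fh (L A3) g'')]] /
  [vsid (fh (R C0) (hcmp f f')) | [qhh H f'' (hcmp g g') | vsid (fh (L A3) g'')]] =
  [vsid (hcmp (fh (R C0) f) (fh (R C0) f')) | [[vsid (fh (L A2) g) | qhh H f'' g'] | vsid (fh (L A3) g'')]] /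
  ([vsid (hcmp (fh (R C0) f) (fh (R C0) f')) | [[qhh H f'' g | vsid (fh (L A3) g')] | vsid (fh (L A3) g'')]] /
  [fc (R C0) f f' | [[vsid (fh (R C0) f'') | fc (L A3) g g'] | vsid (fh (L A3) g'')]])).
{ lhs (hA; rewrite <- (@hscmpA _ (fc (L A2) _ _)) by sc).
  lhs (rewrite interchange by sc; rewrite (@interchange _ [fc _ _ _ | _]) by sc).
  erewrite qhh_cmpr by eassumption. repeat (ich; v1). vA. reflexivity. }
assert (X2 : [[vsid (fh (R C0) f) | vsid (fh (L A1) g)] | [fc (R C1) f' f'' | fc (L A3) g' g'']] /
  [vsid (fh (R C0) f) | [qhh H (hcmp f' f'') g | vsid (fh (L A3) (hcmp g' g''))]] =
  [vsid (fh (R C0) f) | [[qhh H f' g | vsid (fh (R C1) f'')] | vsid (hcmp (fh (L A3) g') (fh (L A3) g''))]] /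
  ([vsid (fh (R C0) f) | [[vsid (fh (R C0) f') | qhh H f'' g] | vsid (hcmp (fh (L A3) g') (fh (L A3) g''))]] /
  [vsid (fh (R C0) f) | [[fc (R C0) f' f'' | vsid (fh (L A3) g)] | fc (L A3) g' g'']])).
{ lhs (hA; rewrite <- (@hscmpA _ (vsid _) (fc (R C1) _ _)) by sc).
  lhs (rewrite interchange by sc; rewrite (@interchange _ [_ | fc _ _ _]) by sc).
  erewrite qhh_cmpl by eassumption. repeat (ich; v1). vA. reflexivity. }
rewrite (@vscmpA _ [[vsid (fh (R C0) f) | _] | _]), <- (@vscmpA _ [[fc _ _ _ | _] | _]) by sc.
rewrite X1, !vscmpA by sc.
rewrite <- (@vscmpA _ [[vsid _ | _] | [fc _ _ _ | _]]) by sc.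
rewrite X2, !vscmpA by sc.
rewrite <- !(@vscmpA _ [[_ | _] | [_ | _]]) by sc.
f_equal; [|f_equal].
- rewrite !vsid_cmp by sc. hA.
  rewrite <- (@hscmpA _ (vsid (fh (R C0) f')) (vsid (fh (L A2) g))) by sc.
  rewrite <- (@hscmpA _ (vsid (fh (L A2) g')) (vsid (fh (R C2) f''))) by sc.
  rewrite <- (@hscmpA _ (vsid (fh (L A1) g)) (vsid (fh (R C1) f'))) by sc.
  rewrite <- (@hscmpA _ (vsid (fh (R C1) f'')) (vsid (fh (L A3) g'))) by sc.
  rewrite <- !vsid_cmp by sc. repeat ich. v1. reflexivity.
- rewrite !vsid_cmp by sc. hA. reflexivity.
- hA. lhs (rewrite <- (@hscmpA _ (fc _ _ _) (vsid _)) by sc).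
  rhs (rewrite <- (@hscmpA _ (vsid _) (fc _ _ _)) by sc).
  rewrite !interchange by sc. f_equal; eapply fc_assoc; sc.
Qed.

Lemma tcK f f' g g' A0 A1 A2 C0 C1 C2 : hc f A0 A1 -> hc f' A1 A2 -> hc g C0 C1 -> hc g' C1 C2 ->
  vinv (tc f g f' g') (tci f g f' g').
Proof.
intros Hf Hf' Hg Hg'. erewrite tcE, tciE by eassumption.
apply vinv_vcmp; [sc| |]; repeat (apply vinv_hcmp; [sc | sc | |]).
all: first [ apply vinv_id | apply qhhK | apply fcK; sc ].
Qed.
Lemma cell_tc f f' g g' A0 A1 A2 C0 C1 C2 :
  hc f A0 A1 -> hc f' A1 A2 -> hc g C0 C1 -> hc g' C1 C2 ->
  cell (tc f g f' g') (hcmp (th f g) (th f' g')) (th (hcmp f f') (hcmp g g'))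
    (vid (L A0 C0)) (vid (L A2 C2)).
Proof.
intros Hf Hf' Hg Hg'.
erewrite tcE, (thE Hf Hg), (thE Hf' Hg'), (thE (hc_hcmp Hf Hf' eq_refl) (hc_hcmp Hg Hg' eq_refl))
  by eassumption.
sc.
Qed.
Lemma cell_tu A C : cell (tu A C) (hid (L A C)) (th (hid A) (hid C)) (vid (L A C)) (vid (L A C)).
Proof. unfold tu. erewrite thE by apply hc_hid. sc. Qed.
Lemma tuK A C : vinv (tu A C) (tui A C).
Proof. apply vinv_hcmp; [sc | sc | |]; apply fuK. Qed.

Lemma tc_unitl f g A A' C C' : hc f A A' -> hc g C C' ->
  [tu A C | vsid (th f g)] / tc (hid A) (hid C) f g = vsid (th f g).
Proof.
intros Hf Hg. erewrite tcE, (thE Hf Hg) by (first [apply hc_hid | eassumption]).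
unfold tu. rewrite vsid_cmp by sc.
rewrite <- vscmpA by sc.
lhs (hA; rewrite <- (@hscmpA _ (fu (L A) C)) by sc).
rewrite interchange by sc. rewrite (@interchange _ [_ | _]) by sc.
rewrite (qhh_idr H C Hf). v1.
rewrite (@hscmpA _ (vsid _) (fu _ _)), <- hscmpA, interchange by sc.
f_equal.
- pose proof (fc_unitl (R C) f) as E. now rewrite (proj1 Hf) in E.
- pose proof (fc_unitl (L A') g) as E. now rewrite (proj1 Hg) in E.
Qed.
Lemma tc_unitr f g A A' C C' : hc f A A' -> hc g C C' ->
  [vsid (th f g) | tu A' C'] / tc f g (hid A') (hid C') = vsid (th f g).
Proof.
intros Hf Hg. erewrite tcE, (thE Hf Hg) by (first [apply hc_hid | eassumption]).
unfold tu. rewrite vsid_cmp by sc.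
rewrite <- vscmpA by sc.
lhs (hA; rewrite <- (@hscmpA _ (vsid _) (fu _ _)) by sc).
rewrite interchange by sc. rewrite (@interchange _ [_ | _]) by sc.
rewrite (qhh_idl H A' Hg). v1.
rewrite (@hscmpA _ (fu _ _) (vsid _)), <- hscmpA, interchange by sc.
f_equal.
- pose proof (fc_unitr (R C) f) as E. now rewrite (proj2 Hf) in E.
- pose proof (fc_unitr (L A') g) as E. now rewrite (proj2 Hg) in E.
Qed.
Lemma tu_nat u v A A' C C' : vc u A A' -> vc v C C' ->
  hsid (tv u v) / tu A' C' = tu A C / ts (hsid u) (hsid v).
Proof.
intros Hu Hv. erewrite (tvE Hu Hv), tsE by (first [eapply cell_hsid; eassumption | eassumption]).
unfold tu. rewrite interchange by sc.
rewrite <- (@vscmpA _ (fu (R C) A)) by sc.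
pose proof (fu_nat (R C) u) as E1. rewrite (proj1 Hu), (proj2 Hu) in E1.
pose proof (fu_nat (L A') v) as E2. rewrite (proj1 Hv), (proj2 Hv) in E2.
rewrite <- E1, vscmpA, <- (qhv_fu H A' Hv), <- (@vscmpA _ (fu (L A) C)), <- (qvh_fu H C Hu), vscmpA, <- E2, <- !vscmpA, <- !hsid_cmp, (qvv_comm Hvv Hu Hv) by sc.
rewrite <- interchange by sc. rewrite hscmp1l' by sc. reflexivity.
Qed.

(** The two sides differ by the order of [v] and [u'] in the middle. [sc] exchanges them through
    [qvv_comm], so the product is strict on 1v-cells. *)
Lemma tv_vcmp u u' v v' A A' A'' C C' C'' :
  vc u A A' -> vc u' A' A'' -> vc v C C' -> vc v' C' C'' ->
  tv (vcmp u u') (vcmp v v') = vcmp (tv u v) (tv u' v').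
Proof.
intros Hu Hu' Hv Hv'. erewrite (tvE Hu Hv), (tvE Hu' Hv'), tvE by (eapply vc_vcmp; eauto).
sc.
Qed.
End Tens.

Ltac splitpairs := simpl in *;
  repeat match goal with
  | x : ob (dblprod _ _) |- _ => destruct x
  | x : hor (dblprod _ _) |- _ => destruct x
  | x : ver (dblprod _ _) |- _ => destruct x
  | x : sq (dblprod _ _) |- _ => destruct x
  | x : _ * _ |- _ => destruct x end; simpl in *;
  repeat match goal with
  | H : (_, _) = (_, _) |- _ => injection H; clear H; intros end.

Ltac bounds := first [ apply hc_refl | apply vc_refl | apply cell_refl
  | split; [symmetry; eassumption | reflexivity]
  | split; [eassumption | reflexivity] | eassumption
  | repeat split; first [reflexivity | symmetry; eassumption]
  | split; [ rewrite <- ?hsrc_top, <- ?hsrc_bot, <- ?htgt_top, <- ?htgt_bot; congruence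
           | reflexivity ]].

Section TensFunctor.
Variables (B : dblcat) (H : quasi_functor B).
Hypothesis Hvv : forall u v, vtrivial (qvv H u v).

Definition tensf : psfun (dblprod B B) B.
Proof.
refine (@Psfun (dblprod B B) B (fun A => qL H (fst A) (snd A))
  (fun f => th H (fst f) (snd f)) (fun u => tv H (fst u) (snd u))
  (fun a => ts H (fst a) (snd a))
  (fun f g => tc H (fst f) (snd f) (fst g) (snd g))
  (fun f g => tci H (fst f) (snd f) (fst g) (snd g))
  (fun A => tu H (fst A) (snd A)) (fun A => tui H (fst A) (snd A))
  _ _ _ _ _ _ _ _ _ _ _ _ _ _ _ _ _ _ _ _ _ _ _ _ _ _ _); intros; splitpairs.
all: try (unfold th, tv; sc).
all: try (eapply eq_trans; [first [eapply c_top | eapply c_bot | eapply c_lft | eapply c_rgt]; (eapply cell_ts; first [apply cell_refl | apply vc_refl]) | unfold th, tv; heq]).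
- erewrite tvE by apply vc_vid. sc.
- eapply tv_vcmp; bounds.
- eapply ts_vsid; bounds.
- eapply ts_vcmp; bounds.
- eapply c_top, cell_tc; bounds.
- eapply c_bot, cell_tc; bounds.
- eapply c_lft, cell_tc; bounds.
- eapply c_rgt, cell_tc; bounds.
- eapply tcK; bounds.
- apply (c_top (cell_tu H _ _)).
- apply (c_bot (cell_tu H _ _)).
- apply (c_lft (cell_tu H _ _)).
- apply (c_rgt (cell_tu H _ _)).
- apply tuK.
- eapply tc_nat; bounds.
- eapply tu_nat; bounds.
- eapply tc_assoc; bounds.
- eapply tc_unitl; bounds.
- eapply tc_unitr; bounds.
Defined.
End TensFunctor.

(** * Its associativity and units *)

Section Premonoidal.
Variables (B : dblcat) (H : quasi_functor B).
Notation L := (qL H).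
Notation R := (qR H).
Hypothesis Hvv : forall u v, vtrivial (qvv H u v).
Variable P : central_premonoidal (quasi_binoidal H) (purely_exchange (quasi_purely H)).
Implicit Types (f g h k : hor B) (u v w : ver B) (a b c : sq B).

Lemma vc_alo A C D : vc (alo P A C D) (L (L A C) D) (L A (L C D)).
Proof.
rewrite <- al3_o. pose proof (vsi_trans (al3P P A C)) as K.
split; [apply (vsrc_vo K) | apply (vtgt_vo K)].
Qed.
Lemma vc_lam A : vc (v_o (lam P) A) (L (pI P) A) A.
Proof. pose proof (vsi_trans (lamP P)) as K. split; [apply (vsrc_vo K) | apply (vtgt_vo K)]. Qed.
Lemma vc_rho A : vc (v_o (rho P) A) (L A (pI P)) A.
Proof.
pose proof (vsi_trans (rhoP P)) as K. rewrite <- (qRL H).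
split; [apply (vsrc_vo K) | apply (vtgt_vo K)].
Qed.
Lemma cell_al1 C D f A A' : hc f A A' -> cell (v_h (al1 P C D) f) (fh (R D) (fh (R C) f))
  (fh (R (L C D)) f) (alo P A C D) (alo P A' C D).
Proof. intros Hf. rewrite <- !al1_o. exact (vstrict_cell (al1P P C D) Hf). Qed.
Lemma cell_al2 C D f A A' : hc f A A' -> cell (v_h (al2 P C D) f) (fh (R D) (fh (L C) f))
  (fh (L C) (fh (R D) f)) (alo P C A D) (alo P C A' D).
Proof. intros Hf. rewrite <- !al2_o. exact (vstrict_cell (al2P P C D) Hf). Qed.
Lemma cell_al3 C D f A A' : hc f A A' -> cell (v_h (al3 P C D) f) (fh (L (L C D)) f)
  (fh (L C) (fh (L D) f)) (alo P C D A) (alo P C D A').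
Proof. intros Hf. rewrite <- !al3_o. exact (vstrict_cell (al3P P C D) Hf). Qed.
Lemma cell_lam f A A' : hc f A A' -> cell (v_h (lam P) f) (fh (L (pI P)) f) f
  (v_o (lam P) A) (v_o (lam P) A').
Proof. exact (vstrict_cell (lamP P) (f:=f) (A:=A) (A':=A')). Qed.
Lemma cell_rho f A A' : hc f A A' -> cell (v_h (rho P) f) (fh (R (pI P)) f) f
  (v_o (rho P) A) (v_o (rho P) A').
Proof. exact (vstrict_cell (rhoP P) (f:=f) (A:=A) (A':=A')). Qed.
Lemma alo_nat1 C D u A A' : vc u A A' ->
  vcmp (fv (R D) (fv (R C) u)) (alo P A' C D) = vcmp (alo P A C D) (fv (R (L C D)) u).
Proof. intros Hu. rewrite <- !al1_o. symmetry; exact (vstrict_natv (al1P P C D) Hu). Qed.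
Lemma alo_nat2 C D u A A' : vc u A A' ->
  vcmp (fv (R D) (fv (L C) u)) (alo P C A' D) = vcmp (alo P C A D) (fv (L C) (fv (R D) u)).
Proof. intros Hu. rewrite <- !al2_o. symmetry; exact (vstrict_natv (al2P P C D) Hu). Qed.
Lemma alo_nat3 C D u A A' : vc u A A' ->
  vcmp (fv (L (L C D)) u) (alo P C D A') = vcmp (alo P C D A) (fv (L C) (fv (L D) u)).
Proof. intros Hu. rewrite <- !al3_o. symmetry; exact (vstrict_natv (al3P P C D) Hu). Qed.
Lemma lam_nat u A A' : vc u A A' ->
  vcmp (fv (L (pI P)) u) (v_o (lam P) A') = vcmp (v_o (lam P) A) u.
Proof. intros Hu. symmetry; exact (vstrict_natv (lamP P) Hu). Qed.
Lemma rho_nat u A A' : vc u A A' ->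
  vcmp (fv (R (pI P)) u) (v_o (rho P) A') = vcmp (v_o (rho P) A) u.
Proof. intros Hu. symmetry; exact (vstrict_natv (rhoP P) Hu). Qed.
End Premonoidal.

Lemma vcmp_swap_x (B : dblcat) (x y x' y' : ver B) A A' A'' A3 w C p q :
  vcmp x y = vcmp x' y' -> vc x A A' -> vc y A' A'' -> vc x' A A3 -> vc y' A3 A'' ->
  vc w C q -> A'' = C -> vcmp x' (vcmp y' w) = p -> vcmp x (vcmp y w) = p.
Proof.
intros E [E1 E2] [E3 E4] [E5 E6] [E7 E8] [E9 _] E10 <-.
rewrite <- !vcmpA by congruence. now rewrite E.
Qed.

Ltac vc_hook ::= lazymatch goal with
  | |- vc (alo _ _ _ _) _ _ => eapply vc_alo
  | |- vc (v_o (lam _) _) _ _ => eapply vc_lam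
  | |- vc (v_o (rho _) _) _ _ => eapply vc_rho
  end.
Ltac cell_hook ::= lazymatch goal with
  | |- cell (qhh _ _ _) _ _ _ _ => eapply cell_qhh; hc_tac
  | |- cell (qhhi _ _ _) _ _ _ _ => eapply cell_qhhi; hc_tac
  | |- cell (qhv _ _ _) _ _ _ _ => eapply cell_qhv; [hc_tac | vc_tac]
  | |- cell (qvh _ _ _) _ _ _ _ => eapply cell_qvh; [vc_tac | hc_tac]
  | |- cell (v_h (al1 _ _ _) _) _ _ _ _ => eapply cell_al1; hc_tac
  | |- cell (v_h (al2 _ _ _) _) _ _ _ _ => eapply cell_al2; hc_tac
  | |- cell (v_h (al3 _ _ _) _) _ _ _ _ => eapply cell_al3; hc_tac
  | |- cell (v_h (lam _) _) _ _ _ _ => eapply cell_lam; hc_tac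
  | |- cell (v_h (rho _) _) _ _ _ _ => eapply cell_rho; hc_tac
  | |- cell (fs_cmp _ _ _ _ _ _) _ _ _ _ => unfold fs_cmp; ty
  end.
(** Added rules: by naturality, the 1v-components of the associativity and of the units move to the
    front of a composite. *)
Ltac vcn_hook ::= lazymatch goal with
  | Hvv : forall u v, vtrivial (qvv ?H u v) |- vcmp (fv (qL ?H _) _) (fv (qR ?H _) _) = _ =>
     symmetry; eapply (qvv_comm Hvv); vc_tac
  | Hvv : forall u v, vtrivial (qvv ?H u v) |- vcmp (fv (qL ?H _) _) (vcmp (fv (qR ?H _) _) _) = _ =>
     eapply (qvv_comm_x Hvv); [vc_tac | vc_tac | vc_tac | oeq | vcn | reflexivity]
  | |- vcmp (fv (qR _ _) (fv (qR _ _) _)) (alo _ _ _ _) = _ => eapply alo_nat1; vc_tac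
  | |- vcmp (fv (qR _ _) (fv (qL _ _) _)) (alo _ _ _ _) = _ => eapply alo_nat2; vc_tac
  | |- vcmp (fv (qL _ _) _) (alo _ _ _ _) = _ => eapply alo_nat3; vc_tac
  | |- vcmp (fv (qL _ _) _) (v_o (lam _) _) = _ => eapply lam_nat; vc_tac
  | |- vcmp (fv (qR _ _) _) (v_o (rho _) _) = _ => eapply rho_nat; vc_tac
  | |- vcmp (fv (qR _ _) (fv (qR _ _) _)) (vcmp (alo _ _ _ _) _) = _ =>
     eapply vcmp_swap_x; [ eapply alo_nat1; vc_tac | vc_tac | vc_tac | vc_tac | vc_tac | vc_tac | oeq
        | eapply vcmp_eq; [reflexivity | vcn | reflexivity ] ]
  | |- vcmp (fv (qR _ _) (fv (qL _ _) _)) (vcmp (alo _ _ _ _) _) = _ =>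
     eapply vcmp_swap_x; [ eapply alo_nat2; vc_tac | vc_tac | vc_tac | vc_tac | vc_tac | vc_tac | oeq
        | eapply vcmp_eq; [reflexivity | vcn | reflexivity ] ]
  | |- vcmp (fv (qL _ _) _) (vcmp (alo _ _ _ _) _) = _ =>
     eapply vcmp_swap_x; [ eapply alo_nat3; vc_tac | vc_tac | vc_tac | vc_tac | vc_tac | vc_tac | oeq
        | eapply vcmp_eq; [reflexivity | vcn | reflexivity ] ]
  end.

(** * The associativity squares: naturality and unit law *)

Section Assoc.
Variables (B : dblcat) (H : quasi_functor B).
Notation L := (qL H).
Notation R := (qR H).
Hypothesis Hvv : forall u v, vtrivial (qvv H u v).
Variable P : central_premonoidal (quasi_binoidal H) (purely_exchange (quasi_purely H)).
Implicit Types (f g h k : hor B) (u v w : ver B) (a b c : sq B).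
Notation a1 C D f := (v_h (al1 P C D) f).
Notation a2 C D f := (v_h (al2 P C D) f).
Notation a3 C D f := (v_h (al3 P C D) f).

(* [al1] at f, [al2] at g and [al3] at h side by side, between the two bracketings of f (x) g (x) h. *)
Definition ml f g h :=
  [fci (R (hsrc h)) (fh (R (hsrc g)) f) (fh (L (htgt f)) g) | vsid (fh (L (L (htgt f) (htgt g))) h)] /
  ([a1 (hsrc g) (hsrc h) f | [a2 (htgt f) (hsrc h) g | a3 (htgt f) (htgt g) h]] /
  [vsid (fh (R (L (hsrc g) (hsrc h))) f) | fc (L (htgt f)) (fh (R (hsrc h)) g) (fh (L (htgt g)) h)]).
Lemma mlE f g h A A' C C' D D' : hc f A A' -> hc g C C' -> hc h D D' ->
  ml f g h = [fci (R D) (fh (R C) f) (fh (L A') g) | vsid (fh (L (L A' C')) h)] /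
  ([a1 C D f | [a2 A' D g | a3 A' C' h]] /
  [vsid (fh (R (L C D)) f) | fc (L A') (fh (R D) g) (fh (L C') h)]).
Proof. now intros [<- <-] [<- <-] [<- <-]. Qed.

Lemma cell_ml f g h A A' C C' D D' : hc f A A' -> hc g C C' -> hc h D D' ->
  cell (ml f g h) (th H (th H f g) h) (th H f (th H g h)) (alo P A C D) (alo P A' C' D').
Proof.
intros Hf Hg Hh. rewrite (mlE Hf Hg Hh).
rewrite (thE H Hf Hg), (thE H Hg Hh).
erewrite !thE by (first [eassumption | hc_tac]).
sc.
Qed.

Lemma as12hv f u Z C C' : vc u C C' ->
  fs (R Z) (qhv H f u) / a1 C' Z f = a1 C Z f / qhv H f (fv (R Z) u).
Proof. intros [<- <-]. exact (as_12_hv (cp_assoc P) f u Z). Qed.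
Lemma as13hv f u Y C C' : vc u C C' ->
  qhv H (fh (R Y) f) u / a1 Y C' f = a1 Y C f / qhv H f (fv (L Y) u).
Proof. intros [<- <-]. exact (as_13_hv (cp_assoc P) f Y u). Qed.
Lemma as23hv W f u C C' : vc u C C' ->
  qhv H (fh (L W) f) u / a2 W C' f = a2 W C f / fs (L W) (qhv H f u).
Proof. intros [<- <-]. exact (as_23_hv (cp_assoc P) W f u). Qed.
Lemma as12vh u f Z C C' : vc u C C' ->
  fs (R Z) (qvh H u f) / a2 C' Z f = a2 C Z f / qvh H u (fh (R Z) f).
Proof. intros [<- <-]. exact (as_12_vh (cp_assoc P) u f Z). Qed.
Lemma as13vh u f Y C C' : vc u C C' ->
  qvh H (fv (R Y) u) f / a3 C' Y f = a3 C Y f / qvh H u (fh (L Y) f).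
Proof. intros [<- <-]. exact (as_13_vh (cp_assoc P) u Y f). Qed.
Lemma as23vh W u f C C' : vc u C C' ->
  qvh H (fv (L W) u) f / a3 W C' f = a3 W C f / fs (L W) (qvh H u f).
Proof. intros [<- <-]. exact (as_23_vh (cp_assoc P) W u f). Qed.
Lemma as12hh f g Z A A' C C' : hc f A A' -> hc g C C' ->
  fs_cmp (R Z) (fh (L A) g) (fh (R C') f) (fh (R C) f) (fh (L A') g) (qhh H f g)
    / [a1 C Z f | a2 A' Z g] = [a2 A Z g | a1 C' Z f] / qhh H f (fh (R Z) g).
Proof. intros [<- <-] [<- <-]. exact (as_12_hh (cp_assoc P) f g Z). Qed.
Lemma as13hh f g Y A A' C C' : hc f A A' -> hc g C C' ->
  qhh H (fh (R Y) f) g / [a1 Y C f | a3 A' Y g] = [a3 A Y g | a1 Y C' f] / qhh H f (fh (L Y) g).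
Proof. intros [<- <-] [<- <-]. exact (as_13_hh (cp_assoc P) f Y g). Qed.
Lemma as23hh f g W A A' C C' : hc f A A' -> hc g C C' ->
  qhh H (fh (L W) f) g / [a2 W C f | a3 W A' g] = [a3 W A g | a2 W C' f] /
  fs_cmp (L W) (fh (L A) g) (fh (R C') f) (fh (R C) f) (fh (L A') g) (qhh H f g).
Proof. intros [<- <-] [<- <-]. exact (as_23_hh (cp_assoc P) W f g). Qed.

Lemma a1_nat C D a f f' u u' : cell a f f' u u' ->
  a1 C D f / fs (R (L C D)) a = fs (R D) (fs (R C) a) / a1 C D f'.
Proof. exact (vstrict_nat (al1P P C D) (a := a) (f := f) (f' := f') (u := u) (u' := u')). Qed.
Lemma a2_nat C D a f f' u u' : cell a f f' u u' ->
  a2 C D f / fs (L C) (fs (R D) a) = fs (R D) (fs (L C) a) / a2 C D f'.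
Proof. exact (vstrict_nat (al2P P C D) (a := a) (f := f) (f' := f') (u := u) (u' := u')). Qed.
Lemma a3_nat C D a f f' u u' : cell a f f' u u' ->
  a3 C D f / fs (L C) (fs (L D) a) = fs (L (L C D)) a / a3 C D f'.
Proof. exact (vstrict_nat (al3P P C D) (a := a) (f := f) (f' := f') (u := u) (u' := u')). Qed.
Lemma a1_fc C D f f' A A' A'' : hc f A A' -> hc f' A' A'' ->
  [a1 C D f | a1 C D f'] / fc (R (L C D)) f f' =
  fc (R D) (fh (R C) f) (fh (R C) f') / (fs (R D) (fc (R C) f f') / a1 C D (hcmp f f')).
Proof.
intros Hf Hf'. rewrite <- vscmpA by sc. exact (vstrict_fc (al1P P C D) Hf Hf').
Qed.
Lemma a2_fc C D f f' A A' A'' : hc f A A' -> hc f' A' A'' ->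
  [a2 C D f | a2 C D f'] / (fc (L C) (fh (R D) f) (fh (R D) f') / fs (L C) (fc (R D) f f')) =
  fc (R D) (fh (L C) f) (fh (L C) f') / (fs (R D) (fc (L C) f f') / a2 C D (hcmp f f')).
Proof.
intros Hf Hf'. rewrite <- (@vscmpA _ (fc (R D) _ _)) by sc. exact (vstrict_fc (al2P P C D) Hf Hf').
Qed.
Lemma a3_fc C D f f' A A' A'' : hc f A A' -> hc f' A' A'' ->
  [a3 C D f | a3 C D f'] / (fc (L C) (fh (L D) f) (fh (L D) f') / fs (L C) (fc (L D) f f')) =
  fc (L (L C D)) f f' / a3 C D (hcmp f f').
Proof.
intros Hf Hf'. exact (vstrict_fc (al3P P C D) Hf Hf').
Qed.

(** With compositors moved to the top and the bottom, the two sides fall into three strands, one per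
    variable. In each strand the associativity passes one square by its own naturality and two
    exchange cells by its compatibility with the other two variables. *)
Lemma ml_nat a b c f f' g g' h h' u u' v v' w w' A A' C C' D D' E E' F F' G G' :
  cell a f f' u u' -> cell b g g' v v' -> cell c h h' w w' ->
  vc u A E -> vc u' A' E' -> vc v C F -> vc v' C' F' -> vc w D G -> vc w' D' G' ->
  ml f g h / ts H a (ts H b c) = ts H (ts H a b) c / ml f' g' h'.
Proof.
intros Ha Hb Hc Hu Hu' Hv Hv' Hw Hw'. sat.
erewrite !mlE by eassumption.
pose proof (cell_tsE H Ha Hb Hu Hu' Hv Hv') as Hab.
pose proof (cell_tsE H Hb Hc Hv Hv' Hw Hw') as Hbc.
erewrite (tsE H Ha Hbc), (tsE H Hab Hc) by (first [eassumption | sc]).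
erewrite (tsE H Ha Hb), (tsE H Hb Hc) by eassumption.
erewrite (qhv_cmp H f'), (qvh_cmp H h) by vc_tac.
vA.
(* [E1] moves the lower compositor down past the squares, and [E2] below moves the upper inverse
   compositor up; only strands are left between them. *)
assert (E1 : [vsid (fh (R (L C D)) f) | fc (L A') (fh (R D) g) (fh (L C') h)] /
  [fs (R (L C D)) a / (qhv H f' (fv (R D) v) / qhv H f' (fv (L F) w))
  | qvh H u' (hcmp (fh (R D) g) (fh (L C') h)) /
    fs (L E') [fs (R D) b / qhv H g' w | qvh H v' h / fs (L F') c]] =
  [fs (R (L C D)) a / (qhv H f' (fv (R D) v) / qhv H f' (fv (L F) w))
  | [qvh H u' (fh (R D) g) / (fs (L E') (fs (R D) b) / fs (L E') (qhv H g' w))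
    | qvh H u' (fh (L C') h) / (fs (L E') (qvh H v' h) / fs (L E') (fs (L F') c))]] /
  [vsid (fh (R (L F G)) f') | fc (L E') (fh (R G) g') (fh (L F') h')]).
{ rewrite !interchange by sc. v1. f_equal.
  rewrite <- (@interchange _ (qvh H u' (fh (R D) g))), <- !fs_vscmp, vscmpA by sc.
  erewrite (fc_natE (L E')) by (first [eassumption | sc]).
  rewrite <- !vscmpA by sc. f_equal. symmetry. eapply qvh_fc; sc. }
rewrite E1.
assert (E2 : [fs (R D) [fs (R C) a / qhv H f' v | qvh H u' g / fs (L E') b] /
   qhv H (hcmp (fh (R F) f') (fh (L E') g')) w
  | qvh H (fv (R C') u') h / (qvh H (fv (L E') v') h / fs (L (L E' F')) c)] /
  [fci (R G) (fh (R F) f') (fh (L E') g') | vsid (fh (L (L E' F')) h')] =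
  [fci (R D) (fh (R C) f) (fh (L A') g) | vsid (fh (L (L A' C')) h)] /
  [[(fs (R D) (fs (R C) a) / fs (R D) (qhv H f' v)) / qhv H (fh (R F) f') w
  | (fs (R D) (qvh H u' g) / fs (R D) (fs (L E') b)) / qhv H (fh (L E') g') w]
  | qvh H (fv (R C') u') h / (qvh H (fv (L E') v') h / fs (L (L E' F')) c)]).
{ rewrite !interchange by sc. v1. f_equal.
  rewrite <- (@interchange _ (fs (R D) (fs (R C) a) / _)), <- !fs_vscmp by sc.
  rewrite vscmpA, <- (@vscmpA _ (fci (R D) _ _)) by sc.
  erewrite <- (fci_nat (R D)) by (first [eassumption | sc]). vA. f_equal.
  eapply vinv_conj; [eapply fcKv; sc | eapply fcKv; sc | sc | sc | ].
  eapply qhv_fc; sc. }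
rewrite <- !(@vscmpA _ [_ / _ | _ / _] [fci _ _ _ | _]), E2 by sc.
vA. f_equal. rewrite <- !vscmpA by sc. f_equal.
hA. ich. ich. ich. ich. vA.
f_equal; [|f_equal].
- vrw (a1_nat C D Ha). vrw (eq_sym (as12hv f' D Hv)). now rewrite (as13hv f' F Hw).
- vrw (eq_sym (as12vh g D Hu')). vrw (a2_nat E' D Hb). now rewrite (as23hv E' g' Hw).
- vrw (eq_sym (as13vh h C' Hu')). vrw (eq_sym (as23vh E' h Hv')). now rewrite (a3_nat E' F' Hc).
Qed.

(** The unitor of the product of two identities is a pair of unitors, whose image [fu_cmp] splits.
    What remains in each strand is the unit axiom of one of the one-variable associativities. *)
Lemma ml_fu A C D :
  hsid (alo P A C D) / (tu H A (L C D) / ts H (vsid (hid A)) (tu H C D)) =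
  (tu H (L A C) D / ts H (tu H A C) (vsid (hid D))) / ml (hid A) (hid C) (hid D).
Proof.
pose proof (cell_tu H C D) as K1; pose proof (cell_tu H A C) as K2.
erewrite thE in K1, K2 by apply hc_hid.
erewrite ts_vsidl, ts_vsidr by (first [eassumption | apply vc_vid | apply hc_hid]).
rewrite qhv_id, qvh_id. unfold tu.
erewrite mlE by apply hc_hid.
rewrite !interchange by sc. v1. erewrite !fu_cmp by sc. vA.
rewrite <- (@vscmpA _ _ [fci (R D) _ _ | _]), (@interchange _ (_ / fc (R D) _ _)), (vscmpA (a := [_ / _ | _ / _]) (b := fc (R D) _ _)) by sc.
erewrite fcE_l by sc. v1.
rewrite hscmpA, interchange, <- !vscmpA, (@interchange _ (_ / fs (R D) (fu (L A) C))) by sc.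
rewrite hsid_whl, <- (@vscmpA _ (hsid _)), hsid_whl by sc.
rewrite <- !(@vscmpA _ (hsid _)) by sc.
f_equal; [|f_equal; f_equal].
- rewrite <- al1_o, <- (qRL H A C). exact (vh_id (vsi_trans (al1P P C D)) A).
- rewrite (@vscmpA _ (hsid _)), <- al2_o by sc. pose proof (vh_id (vsi_trans (al2P P A D)) C) as E; simpl in E.
  rewrite qRL in E. exact E.
- rewrite (@vscmpA _ (hsid _)), <- al3_o by sc. exact (vh_id (vsi_trans (al3P P A C)) D).
Qed.
End Assoc.

(** * Compatibility of the associativity with compositors *)

Section AssocCompositor.
Variables (B : dblcat) (H : quasi_functor B).
Notation L := (qL H).
Notation R := (qR H).
Variables (f f' g g' h h' : hor B) (A0 A1 A2 C0 C1 C2 D0 D1 D2 : ob B).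
Hypotheses (Hf : hc f A0 A1) (Hf' : hc f' A1 A2) (Hg : hc g C0 C1) (Hg' : hc g' C1 C2)
  (Hh : hc h D0 D1) (Hh' : hc h' D1 D2).

(** [Xij] and [Yij] exchange the primed cell in variable i with the unprimed cell in variable j, for
    the left and for the right bracketing. [X12] lies in the image of the functor [R D0] and [Y23]
    in that of [L A2], so these two are conjugated by compositors. *)
Local Notation X13 := (qhh H (fh (R C1) f') h).
Local Notation X12 := (fs_cmp (R D0) (fh (L A1) g) (fh (R C1) f') (fh (R C0) f') (fh (L A2) g) (qhh H f' g)).
Local Notation X23 := (qhh H (fh (L A2) g') h).
Local Notation RRf := (fh (R D0) (fh (R C0) f)).
Local Notation RLg := (fh (R D0) (fh (L A1) g)).
Local Notation RLg' := (fh (R D1) (fh (L A2) g')).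
Local Notation Lh' := (fh (L (L A2 C2)) h').

(** The compositors on top separate the six factors. [qhh_cmpl] splits the exchange of a composite
    with [h] into [X13] and [X23], and [fs_cmp_paste] extracts [X12] from the image under [R D0];
    one-variable compositors remain below. *)
Lemma tens_cmpl :
  [[fc (R D0) (fh (R C0) f) (fh (L A1) g) | vsid (fh (L (L A1 C1)) h)] |
   [fc (R D1) (fh (R C1) f') (fh (L A2) g') | vsid Lh']] /
  (tc H (th H f g) h (th H f' g') h' / ts H (tc H f g f' g') (vsid (hcmp h h'))) =
  [vsid RRf | [vsid RLg | [X13 | [vsid RLg' | vsid Lh']]]] /
  ([vsid RRf | [X12 | [X23 | vsid Lh']]] /
   ([fc (R D0) (fh (R C0) f) (fh (R C0) f') / fs (R D0) (fc (R C0) f f') |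
     [fc (R D0) (fh (L A2) g) (fh (L A2) g') / fs (R D0) (fc (L A2) g g') |
      fc (L (L A2 C2)) h h']] /
    [fc (R D0) (fh (R C0) (hcmp f f')) (fh (L A2) (hcmp g g')) |
     vsid (fh (L (L A2 C2)) (hcmp h h'))])).
Proof.
pose proof (cell_tc H Hf Hf' Hg Hg') as K.
erewrite !thE in K by (first [eassumption | sc]).
erewrite (ts_vsidr H K (vc_vid _) (vc_vid _)) by sc. rewrite qvh_id.
erewrite (tcE H (f := th H f g)) by (first [erewrite thE by eassumption; sc | eassumption]).
erewrite (thE H Hf Hg), (thE H Hf' Hg'), (tcE H Hf Hf' Hg Hg') by sc.
assert (E1 : [[fc (R D0) (fh (R C0) f) (fh (L A1) g) | vsid (fh (L (L A1 C1)) h)] |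
   [fc (R D1) (fh (R C1) f') (fh (L A2) g') | vsid Lh']] /
   [vsid (fh (R D0) (hcmp (fh (R C0) f) (fh (L A1) g)))
   | [qhh H (hcmp (fh (R C1) f') (fh (L A2) g')) h | vsid Lh']] =
  [vsid (hcmp RRf RLg) | [[X13 | vsid RLg'] | vsid Lh']] /
  ([vsid (hcmp RRf RLg) | [[vsid (fh (R D0) (fh (R C1) f')) | X23] | vsid Lh']] /
   [[fc (R D0) (fh (R C0) f) (fh (L A1) g) | fc (R D0) (fh (R C1) f') (fh (L A2) g')] |
     [vsid (fh (L (L A2 C2)) h) | vsid Lh']])).
{ lhs (hA; rewrite <- (@hscmpA _ (vsid _) (fc _ _ _)) by sc).
  rewrite interchange by sc. lhs (rewrite (@interchange _ [_ | fc _ _ _]) by sc).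
  erewrite qhh_cmpl by sc.
  rhs (rewrite (@hscmpA _ (fc _ _ _)), <- (@hscmpA _ (fc _ _ _) (vsid _)) by sc).
  repeat (ich; v1). vA. reflexivity. }
rewrite (@vscmpA _ [vsid _ | _]), <- (@vscmpA _ _ [vsid _ | [_ | vsid Lh']]), E1 by sc.
vA. f_equal.
{ rewrite vsid_cmp by sc. hA. reflexivity. }
assert (E2 : [[fc (R D0) (fh (R C0) f) (fh (L A1) g) | fc (R D0) (fh (R C1) f') (fh (L A2) g')] |
     [vsid (fh (L (L A2 C2)) h) | vsid Lh']] /
   ([fc (R D0) (hcmp (fh (R C0) f) (fh (L A1) g)) (hcmp (fh (R C1) f') (fh (L A2) g'))
   | fc (L (L A2 C2)) h h'] /
   [fs (R D0)
      ([vsid (fh (R C0) f) | [qhh H f' g | vsid (fh (L A2) g')]] /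
       [fc (R C0) f f' | fc (L A2) g g'])
   | vsid (fh (L (L A2 C2)) (hcmp h h'))]) =
   [[vsid RRf | [X12 | vsid (fh (R D0) (fh (L A2) g'))]] | [vsid (fh (L (L A2 C2)) h) | vsid Lh']] /
   [[fc (R D0) (fh (R C0) f) (fh (R C0) f') / fs (R D0) (fc (R C0) f f')
    | fc (R D0) (fh (L A2) g) (fh (L A2) g') / fs (R D0) (fc (L A2) g g')] /
    fc (R D0) (fh (R C0) (hcmp f f')) (fh (L A2) (hcmp g g'))
   | fc (L (L A2 C2)) h h']).
{ rewrite <- !vsid_cmp by sc. repeat ich. v1. f_equal.
  unfold fs_cmp. eapply fs_cmp_paste; sc. }
rewrite E2. rewrite <- vscmpA by sc. f_equal.
- rewrite vsid_cmp by sc. lhs (hA).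
  rewrite <- (@hscmpA _ (vsid RLg) (vsid _)) by sc.
  rewrite <- (@hscmpA _ (vsid (fh (R D0) (fh (L A2) g')))) by sc.
  rewrite <- !vsid_cmp by sc. repeat ich. v1. reflexivity.
- rewrite <- (@hscmpA _ (fc (R D0) _ _ / _)) by sc. repeat ich. v1. reflexivity.
Qed.

Local Notation Y13 := (qhh H f' (fh (L C1) h)).
Local Notation Y12 := (qhh H f' (fh (R D0) g)).
Local Notation Y23 := (fs_cmp (L A2) (fh (L C1) h) (fh (R D1) g') (fh (R D0) g') (fh (L C2) h) (qhh H g' h)).
Local Notation Rf := (fh (R (L C0 D0)) f).
Local Notation Rf' := (fh (R (L C0 D0)) f').
Local Notation LRg := (fh (L A1) (fh (R D0) g)).
Local Notation LRg' := (fh (L A2) (fh (R D1) g')).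
Local Notation LLh' := (fh (L A2) (fh (L C2) h')).

(** The mirror image: [qhh_cmpr] yields [Y13] and [Y12], and it is [Y23] that is extracted from an
    image, under [L A2]. *)
Lemma tens_cmpr :
  [[vsid Rf | fc (L A1) (fh (R D0) g) (fh (L C1) h)] |
   [vsid (fh (R (L C1 D1)) f') | fc (L A2) (fh (R D1) g') (fh (L C2) h')]] /
  (tc H f (th H g h) f' (th H g' h') / ts H (vsid (hcmp f f')) (tc H g h g' h')) =
  [vsid Rf | [vsid LRg | [Y13 | [vsid LRg' | vsid LLh']]]] /
  ([vsid Rf | [Y12 | [Y23 | vsid LLh']]] /
   ([fc (R (L C0 D0)) f f' |
     [fc (L A2) (fh (R D0) g) (fh (R D0) g') / fs (L A2) (fc (R D0) g g') |
      fc (L A2) (fh (L C2) h) (fh (L C2) h') / fs (L A2) (fc (L C2) h h')]] /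
    [vsid (fh (R (L C0 D0)) (hcmp f f')) |
     fc (L A2) (fh (R D0) (hcmp g g')) (fh (L C2) (hcmp h h'))])).
Proof.
pose proof (cell_tc H Hg Hg' Hh Hh') as K.
erewrite !thE in K by (first [eassumption | sc]).
erewrite (ts_vsidl H K (vc_vid _) (vc_vid _)) by sc. rewrite qhv_id.
erewrite (tcE H (g := th H g h)) by (first [erewrite thE by eassumption; sc | eassumption]).
erewrite (thE H Hg Hh), (thE H Hg' Hh'), (tcE H Hg Hg' Hh Hh') by sc.
assert (E1 : [[vsid Rf | fc (L A1) (fh (R D0) g) (fh (L C1) h)] |
   [vsid (fh (R (L C1 D1)) f') | fc (L A2) (fh (R D1) g') (fh (L C2) h')]] /
   [vsid Rf | [qhh H f' (hcmp (fh (R D0) g) (fh (L C1) h)) |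
     vsid (fh (L A2) (hcmp (fh (R D1) g') (fh (L C2) h')))]] =
  [vsid Rf | [[vsid LRg | Y13] | vsid (hcmp LRg' LLh')]] /
  ([vsid Rf | [[Y12 | vsid (fh (L A2) (fh (L C1) h))] | vsid (hcmp LRg' LLh')]] /
   [[vsid Rf | vsid Rf'] | [fc (L A2) (fh (R D0) g) (fh (L C1) h)
     | fc (L A2) (fh (R D1) g') (fh (L C2) h')]])).
{ lhs (hA; rewrite <- (@hscmpA _ (fc _ _ _) (vsid _)) by sc).
  rewrite interchange by sc. lhs (rewrite (@interchange _ [fc _ _ _ | _]) by sc).
  erewrite qhh_cmpr by sc.
  rhs (rewrite (@hscmpA _ (vsid _) (vsid _) [fc _ _ _ | _]), <- (@hscmpA _ (vsid _) (fc _ _ _)) by sc).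
  repeat (ich; v1). vA. reflexivity. }
rewrite (@vscmpA _ [vsid _ | _]), <- (@vscmpA _ _ [vsid Rf | [_ | _]]), E1 by sc.
vA. f_equal.
{ rewrite vsid_cmp by sc. hA. reflexivity. }
assert (E2 : [[vsid Rf | vsid Rf'] | [fc (L A2) (fh (R D0) g) (fh (L C1) h)
     | fc (L A2) (fh (R D1) g') (fh (L C2) h')]] /
   ([fc (R (L C0 D0)) f f' | fc (L A2) (hcmp (fh (R D0) g) (fh (L C1) h)) (hcmp (fh (R D1) g') (fh (L C2) h'))] /
   [vsid (fh (R (L C0 D0)) (hcmp f f')) | fs (L A2)
      ([vsid (fh (R D0) g) | [qhh H g' h | vsid (fh (L C2) h')]] /
       [fc (R D0) g g' | fc (L C2) h h'])]) =
   [[vsid Rf | vsid Rf'] | [vsid (fh (L A2) (fh (R D0) g)) | [Y23 | vsid LLh']]] /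
   [fc (R (L C0 D0)) f f' | [fc (L A2) (fh (R D0) g) (fh (R D0) g') / fs (L A2) (fc (R D0) g g')
    | fc (L A2) (fh (L C2) h) (fh (L C2) h') / fs (L A2) (fc (L C2) h h')] /
    fc (L A2) (fh (R D0) (hcmp g g')) (fh (L C2) (hcmp h h'))]).
{ rewrite <- !vsid_cmp by sc. repeat ich. v1. f_equal.
  unfold fs_cmp. eapply fs_cmp_paste; sc. }
rewrite E2. rewrite <- vscmpA by sc. f_equal.
- rewrite vsid_cmp by sc. lhs (hA).
  rewrite <- (@hscmpA _ (vsid (fh (L A2) (fh (L C1) h))) (vsid _)) by sc.
  rewrite <- (@hscmpA _ (vsid Rf') (vsid _)) by sc.
  rewrite <- !vsid_cmp by sc. repeat ich. v1. reflexivity.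
- repeat ich. v1. reflexivity.
Qed.

Variable P : central_premonoidal (quasi_binoidal H) (purely_exchange (quasi_purely H)).
Notation a1 C D f := (v_h (al1 P C D) f).
Notation a2 C D f := (v_h (al2 P C D) f).
Notation a3 C D f := (v_h (al3 P C D) f).

(** The six associativities pass the exchange cells, first by [as13hh], then by [as12hh] and
    [as23hh] together, which replace each [Y] by the corresponding [X]. They then pass the
    compositors by one law per variable. *)
Lemma assoc_strands :
  [[a1 C0 D0 f | [a2 A1 D0 g | a3 A1 C1 h]] | [a1 C1 D1 f' | [a2 A2 D1 g' | a3 A2 C2 h']]] /
  ([vsid Rf | [vsid LRg | [Y13 | [vsid LRg' | vsid LLh']]]] /
  ([vsid Rf | [Y12 | [Y23 | vsid LLh']]] /
   [fc (R (L C0 D0)) f f' |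
     [fc (L A2) (fh (R D0) g) (fh (R D0) g') / fs (L A2) (fc (R D0) g g') |
      fc (L A2) (fh (L C2) h) (fh (L C2) h') / fs (L A2) (fc (L C2) h h')]])) =
  [vsid RRf | [vsid RLg | [X13 | [vsid RLg' | vsid Lh']]]] /
  ([vsid RRf | [X12 | [X23 | vsid Lh']]] /
   ([fc (R D0) (fh (R C0) f) (fh (R C0) f') / fs (R D0) (fc (R C0) f f') |
     [fc (R D0) (fh (L A2) g) (fh (L A2) g') / fs (R D0) (fc (L A2) g g') |
      fc (L (L A2 C2)) h h']] /
    [a1 C0 D0 (hcmp f f') | [a2 A2 D0 (hcmp g g') | a3 A2 C2 (hcmp h h')]])).
Proof.
assert (S1 : [[a1 C0 D0 f | [a2 A1 D0 g | a3 A1 C1 h]] | [a1 C1 D1 f' | [a2 A2 D1 g' | a3 A2 C2 h']]] /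
  [vsid Rf | [vsid LRg | [Y13 | [vsid LRg' | vsid LLh']]]] =
  [vsid RRf | [vsid RLg | [X13 | [vsid RLg' | vsid Lh']]]] /
  [a1 C0 D0 f | [a2 A1 D0 g | [[a1 C1 D0 f' | a3 A2 C1 h] | [a2 A2 D1 g' | a3 A2 C2 h']]]]).
{ lhs (hA; rewrite <- (@hscmpA _ (a3 A1 C1 h)) by sc; repeat ich).
  rewrite <- (as13hh P C1 Hf' Hh). repeat ich. v1. reflexivity. }
rewrite <- vscmpA, S1, vscmpA by sc. f_equal.
assert (S2 : [a1 C0 D0 f | [a2 A1 D0 g | [[a1 C1 D0 f' | a3 A2 C1 h] | [a2 A2 D1 g' | a3 A2 C2 h']]]] /
  [vsid Rf | [Y12 | [Y23 | vsid LLh']]] =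
  [vsid RRf | [X12 | [X23 | vsid Lh']]] /
  [[a1 C0 D0 f | a1 C0 D0 f'] | [[a2 A2 D0 g | a2 A2 D0 g'] | [a3 A2 C2 h | a3 A2 C2 h']]]).
{ lhs (hA; rewrite <- (@hscmpA _ (a3 A2 C1 h)), <- (@hscmpA _ (a2 A1 D0 g)) by sc; repeat ich).
  rewrite <- (as12hh P D0 Hf' Hg), <- (as23hh P A2 Hg' Hh).
  rhs (hA; rewrite <- (@hscmpA _ (a2 A2 D0 g')), <- (@hscmpA _ (a1 C0 D0 f')) by sc).
  repeat ich. v1. reflexivity. }
rewrite <- vscmpA, S2, vscmpA by sc. f_equal.
repeat ich. v1. rewrite !vscmpA by sc.
f_equal; [|f_equal].
- eapply a1_fc; eassumption.
- eapply a2_fc; eassumption.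
- eapply a3_fc; eassumption.
Qed.
End AssocCompositor.

Section AssocTransformation.
Variables (B : dblcat) (H : quasi_functor B).
Notation L := (qL H).
Notation R := (qR H).
Variable P : central_premonoidal (quasi_binoidal H) (purely_exchange (quasi_purely H)).
Notation a1 C D f := (v_h (al1 P C D) f).
Notation a2 C D f := (v_h (al2 P C D) f).
Notation a3 C D f := (v_h (al3 P C D) f).

Lemma ml_fc f f' g g' h h' A0 A1 A2 C0 C1 C2 D0 D1 D2 :
  hc f A0 A1 -> hc f' A1 A2 -> hc g C0 C1 -> hc g' C1 C2 -> hc h D0 D1 -> hc h' D1 D2 ->
  [ml P f g h | ml P f' g' h'] /
    (tc H f (th H g h) f' (th H g' h') / ts H (vsid (hcmp f f')) (tc H g h g' h')) =
  (tc H (th H f g) h (th H f' g') h' / ts H (tc H f g f' g') (vsid (hcmp h h'))) /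
    ml P (hcmp f f') (hcmp g g') (hcmp h h').
Proof.
intros Hf Hf' Hg Hg' Hh Hh'.
pose proof (tens_cmpl H Hf Hf' Hg Hg' Hh Hh') as EL.
pose proof (tens_cmpr H Hf Hf' Hg Hg' Hh Hh') as ER.
pose proof (assoc_strands Hf Hf' Hg Hg' Hh Hh' P) as EA.
assert (Kf : hc (hcmp f f') A0 A2) by sc. assert (Kg : hc (hcmp g g') C0 C2) by sc.
assert (Kh : hc (hcmp h h') D0 D2) by sc.
rewrite (mlE P Hf Hg Hh), (mlE P Hf' Hg' Hh'), (mlE P Kf Kg Kh).
assert (K1 : cell (tc H f (th H g h) f' (th H g' h') / ts H (vsid (hcmp f f')) (tc H g h g' h'))
  (hcmp (fh (R (L C0 D0)) f) (hcmp (fh (L A1) (hcmp (fh (R D0) g) (fh (L C1) h)))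
   (hcmp (fh (R (L C1 D1)) f') (fh (L A2) (hcmp (fh (R D1) g') (fh (L C2) h'))))))
  (hcmp (fh (R (L C0 D0)) (hcmp f f')) (fh (L A2) (hcmp (fh (R D0) (hcmp g g')) (fh (L C2) (hcmp h h')))))
  (vid (L A0 (L C0 D0))) (vid (L A2 (L C2 D2)))).
{ pose proof (cell_tc H Hg Hg' Hh Hh') as K.
  erewrite !thE in K by (first [eassumption | sc]).
  assert (Kgh : hc (th H g h) (L C0 D0) (L C1 D1)) by (rewrite (thE H Hg Hh); sc).
  assert (Kgh' : hc (th H g' h') (L C1 D1) (L C2 D2)) by (rewrite (thE H Hg' Hh'); sc).
  pose proof (cell_tc H Hf Hf' Kgh Kgh') as K'.
  pose proof (cell_tsE H (cell_vsid Kf) K (vc_vid _) (vc_vid _) (vc_vid _) (vc_vid _)) as K''.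
  rewrite (thE H Hf Kgh), (thE H Hf' Kgh'), (thE H Kf (hc_hcmp Kgh Kgh' eq_refl)) in K'.
  eapply cell_eq; [eapply (cell_v K' K''); [|reflexivity|reflexivity]| | |sc|sc].
  all: rewrite ?(thE H Hg Hh), ?(thE H Hg' Hh'); sc. }
assert (K2 : cell (tc H (th H f g) h (th H f' g') h' / ts H (tc H f g f' g') (vsid (hcmp h h')))
  (hcmp (fh (R D0) (hcmp (fh (R C0) f) (fh (L A1) g))) (hcmp (fh (L (L A1 C1)) h)
   (hcmp (fh (R D1) (hcmp (fh (R C1) f') (fh (L A2) g'))) (fh (L (L A2 C2)) h'))))
  (hcmp (fh (R D0) (hcmp (fh (R C0) (hcmp f f')) (fh (L A2) (hcmp g g')))) (fh (L (L A2 C2)) (hcmp h h')))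
  (vid (L (L A0 C0) D0)) (vid (L (L A2 C2) D2))).
{ pose proof (cell_tc H Hf Hf' Hg Hg') as K.
  erewrite !thE in K by (first [eassumption | sc]).
  assert (Kfg : hc (th H f g) (L A0 C0) (L A1 C1)) by (rewrite (thE H Hf Hg); sc).
  assert (Kfg' : hc (th H f' g') (L A1 C1) (L A2 C2)) by (rewrite (thE H Hf' Hg'); sc).
  pose proof (cell_tc H Kfg Kfg' Hh Hh') as K'.
  pose proof (cell_tsE H K (cell_vsid Kh) (vc_vid _) (vc_vid _) (vc_vid _) (vc_vid _)) as K''.
  rewrite (thE H Kfg Hh), (thE H Kfg' Hh'), (thE H (hc_hcmp Kfg Kfg' eq_refl) Kh) in K'.
  eapply cell_eq; [eapply (cell_v K' K''); [|reflexivity|reflexivity]| | |sc|sc].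
  all: rewrite ?(thE H Hf Hg), ?(thE H Hf' Hg'); sc. }
(* [EL] and [ER] say all that is needed about the two composites; hiding their bodies lets boundary
   inference rely on [K1] and [K2]. *)
set (Wr := tc H f (th H g h) f' (th H g' h') / _) in *.
set (Wl := tc H (th H f g) h (th H f' g') h' / _) in *.
clearbody Wl Wr.
rewrite <- (@interchange _ [fci (R D0) _ _ | _]), <- (@interchange _ [a1 C0 D0 f | _]), !vscmpA by sc.
rewrite ER.
(* Inverse compositors followed by compositors are inserted above [Wl], so that the left side of
   [EL] appears. *)
assert (EW : Wl = [[fci (R D0) (fh (R C0) f) (fh (L A1) g) | vsid (fh (L (L A1 C1)) h)]
  | [fci (R D1) (fh (R C1) f') (fh (L A2) g') | vsid (fh (L (L A2 C2)) h')]] /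
  ([[fc (R D0) (fh (R C0) f) (fh (L A1) g) | vsid (fh (L (L A1 C1)) h)]
  | [fc (R D1) (fh (R C1) f') (fh (L A2) g') | vsid (fh (L (L A2 C2)) h')]] / Wl)).
{ rewrite <- vscmpA by sc. repeat ich. v1. erewrite !fcE_r by sc.
  rewrite <- !vsid_cmp by sc. v1. reflexivity. }
rewrite EW, EL, !vscmpA by sc. f_equal.
rewrite <- (@vscmpA _ [fc (R D0) _ _ | _] [fci (R D0) _ _ | _]), (@interchange _ (fc (R D0) _ _)) by sc.
erewrite fcE_l by sc. v1. rewrite <- (@vsid_cmp _ (hcmp _ _)) by sc. v1.
revert EA; vAr; intros ->. reflexivity.
Qed.
End AssocTransformation.

(** A column of four squares stands beside the single square [d]. Only the row of [c] contains [d];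
    the other rows are padded with identities. *)
Lemma split_rows (B : dblcat) (a b c w d s : sq B) t1 t2 t3 t4 t5 s1 s2 l1 l2 l3 l4 m r X X' Y Y' :
  cell a t1 t2 l1 (vid X) -> cell b t2 t3 l2 (vid X) -> cell c t3 t4 l3 m ->
  cell w t4 t5 l4 (vid Y) -> cell d s1 s2 m r -> hc s1 X X' -> hc s2 Y Y' ->
  vc m X Y -> vc r X' Y' -> top s = hcmp t5 s2 ->
  [a / (b / (c / w)) | d] / s =
  [a | vsid s1] / ([b | vsid s1] / ([c | d] / ([w | vsid s2] / s))).
Proof.
intros Ha Hb Hc Hw Hd Hs1 Hs2 Hm Hr Hs.
assert (Es : top s = bot [w | vsid s2]) by (rewrite Hs; symmetry; sc).
rewrite <- (@vscmpA _ [c | d]), <- (@vscmpA _ [b | _]), <- (@vscmpA _ [a | _]) by (first [sc | rewrite Es; sc]).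
repeat ich. v1. reflexivity.
Qed.

(** * The pentagon *)

Section Pentagon.
Variables (B : dblcat) (H : quasi_functor B).
Notation L := (qL H).
Notation R := (qR H).
Hypothesis Hvv : forall u v, vtrivial (qvv H u v).
Variable P : central_premonoidal (quasi_binoidal H) (purely_exchange (quasi_purely H)).
Notation a1 C D f := (v_h (al1 P C D) f).
Notation a2 C D f := (v_h (al2 P C D) f).
Notation a3 C D f := (v_h (al3 P C D) f).
Notation al := (alo P).

(** The premonoidal pentagon uses the centrality structure chosen for the 1v-cell [al W Y Z]; by
    [cp_al] it is the exchange cell of [H], which can be typed and moved. The next three lemmas do
    the same bookkeeping for the other variables. *)
Lemma pent1 f W Y Z :
  fs (R Z) (a1 W Y f) / (a1 (L W Y) Z f / qhv H f (al W Y Z)) =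
  a1 Y Z (fh (R W) f) / a1 W (L Y Z) f.
Proof.
pose proof (pent_1 P f W Y Z) as E. rewrite (ca_r (cp_al P W Y Z)) in E.
eapply eq_trans; [symmetry; apply vscmpA; sc | exact E].
Qed.
Lemma pent2 V f Y Z :
  fs (R Z) (a2 V Y f) / (a2 V Z (fh (R Y) f) / fs (L V) (a1 Y Z f)) =
  a1 Y Z (fh (L V) f) / a2 V (L Y Z) f.
Proof.
pose proof (pent_2 P V f Y Z) as E. eapply eq_trans; [symmetry; apply vscmpA; sc | exact E].
Qed.
Lemma pent3 V W f Z :
  fs (R Z) (a3 V W f) / (a2 V Z (fh (L W) f) / fs (L V) (a2 W Z f)) =
  a2 (L V W) Z f / a3 V W (fh (R Z) f).
Proof.
pose proof (pent_3 P V W f Z) as E. eapply eq_trans; [symmetry; apply vscmpA; sc | exact E].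
Qed.
Lemma pent4 V W Y f :
  qvh H (al V W Y) f / (a3 V (L W Y) f / fs (L V) (a3 W Y f)) =
  a3 (L V W) Y f / a3 V W (fh (L Y) f).
Proof.
pose proof (pent_4 P V W Y f) as E. rewrite (ca_l (cp_al P V W Y)) in E.
eapply eq_trans; [symmetry; apply vscmpA; sc | exact E].
Qed.
Lemma pento V W Y Z :
  vcmp (fv (R Z) (al V W Y)) (vcmp (al V (L W Y) Z) (fv (L V) (al W Y Z))) =
  vcmp (al (L V W) Y Z) (al V W (L Y Z)).
Proof.
pose proof (pent_o P V W Y Z) as E. eapply eq_trans; [symmetry; apply vcmpA; sc | exact E].
Qed.

(** The compositor law solved for the associativity at a composite, so that one square splits into
    two strands. *)
Lemma a2c_fc C D f f' A A' A'' : hc f A A' -> hc f' A' A'' ->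
  fs (R D) (fc (L C) f f') / a2 C D (hcmp f f') = fci (R D) (fh (L C) f) (fh (L C) f') /
  ([a2 C D f | a2 C D f'] / (fc (L C) (fh (R D) f) (fh (R D) f') / fs (L C) (fc (R D) f f'))).
Proof.
intros Hf Hf'. rewrite (a2_fc P C D Hf Hf'), <- vscmpA by sc. erewrite fcE_r by sc. v1. reflexivity.
Qed.
Lemma a1c_fc C D f f' A A' A'' : hc f A A' -> hc f' A' A'' ->
  a1 C D (hcmp f f') = fs (R D) (fci (R C) f f') / (fci (R D) (fh (R C) f) (fh (R C) f') /
  ([a1 C D f | a1 C D f'] / fc (R (L C D)) f f')).
Proof.
intros Hf Hf'. rewrite (a1_fc P C D Hf Hf').
rewrite <- (@vscmpA _ (fci _ _ _)) by sc. erewrite fcE_r by sc. v1.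
rewrite <- vscmpA, <- fs_vscmp by sc. erewrite fcE_r by sc. rewrite fs_vsid. v1. reflexivity.
Qed.
Lemma a3c_fc C D f f' A A' A'' : hc f A A' -> hc f' A' A'' ->
  a3 C D (hcmp f f') = fci (L (L C D)) f f' / ([a3 C D f | a3 C D f'] /
    (fc (L C) (fh (L D) f) (fh (L D) f') / fs (L C) (fc (L D) f f'))).
Proof.
intros Hf Hf'. rewrite (a3_fc P C D Hf Hf').
rewrite <- vscmpA by sc. erewrite fcE_r by sc. v1. reflexivity.
Qed.

Section Cells.
Variables (f g h k : hor B) (A A' C C' D D' E E' : ob B).
Hypotheses (Hf : hc f A A') (Hg : hc g C C') (Hh : hc h D D') (Hk : hc k E E').

(** On [f], [g], [h], the image of the first associativity under [R E] meets the squares [a1] and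
    [a2] of the second. Moving the inverse compositors up and the compositors down leaves one
    vertical composite of two associativities for each factor. *)
Lemma pentagon_head :
  fs (R E) (ml P f g h) / (fci (R E) (fh (R (L C D)) f) (fh (L A') (th H g h)) /
    [a1 (L C D) E f | a2 A' E (th H g h)]) =
  fci (R E) (fh (R D) (th H f g)) (fh (L (L A' C')) h) /
  ([fs (R E) (fci (R D) (fh (R C) f) (fh (L A') g)) / fci (R E) (fh (R D) (fh (R C) f)) (fh (R D) (fh (L A') g)) | vsid (fh (R E) (fh (L (L A' C')) h))] /
  ([fs (R E) (a1 C D f) / a1 (L C D) E f | [fs (R E) (a2 A' D g) / a2 A' E (fh (R D) g) |
     fs (R E) (a3 A' C' h) / a2 A' E (fh (L C') h)]] /
   [vsid (fh (R (L (L C D) E)) f) | fc (L A') (fh (R E) (fh (R D) g)) (fh (R E) (fh (L C') h)) /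
      fs (L A') (fc (R E) (fh (R D) g) (fh (L C') h))])).
Proof.
rewrite (mlE P Hf Hg Hh), (thE H Hg Hh), (thE H Hf Hg), !fs_vscmp by sc.
rewrite vscmpA, (@vscmpA _ (fs (R E) [a1 C D f | _])) by sc.
assert (E1 : fs (R E) [vsid (fh (R (L C D)) f) | fc (L A') (fh (R D) g) (fh (L C') h)] /
   (fci (R E) (fh (R (L C D)) f) (fh (L A') (hcmp (fh (R D) g) (fh (L C') h))) /
   [a1 (L C D) E f | a2 A' E (hcmp (fh (R D) g) (fh (L C') h))]) =
   (fci (R E) (fh (R (L C D)) f) (hcmp (fh (L A') (fh (R D) g)) (fh (L A') (fh (L C') h))) /
    [vsid (fh (R E) (fh (R (L C D)) f)) | fci (R E) (fh (L A') (fh (R D) g)) (fh (L A') (fh (L C') h))]) /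
    ([a1 (L C D) E f | [a2 A' E (fh (R D) g) | a2 A' E (fh (L C') h)]] /
     [vsid (fh (R (L (L C D) E)) f) | fc (L A') (fh (R E) (fh (R D) g)) (fh (R E) (fh (L C') h)) /
      fs (L A') (fc (R E) (fh (R D) g) (fh (L C') h))])).
{ rewrite <- vscmpA by sc. erewrite fci_nat by sc. rewrite fs_vsid.
  vA. f_equal. repeat ich. v1. f_equal. eapply a2c_fc; sc. }
rewrite E1.
rewrite <- (@vscmpA _ (fs (R E) [a1 C D f | _])) by sc.
erewrite fci_nat3 by sc. vA.
rewrite <- (@vscmpA _ (fci (R E) _ (hcmp _ _))) by sc.
erewrite <- fci_assocE by sc. rewrite vscmpA, <- vscmpA by sc.
erewrite fci_nat by sc. rewrite fs_vsid. vA. f_equal.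
rewrite <- vscmpA, interchange by sc. v1. f_equal.
rewrite <- vscmpA by sc. repeat ich. reflexivity.
Qed.

(** The compositors left over by [pentagon_head] meet the image of the last associativity under
    [L A']. Its inverse compositor cancels against them, leaving strands for [g], [h], [k] above a
    three-fold compositor. *)
Lemma pentagon_tail :
  [fc (L A') (fh (R E) (fh (R D) g)) (fh (R E) (fh (L C') h)) / fs (L A') (fc (R E) (fh (R D) g) (fh (L C') h))
    | vsid (fh (L A') (fh (L (L C' D')) k))] /
  (fc (L A') (fh (R E) (th H g h)) (fh (L (L C' D')) k) / fs (L A') (ml P g h k)) =
  [fs (L A') (a1 D E g) | [fs (L A') (a2 C' E h) | fs (L A') (a3 C' D' k)]] /
  ([vsid (fh (L A') (fh (R (L D E)) g)) | fc (L A') (fh (L C') (fh (R E) h)) (fh (L C') (fh (L D') k)) /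
    fs (L A') (fc (L C') (fh (R E) h) (fh (L D') k))] /
   fc (L A') (fh (R (L D E)) g) (fh (L C') (th H h k))).
Proof.
rewrite (mlE P Hg Hh Hk), (thE H Hg Hh), (thE H Hh Hk), !fs_vscmp by sc.
rewrite <- (@vscmpA _ (fc (L A') _ _) (fs (L A') [fci _ _ _ | _])) by sc.
erewrite <- fc_natE by sc. rewrite fs_vsid. vA.
rewrite <- (@vscmpA _ [_ | vsid _]), interchange by sc. v1.
rewrite (@vscmpA _ (fc (L A') _ _) (fs (L A') _)), <- fs_vscmp by sc. erewrite fcE_l by sc.
rewrite fs_vsid. v1.
rewrite <- (@vscmpA _ [_ | vsid _]) by sc. erewrite fc_assocE by sc. vA.
rewrite <- (@vscmpA _ (fc (L A') _ (hcmp _ _))), <- (@vscmpA _ [vsid _ | fc _ _ _]) by sc.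
erewrite fc_nat3 by sc. vA. f_equal.
erewrite <- fc_natE by sc. rewrite fs_vsid, <- vscmpA, interchange by sc. v1. reflexivity.
Qed.

(** Four strands, for [f], [g], [h] and [k], each of which is the pentagon in the corresponding
    variable. The rest of the argument compares the compositors above and below the strands. *)
Lemma ml_pent :
  ts H (ml P f g h) (vsid k) / (ml P f (th H g h) k / ts H (vsid f) (ml P g h k)) =
  ml P (th H f g) h k / ml P f g (th H h k).
Proof.
assert (Kfg : hc (th H f g) (L A C) (L A' C')) by (rewrite (thE H Hf Hg); sc).
assert (Kgh : hc (th H g h) (L C D) (L C' D')) by (rewrite (thE H Hg Hh); sc).
assert (Khk : hc (th H h k) (L D E) (L D' E')) by (rewrite (thE H Hh Hk); sc).
pose proof (cell_ml P Hf Hg Hh) as K1. pose proof (cell_ml P Hg Hh Hk) as K2.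
rewrite (thE H Kfg Hh), (thE H Hf Kgh) in K1. rewrite (thE H Kgh Hk), (thE H Hg Khk) in K2.
rewrite (ts_vsidr H K1 (vc_alo P A C D) (vc_alo P A' C' D') Hk).
rewrite (ts_vsidl H K2 (vc_alo P C D E) (vc_alo P C' D' E') Hf).
rewrite (mlE P Hf Kgh Hk), (mlE P Kfg Hh Hk), (mlE P Hf Hg Khk).
pose proof pentagon_head as EH. pose proof pentagon_tail as ET.
rewrite ?(thE H Hf Hg), ?(thE H Hg Hh), ?(thE H Hh Hk) in *.
clear Kfg Kgh Khk. set (M1 := ml P f g h) in *. set (M2 := ml P g h k) in *. clearbody M1 M2.
rewrite (a1c_fc D E (f := fh (R C) f) (f' := fh (L A') g) (A := L A C) (A' := L A' C) (A'' := L A' C')) by sc.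
rewrite (a3c_fc A' C' (f := fh (R E) h) (f' := fh (L D') k) (A := L D E) (A' := L D' E) (A'' := L D' E')) by sc.
vA.
(* Head and tail together bring the three associativities on the left side into strand form, with
   compositors only above and below. *)
assert (HD : [fs (R E) M1 | qvh H (al A' C' D') k] /
  ([fci (R E) (fh (R (L C D)) f) (fh (L A') (hcmp (fh (R D) g) (fh (L C') h))) | vsid (fh (L (L A' (L C' D'))) k)] /
   ([a1 (L C D) E f | [a2 A' E (hcmp (fh (R D) g) (fh (L C') h)) | a3 A' (L C' D') k]] /
   ([vsid (fh (R (L (L C D) E)) f)
       | fc (L A') (fh (R E) (hcmp (fh (R D) g) (fh (L C') h))) (fh (L (L C' D')) k)] /
      [qhv H f (al C D E) | fs (L A') M2]))) =
  [fci (R E) (fh (R D) (hcmp (fh (R C) f) (fh (L A') g))) (fh (L (L A' C')) h) | vsid (fh (L (L (L A' C') D')) k)] /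
  ([[fs (R E) (fci (R D) (fh (R C) f) (fh (L A') g)) / fci (R E) (fh (R D) (fh (R C) f)) (fh (R D) (fh (L A') g)) |
     vsid (fh (R E) (fh (L (L A' C')) h))] | vsid (fh (L (L (L A' C') D')) k)] /
  ([[fs (R E) (a1 C D f) / a1 (L C D) E f | [fs (R E) (a2 A' D g) / a2 A' E (fh (R D) g) |
     fs (R E) (a3 A' C' h) / a2 A' E (fh (L C') h)]] | qvh H (al A' C' D') k / a3 A' (L C' D') k] /
  [qhv H f (al C D E) | [fs (L A') (a1 D E g) | [fs (L A') (a2 C' E h) | fs (L A') (a3 C' D' k)]] /
  ([vsid (fh (L A') (fh (R (L D E)) g)) | fc (L A') (fh (L C') (fh (R E) h)) (fh (L C') (fh (L D') k)) /
    fs (L A') (fc (L C') (fh (R E) h) (fh (L D') k))] /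
   fc (L A') (fh (R (L D E)) g) (fh (L C') (hcmp (fh (R E) h) (fh (L D') k))))]))).
{ rewrite <- (@hscmpA _ (a1 (L C D) E f)), <- ET by sc.
  rewrite <- (@vscmpA _ [fci _ _ _ | _]), <- (@vscmpA _ [fs (R E) M1 | _]) by sc.
  rewrite (@interchange _ (fci _ _ _)), (@interchange _ (fs (R E) M1)), EH by sc. v1.
  erewrite split_rows by sc. f_equal. f_equal. f_equal.
  rewrite (@hscmpA _ (vsid _) (_ / _) (vsid _)) by sc. lhs (repeat ich; v1). reflexivity. }
rewrite HD. clear HD EH ET. f_equal.
rewrite (@hscmpA _ (_ / a1 _ _ _)), (@hscmpA _ (_ / a2 _ _ _)) by sc.
rewrite (@interchange _ (_ / a1 _ _ _)) by sc.
rewrite <- (@vscmpA _ [_ / a2 _ _ _ | _]), (@interchange _ (_ / a2 _ _ _)), (@interchange _ (_ / a2 _ _ _)) by sc.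
rewrite (@vscmpA _ (fs _ _) (a1 _ _ _)), !(@vscmpA _ (fs _ _) (a2 _ _ _)), (@vscmpA _ (qvh _ _ _)) by sc.
(* One pentagon per strand; from here on only compositors and their inverses have to be
   cancelled. *)
rewrite pent1, pent2, pent3, pent4.
rewrite <- (@hscmpA _ (a1 C (L D E) f)) by sc.
rhs (rewrite <- !(@vscmpA _ _ _ [vsid _ | fc (L A') _ _]), (@interchange _ (fci (R (L D E)) _ _)), (@interchange _ (vsid _)), interchange by sc; v1).
vA. rewrite <- (@vscmpA _ (fc (R (L D E)) _ _)), <- (@vscmpA _ (fc (L (L A' C')) _ _)) by sc.
erewrite !fcE_l by sc. v1.
rewrite (@interchange _ (a1 D E _) (a1 D E _)), <- (@vscmpA _ [a2 _ _ _ | _] [a3 _ _ _ | _]), (@interchange _ (a2 _ _ _) (a3 _ _ _)) by sc.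
rewrite <- (@vscmpA _ [_ / a2 _ _ _ | _] [_ | _]), (@interchange _ (_ / a2 _ _ _) _ (vsid _)) by sc. v1.
rewrite <- (@vscmpA _ (fs (R E) _)) by sc.
rewrite <- (@vscmp1l' _ (hcmp (fh (R E) (fh (L (L A' C')) h)) (fh (L (L (L A' C') D')) k)) ([_ / _ | _] / (fc _ _ _ / _))) by sc.
lhs v1. rewrite <- (@interchange _ (fs (R E) _ / _) (vsid _)), vscmpA by sc. f_equal.
- rewrite hscmpA, <- vsid_cmp by sc. reflexivity.
- rewrite (@hscmpA _ (_ / a1 _ _ _) (_ / a2 _ _ _)), interchange by sc. v1. reflexivity.
Qed.
End Cells.
End Pentagon.

(** * Units and triangles *)

Section FunctorUnits.
Variables (S D : dblcat) (F : psfun S D).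
Lemma fuE_l' A X : F A = X -> fu F A / fui F A = vsid (hid X).
Proof. intros <-. apply fuE_l. Qed.
Lemma fui_hcmp A X Y x t b r : F A = X -> cell x t b (vid X) r -> hc t X Y ->
  [fui F A | x] = [fui F A | vsid t] / x.
Proof.
intros EX Hx Ht.
rewrite <- (@hscmp1l' _ (vid X) x) at 2 by sc. rewrite hsid_vid, interchange by sc. v1. reflexivity.
Qed.
Lemma hcmp_fui A X Y x t b l : F A = X -> cell x t b l (vid X) -> hc t Y X ->
  [x | fui F A] = [vsid t | fui F A] / x.
Proof.
intros EX Hx Ht.
rewrite <- (@hscmp1r' _ (vid X) x) at 2 by sc. rewrite hsid_vid, interchange by sc. v1. reflexivity.
Qed.
Lemma fui_vcmp A X y z t m b r r' : F A = X -> cell y t m (vid X) r -> cell z m b (vid X) r' ->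
  [fui F A | y / z] = [fui F A | y] / z.
Proof.
intros EX Hy Hz. rewrite <- (@hscmp1l' _ (vid X) z) at 2 by sc.
rewrite hsid_vid, interchange by sc. v1. reflexivity.
Qed.
Lemma vcmp_fui A X y z t m b l l' : F A = X -> cell y t m l (vid X) -> cell z m b l' (vid X) ->
  [y / z | fui F A] = [y | fui F A] / z.
Proof.
intros EX Hy Hz. rewrite <- (@hscmp1r' _ (vid X) z) at 2 by sc.
rewrite hsid_vid, interchange by sc. v1. reflexivity.
Qed.
Lemma fc_hid_fui A X : F A = X -> fc F (hid A) (hid A) / fui F A = [fui F A | fui F A].
Proof.
intros EX. rewrite (fcU_l F (hc_hid A)). symmetry. eapply fui_hcmp; sc.
Qed.
Lemma fs_cmpE a b f f' u u' g g' w A A' A'' C C' C'' : cell a f f' u u' -> cell b g g' u' w ->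
  vc u A C -> vc u' A' C' -> vc w A'' C'' ->
  fs F [a | b] = fci F f g / ([fs F a | fs F b] / fc F f' g').
Proof.
intros Ha Hb Hu Hu' Hw. sat. erewrite fc_natE, <- vscmpA by (first [eassumption | sc]).
erewrite fcE_r by eassumption. v1. reflexivity.
Qed.
End FunctorUnits.

Section Triangles.
Variables (B : dblcat) (H : quasi_functor B).
Notation L := (qL H).
Notation R := (qR H).
Hypothesis Hvv : forall u v, vtrivial (qvv H u v).
Variable P : central_premonoidal (quasi_binoidal H) (purely_exchange (quasi_purely H)).
Notation a1 C D f := (v_h (al1 P C D) f).
Notation a2 C D f := (v_h (al2 P C D) f).
Notation a3 C D f := (v_h (al3 P C D) f).
Notation al := (alo P).
Notation I := (pI P).
Notation lm f := (v_h (lam P) f).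
Notation rh f := (v_h (rho P) f).

(** The product of [hid I] with [f] has the extra factor [fh (R _) (hid I)], an image of an
    identity. An inverse unitor removes it before [lam] applies; [rr] is dual. *)
Definition ll f := [fui (R (hsrc f)) I | vsid (fh (L I) f)] / lm f.
Definition rr f := [vsid (fh (R I) f) | fui (L (htgt f)) I] / rh f.
Lemma llE f A A' : hc f A A' -> ll f = [fui (R A) I | vsid (fh (L I) f)] / lm f.
Proof. now intros [<- <-]. Qed.
Lemma rrE f A A' : hc f A A' -> rr f = [vsid (fh (R I) f) | fui (L A') I] / rh f.
Proof. now intros [<- <-]. Qed.
Lemma cell_ll f A A' : hc f A A' -> cell (ll f) (th H (hid I) f) f (v_o (lam P) A) (v_o (lam P) A').
Proof. intros Hf. rewrite (llE Hf), (thE H (hc_hid I) Hf). sc. Qed.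
Lemma cell_rr f A A' : hc f A A' -> cell (rr f) (th H f (hid I)) f (v_o (rho P) A) (v_o (rho P) A').
Proof. intros Hf. rewrite (rrE Hf), (thE H Hf (hc_hid I)). sc. Qed.

Lemma lm_nat a f f' u u' : cell a f f' u u' -> lm f / a = fs (L I) a / lm f'.
Proof. exact (vstrict_nat (lamP P) (a := a) (f := f) (f' := f') (u := u) (u' := u')). Qed.
Lemma rh_nat a f f' u u' : cell a f f' u u' -> rh f / a = fs (R I) a / rh f'.
Proof. exact (vstrict_nat (rhoP P) (a := a) (f := f) (f' := f') (u := u) (u' := u')). Qed.
Lemma lm_fc f f' A A' A'' : hc f A A' -> hc f' A' A'' ->
  [lm f | lm f'] = fc (L I) f f' / lm (hcmp f f').
Proof.
intros Hf Hf'. pose proof (vstrict_fc (lamP P) Hf Hf') as E. simpl in E.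
rewrite vscmp1r' in E by sc. exact E.
Qed.
Lemma rh_fc f f' A A' A'' : hc f A A' -> hc f' A' A'' ->
  [rh f | rh f'] = fc (R I) f f' / rh (hcmp f f').
Proof.
intros Hf Hf'. pose proof (vstrict_fc (rhoP P) Hf Hf') as E. simpl in E.
rewrite vscmp1r' in E by sc. exact E.
Qed.
Lemma lm_fu A : hsid (v_o (lam P) A) = fu (L I) A / lm (hid A).
Proof.
pose proof (vh_id (vsi_trans (lamP P)) A) as E; simpl in E.
rewrite vscmp1r' in E by sc. exact E.
Qed.
Lemma rh_fu A : hsid (v_o (rho P) A) = fu (R I) A / rh (hid A).
Proof.
pose proof (vh_id (vsi_trans (rhoP P)) A) as E; simpl in E.
rewrite vscmp1r' in E by sc. exact E.
Qed.
(** The unit axiom turned around by [vinv_conj]: at an identity, above an inverse unitor, the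
    associativity degenerates to the identity square of its 1v-component. This and its two
    companions remove the strand of [I] from the triangles. *)
Lemma a1_fui C D A : a1 C D (hid A) / fui (R (L C D)) A =
  (fs (R D) (fui (R C) A) / fui (R D) (L A C)) / hsid (al A C D).
Proof.
eapply vinv_conj with (p := fu (R D) (L A C) / fs (R D) (fu (R C) A)) (q := fu (R (L C D)) A).
- apply vinv_vcmp; [sc | apply fuK | apply vinv_fs, fuK].
- apply fuK.
- sc.
- sc.
- rewrite <- al1_o, <- (qRL H A C). exact (vh_id (vsi_trans (al1P P C D)) A).
Qed.
Lemma a2_fui C D A : a2 C D (hid A) / (fs (L C) (fui (R D) A) / fui (L C) (L A D)) =
  (fs (R D) (fui (L C) A) / fui (R D) (L C A)) / hsid (al C A D).
Proof.
eapply vinv_conj with (p := fu (R D) (L C A) / fs (R D) (fu (L C) A))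
  (q := fu (L C) (L A D) / fs (L C) (fu (R D) A)).
- apply vinv_vcmp; [sc | apply fuK | apply vinv_fs, fuK].
- apply vinv_vcmp; [sc | apply fuK | apply vinv_fs, fuK].
- sc.
- sc.
- rewrite <- al2_o. pose proof (vh_id (vsi_trans (al2P P C D)) A) as E; simpl in E.
  rewrite qRL in E. exact E.
Qed.
Lemma a3_fui C D A : a3 C D (hid A) / (fs (L C) (fui (L D) A) / fui (L C) (L D A)) =
  fui (L (L C D)) A / hsid (al C D A).
Proof.
eapply vinv_conj with (p := fu (L (L C D)) A) (q := fu (L C) (L D A) / fs (L C) (fu (L D) A)).
- apply fuK.
- apply vinv_vcmp; [sc | apply fuK | apply vinv_fs, fuK].
- sc.
- sc.
- rewrite <- al3_o. exact (vh_id (vsi_trans (al3P P C D)) A).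
Qed.
(** The unit law of the quasi-functor in the first variable, rearranged so that an exchange cell at
    an identity disappears next to an inverse unitor. *)
Lemma qhh_hidl g C C' : hc g C C' -> forall A,
  qhh H (hid A) g / [fui (R C) A | vsid (fh (L A) g)] = [vsid (fh (L A) g) | fui (R C') A].
Proof.
intros Hg A. pose proof (qhh_idl H A Hg) as E.
rewrite <- (@vscmp1l' _ (hcmp (fh (L A) g) (fh (R C') (hid A))) (qhh H (hid A) g)) by sc.
rewrite vsid_cmp, <- (fuE_r (R C')) by sc. rewrite vsid_whl, !vscmpA, <- (@vscmpA _ [_ | fu (R C') A]) by sc.
rewrite E, interchange by sc. rewrite (fuE_l' (X := L A C)) by sc. v1. rewrite <- vsid_cmp by sc. v1. reflexivity.
Qed.
Lemma qhh_hidr f A A' : hc f A A' -> forall C,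
  qhh H f (hid C) / [vsid (fh (R C) f) | fui (L A') C] = [fui (L A) C | vsid (fh (R C) f)].
Proof.
intros Hf C. pose proof (qhh_idr H C Hf) as E.
rewrite <- (@vscmp1l' _ (hcmp (fh (L A) (hid C)) (fh (R C) f)) (qhh H f (hid C))) by sc.
rewrite vsid_cmp, <- (fuE_r (L A)) by sc. rewrite vsid_whr, !vscmpA, <- (@vscmpA _ [fu (L A) C | _]) by sc.
rewrite E, interchange by sc. rewrite (fuE_l' (X := L A' C)) by sc. v1. rewrite <- vsid_cmp by sc. v1. reflexivity.
Qed.

(** In the compositor of the product, the exchange cell at [hid I] is absorbed by [qhh_hidl] and the
    compositor of two identities by [fc_hid_fui]. What remains is the compositor law of [lam]. *)
Lemma ll_fc f f' A A' A'' : hc f A A' -> hc f' A' A'' ->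
  [ll f | ll f'] = tc H (hid I) f (hid I) f' / ll (hcmp f f').
Proof.
intros Hf Hf'. assert (K : hc (hcmp f f') A A'') by sc.
rewrite (llE Hf), (llE Hf'), (llE K), (tcE H (hc_hid I) (hc_hid I) Hf Hf').
rewrite <- interchange, (lm_fc Hf Hf'), <- (@vscmpA _ _ (fc (L I) f f')) by sc.
vA. rewrite <- (@vscmpA _ [fc _ _ _ | _] [fui _ _ | _]), (@interchange _ (fc _ _ _)) by sc.
rewrite (fc_hid_fui (X := L I A)) by sc. v1.
rewrite (@hscmpA _ (fui _ _) (fui _ _)) by sc. erewrite (fui_hcmp (x := fc _ _ _)), fui_vcmp by sc.
vA. rewrite <- (@vscmpA _ [vsid _ | _]) by sc. f_equal.
repeat ich. v1. rewrite (@vsid_cmp _ (fh (L I) f)), <- (@hscmpA _ (fui _ _) (vsid _)), (@interchange _ (qhh _ _ _)) by sc.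
rewrite (qhh_hidl Hf). v1. hA. reflexivity.
Qed.

Lemma rr_fc f f' A A' A'' : hc f A A' -> hc f' A' A'' ->
  [rr f | rr f'] = tc H f (hid I) f' (hid I) / rr (hcmp f f').
Proof.
intros Hf Hf'. assert (K : hc (hcmp f f') A A'') by sc.
rewrite (rrE Hf), (rrE Hf'), (rrE K), (tcE H Hf Hf' (hc_hid I) (hc_hid I)).
rewrite <- interchange, (rh_fc Hf Hf') by sc.
vA. rewrite <- (@vscmpA _ [fc _ _ _ | _] [_ | fui _ _]), (@interchange _ (fc _ _ _)) by sc.
rewrite (fc_hid_fui (X := L A'' I)) by sc. v1.
rewrite <- (@hscmpA _ (fc _ _ _) (fui _ _)) by sc. erewrite (hcmp_fui (x := fc _ _ _)), vcmp_fui by sc.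
vA. rewrite <- (@vscmpA _ [vsid _ | _]) by sc. f_equal.
rewrite <- (@hscmpA _ (vsid _) (qhh _ _ _)) by sc.
repeat ich. v1. rewrite (@vsid_cmp _ (fh (R I) f)), (@hscmpA _ (vsid _) (vsid _)), interchange by sc.
rewrite (qhh_hidr Hf'). v1. hA. reflexivity.
Qed.

Lemma qhv_fui u A C C' : vc u C C' ->
  qhv H (hid A) u / fui (R C') A = fui (R C) A / hsid (fv (L A) u).
Proof.
intros Hu. eapply vinv_conj; [apply fuK | apply fuK | sc | sc | apply qhv_fu; exact Hu].
Qed.
Lemma qvh_fui u A A' C : vc u A A' ->
  qvh H u (hid C) / fui (L A') C = fui (L A) C / hsid (fv (R C) u).
Proof.
intros Hu. eapply vinv_conj; [apply fuK | apply fuK | sc | sc | apply qvh_fu; exact Hu].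
Qed.

Lemma ll_nat a f f' u u' A A' C C' : cell a f f' u u' -> vc u A C -> vc u' A' C' ->
  ll f / a = ts H (vsid (hid I)) a / ll f'.
Proof.
intros Ha Hu Hu'. sat. erewrite !llE, (ts_vsidl H Ha Hu Hu' (hc_hid I)) by eassumption.
rewrite vscmpA, (lm_nat Ha), <- !vscmpA, !interchange by sc. v1. f_equal.
rewrite (qhv_fui I Hu).
rewrite <- (@vscmp1l' _ (fh (L I) f) (fs (L I) a)) at 2 by sc.
rewrite <- interchange, hscmp1l' by sc. reflexivity.
Qed.
Lemma rr_nat a f f' u u' A A' C C' : cell a f f' u u' -> vc u A C -> vc u' A' C' ->
  rr f / a = ts H a (vsid (hid I)) / rr f'.
Proof.
intros Ha Hu Hu'. sat. erewrite !rrE, (ts_vsidr H Ha Hu Hu' (hc_hid I)) by eassumption.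
rewrite vscmpA, (rh_nat Ha), <- !vscmpA, !interchange by sc. v1. f_equal.
rewrite (qvh_fui I Hu').
rewrite <- (@vscmp1l' _ (fh (R I) f) (fs (R I) a)) at 2 by sc.
rewrite <- interchange, hscmp1r' by sc. reflexivity.
Qed.
Lemma ll_fu A : hsid (v_o (lam P) A) = tu H I A / ll (hid A).
Proof.
rewrite (llE (hc_hid A)). unfold tu. rewrite <- vscmpA, interchange by sc.
rewrite (fuE_l' (X := L I A)) by sc. v1. rewrite <- hsid_vid, hscmp1l' by sc. apply lm_fu.
Qed.
Lemma rr_fu A : hsid (v_o (rho P) A) = tu H A I / rr (hid A).
Proof.
rewrite (rrE (hc_hid A)). unfold tu. rewrite <- vscmpA, interchange by sc.
rewrite (fuE_l' (X := L A I)) by sc. v1. rewrite <- hsid_vid, hscmp1r' by sc. apply rh_fu.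
Qed.

Lemma triM1 f Y : a1 I Y f / qhv H f (v_o (lam P) Y) = fs (R Y) (rh f).
Proof. pose proof (triM_1 P f Y) as E. rewrite (ca_r (cp_lam P Y)) in E. exact E. Qed.
Lemma triM2 W f : a3 W I f / fs (L W) (lm f) = qvh H (v_o (rho P) W) f.
Proof. pose proof (triM_2 P W f) as E. rewrite (ca_l (cp_rho P W)) in E. exact E. Qed.
Lemma triL1 f Y : a2 I Y f / lm (fh (R Y) f) = fs (R Y) (lm f).
Proof. exact (triL_1 P f Y). Qed.
Lemma triL2 W f : a3 I W f / lm (fh (L W) f) = qvh H (v_o (lam P) W) f.
Proof. pose proof (triL_2 P W f) as E. rewrite (ca_l (cp_lam P W)) in E. exact E. Qed.
Lemma triR1 f Y : a1 Y I f / qhv H f (v_o (rho P) Y) = rh (fh (R Y) f).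
Proof. pose proof (triR_1 P f Y) as E. rewrite (ca_r (cp_rho P Y)) in E. exact E. Qed.
Lemma triR2 W f : a2 W I f / fs (L W) (rh f) = rh (fh (L W) f).
Proof. exact (triR_2 P W f). Qed.

(** Strand by strand: [triM1] for [f], [a2_fui] for the identity of [I], and [triM2] for [g]. The
    other two triangles are treated alike, with the unit strand in first or in last position. *)
Lemma ml_triM f g A A' C C' : hc f A A' -> hc g C C' ->
  ml P f (hid I) g / ts H (vsid f) (ll g) = ts H (rr f) (vsid g).
Proof.
intros Hf Hg.
pose proof (cell_ll Hg) as K1. pose proof (cell_rr Hf) as K2.
rewrite (thE H (hc_hid I) Hg) in K1. rewrite (thE H Hf (hc_hid I)) in K2.
rewrite (ts_vsidl H K1 (vc_lam P C) (vc_lam P C') Hf), (ts_vsidr H K2 (vc_rho P A) (vc_rho P A') Hg).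
rewrite (mlE P Hf (hc_hid I) Hg), (llE Hg), (rrE Hf), !fs_vscmp by sc.
erewrite (fs_cmpE (L A')), (fs_cmpE (R C)) by sc. rewrite !fs_vsid.
rewrite (@fcU_l _ _ (L A') _ (L I C) (L I C')) by sc.
rewrite (@fcU_r _ _ (R C) _ (L A I) (L A' I)) by sc.
vA. rewrite (@interchange _ (vsid _) (fc _ _ _)) by sc. rewrite <- (@vscmpA _ (fc _ _ _)) by sc.
erewrite fcE_l by sc. v1.
rewrite (@interchange _ (a1 _ _ _)), triM1 by sc.
rewrite <- (@vscmpA _ [fs _ _ | _] [fui _ _ | _]), (@interchange _ (fs _ _) _ (fui _ _)) by sc. v1.
rewrite <- (@vscmpA _ [a2 _ _ _ | _]), (@interchange _ (a2 _ _ _)), a2_fui by sc. v1.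
(* The unit strand has shrunk to an identity square on the associativity 1v-cell; the neighbouring
   square absorbs it. *)
assert (E1 : [fs (R C) (fui (L A') I) / fui (R C) (L A' I) / hsid (al A' I C) | a3 A' I g] =
  [fs (R C) (fui (L A') I) / fui (R C) (L A' I) | vsid (fh (L (L A' I)) g)] / a3 A' I g).
{ rewrite <- (@hscmp1l' _ (al A' I C) (a3 A' I g)) at 2 by sc. rewrite interchange by sc. v1. reflexivity. }
rewrite E1, vscmpA, triM2 by sc. clear E1.
rewrite <- (@hscmp1l' _ (fv (R C) (v_o (rho P) A')) (qvh H (v_o (rho P) A') g)) at 1 by sc.
rewrite (@interchange _ (fs _ _ / _)), <- hscmpA by sc. v1.
rewrite (@interchange _ (fci _ _ _)) by sc. v1. f_equal. f_equal.
rewrite <- (@vscmpA _ [vsid _ | _]), (@interchange _ (vsid _)) by sc. v1.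
rewrite <- (@hscmp1r' _ (fv (R C) (v_o (rho P) A')) (fs (R C) (rh f))) at 2 by sc.
rewrite interchange by sc. v1. reflexivity.
Qed.

Lemma ml_triL f g A A' C C' : hc f A A' -> hc g C C' ->
  ml P (hid I) f g / ll (th H f g) = ts H (ll f) (vsid g).
Proof.
intros Hf Hg.
assert (K : hc (th H f g) (L A C) (L A' C')) by (rewrite (thE H Hf Hg); sc).
pose proof (cell_ll Hf) as K1. rewrite (thE H (hc_hid I) Hf) in K1.
rewrite (ts_vsidr H K1 (vc_lam P A) (vc_lam P A') Hg).
rewrite (mlE P (hc_hid I) Hf Hg), (llE K), (llE Hf), (thE H Hf Hg), !fs_vscmp by sc.
erewrite (fs_cmpE (R C)) by sc. rewrite !fs_vsid.
rewrite (@fcU_l _ _ (R C) _ (L I A) (L I A')) by sc.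
vA. rewrite <- (@vscmpA _ [vsid _ | fc _ _ _]), (@interchange _ (vsid _)) by sc. v1.
erewrite (fui_hcmp (x := fc _ _ _)), (@vscmpA _ [fui _ _ | _] (fc _ _ _)) by sc.
erewrite <- lm_fc by sc.
rewrite <- (@vscmpA _ [a1 _ _ _ | _]), (@interchange _ (a1 _ _ _)), a1_fui by sc. v1.
assert (E1 : [fs (R C) (fui (R A) I) / fui (R C) (L I A) / hsid (al I A C) | [a2 I C f | a3 I A' g]] =
  [fs (R C) (fui (R A) I) / fui (R C) (L I A) | vsid (hcmp (fh (R C) (fh (L I) f)) (fh (L (L I A')) g))] / [a2 I C f | a3 I A' g]).
{ rewrite <- (@hscmp1l' _ (al I A C) [a2 I C f | _]) at 2 by sc. rewrite interchange by sc. v1. reflexivity. }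
rewrite E1, vscmpA, (@interchange _ (a2 _ _ _)), triL1, triL2 by sc. clear E1.
rewrite vsid_cmp, <- hscmpA, !interchange by sc. v1. f_equal. f_equal.
rewrite <- vscmpA, interchange by sc. v1. reflexivity.
Qed.

Lemma ml_triR f g A A' C C' : hc f A A' -> hc g C C' ->
  ml P f g (hid I) / ts H (vsid f) (rr g) = rr (th H f g).
Proof.
intros Hf Hg.
assert (K : hc (th H f g) (L A C) (L A' C')) by (rewrite (thE H Hf Hg); sc).
pose proof (cell_rr Hg) as K1. rewrite (thE H Hg (hc_hid I)) in K1.
rewrite (ts_vsidl H K1 (vc_rho P C) (vc_rho P C') Hf).
rewrite (mlE P Hf Hg (hc_hid I)), (rrE K), (rrE Hg), (thE H Hf Hg), !fs_vscmp by sc.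
erewrite (fs_cmpE (L A')) by sc. rewrite !fs_vsid.
rewrite (@fcU_r _ _ (L A') _ (L C I) (L C' I)) by sc.
vA. rewrite (@interchange _ (vsid _) (fc _ _ _)) by sc. rewrite <- (@vscmpA _ (fc _ _ _)) by sc.
erewrite fcE_l by sc. v1.
rewrite (@interchange _ (a1 _ _ _)), triR1 by sc.
rewrite <- (@vscmpA _ [vsid _ | fs _ _] [vsid _ | fui _ _]), (@interchange _ _ (fs _ _) _ (fui _ _)) by sc. v1.
rewrite <- (@vscmpA _ [a2 _ _ _ | _]), (@interchange _ (a2 _ _ _)), a3_fui by sc. v1.
assert (E1 : [a2 A' I g | fui (L (L A' C')) I / hsid (al A' C' I)] =
  [vsid (fh (R I) (fh (L A') g)) | fui (L (L A' C')) I] / a2 A' I g).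
{ rewrite <- (@hscmp1r' _ (al A' C' I) (a2 A' I g)) at 2 by sc. rewrite interchange by sc. v1. reflexivity. }
rewrite E1, vscmpA, triR2 by sc. clear E1.
rewrite <- (@vscmp1l' _ (fh (R I) (fh (R C) f)) (rh (fh (R C) f))) by sc.
rewrite <- interchange by sc. erewrite rh_fc by sc. rewrite <- !vscmpA by sc. f_equal.
rewrite <- hscmpA, <- vsid_cmp, interchange by sc. v1.
erewrite hcmp_fui, vscmpA, fcE_r by sc. v1. reflexivity.
Qed.
End Triangles.

(** * Invertibility of the structure squares *)

Section Inverses.
Variable D : dblcat.
(** Sides of vertically inverse squares are inverse 1v-cells, and these are unique; hence the
    inverses of adjacent squares are adjacent. *)
Lemma vinv_rgt_lft (a b c d : sq D) : vinv a b -> vinv c d -> rgt a = lft c -> rgt b = lft d.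
Proof.
intros Ha Hc E.
pose proof (vinv_sym Ha) as Hb.
pose proof (vinv_rgt Hb) as E1. pose proof (vinv_lft Hc) as E2.
assert (S1 : vtgt (rgt a) = vsrc (rgt b)).
{ rewrite <- htgt_bot, <- htgt_top. now destruct Ha as (-> & _). }
assert (S2 : vtgt (rgt b) = vsrc (rgt a)).
{ rewrite <- htgt_bot, <- htgt_top. now destruct Hb as (-> & _). }
assert (S3 : vtgt (lft c) = vsrc (lft d)).
{ rewrite <- hsrc_bot, <- hsrc_top. now destruct Hc as (-> & _). }
rewrite <- (vcmp1r (rgt b)), S2.
replace (vid (vsrc (rgt a))) with (vcmp (lft c) (lft d)).
- rewrite <- E, <- vcmpA by congruence.
  rewrite E1, htgt_top, <- S1, E, S3. apply vcmp1l.
- rewrite E2, hsrc_top, E. reflexivity.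
Qed.
Lemma hcmp_invertible (a b a' b' : sq D) : rgt a = lft b -> vinv a a' -> vinv b b' ->
  vinv [a | b] [a' | b'] .
Proof. intros E Ha Hb. apply vinv_hcmp; [exact E | eapply vinv_rgt_lft; eassumption | exact Ha | exact Hb]. Qed.
End Inverses.

Section StructureInverses.
Variables (B : dblcat) (H : quasi_functor B).
Variable P : central_premonoidal (quasi_binoidal H) (purely_exchange (quasi_purely H)).
Lemma ml_inv f g h A A' C C' D D' : hc f A A' -> hc g C C' -> hc h D D' ->
  exists b, vinv (ml P f g h) b.
Proof.
intros Hf Hg Hh. rewrite (mlE P Hf Hg Hh).
destruct (vsi_inv (al1P P C D) f) as [x Hx].
destruct (vsi_inv (al2P P A' D) g) as [y Hy].
destruct (vsi_inv (al3P P A' C') h) as [z Hz].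
eexists. apply vinv_vcmp; [sc | | apply vinv_vcmp; [sc | | ]].
- apply hcmp_invertible; [sc | | apply vinv_id].
  eapply vinv_sym, fcKv; sc.
- apply hcmp_invertible; [sc | exact Hx | apply hcmp_invertible; [sc | exact Hy | exact Hz]].
- apply hcmp_invertible; [sc | apply vinv_id | eapply fcKv; sc].
Qed.
Lemma ll_inv f A A' : hc f A A' -> exists b, vinv (ll P f) b.
Proof.
intros Hf. rewrite (llE P Hf). destruct (vsi_inv (lamP P) f) as [x Hx].
eexists. apply vinv_vcmp; [sc | | exact Hx].
apply hcmp_invertible; [sc | | apply vinv_id].
apply vinv_sym, fuK.
Qed.
Lemma rr_inv f A A' : hc f A A' -> exists b, vinv (rr P f) b.
Proof.
intros Hf. rewrite (rrE P Hf). destruct (vsi_inv (rhoP P) f) as [x Hx].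
eexists. apply vinv_vcmp; [sc | | exact Hx].
apply hcmp_invertible; [sc | apply vinv_id |].
apply vinv_sym, fuK.
Qed.
End StructureInverses.

(** * The monoidal double category of a central premonoidal quasi-functor *)

Section Assemble.
Variables (B : dblcat) (H : quasi_functor B).
Notation L := (qL H).
Notation R := (qR H).
Hypothesis Hvv : forall u v, vtrivial (qvv H u v).
Variable P : central_premonoidal (quasi_binoidal H) (purely_exchange (quasi_purely H)).
Notation al := (alo P).
Notation I := (pI P).
Notation T := (tensf Hvv).
Notation BBB := (dblprod (dblprod B B) B).

Definition mal0 : vdat BBB B := Vdat (C := BBB)
  (fun A => al (fst (fst A)) (snd (fst A)) (snd A))
  (fun f => ml P (fst (fst f)) (snd (fst f)) (snd f))
  (fun u => hsid (vcmp (al (vsrc (fst (fst u))) (vsrc (snd (fst u))) (vsrc (snd u)))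
     (tv H (fst (fst u)) (tv H (snd (fst u)) (snd u)))))
  (fun u => hsid (vcmp (al (vsrc (fst (fst u))) (vsrc (snd (fst u))) (vsrc (snd u)))
     (tv H (fst (fst u)) (tv H (snd (fst u)) (snd u))))).

Lemma al_nat u v w A A' C C' D D' : vc u A A' -> vc v C C' -> vc w D D' ->
  vcmp (al A C D) (tv H u (tv H v w)) = vcmp (tv H (tv H u v) w) (al A' C' D').
Proof.
intros Hu Hv Hw.
assert (K1 : vc (tv H u v) (L A C) (L A' C')) by (rewrite (tvE H Hu Hv); sc).
assert (K2 : vc (tv H v w) (L C D) (L C' D')) by (rewrite (tvE H Hv Hw); sc).
rewrite (tvE H Hu K2), (tvE H K1 Hw), (tvE H Hu Hv), (tvE H Hv Hw). symmetry; sc.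
Qed.

Lemma th_hc f g A A' C C' : hc f A A' -> hc g C C' -> hc (th H f g) (L A C) (L A' C').
Proof. intros Hf Hg. rewrite (thE H Hf Hg). sc. Qed.

Lemma mal0P : is_vstrict_iso (tensl T) (tensr T) mal0.
Proof.
apply (@hsid_vtrans BBB B (tensl T) (tensr T) (fun A => al (fst (fst A)) (snd (fst A)) (snd A))
  (fun f => ml P (fst (fst f)) (snd (fst f)) (snd f))); intros; splitpairs.
- apply vc_alo.
- eapply cell_ml; apply hc_refl.
- eapply al_nat; apply vc_refl.
(* The projections inside [tensl] and [tensr] have identity compositors. With these removed, the
   goal is [ml_fc]. *)
- v1. erewrite !ts_vsid by apply hc_refl.
  rewrite !(@vscmp1r' _ (th H _ _) (tc H _ _ _ _)) by (eapply c_bot, cell_tc; bounds).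
  eapply ml_fc; bounds.
- v1. erewrite !ts_vsid by apply hc_refl.
  rewrite !(@vscmp1r' _ (th H _ _) (tu H _ _)) by apply (c_bot (cell_tu H _ _)).
  apply ml_fu.
- eapply ml_nat; bounds.
- eapply ml_inv; bounds.
Qed.

Definition mlam0 : vdat B B := Vdat (C := B)
  (fun A => v_o (lam P) A) (fun f => ll P f)
  (fun u => hsid (vcmp (v_o (lam P) (vsrc u)) u)) (fun u => hsid (vcmp (v_o (lam P) (vsrc u)) u)).
Definition mrho0 : vdat B B := Vdat (C := B)
  (fun A => v_o (rho P) A) (fun f => rr P f)
  (fun u => hsid (vcmp (v_o (rho P) (vsrc u)) u)) (fun u => hsid (vcmp (v_o (rho P) (vsrc u)) u)).
(** The unit functor is chosen strict: its 1h-cell is [hid I] itself, so the only unitors in [ll]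
    and [rr] are those of the one-variable functors. *)
Notation cI := (constf dbl1 I).

Lemma tv_vidl u A A' C : vc u A A' -> tv H (vid C) u = fv (L C) u.
Proof. intros Hu. rewrite (tvE H (vc_vid C) Hu). sc. Qed.
Lemma tv_vidr u A A' C : vc u A A' -> tv H u (vid C) = fv (R C) u.
Proof. intros Hu. rewrite (tvE H Hu (vc_vid C)). sc. Qed.

Lemma mlam0P : is_vstrict_iso (tensIl T cI) (fid B) mlam0.
Proof.
apply (@hsid_vtrans B B (tensIl T cI) (fid B) (fun A => v_o (lam P) A) (fun f => ll P f)); intros; simpl in *.
- apply vc_lam.
- eapply cell_ll; apply hc_refl.
- erewrite tv_vidl by apply vc_refl. symmetry; apply lam_nat; apply vc_refl.
- assert (Hf : hc f (hsrc f) (htgt f)) by apply hc_refl. assert (Hg : hc g (htgt f) (htgt g)) by bounds.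
  pose proof (cell_ll P Hf) as K1. pose proof (cell_ll P Hg) as K2.
  rewrite (thE H (hc_hid I) Hf) in K1. rewrite (thE H (hc_hid I) Hg) in K2. v1.
  erewrite ts_vsid by bounds.
  rewrite (@vscmp1r' _ (th H (hid I) (hcmp f g)) (tc H _ _ _ _)).
  + eapply ll_fc; bounds.
  + erewrite (c_bot (cell_tc H (hc_hid I) (hc_hid I) Hf Hg)). f_equal. apply hcmp1l'; sc.
- rewrite vscmp1r' by sc. v1. erewrite ts_vsid by bounds.
  rewrite (@vscmp1r' _ (th H (hid I) (hid A)) (tu H _ _)) by apply (c_bot (cell_tu H _ _)).
  apply ll_fu.
- eapply ll_nat; bounds.
- eapply ll_inv; bounds.
Qed.
Lemma mrho0P : is_vstrict_iso (tensIr T cI) (fid B) mrho0.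
Proof.
apply (@hsid_vtrans B B (tensIr T cI) (fid B) (fun A => v_o (rho P) A) (fun f => rr P f)); intros; simpl in *.
- apply vc_rho.
- eapply cell_rr; apply hc_refl.
- erewrite tv_vidr by apply vc_refl. symmetry; apply rho_nat; apply vc_refl.
- assert (Hf : hc f (hsrc f) (htgt f)) by apply hc_refl. assert (Hg : hc g (htgt f) (htgt g)) by bounds.
  pose proof (cell_rr P Hf) as K1. pose proof (cell_rr P Hg) as K2.
  rewrite (thE H Hf (hc_hid I)) in K1. rewrite (thE H Hg (hc_hid I)) in K2. v1.
  erewrite ts_vsid by bounds.
  rewrite (@vscmp1r' _ (th H (hcmp f g) (hid I)) (tc H _ _ _ _)).
  + eapply rr_fc; bounds.
  + erewrite (c_bot (cell_tc H Hf Hg (hc_hid I) (hc_hid I))). f_equal. apply hcmp1l'; sc.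
- rewrite vscmp1r' by sc. v1. erewrite ts_vsid by bounds.
  rewrite (@vscmp1r' _ (th H (hid A) (hid I)) (tu H _ _)) by apply (c_bot (cell_tu H _ _)).
  apply rr_fu.
- eapply rr_nat; bounds.
- eapply rr_inv; bounds.
Qed.

Definition quasi_monoidal : monoidal B.
Proof.
refine (@Monoidal B T cI mal0 mlam0 mrho0 mal0P mlam0P mrho0P _ _ _ _ _ _ _ _); intros; simpl.
- erewrite tv_vidr, tv_vidl by apply vc_alo.
  eapply eq_trans; [apply vcmpA; sc | apply pento].
- assert (K1 := cell_ml P (hc_refl f) (hc_refl g) (hc_refl h)).
  assert (K2 := cell_ml P (hc_refl g) (hc_refl h) (hc_refl k)).
  eapply eq_trans; [|eapply ml_pent; apply hc_refl].
  pose proof (cell_ts H K1 (cell_vsid (hc_refl k)) (vc_alo _ _ _ _) (vc_alo _ _ _ _) (vc_vid _) (vc_vid _)) as C1.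
  pose proof (cell_ts H (cell_vsid (hc_refl f)) K2 (vc_vid _) (vc_vid _) (vc_alo _ _ _ _) (vc_alo _ _ _ _)) as C2.
  pose proof (cell_ml P (hc_refl f) (th_hc (hc_refl g) (hc_refl h)) (hc_refl k)) as C3.
  apply vscmpA; simpl.
  + rewrite (c_bot C1). symmetry; apply (c_top C3).
  + rewrite (c_bot C3). symmetry; apply (c_top C2).
- erewrite tv_vidr by apply vc_rho. erewrite tv_vidl by apply vc_lam. exact (triM_o P W Y).
- eapply ml_triM; apply hc_refl.
- erewrite tv_vidr by apply vc_lam. exact (triL_o P W Y).
- eapply ml_triL; apply hc_refl.
- erewrite tv_vidl by apply vc_rho. exact (triR_o P W Y).
- eapply ml_triR; apply hc_refl.
Defined.

Lemma quasi_tens_r : tens_r (quasi_binoidal H) quasi_monoidal.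
Proof. constructor; reflexivity. Qed.
End Assemble.

Lemma quasi_has_monoidal_r B : has_quasi_premonoidal B -> has_monoidal_r B.
Proof.
intros (H & Hvv & [P]). exists (quasi_binoidal H), (quasi_monoidal Hvv P). apply quasi_tens_r.
Qed.

(** * The premonoidal structure of a monoidal double category *)

Lemma invertible_vcmp (D : dblcat) (a b : sq D) : bot a = top b -> (exists a', vinv a a') -> (exists b', vinv b b') ->
  exists c, vinv (a / b) c.
Proof. intros E [a' Ha] [b' Hb]. exists (b' / a'). now apply vinv_vcmp. Qed.

(** * Functors on a product, restated for explicit pairs of cells *)

Section Pairs.
Variables (B C D : dblcat) (T : psfun (dblprod B C) D).
Lemma vc_pair u v A A' X X' : vc u A A' -> vc v X X' -> @vc (dblprod B C) (u, v) (A, X) (A', X').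
Proof. intros [<- <-] [<- <-]. now split. Qed.
Lemma cell_pair a c t b l r t' b' l' r' : cell a t b l r -> cell c t' b' l' r' ->
  @cell (dblprod B C) (a, c) (t, t') (b, b') (l, l') (r, r').
Proof. intros (<- & <- & <- & <-) (<- & <- & <- & <-). now repeat split. Qed.
Lemma hc_fh2 f g A A' X X' : hc f A A' -> hc g X X' -> hc (fh T (f, g)) (T (A, X)) (T (A', X')).
Proof. intros [<- <-] [<- <-]. split; [apply hsrc_fh | apply htgt_fh]. Qed.
Lemma vc_fv2 f g A A' X X' : vc f A A' -> vc g X X' -> vc (fv T (f, g)) (T (A, X)) (T (A', X')).
Proof. intros [<- <-] [<- <-]. split; [apply vsrc_fv | apply vtgt_fv]. Qed.
Lemma fv2_id A X : fv T (vid A, vid X) = vid (T (A, X)).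
Proof. apply (fv_id T (A, X)). Qed.
Lemma cell_fs2 a c t b l r t' b' l' r' L R : cell a t b l r -> cell c t' b' l' r' ->
  fv T (l, l') = L -> fv T (r, r') = R ->
  cell (fs T (a, c)) (fh T (t, t')) (fh T (b, b')) L R.
Proof. intros (<- & <- & <- & <-) (<- & <- & <- & <-) <- <-. repeat split; [apply top_fs | apply bot_fs | apply lft_fs | apply rgt_fs]. Qed.
Lemma cell_fc2 f f' g g' h k A0 A1 A1' A2 X0 X1 X1' X2 : hc f A0 A1 -> hc f' A1' A2 -> hc g X0 X1 -> hc g' X1' X2 ->
  A1 = A1' -> X1 = X1' -> hcmp f f' = h -> hcmp g g' = k ->
  cell (fc T (f, g) (f', g')) (hcmp (fh T (f, g)) (fh T (f', g'))) (fh T (h, k)) (vid (T (A0, X0))) (vid (T (A2, X2))).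
Proof.
intros [<- <-] [<- <-] [<- <-] [<- <-] E1 E2 <- <-.
apply (@cell_fc _ _ T (f, g) (f', g') _ (hsrc f, hsrc g) (htgt f, htgt g) (hsrc f', hsrc g') (htgt f', htgt g'));
 try (now split); simpl; congruence.
Qed.
Lemma cell_fci2 f f' g g' h k A0 A1 A1' A2 X0 X1 X1' X2 : hc f A0 A1 -> hc f' A1' A2 -> hc g X0 X1 -> hc g' X1' X2 ->
  A1 = A1' -> X1 = X1' -> hcmp f f' = h -> hcmp g g' = k ->
  cell (fci T (f, g) (f', g')) (fh T (h, k)) (hcmp (fh T (f, g)) (fh T (f', g'))) (vid (T (A0, X0))) (vid (T (A2, X2))).
Proof.
intros [<- <-] [<- <-] [<- <-] [<- <-] E1 E2 <- <-.
apply (@cell_fci _ _ T (f, g) (f', g') _ (hsrc f, hsrc g) (htgt f, htgt g) (hsrc f', hsrc g') (htgt f', htgt g'));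
 try (now split); simpl; congruence.
Qed.
Lemma cell_fu2 A X : cell (fu T (A, X)) (hid (T (A, X))) (fh T (hid A, hid X)) (vid (T (A, X))) (vid (T (A, X))).
Proof. apply (@cell_fu _ _ T (A, X) _ eq_refl). Qed.
Lemma cell_fui2 A X : cell (fui T (A, X)) (fh T (hid A, hid X)) (hid (T (A, X))) (vid (T (A, X))) (vid (T (A, X))).
Proof. apply (@cell_fui _ _ T (A, X) _ eq_refl). Qed.
Lemma pair_eq (S S' : Type) (a a' : S) (b b' : S') : a = a' -> b = b' -> (a, b) = (a', b').
Proof. now intros <- <-. Qed.

Lemma fs2_v a b a' b' : bot a = top b -> bot a' = top b' -> fs T (a, a') / fs T (b, b') = fs T (a / b, a' / b').
Proof. intros E1 E2. symmetry. apply (@fs_vscmp _ _ T (a, a') (b, b')). simpl; congruence. Qed.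
Lemma fs2_whr f a b : bot a = top b -> fs T (vsid f, a / b) = fs T (vsid f, a) / fs T (vsid f, b).
Proof. intros E. rewrite fs2_v by (rewrite ?top_vsid, ?bot_vsid; auto). now rewrite vscmp1l' by apply top_vsid. Qed.
Lemma fs2_whl f a b : bot a = top b -> fs T (a / b, vsid f) = fs T (a, vsid f) / fs T (b, vsid f).
Proof. intros E. rewrite fs2_v by (rewrite ?top_vsid, ?bot_vsid; auto). now rewrite (@vscmp1l' _ f (vsid f)) by apply top_vsid. Qed.
Lemma vinv_fs2 a a' b b' : vinv a a' -> vinv b b' -> vinv (fs T (a, b)) (fs T (a', b')).
Proof.
intros (A1 & A2 & A3 & A4) (B1 & B2 & B3 & B4). apply vinv_fs. repeat split; simpl; congruence.
Qed.
Lemma fs2_vsid f g : fs T (vsid f, vsid g) = vsid (fh T (f, g)).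
Proof. apply (fs_vsid T (f, g)). Qed.
Lemma fu2_nat u v A A' X X' : vc u A A' -> vc v X X' ->
  hsid (fv T (u, v)) / fu T (A', X') = fu T (A, X) / fs T (hsid u, hsid v).
Proof. intros [<- <-] [<- <-]. apply (fu_nat T (u, v)). Qed.
End Pairs.

Ltac hc_hook ::= lazymatch goal with
  | |- hc (fh _ (_, _)) _ _ => eapply hc_fh2; hc_tac end.
Ltac vc_hook ::= lazymatch goal with
  | |- vc (fv _ (_, _)) _ _ => eapply vc_fv2; vc_tac end.
Ltac hn_hook ::= lazymatch goal with
  | |- (_, _) = _ => eapply pair_eq; hn end.
Ltac fvn ::=
  lazymatch goal with
  | |- fv _ (vid _, vid _) = _ => apply fv2_id
  | |- fv _ (vid _) = _ => apply fv_vid_eq; on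
  | |- fv _ (vcmp _ _) = _ => eapply fv_vcmp_eq; [vc_tac | vc_tac | oeq | fvn | fvn]
  | |- _ => reflexivity
  end.
Ltac cell_hook ::= lazymatch goal with
  | |- cell (fs _ (_, _)) _ _ _ _ => eapply cell_fs2; [ty | ty | fvn | fvn]
  | |- cell (fc _ (_, _) (_, _)) _ _ _ _ => eapply cell_fc2; [hc_tac | hc_tac | hc_tac | hc_tac | oeq | oeq | hcn | hcn ]
  | |- cell (fci _ (_, _) (_, _)) _ _ _ _ => eapply cell_fci2; [hc_tac | hc_tac | hc_tac | hc_tac | oeq | oeq | hcn | hcn ]
  | |- cell (fu _ (_, _)) _ _ _ _ => eapply cell_fu2
  | |- cell (fui _ (_, _)) _ _ _ _ => eapply cell_fui2
  end.
Section PairCompositors.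
Variables (B C D : dblcat) (T : psfun (dblprod B C) D).
Lemma fui2_nat u v A A' X X' : vc u A A' -> vc v X X' ->
  fs T (hsid u, hsid v) / fui T (A', X') = fui T (A, X) / hsid (fv T (u, v)).
Proof.
intros Hu Hv. apply (@vinv_conj _ (fu T (A, X)) _ (fu T (A', X')) _ (hsid (fv T (u, v)))); [apply fuK | apply fuK | sc | sc | now apply fu2_nat].
Qed.
Lemma fc2_nat a a' b b' f f' u u' g g' w p p' q q' v v' z A A' A'' E E' E'' X X' X'' Y Y' Y'' :
  cell a f f' u u' -> cell b g g' u' w -> cell a' p p' v v' -> cell b' q q' v' z ->
  vc u A E -> vc u' A' E' -> vc w A'' E'' -> vc v X Y -> vc v' X' Y' -> vc z X'' Y'' ->
  [fs T (a, a') | fs T (b, b')] / fc T (f', p') (g', q') = fc T (f, p) (g, q) / fs T ([a | b], [a' | b']).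
Proof.
intros (<- & <- & <- & E1) (<- & <- & E2 & <-) (<- & <- & <- & E3) (<- & <- & E4 & <-) _ _ _ _ _ _.
apply (@fc_nat _ _ T (a, a') (b, b')). simpl; congruence.
Qed.
Lemma fci2_nat a a' b b' f f' u u' g g' w p p' q q' v v' z A A' A'' E E' E'' X X' X'' Y Y' Y'' :
  cell a f f' u u' -> cell b g g' u' w -> cell a' p p' v v' -> cell b' q q' v' z ->
  vc u A E -> vc u' A' E' -> vc w A'' E'' -> vc v X Y -> vc v' X' Y' -> vc z X'' Y'' ->
  fs T ([a | b], [a' | b']) / fci T (f', p') (g', q') = fci T (f, p) (g, q) / [fs T (a, a') | fs T (b, b')].
Proof.
intros Ha Hb Ha' Hb' Hu Hu' Hw Hv Hv' Hz.
exact (fci_nat T (cell_pair Ha Ha') (cell_pair Hb Hb') (vc_pair Hu Hv) (vc_pair Hu' Hv') (vc_pair Hw Hz)).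
Qed.
Lemma fc2K f g f' g' A A' A'' X X' X'' : hc f A A' -> hc g A' A'' -> hc f' X X' -> hc g' X' X'' ->
  vinv (fc T (f, f') (g, g')) (fci T (f, f') (g, g')).
Proof. intros [<- <-] [E1 <-] [<- <-] [E2 <-]. apply fcK. simpl. congruence. Qed.
Lemma fc2_unitl f g A A' X X' : hc f A A' -> hc g X X' ->
  [fu T (A, X) | vsid (fh T (f, g))] / fc T (hid A, hid X) (f, g) = vsid (fh T (f, g)).
Proof. intros [<- <-] [<- <-]. exact (fc_unitlE T (@hc_refl (dblprod B C) (f, g))). Qed.
Lemma fc2U_r f g A A' X X' : hc f A A' -> hc g X X' ->
  fc T (f, g) (hid A', hid X') = [vsid (fh T (f, g)) | fui T (A', X')].
Proof. intros [<- <-] [<- <-]. exact (fcU_r T (@hc_refl (dblprod B C) (f, g))). Qed.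
Lemma fc2U_l f g A A' X X' : hc f A A' -> hc g X X' ->
  fc T (hid A, hid X) (f, g) = [fui T (A, X) | vsid (fh T (f, g))].
Proof. intros [<- <-] [<- <-]. exact (fcU_l T (@hc_refl (dblprod B C) (f, g))). Qed.
Lemma fci2U_r f g A A' X X' : hc f A A' -> hc g X X' ->
  fci T (f, g) (hid A', hid X') = [vsid (fh T (f, g)) | fu T (A', X')].
Proof. intros [<- <-] [<- <-]. exact (fciU_r T (@hc_refl (dblprod B C) (f, g))). Qed.
Lemma fci2U_l f g A A' X X' : hc f A A' -> hc g X X' ->
  fci T (hid A, hid X) (f, g) = [fu T (A, X) | vsid (fh T (f, g))].
Proof. intros [<- <-] [<- <-]. exact (fciU_l T (@hc_refl (dblprod B C) (f, g))). Qed.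
End PairCompositors.

(** * Cells of a monoidal double category *)

Section MonoidalLaws.
Variables (B : dblcat) (M : monoidal B).
Notation T := (tens M).
Notation m f g h := (v_h (mal M) (f, g, h)).
Notation mo A C E := (v_o (mal M) (A, C, E)).
Notation I := (fo (munit M) tt).
Notation J := (fh (munit M) tt).
Notation mu := (fu (munit M) tt).
Notation muc := (fc (munit M) tt tt).

Lemma vc_mo A C E : vc (mo A C E) (T (T (A, C), E)) (T (A, T (C, E))).
Proof. exact (vstrict_vc (malP M) (A, C, E)). Qed.
Lemma cell_m f g h A A' C C' E E' : hc f A A' -> hc g C C' -> hc h E E' ->
  cell (m f g h) (fh T (fh T (f, g), h)) (fh T (f, fh T (g, h))) (mo A C E) (mo A' C' E').
Proof. intros [<- <-] [<- <-] [<- <-]. exact (vstrict_cell (malP M) (@hc_refl (dblprod (dblprod B B) B) (f, g, h))). Qed.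
Lemma vc_lo A : vc (v_o (mlam M) A) (T (I, A)) A.
Proof. exact (vstrict_vc (mlamP M) A). Qed.
Lemma cell_l f A A' : hc f A A' -> cell (v_h (mlam M) f) (fh T (J, f)) f (v_o (mlam M) A) (v_o (mlam M) A').
Proof. intros [<- <-]. exact (vstrict_cell (mlamP M) (hc_refl f)). Qed.
Lemma vc_ro A : vc (v_o (mrho M) A) (T (A, I)) A.
Proof. exact (vstrict_vc (mrhoP M) A). Qed.
Lemma cell_r f A A' : hc f A A' -> cell (v_h (mrho M) f) (fh T (f, J)) f (v_o (mrho M) A) (v_o (mrho M) A').
Proof. intros [<- <-]. exact (vstrict_cell (mrhoP M) (hc_refl f)). Qed.
Lemma hc_J : hc J I I.
Proof. split; [apply (hsrc_fh (munit M) tt) | apply (htgt_fh (munit M) tt)]. Qed.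
Lemma cell_mu : cell mu (hid I) J (vid I) (vid I).
Proof. apply (@cell_fu _ _ (munit M) tt _ eq_refl). Qed.
Lemma cell_muc : cell muc (hcmp J J) J (vid I) (vid I).
Proof. apply (@cell_fc _ _ (munit M) tt tt tt tt tt tt tt); (reflexivity || now split). Qed.
End MonoidalLaws.

Ltac vc_hook ::= lazymatch goal with
  | |- vc (v_o (mal _) (_, _, _)) _ _ => apply vc_mo
  | |- vc (v_o (mlam _) _) _ _ => apply vc_lo
  | |- vc (v_o (mrho _) _) _ _ => apply vc_ro
  | |- vc (fv _ (_, _)) _ _ => eapply vc_fv2; vc_tac end.
Ltac hc_hook ::= lazymatch goal with
  | |- hc (fh (munit _) tt) _ _ => apply hc_J
  | |- hc (fh _ (_, _)) _ _ => eapply hc_fh2; hc_tac end.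
Ltac cell_hook ::= lazymatch goal with
  | |- cell (fs _ (_, _)) _ _ _ _ => eapply cell_fs2; [ty | ty | fvn | fvn]
  | |- cell (fc _ (_, _) (_, _)) _ _ _ _ => eapply cell_fc2; [hc_tac | hc_tac | hc_tac | hc_tac | oeq | oeq | hcn | hcn ]
  | |- cell (fci _ (_, _) (_, _)) _ _ _ _ => eapply cell_fci2; [hc_tac | hc_tac | hc_tac | hc_tac | oeq | oeq | hcn | hcn ]
  | |- cell (fu (munit _) tt) _ _ _ _ => apply cell_mu
  | |- cell (fc (munit _) tt tt) _ _ _ _ => apply cell_muc
  | |- cell (fu _ (_, _)) _ _ _ _ => eapply cell_fu2
  | |- cell (fui _ (_, _)) _ _ _ _ => eapply cell_fui2
  | |- cell (v_h (mal _) (_, _, _)) _ _ _ _ => eapply cell_m; hc_tac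
  | |- cell (v_h (mlam _) _) _ _ _ _ => eapply cell_l; hc_tac
  | |- cell (v_h (mrho _) _) _ _ _ _ => eapply cell_r; hc_tac
  end.

(** * One-variable associativities and units of a monoidal double category *)

Section AssociativityComponents.
Variables (B : dblcat) (M : monoidal B).
Notation T := (tens M).
Notation m f g h := (v_h (mal M) (f, g, h)).
Notation mo A C E := (v_o (mal M) (A, C, E)).
Notation I := (fo (munit M) tt).
Notation J := (fh (munit M) tt).
Notation mu := (fu (munit M) tt).
Notation muc := (fc (munit M) tt tt).

Lemma m_nat a b c f f' g g' h h' u u' v v' w w' : cell a f f' u u' -> cell b g g' v v' -> cell c h h' w w' ->
  m f g h / fs T (a, fs T (b, c)) = fs T (fs T (a, b), c) / m f' g' h'.
Proof. intros (<- & <- & _) (<- & <- & _) (<- & <- & _). exact (vstrict_nat (malP M) (@cell_refl (dblprod (dblprod B B) B) (a, b, c))). Qed.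
Lemma m_natv u v w A A' C C' E E' : vc u A A' -> vc v C C' -> vc w E E' ->
  vcmp (mo A C E) (fv T (u, fv T (v, w))) = vcmp (fv T (fv T (u, v), w)) (mo A' C' E').
Proof. intros [<- <-] [<- <-] [<- <-]. exact (vstrict_natv (malP M) (@vc_refl (dblprod (dblprod B B) B) (u, v, w))). Qed.
Lemma m_fc f g h f' g' h' A0 A1 A2 C0 C1 C2 E0 E1 E2 : hc f A0 A1 -> hc f' A1 A2 ->
  hc g C0 C1 -> hc g' C1 C2 -> hc h E0 E1 -> hc h' E1 E2 ->
  [m f g h | m f' g' h'] / fc T (f, fh T (g, h)) (f', fh T (g', h')) / fs T (vsid (hcmp f f'), fc T (g, h) (g', h')) =
  fc T (fh T (f, g), h) (fh T (f', g'), h') / fs T (fc T (f, g) (f', g'), vsid (hcmp h h')) / m (hcmp f f') (hcmp g g') (hcmp h h').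
Proof.
intros Hf Hf' Hg Hg' Hh Hh'.
pose proof (@vh_cmp _ _ _ _ _ (vsi_trans (malP M)) (f, g, h) (f', g', h')) as K. simpl in K.
(* The projections in [tensl] and [tensr] contribute identity squares to [K]; this and the following
   rewrites clear them. *)
rewrite !fs2_vsid in K.
rewrite (@vscmp1r' _ _ (fc T (f, g) (f', g'))) in K by sc.
assert (Ev : forall x : hor B, vsid x / vsid x = vsid x) by (intros; apply vscmp1l', top_vsid).
rewrite !Ev, fs2_vsid, (@vscmp1r' _ _ (fc T (g, h) (g', h'))) in K by sc.
rewrite vscmpA by sc. apply K. rewrite (proj2 Hf), (proj1 Hf'), (proj2 Hg), (proj1 Hg'), (proj2 Hh), (proj1 Hh'). reflexivity.
Qed.
Lemma m_fu A C E : hsid (mo A C E) / fu T (A, T (C, E)) / fs T (vsid (hid A), fu T (C, E)) =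
  fu T (T (A, C), E) / fs T (fu T (A, C), vsid (hid E)) / m (hid A) (hid C) (hid E).
Proof.
pose proof (vh_id (vsi_trans (malP M)) (A, C, E)) as K. simpl in K.
assert (Ev : forall x : hor B, vsid x / vsid x = vsid x) by (intros; apply vscmp1l', top_vsid).
rewrite ?Ev in K. rewrite ?fs2_vsid in K.
rewrite (@vscmp1r' _ _ (fu T (A, C))), (@vscmp1r' _ _ (fu T (C, E))) in K by sc.
rewrite vscmpA by sc. exact K.
Qed.
Lemma l_nat a f f' u u' : cell a f f' u u' -> v_h (mlam M) f / a = fs T (vsid J, a) / v_h (mlam M) f'.
Proof.
intros (<- & <- & _). pose proof (vstrict_nat (mlamP M) (cell_refl a)) as K. simpl in K.
pose proof (fs_vsid (munit M) tt) as E. simpl in E. now rewrite E in K.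
Qed.
Lemma r_nat a f f' u u' : cell a f f' u u' -> v_h (mrho M) f / a = fs T (a, vsid J) / v_h (mrho M) f'.
Proof.
intros (<- & <- & _). pose proof (vstrict_nat (mrhoP M) (cell_refl a)) as K. simpl in K.
pose proof (fs_vsid (munit M) tt) as E. simpl in E. now rewrite E in K.
Qed.
Lemma l_natv u A A' : vc u A A' -> vcmp (v_o (mlam M) A) u = vcmp (fv T (vid I, u)) (v_o (mlam M) A').
Proof.
intros [<- <-]. pose proof (vstrict_natv (mlamP M) (vc_refl u)) as K. simpl in K.
pose proof (fv_id (munit M) tt) as E. simpl in E. now rewrite E in K.
Qed.
Lemma r_natv u A A' : vc u A A' -> vcmp (v_o (mrho M) A) u = vcmp (fv T (u, vid I)) (v_o (mrho M) A').
Proof.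
intros [<- <-]. pose proof (vstrict_natv (mrhoP M) (vc_refl u)) as K. simpl in K.
pose proof (fv_id (munit M) tt) as E. simpl in E. now rewrite E in K.
Qed.
Lemma l_fc f g A A' A'' : hc f A A' -> hc g A' A'' -> [v_h (mlam M) f | v_h (mlam M) g] =
  fc T (J, f) (J, g) / fs T (muc, vsid (hcmp f g)) / v_h (mlam M) (hcmp f g).
Proof.
intros Hf Hg. pose proof (@vh_cmp _ _ _ _ _ (vsi_trans (mlamP M)) f g) as K. simpl in K.
pose proof (fs_vsid (munit M) tt) as E. simpl in E.
rewrite E, !vscmp1r' in K by sc. apply K. now rewrite (proj2 Hf), (proj1 Hg).
Qed.
Lemma l_fu A : hsid (v_o (mlam M) A) =
  fu T (I, A) / fs T (mu, vsid (hid A)) / v_h (mlam M) (hid A).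
Proof.
pose proof (@vh_id _ _ _ _ _ (vsi_trans (mlamP M)) A) as K. simpl in K.
pose proof (fs_vsid (munit M) tt) as E. simpl in E.
rewrite E, !vscmp1r' in K by sc. exact K.
Qed.
Lemma r_fc f g A A' A'' : hc f A A' -> hc g A' A'' -> [v_h (mrho M) f | v_h (mrho M) g] =
  fc T (f, J) (g, J) / fs T (vsid (hcmp f g), muc) / v_h (mrho M) (hcmp f g).
Proof.
intros Hf Hg. pose proof (@vh_cmp _ _ _ _ _ (vsi_trans (mrhoP M)) f g) as K. simpl in K.
pose proof (fs_vsid (munit M) tt) as E. simpl in E.
rewrite E, !vscmp1r' in K by sc. apply K. now rewrite (proj2 Hf), (proj1 Hg).
Qed.
Lemma r_fu A : hsid (v_o (mrho M) A) =
  fu T (A, I) / fs T (vsid (hid A), mu) / v_h (mrho M) (hid A).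
Proof.
pose proof (@vh_id _ _ _ _ _ (vsi_trans (mrhoP M)) A) as K. simpl in K.
pose proof (fs_vsid (munit M) tt) as E. simpl in E.
rewrite E, !vscmp1r' in K by sc. exact K.
Qed.

Lemma muc_l : [mu | vsid J] / muc = vsid J.
Proof. exact (fc_unitl (munit M) tt). Qed.
(** The unit functor may be non-strict, and [mu] compares [hid I] with [J]. By the unit law this
    comparison respects composition, which the compositor laws of [tlam] and [trho] require. *)
Lemma mu_muc : [mu | mu] / muc = mu.
Proof.
rewrite <- (@slide_rl _ mu mu) by sc. rewrite (c_bot (cell_mu M)), (c_top (cell_mu M)).
rewrite vscmpA, muc_l by sc. rewrite <- hsid_vid. h1. v1. reflexivity.
Qed.
(** The inverse unitor respects composition; hence the correction in [tal1] is compatible with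
    compositors. [fu_fu] plays this part for [tal3]. *)
Lemma ui_ui (A C : ob B) : [fui T (A, C) | fui T (A, C)] = fc T (hid A, hid C) (hid A, hid C) / fui T (A, C).
Proof.
rewrite <- (@slide_rl _ (fui T (A, C)) (fui T (A, C))) by sc.
replace (top (fui T (A, C))) with (fh T (hid A, hid C)) by (symmetry; sc).
replace (bot (fui T (A, C))) with (hid (T (A, C))) by (symmetry; sc).
rewrite <- hsid_vid, (@hscmp1r' _ _ (fui T (A, C))) by sc.
rewrite <- (fc2U_r T (hc_hid A) (hc_hid C)). reflexivity.
Qed.

Lemma fu_fu (A C : ob B) : [fu T (A, C) | fu T (A, C)] / fc T (hid A, hid C) (hid A, hid C) = fu T (A, C).
Proof.
rewrite <- (@slide_rl _ (fu T (A, C)) (fu T (A, C))) by sc.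
replace (top (fu T (A, C))) with (hid (T (A, C))) by (symmetry; sc).
replace (bot (fu T (A, C))) with (fh T (hid A, hid C)) by (symmetry; sc).
rewrite vscmpA, (fc2_unitl T (hc_hid A) (hc_hid C)) by sc. rewrite <- hsid_vid. h1. v1. reflexivity.
Qed.

(** The bottom of [m f (hid Y) (hid Z)] has the product of two identities where [hid (T (Y, Z))] is
    wanted, so the unitor goes below. In [tal3] the product of identities is in the top and the
    unitor goes above; in [tal2] the two identities are never multiplied together. *)
Definition tal1 Y Z : vdat B B := Vdat (fun W => mo W Y Z)
  (fun f => m f (hid Y) (hid Z) / fs T (vsid f, fui T (Y, Z)))
  (fun u => hsid (vcmp (mo (vsrc u) Y Z) (fv T (u, vid (T (Y, Z))))))
  (fun u => hsid (vcmp (mo (vsrc u) Y Z) (fv T (u, vid (T (Y, Z)))))).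
Definition tal2 W Z : vdat B B := Vdat (fun Y => mo W Y Z)
  (fun f => m (hid W) f (hid Z))
  (fun u => hsid (vcmp (mo W (vsrc u) Z) (fv T (vid W, fv T (u, vid Z)))))
  (fun u => hsid (vcmp (mo W (vsrc u) Z) (fv T (vid W, fv T (u, vid Z))))).
Definition tal3 W Y : vdat B B := Vdat (fun Z => mo W Y Z)
  (fun f => fs T (fu T (W, Y), vsid f) / m (hid W) (hid Y) f)
  (fun u => hsid (vcmp (mo W Y (vsrc u)) (fv T (vid W, fv T (vid Y, u)))))
  (fun u => hsid (vcmp (mo W Y (vsrc u)) (fv T (vid W, fv T (vid Y, u))))).
(** The left unit square starts at the product with [J], whereas [I |x f] is the product with
    [hid I]; [mu] bridges the difference. *)
Definition tlam : vdat B B := Vdat (v_o (mlam M))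
  (fun f => fs T (mu, vsid f) / v_h (mlam M) f)
  (fun u => hsid (vcmp (v_o (mlam M) (vsrc u)) u)) (fun u => hsid (vcmp (v_o (mlam M) (vsrc u)) u)).
Definition trho : vdat B B := Vdat (v_o (mrho M))
  (fun f => fs T (vsid f, mu) / v_h (mrho M) f)
  (fun u => hsid (vcmp (v_o (mrho M) (vsrc u)) u)) (fun u => hsid (vcmp (v_o (mrho M) (vsrc u)) u)).

Notation X := (quasi_binoidal (tens_quasi T)).

Lemma tal1P Y Z : is_vstrict_iso (bR X Z \o bR X Y) (bR X (bL X Y Z)) (tal1 Y Z).
Proof.
apply (@hsid_vtrans B B (bR X Z \o bR X Y) (bR X (bL X Y Z)) (fun W => mo W Y Z)
  (fun f => m f (hid Y) (hid Z) / fs T (vsid f, fui T (Y, Z)))); simpl; intros.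
- sc.
- sc.
- rewrite <- fv2_id. erewrite m_natv by sc. reflexivity.
- assert (Hf : hc f (hsrc f) (htgt f)) by sc. assert (Hg : hc g (htgt f) (htgt g)) by (split; congruence).
  rewrite !fs2_vsid. v1.
  lhs (rewrite <- interchange by sc; vA; erewrite (fc2_nat T) by sc; rewrite <- vsid_cmp, ui_ui, fs2_whr by sc).
  pose proof (m_fc Hf Hg (hc_hid Y) (hc_hid Y) (hc_hid Z) (hc_hid Z)) as K. rewrite !(@hcmp1l' _ _ (hid _)) in K by sc.
  vAr. rewrite K. reflexivity.
- rewrite !fs2_vsid. v1. pose proof (m_fu A Y Z) as K.
  vAr. rewrite <- K. vA. rewrite <- fs2_whr, fuE_l, fs2_vsid by sc. v1. reflexivity.
- pose proof (cell_refl a). rewrite vscmpA, fs2_v, vscmp1l, (vscmp1r' (a := fui T _)) by sc.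
  rewrite <- vscmpA by sc. erewrite <- (m_nat (a := a)) by sc.
  rewrite fs2_vsid. vA. rewrite fs2_v, vscmp1r, vscmp1l' by sc. reflexivity.
- apply invertible_vcmp; [sc | exact (vsi_inv (malP M) (f, hid Y, hid Z)) |].
  eexists. apply vinv_fs2; [apply vinv_id | apply (vinv_sym (fuK T (Y, Z)))].
Qed.

Lemma tal2P W Z : is_vstrict_iso (bR X Z \o bL X W) (bL X W \o bR X Z) (tal2 W Z).
Proof.
apply (@hsid_vtrans B B (bR X Z \o bL X W) (bL X W \o bR X Z) (fun Y => mo W Y Z)
  (fun f => m (hid W) f (hid Z))); simpl; intros.
- sc.
- sc.
- erewrite m_natv by sc. reflexivity.
- assert (Hf : hc f (hsrc f) (htgt f)) by sc. assert (Hg : hc g (htgt f) (htgt g)) by (split; congruence).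
  rewrite !fs2_vsid. v1.
  pose proof (m_fc (hc_hid W) (hc_hid W) Hf Hg (hc_hid Z) (hc_hid Z)) as K. rewrite !(@hcmp1l' _ _ (hid _)) in K by sc.
  vAr. exact K.
- rewrite !fs2_vsid. v1. vAr. apply m_fu.
- pose proof (cell_refl a). erewrite (m_nat (b := a)) by sc. reflexivity.
- exact (vsi_inv (malP M) (hid W, f, hid Z)).
Qed.

Lemma tal3P W Y : is_vstrict_iso (bL X (bL X W Y)) (bL X W \o bL X Y) (tal3 W Y).
Proof.
apply (@hsid_vtrans B B (bL X (bL X W Y)) (bL X W \o bL X Y) (fun Z => mo W Y Z)
  (fun f => fs T (fu T (W, Y), vsid f) / m (hid W) (hid Y) f)); simpl; intros.
- sc.
- sc.
- erewrite m_natv by sc. now rewrite fv2_id.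
- assert (Hf : hc f (hsrc f) (htgt f)) by sc. assert (Hg : hc g (htgt f) (htgt g)) by (split; congruence).
  rewrite !fs2_vsid. v1.
  pose proof (m_fc (hc_hid W) (hc_hid W) (hc_hid Y) (hc_hid Y) Hf Hg) as K. rewrite !(@hcmp1l' _ _ (hid _)) in K by sc.
  lhs (rewrite <- interchange by sc; vA; rewrite <- (@vscmpA _ [v_h (mal M) _ | _]), K by sc).
  vAr. erewrite (fc2_nat T) by sc. rewrite <- vsid_cmp by sc. vA. f_equal. vAr. f_equal.
  rewrite fs2_v, fu_fu by sc. v1. reflexivity.
- rewrite !fs2_vsid. v1. vAr. rewrite m_fu. f_equal.
- pose proof (cell_refl a). rewrite vscmpA by sc. erewrite (m_nat (c := a)) by sc.
  vAr. rewrite fs2_vsid, !fs2_v by sc. rewrite vscmp1r, !vscmp1l' by sc. rewrite vscmp1r' by sc. reflexivity.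
- apply invertible_vcmp; [sc | | exact (vsi_inv (malP M) (hid W, hid Y, f))].
  eexists. apply vinv_fs2; [apply (fuK T (W, Y)) | apply vinv_id].
Qed.

Lemma tlamP : is_vstrict_iso (bL X I) (fid B) tlam.
Proof.
apply (@hsid_vtrans B B (bL X I) (fid B) (v_o (mlam M)) (fun f => fs T (mu, vsid f) / v_h (mlam M) f)); simpl; intros.
- sc.
- sc.
- now apply l_natv.
- assert (Hf : hc f (hsrc f) (htgt f)) by sc. assert (Hg : hc g (htgt f) (htgt g)) by (split; congruence).
  rewrite !fs2_vsid. v1. rewrite <- interchange, (l_fc Hf Hg) by sc. vAr. erewrite (fc2_nat T) by sc.
  rewrite (vscmpA (a := fc T (hid I, f) _)), fs2_v, mu_muc, <- vsid_cmp by sc. v1. reflexivity.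
- rewrite !fs2_vsid. v1. vAr. apply l_fu.
- pose proof (cell_refl a). rewrite vscmpA by sc. erewrite (l_nat (a := a)) by sc.
  vAr. rewrite !fs2_v by sc. rewrite vscmp1r, !vscmp1l' by sc. rewrite vscmp1r' by sc. reflexivity.
- apply invertible_vcmp; [sc | | exact (vsi_inv (mlamP M) f)].
  eexists. apply vinv_fs2; [apply (fuK (munit M) tt) | apply vinv_id].
Qed.
Lemma trhoP : is_vstrict_iso (bR X I) (fid B) trho.
Proof.
apply (@hsid_vtrans B B (bR X I) (fid B) (v_o (mrho M)) (fun f => fs T (vsid f, mu) / v_h (mrho M) f)); simpl; intros.
- sc.
- sc.
- now apply r_natv.
- assert (Hf : hc f (hsrc f) (htgt f)) by sc. assert (Hg : hc g (htgt f) (htgt g)) by (split; congruence).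
  rewrite !fs2_vsid. v1. rewrite <- interchange, (r_fc Hf Hg) by sc. vAr. erewrite (fc2_nat T) by sc.
  rewrite (vscmpA (a := fc T (f, hid I) _)), fs2_v, mu_muc, <- vsid_cmp by sc. v1. reflexivity.
- rewrite !fs2_vsid. v1. vAr. apply r_fu.
- pose proof (cell_refl a). rewrite vscmpA by sc. erewrite (r_nat (a := a)) by sc.
  vAr. rewrite !fs2_v by sc. rewrite vscmp1r, !vscmp1l' by sc. rewrite vscmp1r' by sc. reflexivity.
- apply invertible_vcmp; [sc | | exact (vsi_inv (mrhoP M) f)].
  eexists. apply vinv_fs2; [apply vinv_id | apply (fuK (munit M) tt)].
Qed.
End AssociativityComponents.

Definition ver_inv (D : dblcat) (U U' : ver D) : Prop :=
  vsrc U' = vtgt U /\ vtgt U' = vsrc U /\ vcmp U U' = vid (vsrc U) /\ vcmp U' U = vid (vtgt U).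

(** The square at the identity 1h-cell of [A] is vertically invertible, and the left side of its
    inverse is an inverse of the 1v-component at [A]. *)
Lemma vstrict_inv (C D : dblcat) (F G : psfun C D) x A : is_vstrict_iso F G x ->
  exists U', ver_inv (v_o x A) U'.
Proof.
intros Hx. destruct (vsi_inv Hx (hid A)) as [b Hb]. exists (lft b).
pose proof (vstrict_cell Hx (hc_refl (hid A))) as Hc. rewrite hsrc_id, htgt_id in Hc.
pose proof (vstrict_vc Hx A) as Hv.
pose proof (vinv_lft Hb) as K1. pose proof (vinv_lft (vinv_sym Hb)) as K2.
destruct Hb as (E1 & E2 & _). rewrite (c_lft Hc), (c_top Hc) in *.
rewrite hsrc_fh, hsrc_id in K1. rewrite <- E1, (c_bot Hc), hsrc_fh, hsrc_id in K2.
repeat split.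
- rewrite <- hsrc_top, <- E1, (c_bot Hc), hsrc_fh, hsrc_id. symmetry; apply Hv.
- rewrite <- hsrc_bot, E2, hsrc_fh, hsrc_id. symmetry; apply Hv.
- now rewrite K1, (proj1 Hv).
- now rewrite K2, (proj2 Hv).
Qed.

Lemma vinv_hsid (D : dblcat) (U U' : ver D) : ver_inv U U' -> vinv (hsid U) (hsid U').
Proof.
intros (E1 & E2 & E3 & E4). repeat split; rewrite ?top_hsid, ?bot_hsid; try congruence.
- now rewrite <- hsid_cmp, E3, hsid_vid.
- now rewrite <- hsid_cmp, E4, hsid_vid.
Qed.

(** * Pentagon, triangles and exchange laws in one variable *)

Section MonoidalPremonoidal.
Variables (B : dblcat) (M : monoidal B).
Notation T := (tens M).
Notation H := (tens_quasi T).
Notation X := (quasi_binoidal H).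
Notation m f g h := (v_h (mal M) (f, g, h)).
Notation mo A C E := (v_o (mal M) (A, C, E)).
Notation I := (fo (munit M) tt).
Notation J := (fh (munit M) tt).
Notation mu := (fu (munit M) tt).
Notation muc := (fc (munit M) tt tt).

Definition tcentral (U : ver B) (e : exists U', ver_inv U U') : inv_central X U.
Proof.
(* The existence of an inverse is a proposition whereas [inv_central] is data, so an inverse is
   chosen. Its centrality structures are those of the quasi-functor. *)
pose (s := constructive_indefinite_description _ e).
refine (@Inv_central B X U (proj1_sig s) (proj1 (proj2_sig s)) (proj1 (proj2 (proj2_sig s)))
  (proj1 (proj2 (proj2 (proj2_sig s)))) (proj2 (proj2 (proj2 (proj2_sig s))))
  (ql_ver H U) (qr_ver H U) (ql_ver H (proj1_sig s)) (qr_ver H (proj1_sig s))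
  (conj (ql_verP H U) (fun _ => eq_refl)) (conj (qr_verP H U) (fun _ => eq_refl))
  (conj (ql_verP H (proj1_sig s)) (fun _ => eq_refl)) (conj (qr_verP H (proj1_sig s)) (fun _ => eq_refl)) _ _).
- intros k. simpl. apply (vinv_fs2 T); [apply vinv_hsid, (proj2_sig s) | apply vinv_id].
- intros k. simpl. apply (vinv_fs2 T); [apply vinv_id | apply vinv_hsid, (proj2_sig s)].
Defined.

Lemma tcentral_agrees U e : central_agrees (purely_exchange (quasi_purely H)) (@tcentral U e).
Proof. now constructor. Qed.

(** The unit law of the associativity turned around. It trades the identity square on the 1v-cell
    [mo A C E], which whiskering produces in the one-variable pentagons, for a value of [m] at
    identities. *)
Lemma m_fui A C E : fs T (fui T (A, C), vsid (hid E)) / fui T (T (A, C), E) / hsid (mo A C E) =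
  m (hid A) (hid C) (hid E) / fs T (vsid (hid A), fui T (C, E)) / fui T (A, T (C, E)).
Proof.
pose proof (m_fu M A C E) as K.
symmetry. rewrite vscmpA in K |- * by sc.
refine (vinv_conj (p := fu T (T (A, C), E) / fs T (fu T (A, C), vsid (hid E)))
  (q := fu T (A, T (C, E)) / fs T (vsid (hid A), fu T (C, E))) _ _ _ _ K).
- apply vinv_vcmp; [sc | apply fuK | apply vinv_fs2; [apply fuK | apply vinv_id]].
- apply vinv_vcmp; [sc | apply fuK | apply vinv_fs2; [apply vinv_id | apply fuK]].
- sc.
- sc.
Qed.

(* Naturality of [m] at three given squares, with boundaries inferred. It is used to carry the
   unitor corrections and [mu] across an associativity. *)
Tactic Notation "mnat" constr(a) constr(b) constr(c) ident(E) :=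
  let Ha := fresh in let Hb := fresh in let Hc := fresh in
  eassert (Ha : cell a _ _ _ _) by ty; eassert (Hb : cell b _ _ _ _) by ty; eassert (Hc : cell c _ _ _ _) by ty;
  pose proof (m_nat M Ha Hb Hc) as E; clear Ha Hb Hc; rewrite ?fs2_vsid in E.

(** The monoidal pentagon at [f] and three identities. Naturality of [m] ([E1], [E2]) collects the
    unitor corrections at the end, and [m_fui] supplies the missing associativity at identities. The
    other variables follow the same pattern. *)
Lemma tpent_1 f A A' W Y Z : hc f A A' ->
  fs T (m f (hid W) (hid Y) / fs T (vsid f, fui T (W, Y)), vsid (hid Z)) /
  (m f (hid (T (W, Y))) (hid Z) / fs T (vsid f, fui T (T (W, Y), Z))) /
  fs T (vsid f, hsid (mo W Y Z)) =
  m (fh T (f, hid W)) (hid Y) (hid Z) / fs T (vsid (fh T (f, hid W)), fui T (Y, Z)) /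
  (m f (hid W) (hid (T (Y, Z))) / fs T (vsid f, fui T (W, T (Y, Z)))).
Proof.
intros Hf. pose proof (mpent_h M f (hid W) (hid Y) (hid Z)) as K.
mnat (vsid f) (fui T (W, Y)) (vsid (hid Z)) E1.
mnat (vsid f) (vsid (hid W)) (fui T (Y, Z)) E2.
lhs (rewrite fs2_whl by sc; vA; vrw (eq_sym E1); rewrite <- !fs2_whr by sc; rewrite <- (@vscmpA _ (fs T (fui T _, _))), m_fui by sc).
rhs (vA; vrw (eq_sym E2); vA; vrw (eq_sym K)).
rewrite !fs2_whr by sc. vA. reflexivity.
Qed.
Lemma tpent_2 V f A A' Y Z : hc f A A' ->
  fs T (m (hid V) f (hid Y), vsid (hid Z)) / m (hid V) (fh T (f, hid Y)) (hid Z) /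
  fs T (vsid (hid V), m f (hid Y) (hid Z) / fs T (vsid f, fui T (Y, Z))) =
  m (fh T (hid V, f)) (hid Y) (hid Z) / fs T (vsid (fh T (hid V, f)), fui T (Y, Z)) / m (hid V) f (hid (T (Y, Z))).
Proof.
intros Hf. pose proof (mpent_h M (hid V) f (hid Y) (hid Z)) as K.
mnat (vsid (hid V)) (vsid f) (fui T (Y, Z)) E1.
lhs (rewrite fs2_whr by sc; vAr; rewrite K). vA. now rewrite E1.
Qed.
Lemma tpent_3 V W f A A' Z : hc f A A' ->
  fs T (fs T (fu T (V, W), vsid f) / m (hid V) (hid W) f, vsid (hid Z)) / m (hid V) (fh T (hid W, f)) (hid Z) /
  fs T (vsid (hid V), m (hid W) f (hid Z)) =
  m (hid (T (V, W))) f (hid Z) / (fs T (fu T (V, W), vsid (fh T (f, hid Z))) / m (hid V) (hid W) (fh T (f, hid Z))).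
Proof.
intros Hf. pose proof (mpent_h M (hid V) (hid W) f (hid Z)) as K.
mnat (fu T (V, W)) (vsid f) (vsid (hid Z)) E1.
rhs (vAr; rewrite E1; vA; rewrite <- K).
rewrite fs2_whl by sc. vA. reflexivity.
Qed.
Lemma tpent_4 V W Y f A A' : hc f A A' ->
  fs T (hsid (mo V W Y), vsid f) / (fs T (fu T (V, T (W, Y)), vsid f) / m (hid V) (hid (T (W, Y))) f) /
  fs T (vsid (hid V), fs T (fu T (W, Y), vsid f) / m (hid W) (hid Y) f) =
  fs T (fu T (T (V, W), Y), vsid f) / m (hid (T (V, W))) (hid Y) f /
  (fs T (fu T (V, W), vsid (fh T (hid Y, f))) / m (hid V) (hid W) (fh T (hid Y, f))).
Proof.
intros Hf. pose proof (mpent_h M (hid V) (hid W) (hid Y) f) as K.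
mnat (vsid (hid V)) (fu T (W, Y)) (vsid f) E1.
mnat (fu T (V, W)) (vsid (hid Y)) (vsid f) E2.
rhs (vA; vrw E2; vA; rewrite <- K; vAr; rewrite <- !fs2_whl, <- m_fu by sc).
rewrite (@fs2_whr _ _ _ T (hid V)) by sc. vA. vrw E1. rewrite !fs2_whl by sc. vA. reflexivity.
Qed.
Lemma l_fui Y : fui T (I, Y) / hsid (v_o (mlam M) Y) = fs T (mu, vsid (hid Y)) / v_h (mlam M) (hid Y).
Proof. rewrite l_fu. vAr. rewrite fuE_r. rewrite vscmp1l' by sc. reflexivity. Qed.
Lemma r_fui Y : fui T (Y, I) / hsid (v_o (mrho M) Y) = fs T (vsid (hid Y), mu) / v_h (mrho M) (hid Y).
Proof. rewrite r_fu. vAr. rewrite fuE_r. rewrite vscmp1l' by sc. reflexivity. Qed.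
(** The monoidal triangle speaks of [J] and the premonoidal one of [hid I]. Naturality of [m] in its
    middle argument carries [mu] from one side to the other. *)
Lemma ttriM_1 f A A' Y : hc f A A' ->
  m f (hid I) (hid Y) / fs T (vsid f, fui T (I, Y)) / fs T (vsid f, hsid (v_o (mlam M) Y)) =
  fs T (fs T (vsid f, mu) / v_h (mrho M) f, vsid (hid Y)).
Proof.
intros Hf. pose proof (mtriM_h M f (hid Y)) as K. mnat (vsid f) mu (vsid (hid Y)) E1.
rewrite vscmpA, <- fs2_whr, l_fui, fs2_whr, fs2_whl, <- K by sc. vAr. now rewrite E1.
Qed.
Lemma ttriM_2 W f A A' : hc f A A' ->
  fs T (fu T (W, I), vsid f) / m (hid W) (hid I) f / fs T (vsid (hid W), fs T (mu, vsid f) / v_h (mlam M) f) =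
  fs T (hsid (v_o (mrho M) W), vsid f).
Proof.
intros Hf. pose proof (mtriM_h M (hid W) f) as K. mnat (vsid (hid W)) mu (vsid f) E1.
rewrite r_fu, fs2_whr, !fs2_whl, <- K by sc. vA. now vrw E1.
Qed.
Lemma ttriL_1 f A A' Y : hc f A A' ->
  m (hid I) f (hid Y) / (fs T (mu, vsid (fh T (f, hid Y))) / v_h (mlam M) (fh T (f, hid Y))) =
  fs T (fs T (mu, vsid f) / v_h (mlam M) f, vsid (hid Y)).
Proof.
intros Hf. pose proof (mtriL_h M f (hid Y)) as K. mnat mu (vsid f) (vsid (hid Y)) E1.
rewrite fs2_whl, <- K by sc. vAr. now rewrite E1.
Qed.
Lemma ttriL_2 W f A A' : hc f A A' ->
  fs T (fu T (I, W), vsid f) / m (hid I) (hid W) f / (fs T (mu, vsid (fh T (hid W, f))) / v_h (mlam M) (fh T (hid W, f))) =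
  fs T (hsid (v_o (mlam M) W), vsid f).
Proof.
intros Hf. pose proof (mtriL_h M (hid W) f) as K. mnat mu (vsid (hid W)) (vsid f) E1.
rewrite l_fu, !fs2_whl, <- K by sc. vA. now vrw E1.
Qed.
Lemma ttriR_1 f A A' Y : hc f A A' ->
  m f (hid Y) (hid I) / fs T (vsid f, fui T (Y, I)) / fs T (vsid f, hsid (v_o (mrho M) Y)) =
  fs T (vsid (fh T (f, hid Y)), mu) / v_h (mrho M) (fh T (f, hid Y)).
Proof.
intros Hf. pose proof (mtriR_h M f (hid Y)) as K. mnat (vsid f) (vsid (hid Y)) mu E1.
rewrite vscmpA, <- fs2_whr, r_fui, fs2_whr, <- K by sc. vAr. now rewrite E1.
Qed.
Lemma ttriR_2 W f A A' : hc f A A' ->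
  m (hid W) f (hid I) / fs T (vsid (hid W), fs T (vsid f, mu) / v_h (mrho M) f) =
  fs T (vsid (fh T (hid W, f)), mu) / v_h (mrho M) (fh T (hid W, f)).
Proof.
intros Hf. pose proof (mtriR_h M (hid W) f) as K. mnat (vsid (hid W)) (vsid f) mu E1.
rewrite fs2_whr, <- K by sc. vAr. now rewrite E1.
Qed.

Definition tens_premonoidal : premonoidal X.
Proof.
refine (@Premonoidal B X I (tlam M) (trho M) (fun A C E => mo A C E) (tal1 M) (tal2 M) (tal3 M)
  (tlamP M) (trhoP M) (tal1P M) (tal2P M) (tal3P M) (fun _ _ _ => eq_refl) (fun _ _ _ => eq_refl) (fun _ _ _ => eq_refl)
  (fun Y => tcentral (vstrict_inv Y (tlamP M))) (fun Y => tcentral (vstrict_inv Y (trhoP M)))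
  (fun W Y Z => tcentral (@vstrict_inv (dblprod (dblprod B B) B) _ _ _ _ (W, Y, Z) (malP M))) _ _ _ _ _ _ _ _ _ _ _ _ _ _); simpl; intros.
all: try exact (mpent_o M _ _ _ _); try apply (mtriM_o M); try apply (mtriL_o M); try apply (mtriR_o M).
- eapply tpent_1; apply hc_refl.
- eapply tpent_2; apply hc_refl.
- eapply tpent_3; apply hc_refl.
- eapply tpent_4; apply hc_refl.
- eapply ttriM_1; apply hc_refl.
- eapply ttriM_2; apply hc_refl.
- eapply ttriL_1; apply hc_refl.
- eapply ttriL_2; apply hc_refl.
- eapply ttriR_1; apply hc_refl.
- eapply ttriR_2; apply hc_refl.
Defined.
Lemma m_fci f g h f' g' h' A0 A1 A2 C0 C1 C2 E0 E1 E2 : hc f A0 A1 -> hc f' A1 A2 ->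
  hc g C0 C1 -> hc g' C1 C2 -> hc h E0 E1 -> hc h' E1 E2 ->
  m (hcmp f f') (hcmp g g') (hcmp h h') / fs T (vsid (hcmp f f'), fci T (g, h) (g', h')) / fci T (f, fh T (g, h)) (f', fh T (g', h')) =
  fs T (fci T (f, g) (f', g'), vsid (hcmp h h')) / fci T (fh T (f, g), h) (fh T (f', g'), h') / [m f g h | m f' g' h'].
Proof.
intros Hf Hf' Hg Hg' Hh Hh'. pose proof (m_fc M Hf Hf' Hg Hg' Hh Hh') as K. rewrite vscmpA in K by sc.
rewrite vscmpA by sc.
eapply vinv_conj; [ | | | | exact K].
- apply vinv_vcmp; [sc | eapply fc2K; sc | apply vinv_fs2; [eapply fc2K; sc | apply vinv_id]].
- apply vinv_vcmp; [sc | eapply fc2K; sc | apply vinv_fs2; [apply vinv_id | eapply fc2K; sc]].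
- sc.
- sc.
Qed.

(** The compositor law of [m] for the factorization of (K,k,1) into (1,k,1) and (K,1,1); [ex21] is
    the inverse law for the opposite factorization. Since the exchange cell is a compositor followed
    by an inverse compositor, both sides of the exchange axiom reduce to a pasting through
    [m K k (hid Z)]. The pairs [ex13], [ex31] and [ex23], [ex32] serve the other variables. *)
Lemma ex12 K k A A' C C' Z : hc K A A' -> hc k C C' ->
  [m (hid A) k (hid Z) | m K (hid C') (hid Z) / fs T (vsid K, fui T (C', Z))] / fc T (hid A, fh T (k, hid Z)) (K, hid (T (C', Z))) =
  fc T (fh T (hid A, k), hid Z) (fh T (K, hid C'), hid Z) / fs T (fc T (hid A, k) (K, hid C'), vsid (hid Z)) / m K k (hid Z).
Proof.
intros HK Hk. pose proof (m_fc M (hc_hid A) HK Hk (hc_hid C') (hc_hid Z) (hc_hid Z)) as E.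
rewrite !hcmp1l', hcmp1r', (fc2U_r T Hk (hc_hid Z)) in E by sc. rewrite <- E.
transitivity ([m (hid A) k (hid Z) | m K (hid C') (hid Z)] / [fs T (vsid (hid A), vsid (fh T (k, hid Z))) | fs T (vsid K, fui T (C', Z))]
  / fc T (hid A, fh T (k, hid Z)) (K, hid (T (C', Z)))).
{ rewrite fs2_vsid, interchange by sc. v1. reflexivity. }
vA. erewrite (fc2_nat T) by sc. rewrite <- vsid_cmp, hcmp1l' by sc. reflexivity.
Qed.
Lemma ex21 K k A A' C C' Z : hc K A A' -> hc k C C' ->
  fs T (fci T (K, hid C) (hid A', k), vsid (hid Z)) / fci T (fh T (K, hid C), hid Z) (fh T (hid A', k), hid Z) /
    [m K (hid C) (hid Z) / fs T (vsid K, fui T (C, Z)) | m (hid A') k (hid Z)] =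
  m K k (hid Z) / fci T (K, hid (T (C, Z))) (hid A', fh T (k, hid Z)).
Proof.
intros HK Hk. pose proof (m_fci HK (hc_hid A') (hc_hid C) Hk (hc_hid Z) (hc_hid Z)) as E.
rewrite !hcmp1l', hcmp1r', (fci2U_l T Hk (hc_hid Z)) in E by sc.
transitivity (fs T (fci T (K, hid C) (hid A', k), vsid (hid Z)) / fci T (fh T (K, hid C), hid Z) (fh T (hid A', k), hid Z) /
    [m K (hid C) (hid Z) | m (hid A') k (hid Z)] / [fs T (vsid K, fui T (C, Z)) | fs T (vsid (hid A'), vsid (fh T (k, hid Z)))]).
{ rewrite fs2_vsid. vA. rewrite interchange by sc. v1. reflexivity. }
rewrite <- E. vA. erewrite <- (fci2_nat T) by sc. vAr. rewrite (vscmpA (a := m _ _ _)), fs2_v, <- vsid_cmp, hcmp1r', interchange by sc.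
rewrite fuE_l. v1. rewrite <- vsid_cmp by sc. rewrite hcmp1l', fs2_vsid by sc. v1. reflexivity.
Qed.
Lemma ex13 K k A A' C C' Y : hc K A A' -> hc k C C' ->
  [fs T (fu T (A, Y), vsid k) / m (hid A) (hid Y) k | m K (hid Y) (hid C') / fs T (vsid K, fui T (Y, C'))]
    / fc T (hid A, fh T (hid Y, k)) (K, hid (T (Y, C'))) =
  fc T (hid (T (A, Y)), k) (fh T (K, hid Y), hid C') / m K (hid Y) k.
Proof.
intros HK Hk. pose proof (m_fc M (hc_hid A) HK (hc_hid Y) (hc_hid Y) Hk (hc_hid C')) as E.
rewrite !hcmp1l', hcmp1r', (fc2U_r T (hc_hid Y) Hk), (fc2U_l T HK (hc_hid Y)) in E by sc.
transitivity ([fs T (fu T (A, Y), vsid k) | fs T (vsid (fh T (K, hid Y)), vsid (hid C'))] /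
  ([m (hid A) (hid Y) k | m K (hid Y) (hid C')] / [fs T (vsid (hid A), vsid (fh T (hid Y, k))) | fs T (vsid K, fui T (Y, C'))]
  / fc T (hid A, fh T (hid Y, k)) (K, hid (T (Y, C'))))).
{ rewrite !fs2_vsid. vAr. rewrite !interchange by sc. v1. reflexivity. }
rewrite (vscmpA (a := [m _ _ _ | _])) by sc. erewrite (fc2_nat T) by sc. rewrite <- vsid_cmp, hcmp1l' by sc.
vAr. rewrite (vscmpA (c := fc T _ _)), (vscmpA (c := fs T (vsid K, _))) by sc. rewrite E. vAr.
erewrite (fc2_nat T) by sc. rewrite <- vsid_cmp, hcmp1r' by sc. rewrite (vscmpA (a := fc T _ _)), fs2_v, interchange, fuE_l by sc.
v1. rewrite <- vsid_cmp, hcmp1l', fs2_vsid by sc. v1. reflexivity.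
Qed.
Lemma ex31 K k A A' C C' Y : hc K A A' -> hc k C C' ->
  fci T (fh T (K, hid Y), hid C) (hid (T (A', Y)), k) /
    [m K (hid Y) (hid C) / fs T (vsid K, fui T (Y, C)) | fs T (fu T (A', Y), vsid k) / m (hid A') (hid Y) k] =
  m K (hid Y) k / fci T (K, hid (T (Y, C))) (hid A', fh T (hid Y, k)).
Proof.
intros HK Hk. pose proof (m_fci HK (hc_hid A') (hc_hid Y) (hc_hid Y) (hc_hid C) Hk) as E.
rewrite !hcmp1l', hcmp1r', (fci2U_l T (hc_hid Y) Hk), (fci2U_r T HK (hc_hid Y)) in E by sc.
transitivity (fci T (fh T (K, hid Y), hid C) (hid (T (A', Y)), k) /
  [fs T (vsid (fh T (K, hid Y)), vsid (hid C)) | fs T (fu T (A', Y), vsid k)] /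
  [m K (hid Y) (hid C) | m (hid A') (hid Y) k] / [fs T (vsid K, fui T (Y, C)) | fs T (vsid (hid A'), vsid (fh T (hid Y, k)))]).
{ rewrite !fs2_vsid. vA. rewrite !interchange by sc. v1. reflexivity. }
erewrite <- (fci2_nat T) by sc. rewrite <- vsid_cmp, hcmp1l' by sc. rewrite <- E.
vA. erewrite <- (fci2_nat T) by sc. rewrite <- vsid_cmp, hcmp1r' by sc. vAr.
rewrite (vscmpA (a := m _ _ _)), fs2_v, interchange, fuE_l by sc.
v1. rewrite <- vsid_cmp, hcmp1l', fs2_vsid by sc. v1. reflexivity.
Qed.
Lemma ex23 K k A A' C C' W : hc K A A' -> hc k C C' ->
  [fs T (fu T (W, A), vsid k) / m (hid W) (hid A) k | m (hid W) K (hid C')]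
    / fc T (hid W, fh T (hid A, k)) (hid W, fh T (K, hid C')) / fs T (vsid (hid W), fc T (hid A, k) (K, hid C')) =
  fc T (hid (T (W, A)), k) (fh T (hid W, K), hid C') / m (hid W) K k.
Proof.
intros HK Hk. pose proof (m_fc M (hc_hid W) (hc_hid W) (hc_hid A) HK Hk (hc_hid C')) as E.
rewrite !hcmp1l', hcmp1r', (fc2U_l T (hc_hid W) HK) in E by sc.
transitivity ([fs T (fu T (W, A), vsid k) | fs T (vsid (fh T (hid W, K)), vsid (hid C'))] /
  [m (hid W) (hid A) k | m (hid W) K (hid C')]
    / fc T (hid W, fh T (hid A, k)) (hid W, fh T (K, hid C')) / fs T (vsid (hid W), fc T (hid A, k) (K, hid C'))).
{ rewrite !fs2_vsid, interchange by sc. v1. reflexivity. }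
vA. rewrite <- (@vscmpA _ [v_h (mal M) _ | _]), E by sc. vAr.
erewrite (fc2_nat T) by sc. rewrite <- vsid_cmp, hcmp1r' by sc. rewrite (vscmpA (a := fc T _ _)), fs2_v, interchange, fuE_l by sc.
v1. rewrite <- vsid_cmp, hcmp1l', fs2_vsid by sc. v1. reflexivity.
Qed.
Lemma ex32 K k A A' C C' W : hc K A A' -> hc k C C' ->
  fci T (fh T (hid W, K), hid C) (hid (T (W, A')), k) /
    [m (hid W) K (hid C) | fs T (fu T (W, A'), vsid k) / m (hid W) (hid A') k] =
  m (hid W) K k / fs T (vsid (hid W), fci T (K, hid C) (hid A', k)) / fci T (hid W, fh T (K, hid C)) (hid W, fh T (hid A', k)).
Proof.
intros HK Hk. pose proof (m_fci (hc_hid W) (hc_hid W) HK (hc_hid A') (hc_hid C) Hk) as E.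
rewrite !hcmp1l', hcmp1r', (fci2U_r T (hc_hid W) HK) in E by sc. rewrite E.
transitivity (fci T (fh T (hid W, K), hid C) (hid (T (W, A')), k) /
  [fs T (vsid (fh T (hid W, K)), vsid (hid C)) | fs T (fu T (W, A'), vsid k)] / [m (hid W) K (hid C) | m (hid W) (hid A') k]).
{ rewrite !fs2_vsid. vA. rewrite interchange by sc. v1. reflexivity. }
erewrite <- (fci2_nat T) by sc. rewrite <- vsid_cmp, hcmp1l' by sc. reflexivity.
Qed.

Lemma fui_l u A A' Z : vc u A A' ->
  fs T (hsid u, vsid (hid Z)) / fui T (A', Z) = fui T (A, Z) / hsid (fv T (u, vid Z)).
Proof. intros Hu. rewrite <- hsid_vid. exact (fui2_nat T Hu (vc_vid Z)). Qed.
Lemma fui_r u A A' Z : vc u A A' ->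
  fs T (vsid (hid Z), hsid u) / fui T (Z, A') = fui T (Z, A) / hsid (fv T (vid Z, u)).
Proof. intros Hu. rewrite <- hsid_vid. exact (fui2_nat T (vc_vid Z) Hu). Qed.
Lemma fu_l u A A' Z : vc u A A' ->
  hsid (fv T (u, vid Z)) / fu T (A', Z) = fu T (A, Z) / fs T (hsid u, vsid (hid Z)).
Proof. intros Hu. rewrite <- hsid_vid. exact (fu2_nat T Hu (vc_vid Z)). Qed.
Lemma fu_r u A A' Z : vc u A A' ->
  hsid (fv T (vid Z, u)) / fu T (Z, A') = fu T (Z, A) / fs T (vsid (hid Z), hsid u).
Proof. intros Hu. rewrite <- hsid_vid. exact (fu2_nat T (vc_vid Z) Hu). Qed.
(** Naturality of the unitor makes the conjugated image of identity squares an identity square; in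
    particular the exchange cells of two 1v-cells are trivial for [tens_quasi]. *)
Lemma fv2_vglob U u A A' C C' : vc U A A' -> vc u C C' ->
  fu T (A, C) / fs T (hsid U, hsid u) / fui T (A', C') = hsid (fv T (U, u)).
Proof.
intros HU Hu. erewrite <- (fu2_nat T) by eassumption. rewrite vscmpA, fuE_l by sc. v1. reflexivity.
Qed.

Lemma tens_assoc_compat : assoc_compat (purely_exchange (quasi_purely H)) tens_premonoidal.
Proof.
constructor; unfold fs_cmp, fs_id; simpl.
- intros K k Z. pose proof (hc_refl K) as HK. pose proof (hc_refl k) as Hk.
  rewrite hsrc_fh, htgt_fh. simpl. rewrite hsrc_id, htgt_id.
  (* The exchange cell is reduced to a compositor and an inverse compositor; [ex21] and [ex12] then
     meet at [m K k (hid Z)]. *)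
  rewrite !fs2_vsid. v1. rewrite !fs2_whl by sc. vA. rewrite <- (@vscmpA _ (fs T _) (fci T _ _)), (ex21 Z HK Hk) by sc.
  vAr. rewrite (ex12 Z HK Hk). reflexivity.
- intros K Y k. pose proof (hc_refl K) as HK. pose proof (hc_refl k) as Hk.
  rewrite !hsrc_fh, !htgt_fh. simpl. rewrite !hsrc_id, !htgt_id.
  rewrite !fs2_vsid. v1. vA. rewrite (ex31 Y HK Hk).
  vAr. rewrite (ex13 Y HK Hk). reflexivity.
- intros W K k. pose proof (hc_refl K) as HK. pose proof (hc_refl k) as Hk.
  rewrite !hsrc_fh, !htgt_fh. simpl. rewrite !hsrc_id, !htgt_id.
  rewrite !fs2_vsid. v1. rewrite !fs2_whr by sc. vA. rewrite (ex32 W HK Hk).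
  vAr. rewrite (ex23 W HK Hk). reflexivity.
- intros K u Z. pose proof (hc_refl K) as HK. pose proof (vc_refl u) as Hu.
  (* Naturality of [m] at the identity squares of [K] and [u] is the axiom up to the correction in
     [tal1], which [fui_l] moves past an identity square. *)
  mnat (vsid K) (hsid u) (vsid (hid Z)) E.
  rewrite <- vscmpA, <- E by sc. vA. rewrite <- !fs2_whr, (fui_l Z Hu) by sc. reflexivity.
- intros K Y u. pose proof (hc_refl K) as HK. pose proof (vc_refl u) as Hu.
  mnat (vsid K) (vsid (hid Y)) (hsid u) E.
  rewrite <- vscmpA, <- E by sc. vA. rewrite <- !fs2_whr, (fui_r Y Hu) by sc. reflexivity.
- intros W K u. pose proof (hc_refl K) as HK. pose proof (vc_refl u) as Hu.
  mnat (vsid (hid W)) (vsid K) (hsid u) E. symmetry. exact E.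
- intros U k Z. pose proof (hc_refl k) as Hk. pose proof (vc_refl U) as HU.
  mnat (hsid U) (vsid k) (vsid (hid Z)) E. symmetry. exact E.
- intros U Y k. pose proof (hc_refl k) as Hk. pose proof (vc_refl U) as HU.
  mnat (hsid U) (vsid (hid Y)) (vsid k) E.
  rewrite vscmpA, E by sc. vAr. rewrite <- !fs2_whl, (fu_l Y HU) by sc. reflexivity.
- intros W U k. pose proof (hc_refl k) as Hk. pose proof (vc_refl U) as HU.
  mnat (vsid (hid W)) (hsid U) (vsid k) E.
  rewrite vscmpA, E by sc. vAr. rewrite <- !fs2_whl, (fu_r W HU) by sc. reflexivity.
- intros U u Z. pose proof (vc_refl U) as HU. pose proof (vc_refl u) as Hu.
  rewrite vsrc_fv, vtgt_fv. simpl. rewrite vsrc_id, vtgt_id, !fs2_vsid. v1.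
  (* All exchange squares become identity squares, and the axiom reduces to naturality of the
     1v-components of the associativity. *)
  rewrite (fv2_vglob HU Hu), (fv2_vglob (C := T (vsrc u, Z)) (C' := T (vtgt u, Z)) HU) by sc.
  rewrite <- hsid_vid. erewrite fv2_vglob by sc.
  rewrite <- !hsid_cmp by sc. erewrite m_natv by sc. reflexivity.
- intros U Y u. pose proof (vc_refl U) as HU. pose proof (vc_refl u) as Hu.
  rewrite !vsrc_fv, !vtgt_fv. simpl. rewrite !vsrc_id, !vtgt_id.
  erewrite !fv2_vglob by sc.
  rewrite <- !hsid_cmp by sc. erewrite m_natv by sc. reflexivity.
- intros W U u. pose proof (vc_refl U) as HU. pose proof (vc_refl u) as Hu.
  rewrite !vsrc_fv, !vtgt_fv. simpl. rewrite !vsrc_id, !vtgt_id, !fs2_vsid. v1.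
  rewrite (fv2_vglob HU Hu), <- hsid_vid.
  erewrite !fv2_vglob by sc.
  rewrite <- !hsid_cmp by sc. erewrite m_natv by sc. reflexivity.
Qed.

Lemma monoidal_has_quasi : has_quasi_premonoidal B.
Proof.
exists H. split.
- intros U u. unfold vtrivial. simpl. erewrite fv2_vglob by apply vc_refl. now rewrite lft_hsid.
- constructor. refine (@Central_premonoidal B X _ tens_premonoidal _ _ _ tens_assoc_compat); intros; apply tcentral_agrees.
Qed.
End MonoidalPremonoidal.

Theorem theorem7p13 (B : dblcat) :
  (has_quasi_premonoidal B <-> has_purely_central_premonoidal B) /\
  (has_quasi_premonoidal B <-> has_left_central_premonoidal B) /\
  (has_quasi_premonoidal B <-> has_right_central_premonoidal B) /\
  (has_quasi_premonoidal B <-> has_lr_purely_central_premonoidal B) /\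
  (has_quasi_premonoidal B <-> has_monoidal_r B).
Proof.
split; [apply quasi_iff_purely |].
split; [split; [apply quasi_has_left | apply left_has_quasi] |].
split; [split; [apply quasi_has_right | apply right_has_quasi] |].
split; [split; [apply quasi_has_lr | intros H; now apply quasi_iff_purely, lr_has_purely] |].
split; [apply quasi_has_monoidal_r | intros (_ & M & _); exact (monoidal_has_quasi M)].
Qed.
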